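(* Let $G$ be a real reductive group, $H\subseteq G$ a reductive subgroup, and $(\pi,\mathcal{H}_\pi)$ an irreducible unitary representation of $G$. Let $$T:\mathcal{H}_\pi\to\int^\oplus_{\widehat{H}}\mathcal{H}_\tau\otimes\mathcal{M}_{\pi,\tau}\,d\mu_\pi(\tau)$$ be an $H$-equivariant unitary isomorphism realizing the decomposition of $\pi|_H$ into a direct integral of irreducible unitary representations $(\tau,\mathcal{H}_\tau)$ of $H$, where $(\mathcal{M}_{\pi,\tau})_{\tau\in\widehat{H}}$ is a family of Hilbert spaces (the multiplicity spaces), $\mu_\pi$ is a $\sigma$-finite Borel measure on the unitary dual $\widehat{H}$, and $H$ acts only on the first factor of each $\mathcal{H}_\tau\otimes\mathcal{M}_{\pi,\tau}$. Then the restriction of $T$ to the smooth vectors $\mathcal{H}_\pi^\infty$ is pointwise defined by $H$-equivariant maps: for every $\tau\in\widehat{H}$ there exists an $H$-equivariant continuous linear map $A_{\pi,\tau}^\infty:\mathcal{H}_\pi^\infty\to\mathcal{H}_\tau\otimes\mathcal{M}_{\pi,\tau}$ such that for every $v\in\mathcal{H}_\pi^\infty$ $$T(v)_\tau=A_{\pi,\tau}^\infty(v)\qquad\text{for }\mu_\pi\text{-almost every }\tau\in\widehat{H}.$$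
   Context: All Hilbert spaces are assumed separable. $\mathcal{H}_\pi^\infty$ denotes the space of smooth vectors of $\pi$ (as a representation of $G$) with its usual Fréchet topology. $\widehat{H}$ is the unitary dual of $H$, i.e. the set of equivalence classes of irreducible unitary representations of $H$, with its usual (second-countable) topology; for each class one fixes a representative $(\tau,\mathcal{H}_\tau)$. Tensor products of Hilbert spaces are Hilbert space tensor products. Direct integrals: let $(\mathcal{H}_\lambda)_{\lambda\in\Lambda}$ be a family of Hilbert spaces indexed by a second-countable topological space $\Lambda$, with inner products $\langle\cdot,\cdot\rangle_\lambda$, and let $\mu$ be a $\sigma$-finite Borel measure on $\Lambda$. It is a measurable family of Hilbert spaces if it is equipped with a subspace $\mathcal{F}\subseteq\prod_{\lambda\in\Lambda}\mathcal{H}_\lambda$ (the measurable sections) such that: (i) for all $s,t\in\mathcal{F}$ the function $\lambda\mapsto\langle s(\lambda),t(\lambda)\rangle_\lambda$ is measurable; (ii) if $s\in\prod_\lambda\mathcal{H}_\lambda$ is such that $\lambda\mapsto\langle s(\lambda),t(\lambda)\rangle_\lambda$ is measurable for all $t\in\mathcal{F}$, then $s\in\mathcal{F}$; (iii) there is a countable subset $(s_n)_{n\in\mathbb{N}}\subseteq\mathcal{F}$ such that $\{s_n(\lambda):n\in\mathbb{N}\}$ spans a dense subspace of $\mathcal{H}_\lambda$ for every $\lambda\in\Lambda$. The direct integral $\int^\oplus_\Lambda\mathcal{H}_\lambda\,d\mu(\lambda)$ is the Hilbert space of all $s\in\mathcal{F}$ with $\int_\Lambda\langle s(\lambda),s(\lambda)\rangle_\lambda\,d\mu(\lambda)<\infty$,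 modulo sections vanishing almost everywhere, with the obvious inner product. Here it is applied with $\Lambda=\widehat{H}$ and the spaces $\mathcal{H}_\tau\otimes\mathcal{M}_{\pi,\tau}$; $T(v)_\tau$ denotes the value at $\tau$ of (a representative of) the section $T(v)$. A continuous linear map $T:E\to\int^\oplus_\Lambda\mathcal{H}_\lambda\,d\mu(\lambda)$ from a topological vector space $E$ is called pointwise defined if for every $\lambda\in\Lambda$ there is a continuous linear map $T_\lambda:E\to\mathcal{H}_\lambda$ such that for every $v\in E$ one has $T(v)(\lambda)=T_\lambda(v)$ for almost every $\lambda\in\Lambda$. *)

(* Defs.v *)
From HB Require Import structures.
From mathcomp Require Import all_boot all_order all_algebra.
From mathcomp Require Import all_classical all_reals all_analysis.
From mathcomp Require Import measurable_realfun complex ring lra.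
From mathcomp Require mpoly.
Set Implicit Arguments.
Unset Strict Implicit.
Unset Printing Implicit Defensive.
Import Order.TTheory GRing.Theory Num.Theory numFieldNormedType.Exports.
Local Open Scope classical_set_scope.
Local Open Scope ring_scope.
Local Open Scope complex_scope.
Local Open Scope quotient_scope.

HB.mixin Record isTopologicalGroup G & Topological G & Group G := {
  mulg_continuous : continuous (fun x : G * G => (x.1 * x.2)%g);
  invg_continuous : continuous (fun x : G => (x^-1)%g);
}.
#[short(type="topGroupType")]
HB.structure Definition TopGroup :=
  {G of Topological G & Group G & isTopologicalGroup G}.

(* Real reductive groups in the sense of Wallach: finite covering groups of open
   subgroups of a self-adjoint (closed under transposition) real algebraic
   subgroup of GL_n(R).  By Mostow's theorem every linear reductive algebraic
   group defined over R is conjugate to a self-adjoint one, so self-adjointness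
   expresses reductivity. *)
Section reductive.
Variable R : realType.

Definition poly_eval n (f : mpoly.mpoly (n * n) R) (g : 'M[R]_n) : R :=
  mpoly.meval (fun i => mxvec g ord0 i) f.

Definition self_adjoint_algebraic_group n (S : set 'M[R]_n) :=
  [/\ exists P : set (mpoly.mpoly (n * n) R),
        S = [set g | g \in unitmx /\ forall f, P f -> poly_eval f g = 0],
      S 1%:M,
      forall g h, S g -> S h -> S (g *m h),
      forall g, S g -> S (invmx g)
    & forall g, S g -> S g^T].

(* The covering map is a continuous homomorphism into S with finite kernel that
   is open as a map into S; its image is then automatically open in S. *)
Definition real_reductive (G : topGroupType) :=
  hausdorff_space G /\
  exists n (S : set 'M[R]_n) (p : G -> 'M[R]_n),
    [/\ self_adjoint_algebraic_group S,
        forall g, S (p g),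
        p 1%g = 1%:M /\ (forall g h, p (g * h)%g = p g *m p h),
        continuous p /\
        (forall U : set G, open U -> exists2 W, open W & p @` U = W `&` S)
      & finite_set [set g | p g = 1%:M]].

End reductive.

(* A closed subgroup of G, given by its inclusion H -> G. *)
Definition closed_subgroup (G H : topGroupType) (iota : H -> G) :=
  [/\ {morph iota : g h / (g * h)%g >-> (g * h)%g}, injective iota,
      continuous iota & forall C, closed C -> closed (iota @` C)].

Definition lin_span (K : pzRingType) (V : lmodType K) (A : set V) : set V :=
  [set v | exists s : seq (K * V),
     (forall p, p \in s -> A p.2) /\ v = \sum_(p <- s) p.1 *: p.2].

(* Separable complex Hilbert spaces; the inner product is linear in its first
   argument. *)
HB.mixin Record isHilbert (R : realType) V & CompleteNormedModule R[i] V := {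
  inner : V -> V -> R[i];
  innerDl : forall x y z, inner (x + y) z = inner x z + inner y z;
  innerZl : forall (a : R[i]) x z, inner (a *: x) z = a * inner x z;
  innerC : forall x y, inner y x = (inner x y)^*;
  inner_norm : forall x, inner x x = `|x| ^+ 2;
  hilbert_separable : exists2 D : set V, countable D & dense D;
}.
#[short(type="hilbertType")]
HB.structure Definition Hilbert (R : realType) :=
  {V of CompleteNormedModule R[i] V & isHilbert R V}.

Section inner_theory.
Context {R : realType} {V : hilbertType R}.
Implicit Types (a : R[i]) (x y z : V).

Lemma innerDr x y z : inner x (y + z) = inner x y + inner x z.
Proof. by rewrite innerC innerDl rmorphD/= -!innerC. Qed.

Lemma innerZr a x y : inner x (a *: y) = a^* * inner x y.
Proof. by rewrite innerC innerZl rmorphM/= -innerC. Qed.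

Lemma inner0l x : inner 0 x = 0.
Proof. by rewrite -(scale0r (0 : V)) innerZl mul0r. Qed.

Lemma Re_inner_ge0 x : 0 <= complex.Re (inner x x).
Proof.
have : 0 <= inner x x by rewrite inner_norm exprn_ge0.
by rewrite lecE => /andP[].
Qed.

Lemma Im_inner x : complex.Im (inner x x) = 0.
Proof.
have : 0 <= inner x x by rewrite inner_norm exprn_ge0.
by rewrite lecE => /andP[/eqP ].
Qed.

Lemma Re_innerZ a x : complex.Re (inner (a *: x) (a *: x)) =
  complex.Re (a * a^* ) * complex.Re (inner x x).
Proof.
rewrite innerZl innerZr mulrA; have := Im_inner x.
by case: (a * _) (inner x x) => [u w] [c e] /= ->; rewrite mulr0 subr0.
Qed.

Lemma Re_innerD_le x y : complex.Re (inner (x + y) (x + y)) <=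
  2 * complex.Re (inner x x) + 2 * complex.Re (inner y y).
Proof.
have : complex.Re (inner (x + y) (x + y)) +
       complex.Re (inner (x + (- 1) *: y) (x + (- 1) *: y)) =
       2 * complex.Re (inner x x) + 2 * complex.Re (inner y y).
  rewrite !(innerDl, innerDr, innerZl, innerZr).
  case: (inner x x) (inner x y) (inner y x) (inner y y)
    => [a1 a2] [b1 b2] [c1 c2] [d1 d2]; rewrite /=.
  rewrite !(mulNr, mulrN, mul0r, mulr0, subr0, sub0r, mul1r, oppr0, add0r,
    addr0, opprK, mul1r); ring.
by move=> <-; rewrite lerDl Re_inner_ge0.
Qed.

End inner_theory.

Section representations.
Variables (R : realType) (G : topGroupType).

Record unitary_rep (V : hilbertType R) := UnitaryRep {
  rep_act :> G -> {linear V -> V};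
  rep1 : forall v, rep_act 1%g v = v;
  repM : forall g h v, rep_act (g * h)%g v = rep_act g (rep_act h v);
  rep_inner : forall g v w, inner (rep_act g v) (rep_act g w) = inner v w;
  rep_continuous : forall v, continuous (fun g => rep_act g v);
}.

Definition irreducible_rep (V : hilbertType R) (p : unitary_rep V) :=
  (exists v : V, v != 0) /\
  forall W : set V, closed W -> W 0 ->
    (forall (a : R[i]) v w, W v -> W w -> W (a *: v + w)) ->
    (forall g v, W v -> W (p g v)) -> W = [set 0] \/ W = setT.

Record irrep := Irrep {
  irrep_space : hilbertType R;
  irrep_act : unitary_rep irrep_space;
  irrepP : irreducible_rep irrep_act;
}.

Definition unitarily_equivalent (x y : irrep) :=
  exists U : {linear irrep_space x -> irrep_space y},
    [/\ bijective U,
        forall v w, inner (U v) (U w) = inner v w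
      & forall g v, U (irrep_act x g v) = irrep_act y g (U v)].

(* The basic neighbourhood W(x, phi_1 .. phi_n, Q, e) of the Fell topology:
   the y such that each function of positive type phi_j = <x(.)v_j, v_j>,
   v_j in vs, is e-close on Q to a finite sum of functions of positive type
   associated with y. *)
Definition fell_nbhd (x : irrep) (vs : seq (irrep_space x)) (Q : set G) (e : R)
    (y : irrep) : Prop :=
  forall v, v \in vs -> exists ws : seq (irrep_space y),
    forall h, Q h -> `|inner (irrep_act x h v) v -
      \sum_(w <- ws) inner (irrep_act y h w) w| < e%:C.

(* The type irrep lies in a universe that is too large for [set irrep], hence for
   a topology on a quotient of it.  So the unitary dual is a type of labels of the
   equivalence classes, with the chosen representatives dual_rep, and carries the
   Fell topology, in which the sets fell_nbhd around t form a neighbourhood base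
   of t.  ptopologicalType only adds a base point (the dual is nonempty), which
   measurableType requires. *)
Record unitary_dual := UnitaryDual {
  dual_label :> ptopologicalType;
  dual_rep : dual_label -> irrep;
  dual_complete : forall x : irrep,
    exists t, unitarily_equivalent (dual_rep t) x;
  dual_irredundant : forall s t,
    unitarily_equivalent (dual_rep s) (dual_rep t) -> s = t;
  dual_openE : forall U : set dual_label, open U <->
    forall t, U t -> exists (vs : seq (irrep_space (dual_rep t))) Q e,
      [/\ compact Q, 0 < e & [set s | fell_nbhd vs Q e (dual_rep s)] `<=` U];
}.

Definition borel_dual (D : unitary_dual) :=
  g_sigma_algebraType (open : set (set D)).

End representations.

(* Differential calculus on a Lie group G through its left invariant vector
   fields, which are the one-parameter subgroups t |-> gamma t: the field attached
   to gamma sends f to g |-> d/dt f (g * gamma t) at t = 0.  As these fields span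
   every tangent space, f is C^k iff its iterated left invariant derivatives up to
   order k exist and are continuous. *)
Section smooth.
Variables (R : realType) (G : topGroupType) (V : hilbertType R).
Implicit Types (gamma : R -> G) (f : G -> V).

Definition one_parameter_subgroup gamma :=
  continuous gamma /\ {morph gamma : s t / s + t >-> (s * t)%g}.

Definition diff_quotient gamma f (g : G) (t : R) : V :=
  (t^-1)%:C *: (f (g * gamma t)%g - f g).

Definition left_derivative gamma f (g : G) : V :=
  lim (diff_quotient gamma f g @ 0^').

Fixpoint class_C (k : nat) f : Prop :=
  continuous f /\
  if k is k'.+1 then
    forall gamma, one_parameter_subgroup gamma ->
      (forall g, cvg (diff_quotient gamma f g @ 0^')) /\
      class_C k' (left_derivative gamma f)
  else True.

Variable p : unitary_rep G V.

Definition smooth_vector (v : V) := forall k, class_C k (fun g => p g v).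

Definition infinitesimal gamma (v : V) : V :=
  lim (((t^-1)%:C *: (p (gamma t) v - v) : V) @[t --> (0 : R)^']).

Lemma class_C_linear k a f1 f2 : class_C k f1 -> class_C k f2 ->
  class_C k (fun g => a *: f1 g + f2 g).
Proof.
elim: k f1 f2 => [|k IH] f1 f2 /= [c1 h1] [c2 h2].
  split=> // x; apply: cvgD; last exact: c2.
  by apply: cvgZr; exact: c1.
split=> [x|gamma hg].
  apply: cvgD; last exact: c2.
  by apply: cvgZr; exact: c1.
have [d1 {}h1] := h1 _ hg; have [d2 {}h2] := h2 _ hg.
have e (g : G) : diff_quotient gamma (fun g => a *: f1 g + f2 g) g @ 0^' -->
    a *: left_derivative gamma f1 g + left_derivative gamma f2 g.
  have -> : diff_quotient gamma (fun g => a *: f1 g + f2 g) g =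
    (fun t => a *: diff_quotient gamma f1 g t + diff_quotient gamma f2 g t).
    apply/funext => t; rewrite /diff_quotient [in RHS]scalerA [a * _]mulrC.
    rewrite -scalerA -scalerDr; congr (_ *: _).
    by rewrite scalerBr opprD addrACA.
  by apply: cvgD; [apply: cvgZr; exact: d1|exact: d2].
split=> [g|]; first by apply/cvg_ex; eexists; exact: e.
suff -> : left_derivative gamma (fun g => a *: f1 g + f2 g) =
    (fun g => a *: left_derivative gamma f1 g + left_derivative gamma f2 g).
  exact: IH.
by apply/funext => g; apply/cvg_lim => //; exact: e.
Qed.

Lemma class_C0 k : class_C k (fun=> 0).
Proof.
elim: k => [|k IH] /=; first by split=> // x; exact: cvg_cst.
split=> [x|gamma hg]; first exact: cvg_cst.
have e (g : G) : diff_quotient gamma (fun=> 0) g @ 0^' --> (0 : V).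
  have -> : diff_quotient gamma (fun=> 0) g = (fun=> 0).
    by apply/funext => t; rewrite /diff_quotient subrr scaler0.
  exact: cvg_cst.
split=> [g|]; first by apply/cvg_ex; eexists; exact: e.
suff -> : left_derivative gamma (fun=> 0) = (fun=> 0) by [].
by apply/funext => g; apply/cvg_lim => //; exact: e.
Qed.

Lemma class_C_translate k f (h : G) :
  class_C k f -> class_C k (fun g => f (g * h)%g).
Proof.
have ch (F : G -> V) : continuous F -> continuous (fun g => F (g * h)%g).
  move=> cF x; apply: (@continuous_comp _ _ _ (fun g : G => (g * h)%g) F);
    last exact: cF.
  apply: (@continuous_comp _ _ _ (fun g : G => (g, h))
    (fun x : G * G => (x.1 * x.2)%g)); last exact: mulg_continuous.
  by apply: cvg_pair; [exact: cvg_id|exact: cvg_cst].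
elim: k f => [|k IH] f /= [c1 h1]; first by split=> //; exact: ch.
split=> [|gamma [cg mg]]; first exact: ch.
pose gammah t := (h^-1 * (gamma t * h))%g.
have e (g : G) : diff_quotient gamma (fun g => f (g * h)%g) g =
    diff_quotient gammah f (g * h)%g.
  apply/funext => t; rewrite /diff_quotient /gammah; congr (_ *: (f _ - _)).
  by rewrite -!mulgA mulVKg.
have hgh : one_parameter_subgroup gammah.
  split=> [x|s t]; last by rewrite /gammah mg -!mulgA mulVKg.
  rewrite /gammah; apply: (@continuous_comp _ _ _ (fun t => (h^-1, gamma t * h)%g)
    (fun x : G * G => (x.1 * x.2)%g)); last exact: mulg_continuous.
  apply: cvg_pair; first exact: cvg_cst.
  apply: (@continuous_comp _ _ _ (fun t => (gamma t, h)%g)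
    (fun x : G * G => (x.1 * x.2)%g)); last exact: mulg_continuous.
  by apply: cvg_pair; [exact: cg|exact: cvg_cst].
have [d1 {}h1] := h1 _ hgh.
split=> [g|]; first by rewrite e.
have -> : left_derivative gamma (fun g => f (g * h)%g) =
    (fun g => left_derivative gammah f (g * h)%g).
  by apply/funext => g; rewrite /left_derivative e.
exact: IH.
Qed.

Definition smooth_pred : {pred V} := fun v => `[< smooth_vector v >].

Lemma smooth_submod_closed : submod_closed smooth_pred.
Proof.
split=> [|a v w /asboolP hv /asboolP hw]; apply/asboolP => k.
  rewrite [X in class_C k X](_ : _ = fun=> 0); first exact: class_C0.
  by apply/funext => g; rewrite linear0.
rewrite [X in class_C k X](_ : _ = fun g => a *: p g v + p g w).
  exact: class_C_linear.
by apply/funext => g; rewrite linearP.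
Qed.

HB.instance Definition _ :=
  GRing.isSubmodClosed.Build R[i] V smooth_pred smooth_submod_closed.

Record smooth_vectors := SmoothVector {
  sv_val :> V;
  sv_smooth : sv_val \in smooth_pred;
}.

HB.instance Definition _ := [isSub for sv_val].
HB.instance Definition _ := [Choice of smooth_vectors by <:].
HB.instance Definition _ := [SubChoice_isSubLmodule of smooth_vectors by <:].

(* The Frechet topology: the coarsest one that makes all the maps
   v |-> dp(X_1) .. dp(X_m) v into V continuous. *)
HB.instance Definition _ := isSubBaseTopological.Build smooth_vectors
  [set A | exists (gammas : seq (R -> G)) (U : set V),
     [/\ forall gamma, List.In gamma gammas -> one_parameter_subgroup gamma,
         open U
       & A = [set v | U (foldr infinitesimal (sv_val v) gammas)]]] id.

Lemma smooth_act_subproof (h : G) (v : smooth_vectors) :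
  p h (sv_val v) \in smooth_pred.
Proof.
have /asboolP hv := sv_smooth v; apply/asboolP => k.
rewrite [X in class_C k X](_ : _ = fun g => p (g * h)%g (sv_val v)).
  exact: (@class_C_translate k (fun g => p g (sv_val v))).
by apply/funext => g; rewrite repM.
Qed.

Definition smooth_act (h : G) (v : smooth_vectors) : smooth_vectors :=
  SmoothVector (smooth_act_subproof h v).

End smooth.

(* A Hilbert tensor product of V and W: a Hilbert space with a bilinear map
   whose values have the prescribed inner products and span a dense subspace.
   This determines it up to a unique isomorphism. *)
Record hilbert_tensor (R : realType) (V W : hilbertType R) := HilbertTensor {
  tensor_space :> hilbertType R;
  tensor : V -> W -> tensor_space;
  tensor_linearl : forall w, linear (tensor^~ w);
  tensor_linearr : forall v, linear (tensor v);
  tensor_inner : forall v w v' w',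
    inner (tensor v w) (tensor v' w') = inner v v' * inner w w';
  tensor_dense :
    dense (lin_span [set x | exists v w, x = tensor v w]);
}.

Section direct_integral.
Context {R : realType} {d : measure_display} {L : measurableType d}.

Definition measurable_complex (f : L -> R[i]) :=
  measurable_fun setT (fun x => complex.Re (f x)) /\
  measurable_fun setT (fun x => complex.Im (f x)).

Variable K : L -> hilbertType R.
Implicit Types s t : forall l, K l.

Record measurable_family := MeasurableFamily {
  mf_section : set (forall l, K l);
  mf_section0 : mf_section (fun=> 0);
  mf_section_linear : forall (a : R[i]) s t, mf_section s -> mf_section t ->
    mf_section (fun l => a *: s l + t l);
  mf_measurable : forall s t, mf_section s -> mf_section t ->
    measurable_complex (fun l => inner (s l) (t l));
  mf_maximal : forall s, (forall t, mf_section t ->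
      measurable_complex (fun l => inner (s l) (t l))) ->
    mf_section s;
  mf_total : exists u : nat -> forall l, K l, (forall n, mf_section (u n)) /\
    forall l, dense (lin_span (range (fun n => u n l)));
}.

Variables (F : measurable_family) (mu : {measure set L -> \bar R}).

Definition square_integrable s :=
  (\int[mu]_l (complex.Re (inner (s l) (s l)))%:E < +oo)%E.

Record l2_section := L2Section {
  l2_val :> forall l, K l;
  l2_measurable : mf_section F l2_val;
  l2_finite : square_integrable l2_val;
}.
HB.instance Definition _ := gen_eqMixin l2_section.
HB.instance Definition _ := gen_choiceMixin l2_section.

Definition ae_equal (s t : l2_section) : bool :=
  `[< \forall l \ae mu, s l = t l >].

Let ae_equal_refl : reflexive ae_equal.
Proof. by move=> s; apply/asboolP; apply: nearW. Qed.

Let ae_equal_sym : symmetric ae_equal.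
Proof.
by move=> s t; apply/idP/idP => /asboolP h; apply/asboolP; apply: filterS h.
Qed.

Let ae_equal_trans : transitive ae_equal.
Proof.
move=> t s u /asboolP h1 /asboolP h2; apply/asboolP.
by apply: filterS2 h1 h2 => l ->.
Qed.

Canonical ae_equal_equiv :=
  EquivRel ae_equal ae_equal_refl ae_equal_sym ae_equal_trans.

(* The direct integral of the K l: square integrable measurable sections modulo
   almost everywhere equality; repr picks a representative of a class. *)
Definition direct_integral := {eq_quot ae_equal_equiv}.
HB.instance Definition _ := EqQuotient.on direct_integral.
HB.instance Definition _ := Choice.on direct_integral.

Lemma di_eqP (x y : l2_section) :
  \pi_direct_integral x = \pi_direct_integral y <->
  \forall l \ae mu, x l = y l.
Proof.
split=> [/eqmodP/asboolP //|h].
by apply/eqmodP/asboolP.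
Qed.

Lemma di_reprP (x : l2_section) :
  \forall l \ae mu, repr (\pi_direct_integral x) l = x l.
Proof. by apply/di_eqP; rewrite reprK. Qed.

Let l2_0_finite : square_integrable (fun=> 0).
Proof.
rewrite /square_integrable; under eq_integral do rewrite inner0l.
by rewrite integral0 ltry.
Qed.

Definition l2_0 := L2Section (mf_section0 F) l2_0_finite.

Let l2_linear_finite (a : R[i]) (s t : l2_section) :
  square_integrable (fun l => a *: s l + t l).
Proof.
have mRe (u v : forall l, K l) : mf_section F u -> mf_section F v ->
    measurable_fun setT (fun l => (complex.Re (inner (u l) (v l)))%:E).
  by move=> hu hv; apply/measurable_EFinP; have [] := mf_measurable hu hv.
have hs := l2_measurable s; have ht := l2_measurable t.
have hst := mf_section_linear a hs ht.
pose c := 2 * complex.Re (a * a^* ).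
have c0 : 0 <= c by rewrite mulr_ge0//; case: (a) => u v /=; nra.
rewrite /square_integrable.
apply: (@le_lt_trans _ _ (\int[mu]_l (c%:E * (complex.Re (inner (s l) (s l)))%:E
    + 2%:E * (complex.Re (inner (t l) (t l)))%:E)))%E.
  apply: ge0_le_integral => //.
  - by move=> l _; rewrite lee_fin Re_inner_ge0.
  - exact: mRe.
  - by apply: emeasurable_funD; apply: measurable_funeM; exact: mRe.
  - move=> l _; rewrite -!EFinM -EFinD lee_fin.
    by apply: le_trans (Re_innerD_le _ _) _; rewrite Re_innerZ mulrA.
rewrite ge0_integralD//; first last.
- by apply: measurable_funeM; exact: mRe.
- by move=> l _; rewrite -EFinM lee_fin mulr_ge0// Re_inner_ge0.
- by apply: measurable_funeM; exact: mRe.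
- by move=> l _; rewrite -EFinM lee_fin mulr_ge0// Re_inner_ge0.
rewrite !ge0_integralZl_EFin//; first last.
- exact: mRe.
- by move=> l _; rewrite lee_fin Re_inner_ge0.
- exact: mRe.
- by move=> l _; rewrite lee_fin Re_inner_ge0.
apply: lte_add_pinfty; apply: lte_mul_pinfty => //; first exact: l2_finite.
exact: l2_finite.
Qed.

Definition l2_linear (a : R[i]) (s t : l2_section) := L2Section
  (mf_section_linear a (l2_measurable s) (l2_measurable t))
  (l2_linear_finite a s t).

Definition di_zero : direct_integral := \pi_direct_integral l2_0.
Definition di_add (x y : direct_integral) : direct_integral :=
  \pi_direct_integral (l2_linear 1 (repr x) (repr y)).
Definition di_opp (x : direct_integral) : direct_integral :=
  \pi_direct_integral (l2_linear (-1) (repr x) l2_0).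
Definition di_scale (a : R[i]) (x : direct_integral) : direct_integral :=
  \pi_direct_integral (l2_linear a (repr x) l2_0).

Let di_addA : associative di_add.
Proof.
move=> x y z; apply/di_eqP.
apply: filterS2 (di_reprP (l2_linear 1 (repr y) (repr z)))
  (di_reprP (l2_linear 1 (repr x) (repr y))) => l /= -> -> /=.
by rewrite !scale1r addrA.
Qed.

Let di_addC : commutative di_add.
Proof.
by move=> x y; apply/di_eqP; apply: nearW => l /=; rewrite !scale1r addrC.
Qed.

Let di_add0 : left_id di_zero di_add.
Proof.
move=> x; rewrite -[RHS]reprK; apply/di_eqP.
by apply: filterS (di_reprP l2_0) => l /= ->; rewrite scaler0 add0r.
Qed.

Let di_addN : left_inverse di_zero di_opp di_add.
Proof.
move=> x; apply/di_eqP.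
apply: filterS (di_reprP (l2_linear (-1) (repr x) l2_0)) => l /= -> /=.
by rewrite scale1r addr0 scaleN1r addNr.
Qed.

HB.instance Definition _ :=
  GRing.isZmodule.Build direct_integral di_addA di_addC di_add0 di_addN.

Let di_scaleA a b x : di_scale a (di_scale b x) = di_scale (a * b) x.
Proof.
apply/di_eqP.
apply: filterS (di_reprP (l2_linear b (repr x) l2_0)) => l /= -> /=.
by rewrite !addr0 scalerA.
Qed.

Let di_scale1 : left_id 1 di_scale.
Proof.
move=> x; rewrite -[RHS]reprK; apply/di_eqP.
by apply: nearW => l /=; rewrite scale1r addr0.
Qed.

Let di_scaleDr : right_distributive di_scale +%R.
Proof.
move=> a x y; apply/di_eqP.
apply: filterS3 (di_reprP (l2_linear a (repr x) l2_0))
  (di_reprP (l2_linear a (repr y) l2_0))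
  (di_reprP (l2_linear 1 (repr x) (repr y))) => l /= -> -> -> /=.
by rewrite !scale1r !addr0 scalerDr.
Qed.

Let di_scaleDl x : {morph di_scale^~ x : a b / a + b}.
Proof.
move=> a b; apply/di_eqP.
apply: filterS2 (di_reprP (l2_linear a (repr x) l2_0))
  (di_reprP (l2_linear b (repr x) l2_0)) => l /= -> -> /=.
by rewrite !scale1r !addr0 scalerDl.
Qed.

HB.instance Definition _ := GRing.Zmodule_isLmodule.Build R[i] direct_integral
  di_scaleA di_scale1 di_scaleDr di_scaleDl.

Definition di_inner (x y : direct_integral) : R[i] :=
  (\int[mu]_l complex.Re (inner (repr x l) (repr y l))) +i*
  (\int[mu]_l complex.Im (inner (repr x l) (repr y l))).

End direct_integral.

Definition unitary_isomorphism (R : realType) (V : hilbertType R)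
    (d : measure_display) (L : measurableType d) (K : L -> hilbertType R)
    (F : measurable_family K) (mu : {measure set L -> \bar R})
    (T : {linear V -> direct_integral F mu}) :=
  bijective T /\ forall v w, di_inner (T v) (T w) = inner v w.

(* s is the representation p (x) 1 on the tensor product E. *)
Definition acts_on_first_factor (R : realType) (H : topGroupType)
    (V W : hilbertType R) (E : hilbert_tensor V W)
    (p : unitary_rep H V) (s : unitary_rep H E) :=
  forall h v w, s h (tensor E v w) = tensor E (p h v) w.

(* Main.v *)
(* If p has no nonzero smooth vector there is nothing to prove. Otherwise let K be the maximal
   compact subgroup of G above the orthogonal matrices. Averaging rank one operators over K
   yields a finite-dimensional K-invariant space W of smooth vectors. Schur's lemma for
   symmetric operators makes the operators sum tr(X_1^T .. X_j^T) X_1 .. X_j scalar; analyticity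
   of the vectors of W makes U(g) W dense; and with g = k + a + Ad(a0)^-1 k the power sums of a
   being scalar modulo lower order give finitely many smooth vectors f with K f total in V.
   Hence the multiplicity of K-types grows polynomially, so that some negative power of
   1 + Casimir_K is trace class: for an orthonormal eigenbasis (e, c e) and some N the sum of
   (1 + c e)^(-2N) is finite. By monotone convergence, sum (1 + c e)^(-2N) |T(e)(t)|^2 is finite
   for almost every t, and there A_t v = sum <v, e> T(e)(t) converges and is bounded by
   |(1 + Casimir_K)^N v|. Equivariance is an equality almost everywhere for each of countably
   many pairs in H x V^oo that are dense for the relevant seminorms. *)

Require Import Defs.
From HB Require Import structures.
From mathcomp Require Import all_boot all_order all_algebra.
From mathcomp Require Import all_classical all_reals all_analysis.
From mathcomp Require Import measurable_realfun complex.
From mathcomp Require Import ring lra zify.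
From mathcomp Require mpoly finmap.
Import Order.TTheory GRing.Theory Num.Theory numFieldNormedType.Exports.
Local Open Scope classical_set_scope.
Local Open Scope ring_scope.

Set Implicit Arguments.
Unset Strict Implicit.
Unset Printing Implicit Defensive.
Local Open Scope complex_scope.
Notation Re := complex.Re.

(** Averages over K are limits of minimizers of the Hilbert-Schmidt norm on the convex hull of a
    K-orbit of rank one operators: the parallelogram identity makes the limit unique, hence
    K-invariant, and no integral over K is formed. The trace operators stand in for the centre of
    the enveloping algebra: on [a] they are power sums of n coordinates, and by Newton's identities
    only the n^n monomials with exponents below n have to be applied to W. The element a0 = exp H0,
    with H0 generic in [a], takes over the role of the nilpotent part of an Iwasawa decomposition:
    the orthogonal complement of k + Ad(a0)^-1 k is [a]. Polynomial growth is a volume count: where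
    the basis of k acts with norm at most L, a vector stays close to itself on a ball of K of radius
    about 1 / (1 + L), and O((1 + L)^(n^2)) such balls cover K. One nonzero smooth vector suffices
    to start: irreducibility makes smooth vectors dense, and identities are then tested against
    them. Sections are defined only up to null sets that depend on the vector, so everything asked
    of almost every t is first reduced to countably many conditions. *)

Lemma eq_ler (R : numDomainType) (x y : R) : x = y -> x <= y.
Proof. by move=> ->. Qed.

Lemma half_lt (R : realFieldType) (x : R) : 0 < x -> x / 2 < x.
Proof. by move=> x0; rewrite ltr_pdivrMr// ltr_pMr// ltr1n. Qed.

(** * Finite sums and a normalizer for linear identities in modules *)

Section sums.
Variables (R : numDomainType) (I : eqType) (r : seq I).
Implicit Types F G : I -> R.

Lemma ler_sum_seq F G : (forall i, i \in r -> F i <= G i) -> \sum_(i <- r) F i <= \sum_(i <- r) G i.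
Proof. by move=> h; rewrite big_seq [leRHS]big_seq; exact: ler_sum. Qed.

Lemma sumr_ge0_seq F : (forall i, i \in r -> 0 <= F i) -> 0 <= \sum_(i <- r) F i.
Proof. by move=> h; rewrite big_seq; exact: sumr_ge0. Qed.

End sums.

Lemma sum_sqr_ge0 (R : realDomainType) (I : Type) (r : seq I) (F : I -> R) : 0 <= \sum_(i <- r) F i ^+ 2.
Proof. by apply: sumr_ge0 => i _; exact: sqr_ge0. Qed.

(* Reflexive normalization of linear identities in a module to one ring identity per atom. *)
Section lmod_solver.
Variables (K : comPzRingType) (V : lmodType K).

Inductive lexp := LVar of nat | LZero | LAdd of lexp & lexp | LOpp of lexp | LScale of K & lexp.

Fixpoint leval (env : seq V) e : V := match e with
 | LVar i => nth 0 env i | LZero => 0 | LAdd a b => leval env a + leval env b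
 | LOpp a => - leval env a | LScale k a => k *: leval env a end.

Fixpoint lcoef (i : nat) e : K := match e with
 | LVar j => if Nat.eqb i j then 1 else 0 | LZero => 0 | LAdd a b => lcoef i a + lcoef i b
 | LOpp a => - lcoef i a | LScale k a => k * lcoef i a end.

Fixpoint lcheck n e1 e2 : Prop := match n with
 | 0%N => True | n'.+1 => lcoef n' e1 = lcoef n' e2 /\ lcheck n' e1 e2 end.

Lemma levalE (env : seq V) e : leval env e = \sum_(i < size env) lcoef i e *: env`_i.
Proof.
elim: e => [j| |a IHa b IHb|a IHa|k a IHa] /=.
- have eqb (i : nat) : Nat.eqb i j = (i == j) by elim: i j => [|i IH] [|j].
 have [jn|nj] := ltnP j (size env).
  rewrite (bigD1 (Ordinal jn))//= eqb eqxx scale1r big1 ?addr0// => i ij.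
  by rewrite eqb; case: eqP => [e|]; rewrite ?scale0r//; case/eqP: ij; exact: val_inj.
 rewrite nth_default// big1// => i _; rewrite eqb ltn_eqF ?scale0r//.
 exact: leq_trans (ltn_ord i) nj.
- by rewrite big1// => i _; rewrite scale0r.
- by rewrite IHa IHb -big_split; apply: eq_bigr => i _; rewrite scalerDl.
- by rewrite IHa -sumrN; apply: eq_bigr => i _; rewrite scaleNr.
- by rewrite IHa scaler_sumr; apply: eq_bigr => i _; rewrite scalerA.
Qed.

Lemma lmod_correct env e1 e2 : lcheck (size env) e1 e2 -> leval env e1 = leval env e2.
Proof.
move=> h; rewrite !levalE; apply: eq_bigr => -[i /= hi] _; congr (_ *: _).
elim: (size env) hi h => // m IH; rewrite ltnS leq_eqVlt => /orP[/eqP->|im] [] //.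
by move=> _; exact: IH.
Qed.

End lmod_solver.

Ltac lm_find x l k :=
 lazymatch l with
 | nil => constr:(@None nat)
 | x :: _ => constr:(Some k)
 | _ :: ?l' => lm_find x l' (S k)
 end.
Ltac lm_add x l :=
 lazymatch lm_find x l O with
 | None => let n := constr:(x) in
   let rec app l := lazymatch l with nil => constr:(x :: nil)
    | ?y :: ?l' => let r := app l' in constr:(y :: r) end in app l
 | _ => l end.
Ltac lm_atoms t l :=
 lazymatch t with
 | (?a + ?b)%R => let l := lm_atoms a l in lm_atoms b l
 | (- ?a)%R => lm_atoms a l
 | (_ *: ?a)%R => lm_atoms a l
 | (0)%R => l
 | _ => lm_add t l
 end.
Ltac lm_reify K t l :=
 lazymatch t with
 | (?a + ?b)%R => let x := lm_reify K a l in let y := lm_reify K b l in constr:(@LAdd K x y)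
 | (- ?a)%R => let x := lm_reify K a l in constr:(@LOpp K x)
 | (?k *: ?a)%R => let x := lm_reify K a l in constr:(@LScale K k x)
 | (0)%R => constr:(@LZero K)
 | _ => lazymatch lm_find t l O with Some ?i => constr:(@LVar K i) end
 end.
Ltac lmod_with K V :=
 lazymatch goal with |- @eq _ ?a ?b =>
  let l := constr:(@nil V) in let l := lm_atoms a l in let l := lm_atoms b l in
  let x := lm_reify K a l in let y := lm_reify K b l in
  refine (@lmod_correct K V l x y _);
  cbn [lcheck lcoef size Nat.eqb]; repeat split; ring
 end.
Ltac lmod R V := lmod_with (R[i] : comPzRingType) (V : lmodType R[i]).

(** * The real-valued norm of a complex normed space *)

Section real_norm.
Variable R : realType.

(** Norms of complex spaces take values in [R[i]], whose order is only partial. As a norm is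
    nonnegative, its real part carries the same information and lives in a totally ordered field. *)
Definition rn (V : normedZmodType R[i]) (x : V) : R := Re `|x|.

Lemma ge0_complexE (z : R[i]) : 0 <= z -> z = (Re z)%:C.
Proof. by case: z => a b; rewrite lecE /= => /andP[/eqP -> _]. Qed.

Lemma rnE (V : normedZmodType R[i]) (x : V) : `|x| = (rn x)%:C.
Proof. exact: ge0_complexE. Qed.

Section zmod.
Variable V : normedZmodType R[i].
Implicit Types x y : V.

Lemma rn_ge0 x : 0 <= rn x.
Proof. by rewrite -lecR -rnE; exact: normr_ge0. Qed.
Lemma rn0 : rn (0 : V) = 0.
Proof. by rewrite /rn normr0. Qed.
Lemma rnN x : rn (- x) = rn x.
Proof. by rewrite /rn normrN. Qed.
Lemma rn_distC x y : rn (x - y) = rn (y - x).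
Proof. by rewrite /rn distrC. Qed.
Lemma rn0_eq0 x : rn x = 0 -> x = 0.
Proof. by move=> h; apply/eqP; rewrite -normr_eq0 rnE h. Qed.
Lemma rn_eq0 x : (rn x == 0) = (x == 0).
Proof. by apply/eqP/eqP => [/rn0_eq0//|->]; exact: rn0. Qed.
Lemma rn_gt0 x : (0 < rn x) = (x != 0).
Proof. by rewrite lt_def rn_ge0 andbT rn_eq0. Qed.
Lemma rnD x y : rn (x + y) <= rn x + rn y.
Proof. by rewrite -lecR rmorphD /= -!rnE ler_normD. Qed.
Lemma rnB x y : rn (x - y) <= rn x + rn y.
Proof. by rewrite -(rnN y) rnD. Qed.
Lemma rn_le0 x : rn x <= 0 -> x = 0.
Proof. by move=> h; apply: rn0_eq0; apply/eqP; rewrite eq_le h rn_ge0. Qed.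
Lemma rn_dist_eq x y : (forall e, 0 < e -> rn (x - y) <= e) -> x = y.
Proof.
move=> h; apply/eqP; rewrite -subr_eq0 -rn_eq0 eq_le rn_ge0 andbT.
by apply/ler_addgt0Pr => e e0; rewrite add0r h.
Qed.
Lemma rn_dist_triangle z x y : rn (x - y) <= rn (x - z) + rn (z - y).
Proof. by rewrite (le_trans _ (rnD _ _))// addrA subrK. Qed.

Lemma rn_sum (I : Type) (r : seq I) (P : pred I) (F : I -> V) :
 rn (\sum_(i <- r | P i) F i) <= \sum_(i <- r | P i) rn (F i).
Proof.
apply: (big_ind2 (fun (a : V) b => rn a <= b)) => //; first by rewrite rn0.
by move=> x a y b h1 h2; rewrite (le_trans (rnD _ _)) ?lerD.
Qed.
End zmod.

Lemma rnZ (V : normedModType R[i]) (a : R[i]) (x : V) : rn (a *: x) = rn a * rn x.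
Proof. by apply: (@complexI R); rewrite rmorphM /= -!rnE normrZ. Qed.

Lemma rnM (a b : R[i]) : rn (a * b) = rn a * rn b.
Proof. by apply: (@complexI R); rewrite rmorphM /= -!rnE normrM. Qed.

Lemma rn_real (a : R) : rn (a%:C) = `|a|.
Proof. by rewrite /rn normc_def /= expr0n /= addr0 sqrtr_sqr. Qed.

Lemma rn_conj (a : R[i]) : rn a^* = rn a.
Proof. by case: a => a b; rewrite /rn !normc_def /= sqrrN. Qed.

Lemma rn_sqr (a : R[i]) : rn a ^+ 2 = Re a ^+ 2 + complex.Im a ^+ 2.
Proof. by apply: (@complexI R); rewrite add_Re2_Im2 rnE rmorphXn. Qed.

Lemma Re_le_rn (a : R[i]) : Re a <= rn a.
Proof.
have := normc_ge_Re a; rewrite rnE lecR => h.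
exact: le_trans (ler_norm _) h.
Qed.
Lemma absRe_le_rn (a : R[i]) : `|Re a| <= rn a.
Proof. by have := normc_ge_Re a; rewrite rnE lecR. Qed.
Lemma absIm_le_rn (a : R[i]) : `|complex.Im a| <= rn a.
Proof.
rewrite -(@ler_pXn2r _ 2) ?nnegrE ?rn_ge0// rn_sqr real_normK ?num_real//.
by rewrite lerDr sqr_ge0.
Qed.

Lemma cvg_rnP (V : normedModType R[i]) (T : Type) (F : set_system T)
 (FF : Filter F) (f : T -> V) (l : V) :
 (f x @[x --> F] --> l) <-> (forall e : R, 0 < e -> \forall x \near F, rn (l - f x) < e).
Proof.
rewrite cvgrPdist_lt; split => h e e0.
 have := h e%:C; rewrite ltcR => /(_ e0); apply: filterS => x.
 by rewrite rnE ltcR.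
have e0' := e0; rewrite ltcE /= in e0' => {}.
case/andP: e0' => /eqP he e0'; have := h _ e0'; apply: filterS => x.
by rewrite rnE => hx; rewrite (ge0_complexE (ltW e0)) ltcR.
Qed.

(** The epsilon form of convergence of scalars, which is what Cauchy-Schwarz delivers for inner
    products and all that uniqueness of limits uses. *)
Definition ctends (T : Type) (F : set_system T) (f : T -> R[i]) (l : R[i]) :=
 forall e : R, 0 < e -> \forall x \near F, rn (l - f x) < e.

Lemma ctends_unique (T : Type) (F : set_system T) (FF : ProperFilter F) f l l' :
 ctends F f l -> ctends F f l' -> l = l'.
Proof.
move=> h h'; apply/eqP; rewrite -subr_eq0 -rn_eq0 eq_le rn_ge0 andbT leNgt.
apply/negP => p0; have p2 : 0 < rn (l - l') / 2 by rewrite divr_gt0.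
have [x [h1 h2]] := @filter_ex _ F FF _ (@filterI _ F _ _ _ (h _ p2) (h' _ p2)).
have := rn_dist_triangle (f x) l l'; rewrite (rn_distC (f x) l').
rewrite leNgt => /negP; apply; lra.
Qed.

End real_norm.

(** * Inner products and Cauchy-Schwarz *)

Section hilbert.
Variables (R : realType) (V : hilbertType R).
Implicit Types (x y z : V) (a : R[i]).

Lemma inner_rn x : inner x x = (rn x ^+ 2)%:C.
Proof. by rewrite inner_norm rnE rmorphXn. Qed.
Lemma Re_inner_rn x : Re (inner x x) = rn x ^+ 2.
Proof. by rewrite inner_rn. Qed.

Lemma inner0r x : inner x 0 = 0 :> R[i].
Proof. by rewrite innerC inner0l rmorph0. Qed.
Lemma innerNl x y : inner (- x) y = - inner x y.
Proof. by rewrite -scaleN1r innerZl mulN1r. Qed.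
Lemma innerNr x y : inner x (- y) = - inner x y.
Proof. by rewrite innerC innerNl rmorphN /= -innerC. Qed.
Lemma innerBl x y z : inner (x - y) z = inner x z - inner y z.
Proof. by rewrite innerDl innerNl. Qed.
Lemma innerBr x y z : inner x (y - z) = inner x y - inner x z.
Proof. by rewrite innerDr innerNr. Qed.
Lemma inner_suml (I : Type) (r : seq I) (P : pred I) (F : I -> V) y :
 inner (\sum_(i <- r | P i) F i) y = \sum_(i <- r | P i) inner (F i) y.
Proof.
by apply: (big_morph (fun x => inner x y)) => [u v|]; rewrite ?innerDl ?inner0l.
Qed.
Lemma inner_sumr (I : Type) (r : seq I) (P : pred I) (F : I -> V) y :
 inner y (\sum_(i <- r | P i) F i) = \sum_(i <- r | P i) inner y (F i).
Proof.
by apply: (big_morph (fun x => inner y x)) => [u v|]; rewrite ?innerDr ?inner0r.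
Qed.
Lemma innerZl_real (r : R) x y : inner (r%:C *: x) y = r%:C * inner x y.
Proof. exact: innerZl. Qed.
Lemma innerZr_real (r : R) x y : inner x (r%:C *: y) = r%:C * inner x y.
Proof. by rewrite innerZr; congr (_ * _); apply/eqP; rewrite eq_complex /= oppr0 !eqxx. Qed.

Lemma Re_innerC x y : Re (inner y x) = Re (inner x y).
Proof. by rewrite innerC; case: (inner x y). Qed.

Lemma rn_sqrD x y :
 rn (x + y) ^+ 2 = rn x ^+ 2 + rn y ^+ 2 + 2 * Re (inner x y).
Proof.
rewrite -!Re_inner_rn innerDl !innerDr !raddfD /= (Re_innerC x y); ring.
Qed.
Lemma rn_sqrB x y :
 rn (x - y) ^+ 2 = rn x ^+ 2 + rn y ^+ 2 - 2 * Re (inner x y).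
Proof. by rewrite rn_sqrD rnN innerNr raddfN /=; ring. Qed.
Lemma parallelogram x y :
 rn (x + y) ^+ 2 + rn (x - y) ^+ 2 = 2 * rn x ^+ 2 + 2 * rn y ^+ 2.
Proof. by rewrite rn_sqrD rn_sqrB; ring. Qed.

(** The squared norm of |y| x - |x| y is nonnegative, and it expands to 2 |x| |y| (|x| |y| - Re <x,
    y>). *)
Lemma Re_inner_le x y : Re (inner x y) <= rn x * rn y.
Proof.
have [->|x0] := eqVneq x 0; first by rewrite inner0l rn0 mul0r.
have hx : 0 < rn x by rewrite rn_gt0.
have [->|y0] := eqVneq y 0; first by rewrite inner0r rn0 mulr0.
have hy : 0 < rn y by rewrite rn_gt0.
have h := sqr_ge0 (rn ((rn y)%:C *: x - (rn x)%:C *: y)).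
rewrite rn_sqrB !rnZ !rn_real !gtr0_norm// innerZl_real innerZr_real in h.
have e : Re ((rn y)%:C * ((rn x)%:C * inner x y)) = rn y * rn x * Re (inner x y).
 by case: (inner x y) => u v /=; rewrite !mul0r !subr0 mulrA.
rewrite e in h.
rewrite -subr_ge0 -(@pmulr_rge0 _ (rn x * rn y)) ?mulr_gt0// -(@pmulr_rge0 _ 2)//.
by apply: le_trans h _; apply: eq_ler; ring.
Qed.

(** Multiplying [x] by the conjugate of <x, y> turns the inner product into |<x, y>|^2, so the bound
    on real parts applies and one factor |<x, y>| cancels. *)
Lemma rn_inner_le x y : rn (inner x y) <= rn x * rn y.
Proof.
set c := inner x y.
have [c0|c0] := eqVneq c 0; first by rewrite c0 rn0 mulr_ge0 ?rn_ge0.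
have hc : 0 < rn c by rewrite rn_gt0.
have := Re_inner_le (c^* *: x) y.
rewrite innerZl -/c rnZ rn_conj => h.
have e : Re (c^* * c) = rn c ^+ 2.
 by rewrite rn_sqr; case: (c) => u v /=; ring.
by rewrite e expr2 -mulrA ler_pM2l in h.
Qed.

Lemma cvg_innerl (T : Type) (F : set_system T) {FF : Filter F} (f : T -> V) l y :
 f t @[t --> F] --> l -> ctends F (fun t => inner (f t) y) (inner l y).
Proof.
move=> /cvg_rnP h e e0.
have p0 : 0 < rn y + 1 by rewrite ltr_wpDl ?rn_ge0.
have := h (e / (rn y + 1)); rewrite divr_gt0// => /(_ isT).
apply: filterS => x hx; rewrite -innerBl (le_lt_trans (rn_inner_le _ _))//.
rewrite ltr_pdivlMr// in hx; apply: le_lt_trans hx.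
by rewrite ler_wpM2l ?rn_ge0// lerDl.
Qed.

Lemma cvg_innerr (T : Type) (F : set_system T) {FF : Filter F} (f : T -> V) l y :
 f t @[t --> F] --> l -> ctends F (fun t => inner y (f t)) (inner y l).
Proof.
move=> /cvg_rnP h e e0.
have p0 : 0 < rn y + 1 by rewrite ltr_wpDl ?rn_ge0.
have := h (e / (rn y + 1)); rewrite divr_gt0// => /(_ isT).
apply: filterS => x hx; rewrite -innerBr (le_lt_trans (rn_inner_le _ _))//.
rewrite ltr_pdivlMr// mulrC in hx; apply: le_lt_trans hx.
by rewrite ler_wpM2r ?rn_ge0// lerDl.
Qed.

(** A nonzero x would have some z of D at distance less than |x|, and then |x|^2 = <x, x - z> <
    |x|^2. *)
Lemma dense_inner_eq0 (D : V -> Prop) x :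
 (forall y e, 0 < e -> exists2 z, D z & rn (y - z) < e) ->
 (forall z, D z -> inner x z = 0) -> x = 0.
Proof.
move=> dD h; apply/eqP; rewrite -rn_eq0 eq_le rn_ge0 andbT leNgt; apply/negP => x0.
have [z Dz hz] := dD x _ x0.
have : rn x ^+ 2 <= rn x * rn (x - z).
 rewrite -Re_inner_rn -[inner x x]subr0 -(h _ Dz) -innerBr.
 exact: Re_inner_le.
by rewrite expr2 ler_pM2l// leNgt hz.
Qed.

Lemma absRe_inner_le x y : `|Re (inner x y)| <= rn x * rn y.
Proof. exact: le_trans (absRe_le_rn _) (rn_inner_le x y). Qed.

End hilbert.

(** * Matrix norms and the matrix exponential *)

Section matrix_norm.
Variables (R : realType) (n : nat).
Implicit Types (A B X Y Z : 'M[R]_n).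

(** The entrywise sum is submultiplicative and invariant under transposition, but the identity has
    norm n. Estimates of powers therefore treat exponent 0 apart or are written for 1 + Z. *)
Definition mnorm (A : 'M[R]_n) : R := \sum_i \sum_j `|A i j|.

Lemma mnorm_ge0 A : 0 <= mnorm A.
Proof. by apply: sumr_ge0 => i _; apply: sumr_ge0. Qed.
Lemma mnorm_entry A i j : `|A i j| <= mnorm A.
Proof.
rewrite /mnorm (bigD1 i)//= (bigD1 j)//= -addrA lerDl addr_ge0//.
 by apply: sumr_ge0.
by apply: sumr_ge0 => k _; apply: sumr_ge0.
Qed.
Lemma mnorm_le (A : 'M[R]_n) (c : R) : (forall i j, `|A i j| <= c) ->
 mnorm A <= n%:R ^+ 2 * c.
Proof.
move=> h; rewrite /mnorm expr2 -mulrA.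
apply: (@le_trans _ _ (\sum_(i < n) n%:R * c)).
 apply: ler_sum => i _; apply: (@le_trans _ _ (\sum_(j < n) c)); first exact: ler_sum.
 by rewrite sumr_const card_ord mulr_natl.
by rewrite sumr_const card_ord -[X in X <= _]mulr_natl.
Qed.
Lemma mnorm_eq0 A : mnorm A = 0 -> A = 0.
Proof.
move=> h; apply/matrixP => i j; rewrite !mxE; apply/eqP.
by rewrite -normr_le0 -h mnorm_entry.
Qed.
Lemma mnorm0 : mnorm 0 = 0.
Proof. by rewrite /mnorm big1// => i _; rewrite big1// => j _; rewrite mxE normr0. Qed.

Lemma mnormD A B : mnorm (A + B) <= mnorm A + mnorm B.
Proof.
rewrite /mnorm -big_split /=; apply: ler_sum => i _.
rewrite -big_split /=; apply: ler_sum => j _; rewrite mxE; exact: ler_normD.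
Qed.
Lemma mnormN A : mnorm (- A) = mnorm A.
Proof. by apply: eq_bigr => i _; apply: eq_bigr => j _; rewrite mxE normrN. Qed.
Lemma mnormB A B : mnorm (A - B) <= mnorm A + mnorm B.
Proof. by rewrite -(mnormN B) mnormD. Qed.
Lemma mnorm_distC A B : mnorm (A - B) = mnorm (B - A).
Proof. by rewrite -mnormN opprB. Qed.
Lemma mnorm_dist_triangle B A C : mnorm (A - C) <= mnorm (A - B) + mnorm (B - C).
Proof. by rewrite (le_trans _ (mnormD _ _))// addrA subrK. Qed.
Lemma mnormZ (c : R) A : mnorm (c *: A) = `|c| * mnorm A.
Proof.
rewrite /mnorm mulr_sumr; apply: eq_bigr => i _; rewrite mulr_sumr.
by apply: eq_bigr => j _; rewrite mxE normrM.
Qed.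
Lemma mnorm_tr A : mnorm A^T = mnorm A.
Proof.
by rewrite /mnorm exchange_big; apply: eq_bigr => i _; apply: eq_bigr => j _; rewrite mxE.
Qed.
Lemma mnorm_sum (I : Type) (r : seq I) (P : pred I) (F : I -> 'M[R]_n) :
 mnorm (\sum_(i <- r | P i) F i) <= \sum_(i <- r | P i) mnorm (F i).
Proof.
apply: (big_ind2 (fun a b => mnorm a <= b)) => //; first by rewrite mnorm0.
by move=> x a y b h1 h2; rewrite (le_trans (mnormD _ _)) ?lerD.
Qed.
Lemma mnormM A B : mnorm (A *m B) <= mnorm A * mnorm B.
Proof.
rewrite /mnorm mulr_suml; apply: ler_sum => i _.
apply: (@le_trans _ _ (\sum_j \sum_k `|A i k| * `|B k j|)).
 apply: ler_sum => j _; rewrite mxE (le_trans (ler_norm_sum _ _ _))//.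
 by apply: ler_sum => k _; rewrite normrM.
rewrite exchange_big mulr_suml; apply: ler_sum => k _ /=.
rewrite -mulr_sumr ler_wpM2l// [leRHS](bigD1 k)//= lerDl.
by apply: sumr_ge0 => l _; apply: sumr_ge0.
Qed.
Lemma entry_exp X k i j : `|(X ^+ k) i j| <= mnorm X ^+ k.
Proof.
case: k => [|k].
 rewrite !expr0 mxE; case: eqP => _; by rewrite ?normr1 ?normr0 ?ler01.
apply: le_trans (mnorm_entry _ _ _) _.
elim: k => [|k IH]; first by rewrite !expr1.
rewrite exprS [leRHS]exprS; apply: le_trans (mnormM _ _) _.
by rewrite ler_wpM2l ?mnorm_ge0.
Qed.

Lemma mnorm_powl Z Y k : mnorm ((1 + Z) ^+ k *m Y) <= (1 + mnorm Z) ^+ k * mnorm Y.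
Proof.
elim: k => [|k IH]; first by rewrite !expr0 mul1mx mul1r.
rewrite exprS -[X in X *m Y]/((1 + Z) *m (1 + Z) ^+ k) -mulmxA mulmxDl mul1mx.
apply: le_trans (mnormD _ _) _; apply: (le_trans (lerD (lexx _) (mnormM _ _))).
by rewrite -{1}[mnorm _]mul1r -mulrDl exprS -mulrA ler_wpM2l// addr_ge0// mnorm_ge0.
Qed.

Lemma mnorm_powr Z Y k : mnorm (Y *m (1 + Z) ^+ k) <= mnorm Y * (1 + mnorm Z) ^+ k.
Proof.
elim: k => [|k IH]; first by rewrite !expr0 mulmx1 mulr1.
rewrite exprSr -[X in Y *m X]/((1 + Z) ^+ k *m (1 + Z)) mulmxA mulmxDr mulmx1.
apply: le_trans (mnormD _ _) _; apply: (le_trans (lerD (lexx _) (mnormM _ _))).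
by rewrite -{1}[mnorm _]mulr1 -mulrDr exprSr mulrA ler_wpM2r// addr_ge0// mnorm_ge0.
Qed.

(* Telescoping A ^+ k - B ^+ k. *)
Lemma mnorm_pow_sub Z W c k : mnorm Z <= c -> mnorm W <= c ->
 mnorm ((1 + Z) ^+ k - (1 + W) ^+ k) <= k%:R * (1 + c) ^+ k * mnorm (Z - W).
Proof.
move=> hZ hW.
have c0 : 0 <= c by apply: le_trans hZ; exact: mnorm_ge0.
have c1 : 0 <= 1 + c by rewrite addr_ge0.
elim: k => [|k IH]; first by rewrite !expr0 subrr mnorm0 !mul0r.
have -> : (1 + Z) ^+ k.+1 - (1 + W) ^+ k.+1 =
 (Z - W) *m (1 + Z) ^+ k + (1 + W) ^+ 1 *m ((1 + Z) ^+ k - (1 + W) ^+ k).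
 rewrite expr1 !mulmxE !exprS mulrBl !mulrDl !mul1r !mulrBr.
 move: (W * (1 + W) ^+ k) (W * (1 + Z) ^+ k) (Z * (1 + Z) ^+ k) => a b e.
 move: ((1 + Z) ^+ k) ((1 + W) ^+ k) => u v.
 by apply/matrixP => i j; rewrite !mxE; ring.
apply: le_trans (mnormD _ _) _.
apply: (le_trans (lerD (mnorm_powr _ _ _) (mnorm_powl _ _ _))).
have h1 : (1 + mnorm Z) ^+ k <= (1 + c) ^+ k.+1.
 apply: (@le_trans _ _ ((1 + c) ^+ k)).
  by rewrite lerXn2r ?nnegrE ?addr_ge0 ?mnorm_ge0// lerD2l.
 by rewrite exprS ler_peMl ?exprn_ge0// lerDl.
apply: (@le_trans _ _ (mnorm (Z - W) * (1 + c) ^+ k.+1 +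
  (1 + c) * (k%:R * (1 + c) ^+ k * mnorm (Z - W)))).
 apply: lerD; first by rewrite ler_wpM2l ?mnorm_ge0.
 rewrite expr1 ler_pM ?addr_ge0 ?mnorm_ge0//.
 by rewrite lerD2l.
by rewrite exprS -[k.+1]addn1 natrD; apply: eq_ler; ring.
Qed.
End matrix_norm.

Section matrix_exp.
Variables (R : realType) (n : nat).
Implicit Types (A B X Y Z : 'M[R]_n).

(** Coefficients of the power series in t of the entry (i, j) of A e^(tX). Carrying [A] along makes
    the family stable under derivation, which replaces A by A X. *)
Definition ecoef A X i j : R^nat := fun k => (A *m X ^+ k) i j / k`!%:R.
Definition eser A X i j (t : R) : R := limn (pseries (ecoef A X i j) t).
Definition mexp X : 'M[R]_n := \matrix_(i, j) eser 1%:M X i j 1.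

Lemma ecoef_le A X i j k t : `|ecoef A X i j k * t ^+ k| <=
 mnorm A * (exp_coeff (mnorm X * `|t|) k) + `|A i j| * (exp_coeff (mnorm X * `|t|) k).
Proof.
rewrite -mulrDl /ecoef /exp_coeff /= exprMn !normrM normfV normrX (ger0_norm (ler0n _ _)).
rewrite mulrAC -mulrA -[X in _ <= _ * X]mulrA [leRHS]mulrA.
rewrite ler_wpM2r ?mulr_ge0 ?invr_ge0 ?exprn_ge0//.
case: k => [|k]; first by rewrite !expr0 mulmx1 mulr1 lerDr mnorm_ge0.
apply: le_trans (mnorm_entry _ _ _) _; apply: le_trans (mnormM _ _) _.
rewrite mulrDl; apply: ler_wpDr; first by rewrite mulr_ge0 ?exprn_ge0 ?mnorm_ge0.
rewrite ler_wpM2l ?mnorm_ge0//.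
elim: k => [|k IH]; first by rewrite !expr1.
rewrite exprS [leRHS]exprS; apply: le_trans (mnormM _ _) _.
by rewrite ler_wpM2l ?mnorm_ge0.
Qed.

Lemma cvg_eser A X i j t : cvgn (pseries (ecoef A X i j) t).
Proof.
apply: normed_cvg; apply: (@series_le_cvg _ _
 (fun k => (mnorm A + `|A i j|) * exp_coeff (mnorm X * `|t|) k)) => [k|k|k|].
- exact: normr_ge0.
- by rewrite mulr_ge0 ?addr_ge0 ?mnorm_ge0// exp_coeff_ge0// mulr_ge0 ?mnorm_ge0.
- by rewrite mulrDl; exact: ecoef_le.
- by apply: is_cvg_seriesZ; exact: is_cvg_series_exp_coeff.
Qed.

Lemma ecoef_diffs A X i j : pseries_diffs (ecoef A X i j) = ecoef (A *m X) X i j.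
Proof.
apply/funext => k; rewrite /pseries_diffs /ecoef exprS -mulmxE mulmxA.
rewrite factS natrM invfM mulrCA mulVKf ?pnatr_eq0//.
Qed.

Lemma is_derive_eser A X i j (t : R) :
 is_derive t 1 (eser A X i j) (eser (A *m X) X i j t).
Proof.
rewrite /eser -(ecoef_diffs A); apply: (@pseries_snd_diffs _ _ (`|t| + 1)).
- exact: cvg_eser.
- by rewrite ecoef_diffs; exact: cvg_eser.
- by rewrite !ecoef_diffs; exact: cvg_eser.
- by rewrite [ltRHS]ger0_norm ?ltrDl ?addr_ge0.
Qed.

Lemma eserP (A X : 'M[R]_n) i j t l :
 pseries (ecoef A X i j) t @ \oo --> l -> eser A X i j t = l.
Proof. exact: cvg_lim. Qed.

Lemma cvg_eserE A X i j t :
 pseries (ecoef A X i j) t @ \oo --> eser A X i j t.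
Proof. exact: cvg_eser. Qed.

Lemma mexpE X t i j : mexp (t *: X) i j = eser 1%:M X i j t.
Proof.
rewrite mxE /eser; congr (limn _); rewrite /pseries; congr series.
apply/funext => k; rewrite /= expr1n mulr1 /ecoef !mul1mx.
have -> : (t *: X) ^+ k = t ^+ k *: X ^+ k.
 elim: k => [|k IH]; first by rewrite !expr0 scale1r.
 by rewrite !exprS IH -!mulmxE -scalemxAl -scalemxAr scalerA.
by rewrite mxE [X in X / _]mulrC mulrAC.
Qed.

Lemma eser_mul A X Y i j t : (A *m mexp (t *: X)) i j = eser A X i j t.
Proof.
apply/esym/eserP; rewrite mxE.
have -> : pseries (ecoef A X i j) t =
  (fun m => \sum_k A i k * pseries (ecoef 1%:M X k j) t m).
 apply/funext => m; rewrite /pseries /series /=.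
 under [RHS]eq_bigr do rewrite mulr_sumr.
 rewrite exchange_big /=; apply: eq_bigr => l _.
 rewrite /ecoef mul1mx mxE !mulr_suml; apply: eq_bigr => k _.
 by rewrite !mulrA.
apply: cvg_big => [|k _]; first exact: add_continuous.
by apply: cvgMr; rewrite mexpE; exact: cvg_eser.
Qed.

(** The intertwining relation passes to powers, A X^k = Y^k A, hence to the partial sums of each
    entry. *)
Lemma eser_mulr A X Y i j t : A *m X = Y *m A ->
 (mexp (t *: Y) *m A) i j = eser A X i j t.
Proof.
move=> h; apply/esym/eserP; rewrite mxE.
have hk k : A *m X ^+ k = Y ^+ k *m A.
 elim: k => [|k IH]; first by rewrite !expr0 mulmx1 mul1mx.
 by rewrite exprSr -mulmxE mulmxA IH -mulmxA h mulmxA exprSr.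
have -> : pseries (ecoef A X i j) t =
  (fun m => \sum_k pseries (ecoef 1%:M Y i k) t m * A k j).
 apply/funext => m; rewrite /pseries /series /=.
 under [RHS]eq_bigr do rewrite mulr_suml.
 rewrite exchange_big /=; apply: eq_bigr => l _.
 rewrite /ecoef mul1mx hk mxE !mulr_suml; apply: eq_bigr => k _.
 by rewrite !(mulrAC _ (A k j)).
apply: cvg_big => [|k _]; first exact: add_continuous.
by apply: cvgMl; rewrite mexpE; exact: cvg_eser.
Qed.

Lemma mexp_conj A X Y : A *m X = Y *m A -> A *m mexp X = mexp Y *m A.
Proof.
move=> h; apply/matrixP => i j.
by rewrite -[X]scale1r -[in RHS](scale1r Y) eser_mul// (eser_mulr _ _ _ h).
Qed.

Lemma mexp0 : mexp 0 = 1%:M.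
Proof.
apply/matrixP => i j; rewrite -[0](scale0r (0 : 'M[R]_n)) mexpE; apply: eserP.
rewrite -(cvg_shiftn 1) /=.
have -> : (fun m => pseries (ecoef 1%:M 0 i j) 0 (m + 1)%N) = (fun=> (1%:M : 'M[R]_n) i j).
 apply/funext => m; rewrite addn1 /pseries /series /= big_nat_recl// big1.
  by rewrite /ecoef !expr0 mulmx1 divr1 mulr1 addr0.
 by move=> k _; rewrite expr0n mulr0.
exact: cvg_cst.
Qed.

Lemma is_derive_mexp X i j (t : R) :
 is_derive t 1 (fun t => mexp (t *: X) i j) ((X *m mexp (t *: X)) i j).
Proof.
rewrite eser_mul//; have := is_derive_eser 1%:M X i j t; rewrite mul1mx.
by congr is_derive; apply/funext => s; rewrite mexpE.
Qed.

(** The product e^((s+t)X) e^(-tX) has derivative 0 in t because X commutes with its exponential;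
    its value is read off at t = 0. *)
Lemma mexpDl_aux X s t : mexp ((s + t) *: X) *m mexp ((- t) *: X) = mexp (s *: X).
Proof.
apply/matrixP => i j.
pose f u := (mexp ((s + u) *: X) *m mexp ((- u) *: X)) i j.
rewrite -[LHS]/(f t); have -> : f t = f 0; last first.
 by rewrite /f addr0 oppr0 scale0r mexp0 mulmx1.
apply: is_derive_0_is_cst => u.
have -> : f = \sum_k (fun u => mexp ((s + u) *: X) i k * mexp ((- u) *: X) k j).
 by apply/funext => v; rewrite /f mxE fct_sumE.
have e (k : 'I_n) : is_derive u 1 (fun u => mexp ((s + u) *: X) i k * mexp ((- u) *: X) k j)
  ((mexp ((s + u) *: X)) i k *: - ((X *m mexp ((- u) *: X)) k j) +
   mexp ((- u) *: X) k j *: ((X *m mexp ((s + u) *: X)) i k)).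
 apply: is_deriveM.
  have := @is_derive1_comp _ (fun v => mexp (v *: X) i k) (fun u => s + u) u _ 1
   (is_derive_mexp X i k (s + u)).
  by rewrite mulr1; apply; rewrite -[X in is_derive _ _ _ X]add0r; apply: is_deriveD.
 have := @is_derive1_comp _ (fun v => mexp (v *: X) k j) (fun u => - u) u _ (- 1)
   (is_derive_mexp X k j (- u)).
 by rewrite mulrN1; apply; apply: is_deriveN.
apply: is_derive_eq.
rewrite big_split /= ; under eq_bigr do rewrite scalerN.
rewrite sumrN.
have c : X *m mexp ((s + u) *: X) = mexp ((s + u) *: X) *m X.
 apply: mexp_conj; by rewrite -scalemxAl -scalemxAr.
have -> : \sum_i0 mexp ((- u) *: X) i0 j *: (X *m mexp ((s + u) *: X)) i i0 =
  ((X *m mexp ((s + u) *: X)) *m mexp ((- u) *: X)) i j.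
 by rewrite [RHS]mxE; apply: eq_bigr => k _; rewrite mulrC.
have -> : \sum_i0 mexp ((s + u) *: X) i i0 *: (X *m mexp ((- u) *: X)) i0 j =
  (mexp ((s + u) *: X) *m (X *m mexp ((- u) *: X))) i j.
 by rewrite [RHS]mxE; apply: eq_bigr => k _.
by rewrite c mulmxA addNr.
Qed.

Lemma mexpNV X t : mexp (t *: X) *m mexp ((- t) *: X) = 1%:M.
Proof. by have := mexpDl_aux X 0 t; rewrite add0r scale0r mexp0. Qed.

Lemma mexpD X s t : mexp ((s + t) *: X) = mexp (s *: X) *m mexp (t *: X).
Proof.
have := mexpNV X (- t); rewrite opprK => h.
by rewrite -(mexpDl_aux X s t) -mulmxA h mulmx1.
Qed.

Lemma mexp_unit X : mexp X \in unitmx.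
Proof.
have h : mexp X *m mexp ((- 1) *: X) = 1%:M by rewrite -[X in mexp X *m _]scale1r mexpNV.
exact: (mulmx1_unit h).1.
Qed.

Lemma invmx_mexp X t : invmx (mexp (t *: X)) = mexp ((- t) *: X).
Proof.
by rewrite -[RHS]mul1mx -(mulVmx (mexp_unit (t *: X))) -mulmxA mexpNV mulmx1.
Qed.

Lemma mexp_natmul X t k : mexp (t *: X) ^+ k = mexp ((t * k%:R) *: X).
Proof.
elim: k => [|k IH]; first by rewrite expr0 mulr0 scale0r mexp0.
by rewrite exprSr IH -mulmxE -mexpD -natr1 mulrDr mulr1.
Qed.

Lemma mexp_tr X : (mexp X)^T = mexp X^T.
Proof.
apply/matrixP => i j; rewrite !mxE /eser; congr (limn _); congr series.
apply/funext => k; congr (_ / _ * _); rewrite !mul1mx.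
suff -> : X^T ^+ k = (X ^+ k)^T by rewrite mxE.
elim: k => [|k IH]; first by rewrite !expr0 trmx1.
by rewrite exprS IH exprSr -!mulmxE trmx_mul.
Qed.

(** In each entry the term of degree k + 2 is at most |X|^2 |X|^k / k!, as (k+2)! >= k!. Summing
    over k gives |X|^2 e^|X|, and n^2 counts the entries. *)
Lemma mexp_taylor X :
 mnorm (mexp X - 1%:M - X) <= n%:R ^+ 2 * (mnorm X ^+ 2 * expR (mnorm X)).
Proof.
apply: mnorm_le => i j; rewrite -[in mexp _](scale1r X) [_ i j]mxE [(_ - 1%:M) i j]mxE mexpE.
have hl : (fun m => `|pseries (ecoef 1%:M X i j) 1 m.+2 + (- 1%:M : 'M[R]_n) i j + (- X) i j|)
  @ \oo --> `|eser 1%:M X i j 1 + (- 1%:M : 'M[R]_n) i j + (- X) i j|.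
 apply: cvg_norm; apply: cvgD; last exact: cvg_cst.
 apply: cvgD; last exact: cvg_cst.
 have := @cvg_eserE 1%:M X i j 1; rewrite -(cvg_shiftn 2).
 by under [X in X @ _ --> _ -> _]eq_fun do rewrite addn2.
rewrite -(cvg_lim _ hl)//; apply: limr_le; first by apply/cvg_ex; eexists; exact: hl.
near=> m; rewrite /pseries /series /= !big_nat_recl//.
rewrite /ecoef !expr1n !mulr1 fact0 (_ : 1`!%N = 1%N)// !divr1 !mul1mx expr0 expr1.
rewrite [X in `|X|](_ : _ = \sum_(0 <= k < m) (1%:M *m X ^+ k.+2) i j / k.+2`!%:R * 1 ^+ k.+2).
 2: by move: (\sum_(0 <= k < m) _) => S; rewrite !mxE; ring.
apply: le_trans (ler_norm_sum _ _ _) _.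
apply: (@le_trans _ _ (mnorm X ^+ 2 * series (exp_coeff (mnorm X)) m)).
 rewrite /series /= mulr_sumr; apply: ler_sum => k _.
 rewrite expr1n mulr1 mul1mx normrM normfV (ger0_norm (ler0n _ _)) /exp_coeff /=.
 rewrite mulrA -exprD ler_pM ?invr_ge0//.
  by rewrite add2n; exact: entry_exp.
 rewrite lef_pV2 ?posrE ?ltr0n ?fact_gt0// ler_nat.
 by rewrite !factS mulnA leq_pmull.
rewrite ler_wpM2l ?exprn_ge0 ?mnorm_ge0//.
apply: nondecreasing_cvgn_le; last exact: is_cvg_series_exp_coeff.
apply/nondecreasing_seqP => k; rewrite /series /= big_nat_recr//= lerDl.
by rewrite exp_coeff_ge0// mnorm_ge0.
Unshelve. all: by end_near. Qed.

Lemma mexp_diag (d : 'rV[R]_n) : mexp (diag_mx d) = diag_mx (\row_i expR (d 0 i)).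
Proof.
apply/matrixP => i j; rewrite !mxE.
have hk k : (diag_mx d) ^+ k = diag_mx (\row_i (d 0 i) ^+ k).
 elim: k => [|k IH]; first by rewrite expr0; apply/matrixP => a b; rewrite !mxE expr0.
 rewrite exprS IH -mulmxE mulmx_diag; congr diag_mx; apply/rowP => a.
 by rewrite !mxE exprS.
rewrite /eser /expR; have [->|ij] := eqVneq i j.
 rewrite mulr1n; congr (limn _); congr series; apply/funext => k.
 by rewrite /= /ecoef mul1mx hk !mxE eqxx mulr1n expr1n mulr1.
rewrite mulr0n; apply: cvg_lim => //.
have -> : pseries (ecoef 1%:M (diag_mx d) i j) 1 = (fun=> 0).
 apply/funext => m; rewrite /pseries /series /= big1// => k _.
 by rewrite /ecoef mul1mx hk !mxE (negbTE ij) mulr0n !mul0r.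
exact: cvg_cst.
Qed.

End matrix_exp.

(** * Ultralimits, interpolation and exponential polynomials *)

Section ultrafilters.
Variables (R : realType) (T : Type) (U : set_system T).
Hypothesis UU : UltraFilter U.

(** The limit is the supremum of the levels that u reaches on a set of U. An ultrafilter makes all
    bounded functions converge at once, which serves for limits of directions of matrices and for
    weak limits in a Hilbert space. *)
Lemma ultra_bounded_cvg (u : T -> R) (M : R) : (forall x, `|u x| <= M) ->
 exists l, forall e, 0 < e -> \forall x \near U, `|l - u x| < e.
Proof.
move=> hM; pose A := [set y : R | U [set x | y <= u x]].
have A0 : A (- M).
 by apply: filterS filterT => x _ /=; have := hM x; rewrite ler_norml => /andP[].
have Ab : ubound A M.
 move=> y Ay; have [x /= hx] := filter_ex Ay; apply: le_trans hx _.
 by have := hM x; rewrite ler_norml => /andP[].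
have hs : has_sup A by split; [exists (- M)|exists M].
exists (sup A) => e e0.
have [y Ay hy] := sup_adherent e0 hs.
have h2 : U [set x | u x < sup A + e].
 have [h|h] := in_ultra_setVsetC [set x | sup A + e <= u x] UU.
  by have := sup_upper_bound hs h; rewrite gerDl leNgt e0.
 by apply: filterS h => x /= /negP; rewrite -ltNge.
apply: filterS2 Ay h2 => x /= h1 h2; rewrite ltr_norml; apply/andP; split.
 by rewrite ltrBrDr addrC ltrBlDr.
by rewrite ltrBlDr -ltrBlDl (lt_le_trans hy).
Qed.

End ultrafilters.

Lemma nat_ultra : exists U : set_system nat, UltraFilter U /\ \oo `<=` U.
Proof. exact: ultraFilterLemma. Qed.

Section interpolation.
Variable R : fieldType.

(** Induction on the nodes: a multiple of the product of the X - y over the old nodes corrects the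
    value at a new one. *)
Lemma interpolation (xs : seq R) (f : R -> R) :
 exists q : {poly R}, forall x, x \in xs -> q.[x] = f x.
Proof.
elim: xs => [|x xs [q hq]]; first by exists 0.
have [xin|xout] := boolP (x \in xs).
 by exists q => y; rewrite inE => /orP[/eqP ->|]; exact: hq.
pose p := \prod_(y <- xs) ('X - y%:P).
have px : p.[x] != 0.
 rewrite /p horner_prod prodf_seq_neq0; apply/allP => y yin /=.
 by rewrite !hornerE subr_eq0; apply: contraNneq xout => ->.
exists (q + ((f x - q.[x]) / p.[x])%:P * p) => y; rewrite inE => /orP[/eqP ->|yin].
 by rewrite !hornerE divfK// addrC subrK.
rewrite !hornerE hq// (_ : p.[y] = 0) ?mulr0 ?addr0//.
by apply/eqP; rewrite -/(root p y) root_prod_XsubC.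
Qed.
End interpolation.

Section exponential_polynomials.
Variable R : realType.

Definition exppoly (F : R -> R) := exists s : seq (R * R),
 forall t, F t = \sum_(c <- s) c.1 * expR (t * c.2).

Lemma exppoly_ext F G : F =1 G -> exppoly F -> exppoly G.
Proof. by move=> h [s hs]; exists s => t; rewrite -h. Qed.
Lemma exppoly_cst a : exppoly (fun=> a).
Proof. by exists [:: (a, 0)] => t; rewrite big_seq1 mulr0 expR0 mulr1. Qed.
Lemma exppoly_exp l : exppoly (fun t => expR (t * l)).
Proof. by exists [:: (1, l)] => t; rewrite big_seq1 mul1r. Qed.
Lemma exppolyD F G : exppoly F -> exppoly G -> exppoly (fun t => F t + G t).
Proof. by move=> [s hs] [r hr]; exists (s ++ r) => t; rewrite big_cat /= hs hr. Qed.
Lemma exppolyM F G : exppoly F -> exppoly G -> exppoly (fun t => F t * G t).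
Proof.
move=> [s hs] [r hr]; exists [seq (a.1 * b.1, a.2 + b.2) | a <- s, b <- r] => t.
rewrite hs hr big_allpairs_dep /= mulr_suml; apply: eq_bigr => a _.
rewrite mulr_sumr; apply: eq_bigr => b _ /=.
by rewrite mulrDr expRD; ring.
Qed.
Lemma exppoly_sum (I : Type) (r : seq I) (F : I -> R -> R) :
 (forall i, exppoly (F i)) -> exppoly (fun t => \sum_(i <- r) F i t).
Proof.
move=> h; elim: r => [|i r IH].
 by apply: exppoly_ext (exppoly_cst 0) => t; rewrite big_nil.
by apply: exppoly_ext (exppolyD (h i) IH) => t; rewrite big_cons.
Qed.
Lemma exppoly_prod (I : Type) (r : seq I) (F : I -> R -> R) :
 (forall i, exppoly (F i)) -> exppoly (fun t => \prod_(i <- r) F i t).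
Proof.
move=> h; elim: r => [|i r IH].
 by apply: exppoly_ext (exppoly_cst 1) => t; rewrite big_nil.
by apply: exppoly_ext (exppolyM (h i) IH) => t; rewrite big_cons.
Qed.
Lemma exppolyX F k : exppoly F -> exppoly (fun t => F t ^+ k).
Proof.
move=> h; elim: k => [|k IH]; first by apply: exppoly_ext (exppoly_cst 1) => t; rewrite expr0.
by apply: exppoly_ext (exppolyM h IH) => t; rewrite exprS.
Qed.

(* An exponential polynomial sum a_c e^(t l_c) vanishing on the naturals kills
  every polynomial in the points e^(l_c), among them an interpolant of x^t. *)
Lemma exppoly_eq0 F : exppoly F -> (forall k : nat, F k%:R = 0) -> forall t, F t = 0.
Proof.
move=> [s hs] F0 t.
have hp (q : {poly R}) : \sum_(c <- s) c.1 * q.[expR c.2] = 0.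
 under eq_bigr do rewrite horner_coef mulr_sumr.
 rewrite exchange_big big1// => k _ /=.
 transitivity (q`_k * F k%:R); last by rewrite F0 mulr0.
 rewrite hs mulr_sumr; apply: eq_bigr => c _.
 by rewrite mulrCA expRM_natl.
have [q hq] := interpolation [seq expR c.2 | c <- s] (fun x => expR (t * ln x)).
rewrite hs -[RHS](hp q); apply: eq_big_seq => c cin.
by rewrite hq ?expRK//; apply: map_f.
Qed.
End exponential_polynomials.

Section real_symmetric.
Variables (R : realType) (n : nat).

Lemma complexR_real (x : R) : x%:C \is Num.real.
Proof. by rewrite realE !lecE /= !eqxx /= -realE num_real. Qed.

Lemma real_complexE (z : R[i]) : z \is Num.real -> (Re z)%:C = z.
Proof. by case: z => a b; rewrite realE !lecE /= => /orP[] /andP[/eqP h _]; rewrite -?h // h. Qed.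

(** Over C the spectral theorem applies and the eigenvalues are real; real matrices that are similar
    over C are similar over R. The matrix P so obtained is invertible but not claimed to be
    orthogonal, which is why symmetry of functions of A is argued through P P^T later. *)
Lemma real_symmetric_diag (A : 'M[R]_n) : A^T = A ->
 exists (P : 'M[R]_n) (d : 'rV[R]_n), P \in unitmx /\ A = invmx P *m diag_mx d *m P.
Proof.
move=> hA; pose rc := real_complex R.
pose AC := map_mx rc A : 'M[R[i]]_n.
have ArR : AC \is a mxOver Num.real.
 by apply/mxOverP => i j; rewrite !mxE; exact: complexR_real.
have Asym : AC \is symmetricmx.
 apply/is_hermitianmxP; rewrite expr0 scale1r; apply/matrixP => i j.
 by rewrite !mxE -[in LHS]hA mxE.
have AN := symmetric_normalmx Asym ArR.
have AH := realsym_hermsym Asym ArR.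
have dR := hermitian_spectral_diag_real AH.
have e := orthomx_spectralP AN.
have sim : spectralmx AC *m AC = diag_mx (spectral_diag AC) *m spectralmx AC.
 rewrite {2}e !mulmxA mulmxV; last exact: spectral_unit.
 by rewrite mul1mx.
have DR : diag_mx (spectral_diag AC) \is a mxOver Num.real.
 apply/mxOverP => i j; rewrite mxE; case: eqP => _; rewrite ?mulr1n ?mulr0n ?real0//.
 exact: (mxOverP dR).
have [|P Pu simP] := @real_similar _ n AC (diag_mx (spectral_diag AC)) _ ArR DR.
 by exists (spectralmx AC); [exact: spectral_unit|exact/(simmxP (spectral_unit _))].
move: Pu => /andP[PR Pu].
pose Q : 'M[R]_n := \matrix_(i, j) Re (P i j).
pose d : 'rV[R]_n := \row_i Re (spectral_diag AC 0 i).
have QP : map_mx rc Q = P.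
 apply/matrixP => i j; rewrite !mxE; have /mxOverP/(_ i j) := PR.
 exact: real_complexE.
have dd : map_mx rc d = spectral_diag AC.
 apply/rowP => j; rewrite !mxE; have /mxOverP/(_ 0 j) := dR.
 exact: real_complexE.
have Qu : Q \in unitmx by rewrite -(map_unitmx rc) QP.
exists Q, d; split => //.
apply: (@map_mx_inj _ _ rc); rewrite !map_mxM map_invmx map_diag_mx QP dd.
apply: (can_inj (mulKmx Pu)); rewrite !mulmxA mulmxV// mul1mx.
exact: (elimT (simmxP Pu) simP).
Qed.
End real_symmetric.

Section mexp_estimates.
Variables (R : realType) (n : nat).
Implicit Types (A B X Y Z : 'M[R]_n).

Definition mexp_c2 X : R := n%:R ^+ 2 * (mnorm X ^+ 2 * expR (mnorm X)).
Definition mexp_c1 X : R := mnorm X + mexp_c2 X.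

Lemma mexp_c2_ge0 X : 0 <= mexp_c2 X.
Proof. by rewrite /mexp_c2 !mulr_ge0 ?exprn_ge0 ?mnorm_ge0 ?expR_ge0. Qed.
Lemma mexp_c1_ge0 X : 0 <= mexp_c1 X.
Proof. by rewrite /mexp_c1 addr_ge0 ?mnorm_ge0 ?mexp_c2_ge0. Qed.

Lemma mexp_est2 X (t : R) : `|t| <= 1 ->
 mnorm (mexp (t *: X) - 1%:M - t *: X) <= mexp_c2 X * `|t| ^+ 2.
Proof.
move=> t1; apply: le_trans (mexp_taylor _) _.
rewrite /mexp_c2 -mulrA ler_wpM2l ?exprn_ge0// mnormZ exprMn mulrC mulrCA mulrC.
rewrite ler_wpM2r ?exprn_ge0// mulrC ler_wpM2l ?exprn_ge0 ?mnorm_ge0//.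
by rewrite ler_expR ler_piMl ?mnorm_ge0.
Qed.

Lemma mexp_est1 X (t : R) : `|t| <= 1 ->
 mnorm (mexp (t *: X) - 1%:M) <= mexp_c1 X * `|t|.
Proof.
move=> t1; have := mexp_est2 X t1; set E := mexp _ - _ - _ => h.
have -> : mexp (t *: X) - 1%:M = E + t *: X by rewrite /E subrK.
apply: le_trans (mnormD _ _) _; rewrite mnormZ mulrDl addrC lerD//.
 by rewrite mulrC.
by apply: (le_trans h); rewrite ler_wpM2l ?mexp_c2_ge0// expr2 ler_piMl.
Qed.

Lemma mexp_prod_est X Y : exists2 C : R, 0 <= C & forall t : R, `|t| <= 1 ->
 mnorm (mexp (t *: X) *m mexp (t *: Y) - 1%:M - t *: (X + Y)) <= C * `|t| ^+ 2.
Proof.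
exists (mexp_c1 X * mexp_c1 Y + mexp_c2 X + mexp_c2 Y) => [|t t1].
 have := mexp_c1_ge0 X; have := mexp_c1_ge0 Y; have := mexp_c2_ge0 X.
 have := mexp_c2_ge0 Y; nra.
have -> : mexp (t *: X) *m mexp (t *: Y) - 1%:M - t *: (X + Y) =
 (mexp (t *: X) - 1%:M) *m (mexp (t *: Y) - 1%:M) +
 (mexp (t *: X) - 1%:M - t *: X) + (mexp (t *: Y) - 1%:M - t *: Y).
 have aux (a b c d e f : 'M[R]_n) : a - f - (d + e) = a - b - (c - f) + (b - f - d) + (c - f - e).
  by apply/matrixP => i j; rewrite !mxE; ring.
 rewrite mulmxBl mulmxBr mulmx1 mul1mx scalerDr; exact: aux.
apply: le_trans (mnormD _ _) _; apply: (le_trans (lerD (mnormD _ _) (mexp_est2 Y t1))).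
rewrite !mulrDl lerD// lerD ?mexp_est2//.
apply: le_trans (mnormM _ _) _.
apply: (le_trans (ler_pM (mnorm_ge0 _) (mnorm_ge0 _) (mexp_est1 X t1) (mexp_est1 Y t1))).
by apply: eq_ler; rewrite /mexp_c1; ring.
Qed.

Lemma mexp_conj_est X Y : exists2 C : R, 0 <= C & forall t : R, `|t| <= 1 ->
 mnorm (mexp (t *: X) *m Y *m mexp ((- t) *: X) - Y - t *: (X *m Y - Y *m X)) <= C * `|t| ^+ 2.
Proof.
exists (mexp_c2 X * mnorm Y + mnorm Y * mexp_c2 X + mexp_c1 X * mnorm Y * mexp_c1 X) => [|t t1].
 by rewrite addr_ge0 ?addr_ge0 ?mulr_ge0 ?mexp_c1_ge0 ?mexp_c2_ge0 ?mnorm_ge0.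
have t1' : `|- t| <= 1 by rewrite normrN.
have -> : mexp (t *: X) *m Y *m mexp ((- t) *: X) - Y - t *: (X *m Y - Y *m X) =
 (mexp (t *: X) - 1%:M - t *: X) *m Y + Y *m (mexp ((- t) *: X) - 1%:M - (- t) *: X) +
 (mexp (t *: X) - 1%:M) *m Y *m (mexp ((- t) *: X) - 1%:M).
 have aux (a b c d e y : 'M[R]_n) :
   a - y - (d - e) = b - y - d + (c - y + e) + (a - b - (c - y)).
  by apply/matrixP => i j; rewrite !mxE; ring.
 rewrite scalerBr scaleNr !mulmxBl !mulmxBr !mul1mx !mulmx1 !mulmxN -!scalemxAl -!scalemxAr !opprK.
 exact: aux.
rewrite !mulrDl; apply: le_trans (mnormD _ _) _; apply: lerD.
 apply: le_trans (mnormD _ _) _; apply: lerD.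
  apply: le_trans (mnormM _ _) _; rewrite mulrAC ler_wpM2r ?mnorm_ge0//.
  exact: mexp_est2.
 apply: le_trans (mnormM _ _) _; rewrite -mulrA ler_wpM2l ?mnorm_ge0//.
 by apply: le_trans (mexp_est2 X t1') _; rewrite normrN.
apply: le_trans (mnormM _ _) _.
apply: (@le_trans _ _ ((mexp_c1 X * `|t| * mnorm Y) * (mexp_c1 X * `|t|))).
 rewrite ler_pM ?mnorm_ge0//.
  apply: le_trans (mnormM _ _) _; rewrite ler_wpM2r ?mnorm_ge0//; exact: mexp_est1.
 by apply: le_trans (mexp_est1 X t1') _; rewrite normrN.
by apply: eq_ler; rewrite /mexp_c1; ring.
Qed.

End mexp_estimates.

(** One choice of step for which a quadratic error C tau^2 is at most e tau. *)
Lemma pick_small (R : realType) (C e : R) : 0 < e ->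
 exists tau, [/\ 0 < tau, tau < e, tau <= 1 & C * tau <= e].
Proof.
move=> e0; have C0 : 0 < `|C| + 2 by rewrite ltr_wpDl.
pose tau := Num.min 1 (e / (`|C| + 2)).
have tau0 : 0 < tau by rewrite lt_min ltr01 divr_gt0.
have h : tau * (`|C| + 2) <= e by rewrite -ler_pdivlMr// ge_min lexx orbT.
have hC := ler_norm C; have hC0 := normr_ge0 C.
exists tau; split => //; [nra|by rewrite ge_min lexx|nra].
Qed.

(** * Closed linear groups and their Lie algebras *)

Section linear_group.
Variables (R : realType) (n : nat).
Implicit Types (A B X Y Z s : 'M[R]_n).

(** Closedness is relative to the invertible matrices, as it holds for zero sets of polynomials in
    GL_n. *)
Record linear_group (S : set 'M[R]_n) : Prop := LinearGroup {
 lg_unit : forall s, S s -> s \in unitmx;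
 lg1 : S 1%:M;
 lgM : forall s u, S s -> S u -> S (s *m u);
 lgV : forall s, S s -> S (invmx s);
 lg_closed : forall A, A \in unitmx ->
  (forall e, 0 < e -> exists2 s, S s & mnorm (s - A) < e) -> S A;
}.

Definition lie (S : set 'M[R]_n) : set 'M[R]_n := [set X | forall t : R, S (mexp (t *: X))].

Variable S : set 'M[R]_n.
Hypothesis GS : linear_group S.

Lemma lg_exp s k : S s -> S (s ^+ k).
Proof.
move=> Ss; elim: k => [|k IH]; first by rewrite expr0; exact: lg1.
by rewrite exprS -mulmxE; exact: lgM.
Qed.

(** With m the integer part of t / tau, s^m is close to e^(m tau X), because the error e tau of one
    step is accumulated only m times, and e^(tX) differs from it by one last step shorter than tau.
    Closedness of S concludes. *)
Lemma lie_lim X : (forall e : R, 0 < e -> exists s (tau : R),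
  [/\ S s, 0 < tau < e & mnorm (s - 1%:M - tau *: X) <= e * tau]) -> lie S X.
Proof.
move=> h.
suff pos (t : R) : 0 < t -> S (mexp (t *: X)).
 move=> t; have [t0|t0|->] := ltgtP t 0; last by rewrite scale0r mexp0; exact: lg1.
  rewrite -(opprK t) -invmx_mexp; apply: lgV => //; apply: pos; by rewrite oppr_gt0.
 exact: pos.
move=> t0; apply: lg_closed => //; first exact: mexp_unit.
move=> eps eps0.
(* tau C0 bounds both |s - 1| and |e^(tau X) - 1|, so (1 + tau C0)^m <= e^(t C0) controls all
   intermediate powers. *)
pose C0 := 1 + mexp_c1 X.
have C01 : 1 <= C0 by rewrite /C0 lerDl mexp_c1_ge0.
have C00 : 0 < C0 by apply: lt_le_trans C01.
pose K := mexp_c2 X.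
have K0 : 0 <= K by exact: mexp_c2_ge0.
pose N1 := expR (t * C0) * mnorm (1%:M : 'M[R]_n) * C0.
have N10 : 0 <= N1 by rewrite /N1 !mulr_ge0 ?expR_ge0 ?mnorm_ge0// ltW.
(* The accumulated error and the last step add up to at most (D - 1) e, so e D <= eps leaves a
   strict inequality. *)
pose D := t * expR (t * C0) * (1 + K) + N1 + 1.
have D0 : 0 < D.
 by rewrite /D ltr_wpDl// addr_ge0// mulr_ge0 ?mulr_ge0 ?expR_ge0 ?(ltW t0) ?addr_ge0.
pose e := Num.min 1 (eps / D).
have e0 : 0 < e by rewrite /e lt_min ltr01 divr_gt0.
have e1 : e <= 1 by rewrite /e ge_min lexx.
have eD : e * D <= eps by rewrite -ler_pdivlMr// /e ge_min lexx orbT.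
have [s [tau [Ss /andP[tau0 taue] hs]]] := h e e0.
have tau1 : tau < 1 by apply: lt_le_trans e1.
have ntau1 : `|tau| <= 1 by rewrite ger0_norm ltW.
pose m := Num.truncn (t / tau).
have /andP[m1 m2] : m%:R <= t / tau < m.+1%:R by apply: truncn_itv; rewrite divr_ge0// ltW.
have mt1 : m%:R * tau <= t by rewrite -ler_pdivlMr.
have mt2 : t < m%:R * tau + tau.
 by rewrite ltr_pdivrMr// -natr1 mulrDl mul1r in m2.
exists (s ^+ m); first exact: lg_exp.
pose Z := s - 1%:M; pose W := mexp (tau *: X) - 1%:M.
have hW : mnorm W <= tau * C0.
 apply: (le_trans (mexp_est1 X ntau1)); rewrite ger0_norm; last exact: ltW.
 by rewrite mulrC ler_wpM2l ?ltW// /C0 ltrDr.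
have hZ : mnorm Z <= tau * C0.
 rewrite (_ : Z = (s - 1%:M - tau *: X) + tau *: X); last by rewrite subrK.
 apply: le_trans (mnormD _ _) _; rewrite mnormZ gtr0_norm//.
 apply: (le_trans (lerD hs (lexx _))).
 have : e * tau <= tau by rewrite ler_piMl// ltW.
 by rewrite /C0 /mexp_c1 !mulrDr mulr1 -/K => h1; rewrite lerD// lerDl mulr_ge0// ltW.
have hZW : mnorm (Z - W) <= (1 + K) * e * tau.
 rewrite (_ : Z - W = (s - 1%:M - tau *: X) - (mexp (tau *: X) - 1%:M - tau *: X)).
  apply: le_trans (mnormB _ _) _; apply: (le_trans (lerD hs (mexp_est2 X ntau1))).
  rewrite gtr0_norm// !mulrDl mul1r lerD2l -/K expr2 mulrA ler_wpM2r ?(ltW tau0)//.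
  by rewrite ler_wpM2l// ltW.
 rewrite /Z /W.
 by apply/matrixP => i j; rewrite !mxE; ring.
have tC0 : 0 <= tau * C0 by rewrite mulr_ge0 ?(ltW tau0) ?(ltW C00).
have hpow : (1 + tau * C0) ^+ m <= expR (t * C0).
 apply: (@le_trans _ _ (expR (tau * C0) ^+ m)).
  by rewrite lerXn2r ?nnegrE ?expR_ge0 ?expR_ge1Dx ?addr_ge0.
 by rewrite -expRM_natl ler_expR mulrA ler_wpM2r// ltW.
have e1Z : s = 1 + Z by rewrite /Z addrC subrK.
have e1W : mexp (tau *: X) = 1 + W by rewrite /W addrC subrK.
have step1 : mnorm (s ^+ m - mexp (tau *: X) ^+ m) <= t * expR (t * C0) * (1 + K) * e.
 rewrite e1Z e1W; apply: le_trans (mnorm_pow_sub m hZ hW) _.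
 apply: (@le_trans _ _ (m%:R * expR (t * C0) * ((1 + K) * e * tau))).
  rewrite ler_pM ?mnorm_ge0 ?mulr_ge0 ?exprn_ge0 ?ler_wpM2l//.
  by rewrite addr_ge0.
 rewrite (_ : _ * (_ * tau) = m%:R * tau * (expR (t * C0) * (1 + K) * e)); last by ring.
 rewrite -[leRHS]mulrA -[leRHS]mulrA [X in _ <= t * X]mulrA ler_wpM2r//.
 by rewrite mulr_ge0 ?(ltW e0)// mulr_ge0 ?expR_ge0 ?addr_ge0.
pose dl := t - m%:R * tau.
have dl0 : 0 <= dl by rewrite /dl subr_ge0.
have dltau : dl <= tau by rewrite /dl lerBlDr addrC ltW.
have step2 : mnorm (mexp (tau *: X) ^+ m - mexp (t *: X)) <= N1 * e.
 have -> : mexp (t *: X) = mexp (tau *: X) ^+ m *m mexp (dl *: X).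
  by rewrite mexp_natmul -mexpD /dl [tau * _]mulrC addrC subrK.
 rewrite -[X in X - _]mulmx1 -mulmxBr e1W.
 apply: le_trans (mnormM _ _) _.
 have h1 : mnorm ((1 + W) ^+ m) <= expR (t * C0) * mnorm (1%:M : 'M[R]_n).
  rewrite -[X in mnorm X]mulmx1; apply: le_trans (mnorm_powl _ _ _) _.
  rewrite ler_wpM2r ?mnorm_ge0//; apply: le_trans hpow.
  by rewrite lerXn2r ?nnegrE ?addr_ge0 ?mnorm_ge0 ?mulr_ge0 ?(ltW tau0) ?(ltW C00)// lerD2l.
 have h2 : mnorm (1%:M - mexp (dl *: X)) <= C0 * e.
  rewrite mnorm_distC; apply: le_trans (mexp_est1 X _) _.
   by rewrite ger0_norm// (le_trans dltau)// ltW.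
  rewrite ger0_norm// ler_pM ?mexp_c1_ge0//; first by rewrite /C0 lerDr.
  by rewrite (le_trans dltau)// ltW.
 by rewrite /N1 -mulrA ler_pM ?mnorm_ge0.
apply: le_lt_trans (mnorm_dist_triangle (mexp (tau *: X) ^+ m) _ _) _.
apply: (le_lt_trans (lerD step1 step2)); apply: lt_le_trans eD.
rewrite (_ : e * D = t * expR (t * C0) * (1 + K) * e + N1 * e + e); last by rewrite /D; ring.
by rewrite ltrDl.
Qed.

Lemma lieZ c X : lie S X -> lie S (c *: X).
Proof. by move=> h t; rewrite scalerA. Qed.
Lemma lie0 : lie S 0.
Proof. by move=> t; rewrite scaler0 mexp0; exact: lg1. Qed.
Lemma lieN X : lie S X -> lie S (- X).
Proof. by move=> h; rewrite -scaleN1r; exact: lieZ. Qed.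

Lemma lie_lim_sqr X (C : R) (s : R -> 'M[R]_n) :
 (forall tau : R, S (s tau)) -> (forall tau : R, `|tau| <= 1 ->
  mnorm (s tau - 1%:M - tau *: X) <= C * `|tau| ^+ 2) -> lie S X.
Proof.
move=> Ss h; apply: lie_lim => e e0.
have [tau [tau0 taue tau1 tauC]] := pick_small C e0.
exists (s tau), tau; split => //; first by rewrite tau0.
apply: le_trans (h _ _) _; rewrite gtr0_norm//.
by rewrite expr2 mulrA ler_wpM2r// ltW.
Qed.

Lemma lieD X Y : lie S X -> lie S Y -> lie S (X + Y).
Proof.
move=> hX hY; have [C C0 h] := mexp_prod_est X Y.
by apply: (@lie_lim_sqr _ C (fun t => mexp (t *: X) *m mexp (t *: Y))) => // tau; exact: lgM.
Qed.
Lemma lieB X Y : lie S X -> lie S Y -> lie S (X - Y).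
Proof. by move=> hX hY; exact: lieD hX (lieN hY). Qed.

Lemma lie_sum (I : Type) (r : seq I) (F : I -> 'M[R]_n) :
 (forall i, lie S (F i)) -> lie S (\sum_(i <- r) F i).
Proof. by move=> h; apply: (big_ind (lie S)) => [|X Y|i _]; [exact: lie0|exact: lieD|exact: h]. Qed.

Lemma lie_conj s X : S s -> lie S X -> lie S (s *m X *m invmx s).
Proof.
move=> Ss hX t; have su := lg_unit GS Ss.
have : s *m mexp (t *: X) = mexp (t *: (s *m X *m invmx s)) *m s.
 by apply: mexp_conj; rewrite -scalemxAr -scalemxAl -!mulmxA mulVmx// mulmx1.
move=> h; have -> : mexp (t *: (s *m X *m invmx s)) = s *m mexp (t *: X) *m invmx s.
 by rewrite h -[RHS]mulmxA mulmxV// mulmx1.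
by apply: lgM => //; [exact: lgM|exact: lgV].
Qed.

Lemma lie_closed X : (forall e, 0 < e -> exists2 Y, lie S Y & mnorm (Y - X) < e) -> lie S X.
Proof.
move=> h; apply: lie_lim => e e0.
have e2 : 0 < e / 2 by rewrite divr_gt0.
have [Y hY YX] := h _ e2.
have [tau [tau0 taue tau1 tauC]] := pick_small (mexp_c2 Y) e2.
exists (mexp (tau *: Y)), tau; split; first exact: hY.
 by rewrite tau0 /= (lt_trans taue)// half_lt.
rewrite (_ : _ - _ = (mexp (tau *: Y) - 1%:M - tau *: Y) + tau *: (Y - X)); last first.
 by rewrite scalerBr addrA subrK.
apply: le_trans (mnormD _ _) _; rewrite mnormZ gtr0_norm//.
have h1 : mnorm (mexp (tau *: Y) - 1%:M - tau *: Y) <= mexp_c2 Y * tau ^+ 2.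
 by have := @mexp_est2 _ _ Y tau; rewrite gtr0_norm//; apply.
have h2 := mexp_c2_ge0 Y; nra.
Qed.

(** The quotients (Ad(e^(tau X)) Y - Y) / tau belong to the Lie algebra and tend to the bracket, and
    the Lie algebra is closed. *)
Lemma lie_bracket X Y : lie S X -> lie S Y -> lie S (X *m Y - Y *m X).
Proof.
move=> hX hY; apply: lie_closed => e e0.
have [C C0 hC] := mexp_conj_est X Y.
have e2 : 0 < e / 2 by rewrite divr_gt0.
have [tau [tau0 taue tau1 tauC]] := pick_small C e2.
have nt : `|tau| <= 1 by rewrite gtr0_norm.
exists (tau^-1 *: (mexp (tau *: X) *m Y *m mexp ((- tau) *: X) - Y)).
 by apply: lieZ; apply: (lieB _ hY); rewrite -invmx_mexp; exact: lie_conj (hX tau) hY.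
rewrite -[X in _ - X](scalerK (lt0r_neq0 tau0)) -scalerBr mnormZ.
rewrite gtr0_norm ?invr_gt0// mulrC ltr_pdivrMr//.
apply: (le_lt_trans (hC _ nt)); rewrite gtr0_norm//; nra.
Qed.

(** Otherwise there are s_k tending to 1 whose normalized directions (s_k - 1) / |s_k - 1| stay at
    distance eta from the Lie algebra; their limit along an ultrafilter belongs to it by [lie_lim].
    This compactness argument does the work of a local logarithm. *)
Lemma lie_tangent (eta : R) : 0 < eta -> exists2 r : R, 0 < r & forall s, S s ->
 mnorm (s - 1%:M) < r ->
 exists2 X, lie S X & mnorm (s - 1%:M - X) <= eta * mnorm (s - 1%:M).
Proof.
move=> eta0; apply: contrapT => hno.
have bad (k : nat) : exists s, [/\ S s, mnorm (s - 1%:M) < k.+1%:R^-1 &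
  forall X, lie S X -> eta * mnorm (s - 1%:M) < mnorm (s - 1%:M - X)].
 apply: contrapT => hk; apply: hno; exists k.+1%:R^-1; first by rewrite invr_gt0.
 move=> s Ss sk; apply: contrapT => hX; apply: hk; exists s; split => // X lX.
 by rewrite ltNge; apply/negP => hle; apply: hX; exists X.
have [s hs] := choice bad.
have [U [UU Uoo]] := nat_ultra.
have FU : ProperFilter U by exact: ultra_proper.
pose Z k := s k - 1%:M.
have Z0 k : 0 < mnorm (Z k).
 have [_ _ /(_ _ lie0)] := hs k; rewrite subr0 -/(Z k) => h.
 by rewrite lt_def mnorm_ge0 andbT; apply: contraTneq h => ->; rewrite mulr0 ltxx.
pose V k := (mnorm (Z k))^-1 *: Z k.
have hl i j : exists l, forall e, 0 < e -> \forall k \near U, `|l - V k i j| < e.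
 apply: (@ultra_bounded_cvg _ _ _ UU (fun k => V k i j) 1) => k.
 rewrite /V mxE normrM gtr0_norm ?invr_gt0// mulrC ler_pdivrMr// mul1r.
 exact: mnorm_entry.
have /choice[L hL] : forall i, exists li, forall j e, 0 < e ->
  \forall k \near U, `|li j - V k i j| < e.
 by move=> i; have [l h] := choice (hl i); exists l.
pose X : 'M[R]_n := \matrix_(i, j) L i j.
have VX (e : R) : 0 < e -> \forall k \near U, mnorm (X - V k) < e.
 move=> e0; pose d := e / (n%:R ^+ 2 + 1).
 have p0 : 0 < n%:R ^+ 2 + 1 :> R by rewrite ltr_wpDl ?exprn_ge0.
 have d0 : 0 < d by rewrite divr_gt0.
 have : \forall k \near U, forall i j, `|X i j - V k i j| < d.
  apply: (@filter_forall _ _ (fun (i : 'I_n) k => forall j, `|X i j - V k i j| < d)) => i.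
  apply: (@filter_forall _ _ (fun (j : 'I_n) k => `|X i j - V k i j| < d)) => j.
  by rewrite mxE; exact: hL.
 apply: filterS => k hk; apply: (@le_lt_trans _ _ (n%:R ^+ 2 * d)).
  by apply: mnorm_le => i j; have := hk i j; rewrite [in X in _ -> X]mxE [(- V k) i j]mxE => /ltW.
 by rewrite /d mulrA ltr_pdivrMr// mulrC ltr_pM2l// ltrDl.
have small (e : R) : 0 < e -> exists k, mnorm (X - V k) < e /\ mnorm (Z k) < e.
 move=> e0; have : \forall k \near \oo, mnorm (Z k) < e.
  near=> k; have [_ h _] := hs k; apply: lt_trans h _.
  rewrite -[e]invrK ltf_pV2 ?posrE ?invr_gt0//.
  apply: (@lt_le_trans _ _ k%:R); last by rewrite ler_nat.
  by near: k; exact: nbhs_infty_gtr.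
 by move/Uoo/(filterI (VX _ e0)) => /filter_ex.
have lX : lie S X.
 apply: lie_lim => e e0; have [k [h1 h2]] := small _ e0.
 have [Sk _ _] := hs k; exists (s k), (mnorm (Z k)); split => //; first by rewrite Z0.
 have -> : s k - 1%:M = mnorm (Z k) *: V k.
  by rewrite /V scalerA divff ?scale1r// gt_eqF.
 by rewrite -scalerBr mnormZ gtr0_norm// mulrC ler_wpM2r ?(ltW (Z0 k))// mnorm_distC ltW.
have [k [h1 _]] := small _ eta0.
have [_ _ /(_ _ (lieZ (mnorm (Z k)) lX))] := hs k.
have -> : s k - 1%:M = mnorm (Z k) *: V k.
 by rewrite /V scalerA divff ?scale1r// gt_eqF.
rewrite -scalerBr !mnormZ !(gtr0_norm (Z0 k)) ltNge => /negP; apply.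
rewrite gtr0_norm ?invr_gt0// mulVf ?gt_eqF// mulr1 mulrC.
by rewrite ler_wpM2r ?(ltW (Z0 k))// mnorm_distC ltW.
Unshelve. all: by end_near. Qed.

End linear_group.

(** * Algebraic groups and the polar decomposition *)

Section matrix_topology.
Variables (R : realType) (n : nat).

Lemma mnbhsP (A : 'M[R]_n) (P : set 'M[R]_n) :
 nbhs A P <-> exists2 e : R, 0 < e & forall B, mnorm (B - A) < e -> P B.
Proof.
split=> [/nbhs_ballP[e /= e0 he]|[e e0 he]].
 exists e => // B hB; apply: he; split => // i j; rewrite /ball /=.
 apply: le_lt_trans hB; have := mnorm_entry (A - B) i j.
 by rewrite mnorm_distC [(A - B) i j]mxE [(- B) i j]mxE.
have p0 : 0 < n%:R ^+ 2 + 1 :> R by rewrite ltr_wpDl ?exprn_ge0.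
apply/nbhs_ballP; exists (e / (n%:R ^+ 2 + 1)); first by rewrite /= divr_gt0.
move=> B [_ hB]; apply: he; rewrite mnorm_distC.
apply: (@le_lt_trans _ _ (n%:R ^+ 2 * (e / (n%:R ^+ 2 + 1)))).
 apply: mnorm_le => i j; have := hB i j; rewrite /ball /= => h.
 by rewrite [(A - B) i j]mxE [(- B) i j]mxE ltW.
by rewrite mulrA ltr_pdivrMr// mulrC ltr_pM2l// ltrDl.
Qed.

Lemma poly_eval_cvg (F : set_system 'M[R]_n) (FF : Filter F)
  (f : mpoly.mpoly (n * n) R) (A : 'M[R]_n) :
 (forall i j, (fun B : 'M[R]_n => B i j) @ F --> A i j) -> poly_eval f B @[B --> F] --> poly_eval f A.
Proof.
move=> hF; rewrite /poly_eval.
have -> : (fun g : 'M[R]_n => mpoly.meval (fun i => mxvec g ord0 i) f) = (fun g : 'M[R]_n =>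
  \sum_(m <- mpoly.msupp f) mpoly.mcoeff m f *
    \prod_i mxvec g ord0 i ^+ mpoly.fun_of_multinom m i).
 by apply/funext => g; rewrite mpoly.mevalE.
rewrite mpoly.mevalE.
apply: cvg_big => [|m _]; first exact: add_continuous.
apply: cvgMr; apply: cvg_big => [|i _]; first exact: mul_continuous.
apply: (@cvg_comp _ _ _ (fun B : 'M[R]_n => mxvec B ord0 i) (fun x : R => x ^+ _) _
 (nbhs (mxvec A ord0 i))); last exact: exprn_continuous.
case/mxvec_indexP: i => i j; rewrite mxvecE.
by apply: cvg_trans (hF i j); apply: near_eq_cvg; apply: nearW => B; rewrite mxvecE.
Qed.

Lemma algebraic_linear_group (S : set 'M[R]_n) :
 self_adjoint_algebraic_group S -> linear_group S.
Proof.
move=> [[P SE] S1 SM SV ST]; split => //; first by move=> s; rewrite SE => -[].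
move=> A Au hA; rewrite SE; split => // f Pf.
apply: contrapT => /eqP fA0.
have := @poly_eval_cvg (nbhs A) (nbhs_filter A) f A (fun i j => @coord_continuous R n n i j A).
move=> /cvgrPdist_lt/(_ `|poly_eval f A|); rewrite normr_gt0 => /(_ fA0).
move=> /mnbhsP[e e0 he]; have [s Ss sA] := hA e e0.
have := he _ sA; move: Ss; rewrite SE => -[_ /(_ _ Pf) ->].
by rewrite subr0 ltxx.
Qed.

End matrix_topology.

Section symmetric_exp.
Variables (R : realType) (n : nat).
Implicit Types (A B X Y Z P : 'M[R]_n).

Lemma mexp_conj_diag P (d : 'rV[R]_n) t : P \in unitmx ->
 mexp (t *: (invmx P *m diag_mx d *m P)) =
 invmx P *m diag_mx (\row_i expR (t * d 0 i)) *m P.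
Proof.
move=> Pu; have h : P *m mexp (t *: (invmx P *m diag_mx d *m P)) = mexp (t *: diag_mx d) *m P.
 by apply: mexp_conj; rewrite -scalemxAr -scalemxAl !mulmxA mulmxV// mul1mx.
rewrite -[LHS](mulKmx Pu) h -mulmxA; congr (_ *m (_ *m _)).
have -> : t *: diag_mx d = diag_mx (t *: d) by rewrite linearZ.
by rewrite mexp_diag; congr diag_mx; apply/rowP => i; rewrite !mxE.
Qed.

(** In a basis that diagonalizes X, an entry of Z vanishes unless the two eigenvalues of e^(2X)
    agree, and exp is injective on the reals. *)
Lemma mexp_sym_comm X Z : X^T = X ->
 Z *m (mexp X *m mexp X) = (mexp X *m mexp X) *m Z -> Z *m X = X *m Z.
Proof.
move=> /real_symmetric_diag[P [d [Pu XE]]] h.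
have e : mexp X *m mexp X = invmx P *m diag_mx (\row_i expR (2 * d 0 i)) *m P.
 have h1 : mexp X *m mexp X = mexp (2 *: X).
  by have := mexpD X 1 1; rewrite scale1r => <-; congr mexp; congr (_ *: _); ring.
 by rewrite h1 {1}XE mexp_conj_diag.
pose W := P *m Z *m invmx P.
have ZW : Z = invmx P *m W *m P.
 by rewrite /W !mulmxA mulVmx// mul1mx -mulmxA mulVmx// mulmx1.
have hW : W *m diag_mx (\row_i expR (2 * d 0 i)) = diag_mx (\row_i expR (2 * d 0 i)) *m W.
 have := congr1 (fun M => P *m M *m invmx P) h; rewrite e /W !mulmxA.
 by rewrite mulmxK// mulmxV// mul1mx.
have hW' : W *m diag_mx d = diag_mx d *m W.
 apply/matrixP => i j; have /matrixP/(_ i j) := hW.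
 rewrite !mul_mx_diag !mul_diag_mx !mxE mulrC => /eqP.
 rewrite -subr_eq0 -mulrBl mulf_eq0 subr_eq0 => /orP[/eqP/expR_inj|/eqP ->]; last by rewrite mulr0 mul0r.
 by move=> /mulfI -> //; rewrite mulrC.
clearbody W; rewrite XE ZW !mulmxA !mulmxK//; congr (_ *m _).
by rewrite -!mulmxA hW'.
Qed.

Lemma tr_mul_self_gt0 m (w : 'cV[R]_m) : w != 0 -> 0 < (w^T *m w) 0 0.
Proof.
move=> w0; rewrite mxE; under eq_bigr do rewrite mxE -expr2.
rewrite lt_def sumr_ge0 ?andbT; last by move=> i _; exact: sqr_ge0.
apply: contra_neq w0 => /eqP; rewrite psumr_eq0; last by move=> i _; exact: sqr_ge0.
move=> /allP h; apply/colP => i; rewrite mxE; apply/eqP.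
by have := h i (mem_index_enum _); rewrite /= expf_eq0.
Qed.

Variable S : set 'M[R]_n.
Hypothesis SA : self_adjoint_algebraic_group S.

Definition lie_k : set 'M[R]_n := [set X | lie S X /\ X^T = - X].
Definition lie_p : set 'M[R]_n := [set X | lie S X /\ X^T = X].
Definition orth_part : set 'M[R]_n := [set s | S s /\ s^T *m s = 1%:M].

Lemma lie_tr X : lie S X -> lie S X^T.
Proof.
have [_ _ _ _ ST] := SA.
by move=> h t; rewrite -linearZ /= -mexp_tr; exact: ST.
Qed.

(** The exponential of L, half the logarithm of g^T g, is the positive factor. The point is that L
    lies in the Lie algebra: an equation of S along e^(2tL) is an exponential polynomial in t, and
    it vanishes at the naturals, where e^(2tL) is a power of g^T g in S. *)
Lemma polar g : S g -> exists k P, [/\ orth_part k, lie_p P & g = k *m mexp P].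
Proof.
have GS := algebraic_linear_group SA.
move=> Sg; have [[PS SE] S1 SM SV ST] := SA.
have gu := lg_unit GS Sg.
pose s := g^T *m g; have sT : s^T = s by rewrite /s trmx_mul trmxK.
have Ss : S s by apply: SM => //; exact: ST.
have [P [d [Pu sE]]] := real_symmetric_diag sT.
(* For an eigenvector u of g^T g with eigenvalue d, d |u|^2 = |g u|^2. *)
have d0 i : 0 < d 0 i.
 pose u : 'cV[R]_n := invmx P *m delta_mx i 0.
 have u0 : u != 0.
  apply/eqP => /(congr1 (mulmx P)); rewrite /u mulKVmx// mulmx0 => /matrixP/(_ i 0).
  by rewrite !mxE !eqxx => /eqP; rewrite oner_eq0.
 have su : s *m u = d 0 i *: u.
  rewrite sE /u -!mulmxA mulKVmx// scalemxAr; congr (_ *m _).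
  apply/colP => a; rewrite mul_diag_mx !mxE.
  by case: eqP => [->|]; rewrite ?mulr0.
 have gu0 : g *m u != 0.
  by apply: contra_neq u0 => /(congr1 (mulmx (invmx g))); rewrite mulKmx// mulmx0.
 have := tr_mul_self_gt0 gu0.
 rewrite trmx_mul -mulmxA (mulmxA g^T) -/s su -scalemxAr mxE.
 by rewrite pmulr_lgt0// tr_mul_self_gt0.
pose l : 'rV[R]_n := \row_i (ln (d 0 i) / 2).
pose L := invmx P *m diag_mx l *m P.
have expL t : mexp (t *: L) = invmx P *m diag_mx (\row_i expR (t * l 0 i)) *m P.
 exact: mexp_conj_diag.
have sL : mexp (2 *: L) = s.
 rewrite expL sE; congr (_ *m diag_mx _ *m _); apply/rowP => i.
 by rewrite !mxE mulrC divfK// lnK// posrE.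
(* As P need not be orthogonal, symmetry of s is read as: P P^T commutes with the diagonal matrix of
   [d]. It then commutes with that of [l], whose entries are functions of those of [d], and this is
   symmetry of L. *)
have LT : L^T = L.
 have h1 : P *m P^T *m diag_mx d = diag_mx d *m (P *m P^T).
  have : P *m s *m P^T = diag_mx d *m (P *m P^T).
   by rewrite sE !mulmxA mulmxV// mul1mx.
  rewrite -{1}sT sE !trmx_mul tr_diag_mx !mulmxA => <-.
  rewrite -[RHS]mulmxA -trmx_mul mulmxV// trmx1 mulmx1.
  by [].
 have h2 : P *m P^T *m diag_mx l = diag_mx l *m (P *m P^T).
  apply/matrixP => i j; have /matrixP/(_ i j) := h1.
  rewrite !mul_mx_diag !mul_diag_mx !mxE /= mulrC => /eqP.
  rewrite -subr_eq0 -mulrBl mulf_eq0 subr_eq0 => /orP[/eqP ->|/eqP ->].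
   by rewrite mulrC.
  by rewrite mulr0 mul0r.
 rewrite /L !trmx_mul tr_diag_mx.
 apply: (can_inj (mulKmx Pu)); rewrite !mulmxA mulmxV// mul1mx.
 have Pu' : invmx P^T \in unitmx by rewrite unitmx_inv unitmx_tr.
 have PV : P^T *m (invmx P)^T = 1%:M by rewrite -trmx_mul mulVmx// trmx1.
 by rewrite h2 -!mulmxA PV mulmx1.
have liL2 : lie S (2 *: L).
 move=> t; rewrite SE; split; first exact: mexp_unit.
 move=> f Pf; apply: (@exppoly_eq0 _ (fun t => poly_eval f (mexp (t *: (2 *: L))))).
  apply: (@exppoly_ext _ (fun t => \sum_(m <- mpoly.msupp f) mpoly.mcoeff m f *
    \prod_i mxvec (mexp (t *: (2 *: L))) ord0 i ^+ mpoly.fun_of_multinom m i)).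
   by move=> u; rewrite /poly_eval mpoly.mevalE.
  apply: exppoly_sum => m; apply: exppolyM; first exact: exppoly_cst.
  apply: exppoly_prod => i; apply: exppolyX.
  case/mxvec_indexP: i => i j.
  apply: (@exppoly_ext _ (fun t => \sum_k invmx P i k * expR (t * (2 * l 0 k)) * P k j)).
   move=> u; rewrite mxvecE scalerA expL !mxE; apply: eq_bigr => k _.
   by rewrite mul_mx_diag !mxE mulrA.
  apply: exppoly_sum => k; apply: exppolyM; last exact: exppoly_cst.
  by apply: exppolyM; [exact: exppoly_cst|exact: exppoly_exp].
 move=> k; have Sk : S (s ^+ k) by exact: lg_exp.
 have -> : mexp (k%:R *: (2 *: L)) = s ^+ k.
  by rewrite -sL mexp_natmul scalerA mulrC.
 by move: Sk; rewrite SE => -[_]; apply.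
have liL : lie S L.
 have n2 : 2 != 0 :> R by rewrite pnatr_eq0.
 by rewrite -[L](scalerK n2); exact: lieZ.
exists (g *m mexp ((- 1) *: L)), L; split => //; last first.
 have h0 : mexp ((- 1) *: L) *m mexp L = 1%:M.
  by have := mexpNV L (- 1); rewrite opprK scale1r.
 by rewrite -mulmxA h0 mulmx1.
split; first by apply: SM => //; exact: liL.
rewrite trmx_mul mexp_tr linearZ /= LT -mulmxA (mulmxA g^T) -/s -sL.
rewrite mulmxA -!mexpD (_ : -1 + 2 + -1 = 0 :> R) ?scale0r ?mexp0//; by ring.
Qed.

End symmetric_exp.

(** * The trace form and orthonormal bases of matrix spaces *)

Section matrix_dot.
Variables (R : realType) (n : nat).
Implicit Types (X Y Z : 'M[R]_n) (B : seq 'M[R]_n).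

Definition mdot X Y : R := \sum_i \sum_j X i j * Y i j.

Lemma mdot_tr X Y : mdot X Y = \tr (X *m Y^T).
Proof. by apply: eq_bigr => i _; rewrite mxE; apply: eq_bigr => j _; rewrite mxE. Qed.
Lemma mdotC X Y : mdot X Y = mdot Y X.
Proof. by apply: eq_bigr => i _; apply: eq_bigr => j _; rewrite mulrC. Qed.
Lemma mdotDl X Y Z : mdot (X + Y) Z = mdot X Z + mdot Y Z.
Proof. by rewrite !mdot_tr mulmxDl linearD. Qed.
Lemma mdotZl c X Z : mdot (c *: X) Z = c * mdot X Z.
Proof. by rewrite !mdot_tr -scalemxAl linearZ. Qed.
Lemma mdotDr X Y Z : mdot Z (X + Y) = mdot Z X + mdot Z Y.
Proof. by rewrite !(mdotC Z) mdotDl. Qed.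
Lemma mdotZr c X Z : mdot Z (c *: X) = c * mdot Z X.
Proof. by rewrite !(mdotC Z) mdotZl. Qed.
Lemma mdot0l Z : mdot 0 Z = 0.
Proof. by rewrite -(scale0r 0) mdotZl mul0r. Qed.
Lemma mdotNl X Z : mdot (- X) Z = - mdot X Z.
Proof. by rewrite -scaleN1r mdotZl mulN1r. Qed.
Lemma mdotBl X Y Z : mdot (X - Y) Z = mdot X Z - mdot Y Z.
Proof. by rewrite mdotDl mdotNl. Qed.
Lemma mdot_suml (I : Type) (r : seq I) (F : I -> 'M[R]_n) Z :
 mdot (\sum_(i <- r) F i) Z = \sum_(i <- r) mdot (F i) Z.
Proof. by apply: (big_morph (mdot^~ Z)) => [u v|]; rewrite ?mdotDl ?mdot0l. Qed.
Lemma mdot_trT X Y : mdot X^T Y^T = mdot X Y.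
Proof.
by rewrite /mdot exchange_big; apply: eq_bigr => i _; apply: eq_bigr => j _; rewrite !mxE.
Qed.
Lemma mdot_ge0 X : 0 <= mdot X X.
Proof. by apply: sumr_ge0 => i _; apply: sumr_ge0 => j _; rewrite -expr2 sqr_ge0. Qed.
Lemma mdot_eq0 X : mdot X X = 0 -> X = 0.
Proof.
move=> /eqP; rewrite psumr_eq0; last by move=> i _; apply: sumr_ge0 => j _; rewrite -expr2 sqr_ge0.
move=> /allP h; apply/matrixP => i j; rewrite mxE; apply/eqP.
have := h i (mem_index_enum _); rewrite /= psumr_eq0; last by move=> k _; rewrite -expr2 sqr_ge0.
by move=> /allP/(_ j (mem_index_enum _)); rewrite /= -expr2 expf_eq0.
Qed.
Lemma mdot_le X Y : `|mdot X Y| <= mnorm X * mnorm Y.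
Proof.
rewrite /mdot (le_trans (ler_norm_sum _ _ _))// {1}/mnorm mulr_suml; apply: ler_sum => i _.
rewrite (le_trans (ler_norm_sum _ _ _))// mulr_suml; apply: ler_sum => j _.
by rewrite normrM ler_wpM2l// mnorm_entry.
Qed.

Definition morthonormal B :=
 uniq B /\ forall b c, b \in B -> c \in B -> mdot b c = (b == c)%:R.

(** The coordinates form a matrix A with n^2 columns and A A^T = 1, which bounds the number of its
    rows. *)
Lemma morthonormal_size B : morthonormal B -> (size B <= n * n)%N.
Proof.
move=> [uB hB]; pose A : 'M[R]_(size B, n * n) := \matrix_(i, j) mxvec (nth 0 B i) 0 j.
apply: (@mulmx1_min _ _ _ A A^T); apply/matrixP => i j; rewrite !mxE.
transitivity (mdot (nth 0 B i) (nth 0 B j)).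
 under eq_bigr do rewrite !mxE.
 rewrite /mdot pair_bigA /=.
 rewrite (reindex _ (curry_mxvec_bij n n)) /=.
 by apply: eq_bigr => -[a b] _ /=; rewrite !mxvecE.
by rewrite hB ?mem_nth// nth_uniq.
Qed.

Definition msubspace (L : set 'M[R]_n) :=
 [/\ L 0, forall X Y, L X -> L Y -> L (X + Y) & forall c X, L X -> L (c *: X)].

Lemma mproj_orth B X b : morthonormal B -> b \in B ->
 mdot (X - \sum_(c <- B) mdot X c *: c) b = 0.
Proof.
move=> [uB hB] bB; rewrite mdotBl mdot_suml (bigD1_seq b)//= big1_seq ?addr0.
 by rewrite mdotZl (hB b b)// eqxx mulr1 subrr.
by move=> c /andP[cb cB]; rewrite mdotZl (hB c b)// (negbTE cb) mulr0.
Qed.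

(** An orthonormal family in L of maximal size: a nonzero remainder of X after projection could be
    normalized and added. *)
Lemma msubspace_basis L : msubspace L -> exists B : seq 'M[R]_n,
 [/\ morthonormal B, forall b, b \in B -> L b &
   forall X, L X -> X = \sum_(b <- B) mdot X b *: b].
Proof.
move=> LS; have [L0 LD LZ] := LS.
pose P m := `[< exists B, [/\ morthonormal B, forall b, b \in B -> L b & size B = m] >].
have P0 : exists m, P m.
 by exists 0%N; apply/asboolP; exists [::]; split.
have Pb m : P m -> (m <= n * n)%N.
 by move=> /asboolP[B [oB _ <-]]; exact: morthonormal_size.
case: (ex_maxnP P0 Pb) => m /asboolP[B [oB LB sB]] mmax.
exists B; split => // X LX.
pose Y := X - \sum_(b <- B) mdot X b *: b.
have LY : L Y.
 apply: (LD) => //; rewrite -scaleN1r; apply: (LZ).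
 rewrite big_seq; apply: (big_ind L) => // b bB; apply: (LZ); exact: LB.
have [Y0|Y0] := eqVneq (mdot Y Y) 0.
 by apply/eqP; rewrite -subr_eq0; apply/eqP; exact: mdot_eq0.
have pY : 0 < mdot Y Y by rewrite lt_def Y0 mdot_ge0.
pose c := Num.sqrt (mdot Y Y); have c0 : 0 < c by rewrite sqrtr_gt0.
pose y := c^-1 *: Y.
have yB b : b \in B -> mdot y b = 0.
 by move=> bB; rewrite mdotZl mproj_orth// mulr0.
have yy : mdot y y = 1.
 by rewrite mdotZl mdotZr mulrA -expr2 exprVn sqr_sqrtr ?(ltW pY)// mulVf.
have yn : y \notin B.
 by apply/negP => yB'; have := yB _ yB'; rewrite yy => /eqP; rewrite oner_eq0.
suff : P m.+1 by move=> /mmax; rewrite ltnn.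
apply/asboolP; exists (y :: B); split; last by rewrite /= sB.
 have [uB hB] := oB; split; first by rewrite /= yn.
 move=> b d; rewrite !inE => /orP[/eqP ->|bB] /orP[/eqP ->|dB].
 - by rewrite yy eqxx.
 - by rewrite yB//; case: eqP => // yd; rewrite yd dB in yn.
 - by rewrite mdotC yB//; case: eqP => // yd; rewrite -yd bB in yn.
 - exact: hB.
by move=> b; rewrite inE => /orP[/eqP ->|]; [exact: LZ|exact: LB].
Qed.

Lemma morthonormal_cat B1 B2 : morthonormal B1 -> morthonormal B2 ->
 (forall b c, b \in B1 -> c \in B2 -> mdot b c = 0) -> morthonormal (B1 ++ B2).
Proof.
move=> [u1 h1] [u2 h2] h.
have dis b : b \in B1 -> b \in B2 -> False.
 by move=> b1 b2; have := h b b b1 b2; rewrite h1// eqxx => /eqP; rewrite oner_eq0.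
split.
 rewrite cat_uniq u1 u2 andbT /=; apply/hasPn => b b2; apply/negP => b1.
 exact: (dis b).
move=> b c; rewrite !mem_cat => /orP[b1|b2] /orP[c1|c2].
- exact: h1.
- by rewrite h//; case: eqP => // bc; exfalso; apply: (dis b) => //; rewrite bc.
- by rewrite mdotC h//; case: eqP => // bc; exfalso; apply: (dis b) => //; rewrite bc.
- exact: h2.
Qed.

End matrix_dot.

Section mexp_products.
Variables (R : realType) (n : nat).
Implicit Types (Y : seq 'M[R]_n).

Definition mexp_prod Y : 'M[R]_n := foldr (fun A P => mexp A *m P) 1%:M Y.
Definition mnorms Y : R := \sum_(A <- Y) mnorm A.

Lemma mnorms_ge0 Y : 0 <= mnorms Y.
Proof. by apply: sumr_ge0 => A _; exact: mnorm_ge0. Qed.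

(** Induction on the number of factors: e^A - 1 and P - 1 are of first order, so their product is of
    second order. The constant depends on the number of factors only, so it serves when the
    coefficients of the factors vary. *)
Lemma mexp_prod_taylor k : exists2 C : R, 0 <= C & forall Y, (size Y <= k)%N -> mnorms Y <= 1 ->
 mnorm (mexp_prod Y - 1%:M - \sum_(A <- Y) A) <= C * mnorms Y ^+ 2.
Proof.
pose e : R := n%:R ^+ 2 * expR 1.
have e0 : 0 <= e by rewrite mulr_ge0 ?exprn_ge0 ?expR_ge0.
elim: k => [|k [C C0 IH]].
 exists 0 => // -[|//] _ _.
 by rewrite /mexp_prod /= big_nil subr0 subrr mnorm0 mul0r.
pose c := 1 + e.
exists (e + C + c * (1 + C)) => [|]; first by rewrite !addr_ge0 ?mulr_ge0 /c ?addr_ge0.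
case=> [|A Y].
 by move=> _ _; rewrite /mexp_prod /= big_nil subr0 subrr mnorm0 mulr_ge0 ?exprn_ge0 ?mnorms_ge0 ?addr_ge0 ?mulr_ge0 /c ?addr_ge0.
rewrite /= ltnS => sY; rewrite /mnorms big_cons -/(mnorms Y) big_cons => h1.
have Y0 := mnorms_ge0 Y; have A0 := mnorm_ge0 A.
have hY := IH Y sY (le_trans (ler_wpDl A0 (lexx _)) h1).
have A1 : mnorm A <= 1 by apply: le_trans h1; rewrite lerDl.
have hA : mnorm (mexp A - 1%:M - A) <= e * mnorm A ^+ 2.
 apply: le_trans (mexp_taylor _) _; rewrite /e -mulrA ler_wpM2l ?exprn_ge0//.
 by rewrite mulrC ler_wpM2r ?exprn_ge0// ler_expR.
set P := mexp_prod Y; set T := \sum_(B <- Y) B.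
have hA1 : mnorm (mexp A - 1%:M) <= c * mnorm A.
 rewrite -[mexp A - 1%:M](subrK A); apply: le_trans (mnormD _ _) _.
 rewrite /c mulrDl mul1r addrC lerD2l; apply: (le_trans hA).
 by rewrite expr2 ler_wpM2l// ler_piMl.
have hT : mnorm T <= mnorms Y by exact: mnorm_sum.
have hP1 : mnorm (P - 1%:M) <= (1 + C) * mnorms Y.
 rewrite -[P - 1%:M](subrK T); apply: le_trans (mnormD _ _) _.
 rewrite mulrDl mul1r addrC lerD//; apply: (le_trans hY).
 rewrite expr2 ler_wpM2l// ler_piMl//.
 by apply: le_trans h1; rewrite lerDr.
have -> : mexp A *m P - 1%:M - (A + T) =
  (mexp A - 1%:M - A) + (P - 1%:M - T) + (mexp A - 1%:M) *m (P - 1%:M).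
 have aux (a b c' d f p : 'M[R]_n) : a - f - (d + c') = b - f - d + (p - f - c') + (a - b - (p - f)).
  by apply/matrixP => i j; rewrite !mxE; ring.
 rewrite mulmxBl mulmxBr mulmx1 mul1mx.
 exact: aux.
apply: le_trans (mnormD _ _) _; apply: (le_trans (lerD (mnormD _ _) (mnormM _ _))).
have hM : mnorm (mexp A - 1%:M) * mnorm (P - 1%:M) <= (c * mnorm A) * ((1 + C) * mnorms Y).
 by rewrite ler_pM ?mnorm_ge0.
have c0 : 0 <= c by rewrite /c addr_ge0.
apply: (le_trans (lerD (lerD hA hY) hM)).
have m0 : 0 <= mnorm A * mnorms Y by rewrite mulr_ge0.
have cc0 : 0 <= c * (1 + C) by rewrite mulr_ge0// addr_ge0.
rewrite -subr_ge0.
have -> : (e + C + c * (1 + C)) * (mnorm A + mnorms Y) ^+ 2 -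
  (e * mnorm A ^+ 2 + C * mnorms Y ^+ 2 + c * mnorm A * ((1 + C) * mnorms Y)) =
  e * (mnorms Y ^+ 2 + 2 * (mnorm A * mnorms Y)) + C * (mnorm A ^+ 2 + 2 * (mnorm A * mnorms Y))
  + (c * (1 + C)) * (mnorm A ^+ 2 + mnorms Y ^+ 2 + mnorm A * mnorms Y) by ring.
by rewrite !addr_ge0 ?mulr_ge0 ?addr_ge0 ?exprn_ge0 ?mulr_ge0.
Qed.

End mexp_products.

Lemma near0E (R : realType) (P : R -> Prop) :
 (\forall t \near (0 : R), P t) <-> exists2 r : R, 0 < r & forall t : R, `|t| < r -> P t.
Proof.
split=> [/nbhs_ballP[r /= r0 hr]|[r r0 hr]].
 by exists r => // t tr; apply: hr; rewrite /ball /= sub0r normrN.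
by apply/nbhs_ballP; exists r => // t; rewrite /ball /= sub0r normrN => /hr.
Qed.
Lemma near0_le (R : realType) (d : R) : 0 < d -> \forall t \near (0 : R), `|t| <= d.
Proof.
move=> d0; apply/nbhs_ballP; exists d => // t.
by rewrite /ball /= sub0r normrN => /ltW.
Qed.

(** * Finite coverings of linear groups and lifts of one-parameter subgroups *)

Section covering.
Variables (R : realType) (n : nat) (G : topGroupType).
Implicit Types (g h : G) (X Y Z : 'M[R]_n).

Record covering (S : set 'M[R]_n) (pr : G -> 'M[R]_n) : Prop := Covering {
 cov_group : linear_group S;
 cov_in : forall g, S (pr g);
 cov1 : pr 1%g = 1%:M;
 covM : forall g h, pr (g * h)%g = pr g *m pr h;
 cov_cont : continuous pr;
 cov_open : forall U : set G, open U -> exists2 W, open W & pr @` U = W `&` S;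
 cov_ker : finite_set [set g | pr g = 1%:M];
 cov_hausdorff : hausdorff_space G;
}.

Lemma nbhs1_mul (U : set G) : nbhs (1%g : G) U ->
 exists2 V, nbhs (1%g : G) V & forall g h, V g -> V h -> U (g * h)%g.
Proof.
move=> hU; have := @mulg_continuous G (1%g, 1%g); rewrite /continuous_at /= mulg1.
move=> /(_ _ hU) [[A B] [/= hA hB] hAB]; exists (A `&` B); first exact: filterI.
by move=> g h [Ag _] [_ Bh]; exact: (hAB (g, h)).
Qed.

Lemma nbhs1_inv (U : set G) : nbhs (1%g : G) U -> nbhs (1%g : G) [set g | U g^-1%g].
Proof.
move=> hU; have := @invg_continuous G 1%g; rewrite /continuous_at invg1.
by move=> /(_ _ hU).
Qed.

Lemma nbhs1_divl (U : set G) : nbhs (1%g : G) U ->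
 exists V, [/\ nbhs (1%g : G) V, V `<=` U & forall g h, V g -> V h -> U (g^-1 * h)%g].
Proof.
move=> hU; have [V hV VU] := nbhs1_mul hU.
exists (U `&` (V `&` [set g | V g^-1%g])); split.
- by apply: filterI => //; apply: filterI => //; exact: nbhs1_inv.
- by move=> g [].
- by move=> g h [_ [_ Vg]] [_ [Vh _]]; exact: VU.
Qed.

Lemma continuous_mulgl (g : G) : continuous (fun h : G => (g * h)%g).
Proof.
move=> h; apply: (@continuous_comp _ _ _ (fun h : G => (g, h))
  (fun x : G * G => (x.1 * x.2)%g)); last exact: mulg_continuous.
by apply: cvg_pair; [exact: cvg_cst|exact: cvg_id].
Qed.

Lemma continuous_mulgr (g : G) : continuous (fun h : G => (h * g)%g).
Proof.
move=> h; apply: (@continuous_comp _ _ _ (fun h : G => (h, g))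
  (fun x : G * G => (x.1 * x.2)%g)); last exact: mulg_continuous.
by apply: cvg_pair; [exact: cvg_id|exact: cvg_cst].
Qed.

Variables (S : set 'M[R]_n) (pr : G -> 'M[R]_n).
Hypothesis CP : covering S pr.
Let GS : linear_group S := cov_group CP.

Lemma covV g : pr g^-1%g = invmx (pr g).
Proof.
have u := lg_unit GS (cov_in CP g).
by rewrite -[LHS](mulKmx u) -(covM CP) mulgV (cov1 CP) mulmx1.
Qed.

Lemma cov_lift (U : set G) : nbhs (1%g : G) U -> exists2 r : R, 0 < r &
 forall s, S s -> mnorm (s - 1%:M) < r -> exists2 u, U u & pr u = s.
Proof.
move=> hU; have [W oW WE] := cov_open CP (open_interior U).
have W1 : W 1%:M.
 suff : (W `&` S) 1%:M by case.
 by rewrite -WE; exists 1%g; [exact: hU|exact: (cov1 CP)].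
have /mnbhsP[r r0 hr] := open_nbhs_nbhs (conj oW W1).
exists r => // s Ss sr; have : (W `&` S) s by split => //; exact: hr.
by rewrite -WE => -[u Uu <-]; exists u => //; exact: interior_subset.
Qed.

(** The kernel without 1 is finite, hence closed in a Hausdorff group; a neighbourhood V of 1 with
    V^-1 V away from it meets each fibre at most once. *)
Lemma cov_inj : exists2 U : set G, nbhs (1%g : G) U &
 forall g h, U g -> U h -> pr g = pr h -> g = h.
Proof.
pose F := [set g | pr g = 1%:M] `\ 1%g.
have cF : closed F.
 have := hausdorff_accessible (cov_hausdorff CP).
 by move=> /accessible_finite_set_closed; apply; exact/finite_setD/(cov_ker CP).
have hN : nbhs (1%g : G) (~` F).
 by apply: open_nbhs_nbhs; split; [exact: closed_openC|by move=> [_ /(_ erefl)]].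
have [V [hV _ VV]] := nbhs1_divl hN; exists V => // g h Vg Vh gh.
have := VV g h Vg Vh; apply: contra_notP => ne; split.
 by rewrite /= (covM CP) covV gh mulVmx//; exact: lg_unit (cov_in CP h).
by rewrite /= => /mulg1_eq; rewrite invgK => /ne.
Qed.

(** If pr g is close to 1 it has a lift in both U and V, and injectivity on U forces this lift to be
    g. *)
Lemma cov_small (U V : set G) : nbhs (1%g : G) U -> nbhs (1%g : G) V ->
 (forall g h, U g -> U h -> pr g = pr h -> g = h) ->
 exists2 r : R, 0 < r & forall g, U g -> mnorm (pr g - 1%:M) < r -> V g.
Proof.
move=> hU hV inj; have [r r0 hr] := cov_lift (filterI hU hV); exists r => // g Ug gr.
have [u [Uu Vu] pu] := hr _ (cov_in CP g) gr.
by rewrite -(inj u g).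
Qed.

Lemma cov_nbhs1 (r : R) : 0 < r -> nbhs (1%g : G) [set g | mnorm (pr g - 1%:M) < r].
Proof.
move=> r0; have h : pr @ (1%g : G) --> (1%:M : 'M[R]_n).
 by rewrite -(cov1 CP); exact: (cov_cont CP).
by apply: (h [set A | mnorm (A - 1%:M) < r]); apply/mnbhsP; exists r.
Qed.

Lemma one_param1 (gamma : R -> G) : one_parameter_subgroup gamma -> gamma 0 = 1%g.
Proof.
move=> [_ h]; have := h 0 0; rewrite addr0 => /(congr1 (fun x => (gamma 0)^-1 * x)%g).
by rewrite mulVg mulKg.
Qed.

Lemma one_paramN (gamma : R -> G) t : one_parameter_subgroup gamma ->
 gamma (- t) = (gamma t)^-1%g.
Proof.
move=> hg; have [_ h] := hg; apply/esym; apply: mulg1_eq.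
by rewrite -h subrr one_param1.
Qed.

(** For small t the matrix e^(tX) has exactly one lift c(t) in a small neighbourhood of 1, and c is
    a local homomorphism. The value c(t / N)^N does not depend on the choice of a large N and
    extends c to the line. *)
Lemma lift_one_param X : lie S X -> exists2 gamma : R -> G,
 one_parameter_subgroup gamma & forall t, pr (gamma t) = mexp (t *: X).
Proof.
move=> lX; have [U hU inj] := cov_inj.
have [V hV VV] := nbhs1_mul hU.
pose W := U `&` V.
have hW : nbhs (1%g : G) W by exact: filterI.
have [r r0 hr] := cov_lift hW.
have [tau [tau0 _ tau1 htau]] := @pick_small R (mexp_c1 X + 1) (r / 2) (divr_gt0 r0 (ltr0n R 2)).
have hc (t : R) : exists c : G, `|t| <= tau -> W c /\ pr c = mexp (t *: X).
 have [tt|tt] := leP `|t| tau; last by exists 1%g.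
 have [||c Wc pc] := hr (mexp (t *: X)); [exact: lX| |by exists c].
 apply: (le_lt_trans (mexp_est1 X _)); first exact: le_trans tau1.
 have c0 := mexp_c1_ge0 X; have t0 := normr_ge0 t.
 have : mexp_c1 X * `|t| <= (mexp_c1 X + 1) * tau by rewrite ler_pM// lerDl.
 by move=> h; apply: (le_lt_trans h); apply: (le_lt_trans htau); rewrite half_lt.
have [c {}hc] := choice hc.
have cD s t : `|s| <= tau -> `|t| <= tau -> `|s + t| <= tau -> (c s * c t)%g = c (s + t).
 move=> /hc[[_ Vs] es] /hc[[_ Vt] et] /hc[[Ust _] est].
 apply: inj => //; first exact: VV.
 by rewrite (covM CP) es et est mexpD.
have cX k s : `|s| * k%:R <= tau -> (c s ^+ k)%g = c (s * k%:R).
 elim: k => [|k IH] hs.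
  rewrite expg0 mulr0; apply: inj; first exact: nbhs_singleton.
   by case: (hc 0); rewrite ?normr0 ?(ltW tau0)// => -[].
  by have [|_ ->] := hc 0; rewrite ?normr0 ?(ltW tau0)// scale0r mexp0 (cov1 CP).
 have hk : `|s| * k%:R <= tau by apply: le_trans hs; rewrite ler_wpM2l// ler_nat.
 rewrite expgSr IH// cD.
 - by rewrite -[k.+1]addn1 natrD mulrDr mulr1.
 - by rewrite normrM normr_nat.
 - by apply: le_trans hs; rewrite ler_peMr// ler1n.
 - by rewrite -{2}(mulr1 s) -mulrDr natr1 normrM normr_nat.
(* A number of pieces with |t| / N <= tau; the successor keeps it positive at t = 0. *)
pose N (t : R) := (Num.truncn (`|t| / tau)).+1.
have hN t : `|t| <= tau * (N t)%:R.
 have /andP[_ h] : (Num.truncn (`|t| / tau))%:R <= `|t| / tau < (N t)%:R.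
  by apply: truncn_itv; rewrite divr_ge0// ltW.
 by move: h; rewrite ltr_pdivrMr// mulrC => /ltW.
pose gamma t := (c (t / (N t)%:R)%R ^+ N t)%g.
have gE t M : (0 < M)%N -> `|t| <= tau * M%:R -> gamma t = (c (t / M%:R)%R ^+ M)%g.
 move=> M0 hM; pose K := (N t * M)%N.
 have K0 : (0 < K)%N by rewrite muln_gt0 M0.
 have key a b : (0 < a)%N -> (0 < b)%N -> `|t| <= tau * a%:R ->
   (c (t / a%:R)%R ^+ a)%g = (c (t / (a * b)%N%:R)%R ^+ (a * b)%N)%g.
  move=> a0 b0 ha; set u := (t / (a * b)%N%:R)%R.
  rewrite mulnC expgnA (cX b u); first congr (c _ ^+ _)%g.
   by rewrite /u natrM invfM mulrA divfK ?pnatr_eq0 ?gtn_eqF.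
  rewrite /u normrM normfV normr_nat natrM invfM mulrA.
  by rewrite divfK ?pnatr_eq0 ?gtn_eqF// ler_pdivrMr ?ltr0n.
 by rewrite /gamma (key (N t) M) ?hN// (key M (N t))// (mulnC M).
have prg t : pr (gamma t) = mexp (t *: X).
 have [|_ e] := hc (t / (N t)%:R).
  by rewrite normrM normfV normr_nat ler_pdivrMr ?ltr0n.
 have prX k h : pr (h ^+ k)%g = pr h ^+ k.
  by elim: k => [|k IH]; rewrite ?expg0 ?expr0 ?(cov1 CP)// expgS (covM CP) IH exprS.
 by rewrite /gamma prX e mexp_natmul divfK// pnatr_eq0.
have gD : {morph gamma : s t / s + t >-> (s * t)%g}.
 move=> s t; pose M := (N s + N t)%N.
 have M0 : (0 < M)%N by [].
 have hs : `|s| <= tau * M%:R.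
  by apply: le_trans (hN s) _; rewrite (ler_wpM2l (ltW tau0))// ler_nat leq_addr.
 have ht : `|t| <= tau * M%:R.
  by apply: le_trans (hN t) _; rewrite (ler_wpM2l (ltW tau0))// ler_nat leq_addl.
 have hst : `|s + t| <= tau * M%:R.
  by apply: le_trans (ler_normD _ _) _; rewrite natrD mulrDr lerD.
 have small u : `|u| <= tau * M%:R -> `|u / M%:R| <= tau.
  by move=> hu; rewrite normrM normfV normr_nat ler_pdivrMr ?ltr0n.
 (* With the common number of pieces M, the three values are M-th powers of small elements, and
    those of s and t commute because both their products equal c at the sum. *)
 rewrite (gE s M)// (gE t M)// (gE (s + t) M)// -expgMn.
  by rewrite mulrDl cD ?small// -mulrDl small.
 by rewrite /commute !cD ?small// 1?addrC// -mulrDl small// addrC.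
exists gamma => //; split => // t0.
have cont0 (A : set G) : nbhs (1%g : G) A -> \forall t \near (0 : R), A (gamma t).
 move=> hA; have [r' r'0 hr'] := cov_small hU hA inj.
 have [d [d0 _ d1 hd]] := @pick_small R (mexp_c1 X + 1) (r' / 2) (divr_gt0 r'0 (ltr0n R 2)).
 near=> t.
 have tt : `|t| <= tau.
  by near: t; exact: near0_le.
 have td : `|t| <= d by near: t; exact: near0_le.
 have e1 : gamma t = c t by rewrite (gE t 1%N)// ?mulr1// expg1 divr1.
 have [[Uc _] pc] := hc t tt; rewrite e1; apply: hr' => //; rewrite pc.
 apply: (le_lt_trans (mexp_est1 X _)); first exact: le_trans tau1.
 have c0 := mexp_c1_ge0 X.
 have : mexp_c1 X * `|t| <= (mexp_c1 X + 1) * d by rewrite ler_pM// lerDl.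
 by move=> h; apply: (le_lt_trans h); apply: (le_lt_trans hd); rewrite half_lt.
move=> A /= hA.
have h1 : nbhs (1%g : G) [set h | A (gamma t0 * h)%g].
 by apply: continuous_mulgl; rewrite mulg1.
have h2 : (fun t => t - t0) @ t0 --> (0 : R).
 by rewrite -[X in _ --> X](subrr t0); apply: cvgB; [exact: cvg_id|exact: cvg_cst].
have h3 : \forall t \near t0, A (gamma t0 * gamma (t - t0))%g by exact: (h2 _ (cont0 _ h1)).
by apply: filterS h3 => t; rewrite -gD addrC subrK.
Unshelve. all: by end_near. Qed.

Definition lifting (gam : 'M[R]_n -> R -> G) := forall X, lie S X ->
 one_parameter_subgroup (gam X) /\ forall t, pr (gam X t) = mexp (t *: X).

Lemma lifting_exists : exists gam, lifting gam.
Proof.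
have h (X : 'M[R]_n) : exists gamma : R -> G, lie S X -> one_parameter_subgroup gamma /\
  forall t, pr (gamma t) = mexp (t *: X).
 have [/lift_one_param[gamma h1 h2]|h] := pselect (lie S X); first by exists gamma.
 by exists (fun=> 1%g).
by have [f hf] := choice h; exists f => X; exact: hf.
Qed.

Variable gam : 'M[R]_n -> R -> G.
Hypothesis hgam : lifting gam.

Definition gam_prod (bs : seq 'M[R]_n) (x : 'M[R]_n -> R) : G :=
 foldr (fun b h => (gam b (x b) * h)%g) 1%g bs.

Lemma gam_prod_nbhs1 (bs : seq 'M[R]_n) (U : set G) : nbhs (1%g : G) U ->
 (forall b, b \in bs -> lie S b) ->
 exists2 d : R, 0 < d & forall x : 'M[R]_n -> R, (forall b, b \in bs -> `|x b| < d) ->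
  U (gam_prod bs x).
Proof.
move=> hU; elim: bs U hU => [|b bs IH] U hU hgs.
 by exists 1 => // ts _; exact: nbhs_singleton.
have [V hV VV] := nbhs1_mul hU.
have [d d0 hd] := IH V hV (fun c hc => hgs c (mem_behead (s := b :: bs) hc)).
have [hg _] := hgam (hgs b (mem_head _ _)).
have : \forall t \near (0 : R), V (gam b t).
 by have := hg.1 0; rewrite /continuous_at (one_param1 hg); apply.
move=> /nbhs_ballP[e /= e0 he]; exists (Num.min d e); first by rewrite lt_min d0.
move=> x hx; apply: VV; last first.
 by apply: hd => c cbs; have := hx c; rewrite inE cbs orbT lt_min => /(_ isT)/andP[].
apply: he; rewrite /ball /= sub0r normrN.
by have := hx b; rewrite inE eqxx lt_min => /(_ isT)/andP[].
Qed.

Lemma pr_gam_prod (bs : seq 'M[R]_n) x : (forall b, b \in bs -> lie S b) ->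
 pr (gam_prod bs x) = mexp_prod [seq x b *: b | b <- bs].
Proof.
elim: bs => [|b bs IH] h; first exact: (cov1 CP).
rewrite /= (covM CP) IH => [|c cbs]; last by apply: h; rewrite inE cbs orbT.
by have [_ ->] := hgam (h b (mem_head _ _)).
Qed.

(* The element h = prod gam_b(x_b), with x the coordinates of the tangent part of
  pr g - 1, satisfies |pr (h^-1 g) - 1| <= |pr g - 1| / 2; iterating replaces the
  inverse function theorem. *)
Lemma length_lipschitz (S' : set 'M[R]_n) (bs : seq 'M[R]_n) :
 linear_group S' -> S' `<=` S -> morthonormal bs -> (forall b, b \in bs -> lie S' b) ->
 (forall X, lie S' X -> X = \sum_(b <- bs) mdot X b *: b) ->
 exists (C : R) (U : set G), [/\ 0 <= C, nbhs (1%g : G) U & forall (rho : G -> R) (L : R),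
  0 <= L ->
  (forall g h, S' (pr g) -> S' (pr h) -> rho (g * h)%g <= rho g + rho h) ->
  rho 1%g = 0 ->
  (forall e, 0 < e -> nbhs (1%g : G) [set g | S' (pr g) -> rho g < e]) ->
  (forall b t, b \in bs -> rho (gam b t) <= `|t| * L) ->
  forall g, U g -> S' (pr g) -> rho g <= C * mnorm (pr g - 1%:M) * L].
Proof.
move=> GS' S'S ob bL' spanB.
have bL b : b \in bs -> lie S b by move=> /bL' h t; apply: S'S; exact: h.
have [U0 hU0 inj] := cov_inj.
have [U1 [hU1 U10 U1U]] := nbhs1_divl hU0.
have [r1 r10 hr1] := cov_small hU0 hU1 inj.
have [d d0 hd] := gam_prod_nbhs1 hU1 bL.
pose nb : R := \sum_(b <- bs) mnorm b.
have nb0 : 0 <= nb by apply: sumr_ge0 => b _; exact: mnorm_ge0.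
have [A A0 hA] := @mexp_prod_taylor R n (size bs).
have p8 : 0 < 8^-1 :> R by rewrite invr_gt0.
have [r2 r20 hr2] := lie_tangent GS' p8.
(* C3 |Z| bounds the total norm of the factors x_b b. The radius r makes the product differ from its
   first order part by |Z| / 64, and the tangent error is |Z| / 8; the inverse of pr h costs a
   factor 2, so the new remainder is at most 2 (1/8 + 1/64) |Z| <= |Z| / 2. *)
pose C3 : R := 2 * nb ^+ 2.
have C30 : 0 <= C3 by rewrite mulr_ge0// exprn_ge0.
pose Cc := C3 + 8 * A * C3 ^+ 2 + 2 * nb.
pose e0 := Num.min r2 (Num.min r1 (Num.min 8^-1 (d / 2))).
have e00 : 0 < e0 by rewrite !lt_min r20 r10 invr_gt0 divr_gt0//= ltr0n.
have [r [r0 re _ Cr]] := pick_small Cc e00.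
have [er2 [er1 [e8 ed]]] : e0 <= r2 /\ e0 <= r1 /\ e0 <= 8^-1 /\ e0 <= d / 2.
 by rewrite /e0; do !split; rewrite !ge_min lexx ?orbT.
have AC0 : 0 <= 8 * A * C3 ^+ 2 by rewrite !mulr_ge0// exprn_ge0.
have c1 : C3 * r <= 8^-1.
 apply: le_trans e8; apply: le_trans Cr; rewrite ler_wpM2r ?(ltW r0)// /Cc -addrA lerDl.
 by rewrite addr_ge0// mulr_ge0.
have c2 : 8 * A * C3 ^+ 2 * r <= 8^-1.
 apply: le_trans e8; apply: le_trans Cr; rewrite ler_wpM2r ?(ltW r0)// /Cc addrAC lerDr.
 by rewrite addr_ge0// mulr_ge0.
have c3 : 2 * nb * r < d.
 apply: (@le_lt_trans _ _ (d / 2)); last by rewrite half_lt.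
 by apply: le_trans ed; apply: le_trans Cr; rewrite ler_wpM2r ?(ltW r0)// /Cc lerDr addr_ge0.
have r8 : r <= 8^-1 by apply: le_trans e8; exact: ltW.
pose U := U1 `&` [set g | mnorm (pr g - 1%:M) < r].
exists (4 * nb), U; split; first by rewrite mulr_ge0.
 by apply: filterI => //; exact: cov_nbhs1.
move=> rho L L0 rhoM rho1 rhoc rhog.
have rho_prod (cs : seq 'M[R]_n) x : {subset cs <= bs} ->
  S' (pr (gam_prod cs x)) /\ rho (gam_prod cs x) <= (\sum_(b <- cs) `|x b|) * L.
 elim: cs => [|b cs IH] sub.
  by rewrite big_nil mul0r /gam_prod /= rho1 (cov1 CP); split => //; exact: lg1.
 have [h1 h2] : S' (pr (gam_prod cs x)) /\ rho (gam_prod cs x) <= (\sum_(b <- cs) `|x b|) * L.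
  by apply: IH => c ccs; apply: sub; rewrite inE ccs orbT.
 have bb : b \in bs by apply: sub; exact: mem_head.
 have hb : S' (pr (gam b (x b))) by have [_ ->] := hgam (bL b bb); exact: bL'.
 split; first by rewrite /= (covM CP); exact: lgM.
 rewrite big_cons mulrDl /=; apply: le_trans (rhoM _ _ hb h1) _.
 by rewrite lerD// rhog.
have step g : U g -> S' (pr g) -> exists g', [/\ U g', S' (pr g'),
  mnorm (pr g' - 1%:M) <= mnorm (pr g - 1%:M) / 2 &
  rho g <= rho g' + 2 * nb * mnorm (pr g - 1%:M) * L].
 move=> [U1g gr] Sg; set Z := pr g - 1%:M; have Z0 := mnorm_ge0 Z.
 have Zr : mnorm Z < r by exact: gr.
 have [|X lX hX] := hr2 _ Sg; first by rewrite (lt_le_trans gr)// (le_trans _ er2)// ltW.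
 rewrite -/Z in hX.
 have X2 : mnorm X <= 2 * mnorm Z.
  have : mnorm X <= mnorm Z + mnorm (Z - X).
   by rewrite -{1}[X](subKr Z); exact: mnormB.
  by move=> h; apply: (le_trans h); clear - hX Z0; lra.
 pose x b := mdot X b; pose h := gam_prod bs x.
 have xb b : `|x b| <= 2 * mnorm Z * mnorm b.
  by apply: (le_trans (mdot_le _ _)); rewrite ler_wpM2r ?mnorm_ge0.
 have bnb b : b \in bs -> mnorm b <= nb.
  move=> bB; rewrite /nb (bigD1_seq b)//=; last by case: ob.
  by rewrite lerDl; apply: sumr_ge0 => c _; exact: mnorm_ge0.
 have U1h : U1 h.
  apply: hd => b bB; apply: le_lt_trans (xb b) _; apply: le_lt_trans c3.
  rewrite mulrAC ler_pM ?mulr_ge0 ?mnorm_ge0 ?ler_wpM2l ?bnb//; exact: ltW.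
 have sX : \sum_(B <- [seq x b *: b | b <- bs]) B = X.
  by rewrite big_map -spanB.
 have nX : mnorms [seq x b *: b | b <- bs] <= C3 * mnorm Z.
  rewrite /mnorms big_map.
  apply: (@le_trans _ _ (\sum_(b <- bs) 2 * mnorm Z * nb * mnorm b)).
   rewrite big_seq [X in _ <= X]big_seq; apply: ler_sum => b bB.
   rewrite mnormZ ler_wpM2r ?mnorm_ge0//.
   by apply: (le_trans (xb b)); rewrite ler_wpM2l ?mulr_ge0 ?mnorm_ge0 ?bnb.
  by rewrite -mulr_sumr -/nb; apply: eq_ler; rewrite /C3; ring.
 have hT : mnorm (pr h - 1%:M - X) <= A * (C3 * mnorm Z) ^+ 2.
  rewrite pr_gam_prod// -[X in _ - X]sX; apply: le_trans (hA _ _ _) _.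
  - by rewrite size_map.
  - apply: (le_trans nX); apply: (@le_trans _ _ (C3 * r)); first by rewrite ler_wpM2l// ltW.
   by apply: (le_trans c1); rewrite invf_le1// ler1n.
  by rewrite ler_wpM2l// lerXn2r ?nnegrE ?mulr_ge0 ?mnorms_ge0.
 have hT2 : mnorm (pr h - 1%:M - X) <= mnorm Z / 64.
  apply: (le_trans hT); have m0 : 0 <= A * C3 ^+ 2 by rewrite mulr_ge0// exprn_ge0.
  have -> : A * (C3 * mnorm Z) ^+ 2 = (A * C3 ^+ 2) * mnorm Z * mnorm Z by ring.
  rewrite [X in _ <= X]mulrC ler_wpM2r//.
  have : A * C3 ^+ 2 * mnorm Z <= A * C3 ^+ 2 * r by rewrite ler_wpM2l// ltW.
  by move: c2; rewrite -!mulrA; clear; lra.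
 have hh1 : mnorm (pr h - 1%:M) <= 2^-1.
  rewrite -[_ - 1%:M](subrK X); apply: le_trans (mnormD _ _) _.
  clear - hT2 X2 Zr r8 Z0; lra.
 set W := pr g - pr h.
 have hW : mnorm W <= mnorm Z / 8 + mnorm Z / 64.
  have -> : W = (Z - X) - (pr h - 1%:M - X).
   have aux (a a0 a1 a2 : 'M[R]_n) : a - a0 = (a - a1 - a2) - (a0 - a1 - a2).
    by apply/matrixP => i j; rewrite !mxE; ring.
   exact: aux.
  by apply: le_trans (mnormB _ _) _; rewrite lerD// mulrC.
 have [S'h rhoh] := rho_prod bs x (fun _ p => p).
 exists (h^-1 * g)%g.
 have prh' : pr (h^-1 * g)%g = invmx (pr h) *m pr g by rewrite (covM CP) covV.
 have uh := lg_unit GS (cov_in CP h).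
 have eZ' : pr (h^-1 * g)%g - 1%:M = invmx (pr h) *m W.
  by rewrite prh' /W mulmxBr mulVmx.
 have hZ' : mnorm (pr (h^-1 * g)%g - 1%:M) <= mnorm Z / 2.
  rewrite eZ'; set Q := invmx (pr h) *m W.
  (* Q solves a fixed point equation with contraction 1/2, which gives |Q| <= 2 |W| without a bound
     on the inverse of pr h. *)
  have QE : Q = W - (pr h - 1%:M) *m Q by rewrite mulmxBl mul1mx /Q mulKVmx// subKr.
  have h1 : mnorm Q <= mnorm W + 2^-1 * mnorm Q.
   rewrite {1}QE; apply: le_trans (mnormB _ _) _; rewrite lerD2l.
   by apply: le_trans (mnormM _ _) _; rewrite ler_wpM2r ?mnorm_ge0.
  clear - h1 hW Z0; lra.
 have Zr' : mnorm (pr (h^-1 * g)%g - 1%:M) < r.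
  by apply: le_lt_trans hZ' _; clear - Zr Z0; lra.
 split.
 - split; last exact: Zr'.
  by apply: hr1; [exact: U1U|exact: lt_le_trans Zr' (ltW (lt_le_trans re er1))].
 - by rewrite prh'; apply: lgM => //; exact: lgV.
 - exact: hZ'.
 - rewrite -{1}[g](mulVKg h) addrC; apply: le_trans (rhoM _ _ S'h _) _.
   by rewrite prh'; apply: lgM => //; exact: lgV.
  rewrite lerD2r; apply: (le_trans rhoh); rewrite ler_wpM2r//.
  rewrite mulrAC [leRHS]mulr_sumr; apply: ler_sum => b _; exact: xb.
move=> g Ug Sg; set Z := pr g - 1%:M; have Z0 := mnorm_ge0 Z.
(* The j-th halving costs 2 nb 2^-j |Z| L; the geometric series sums to the constant 4 nb, and
   continuity of rho at 1 removes the last remainder. *)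
have iter (j : nat) : exists g', [/\ U g', S' (pr g'), mnorm (pr g' - 1%:M) <= mnorm Z * 2^-1 ^+ j &
  rho g <= rho g' + 4 * nb * mnorm Z * L * (1 - 2^-1 ^+ j)].
 elim: j => [|j [g1 [Ug1 Sg1 hg1 rg1]]].
  by exists g; split => //; rewrite expr0 ?mulr1// subrr mulr0 addr0.
 have [g2 [Ug2 Sg2 hg2 rg2]] := step _ Ug1 Sg1.
 exists g2; split => //.
  by apply: (le_trans hg2); rewrite exprSr mulrA ler_wpM2r// invr_ge0.
 apply: (le_trans rg1); apply: (le_trans (lerD rg2 (lexx _))).
 rewrite -addrA lerD2l.
 have h1 : 2 * nb * mnorm (pr g1 - 1%:M) * L <= 2 * nb * (mnorm Z * 2^-1 ^+ j) * L.
  by rewrite ler_wpM2r// ler_wpM2l// mulr_ge0.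
 apply: (le_trans (lerD h1 (lexx _))); rewrite exprSr.
 by apply: eq_ler; field.
apply/ler_addgt0Pr => e epos.
have [r3 r30 hr3] := cov_small hU0 (rhoc e epos) inj.
have [j hj] : exists j, mnorm Z * 2^-1 ^+ j < r3.
 have h2 : `|2^-1 : R| < 1 by rewrite ger0_norm ?invr_ge0// invf_lt1// ltr1n.
 have := cvg_expr h2 => /cvgrPdist_lt/(_ (r3 / (mnorm Z + 1))).
 rewrite divr_gt0 ?ltr_wpDl// => /(_ isT)[N _ hN]; exists N.
 have := hN N (leqnn N); rewrite /= sub0r normrN ger0_norm ?exprn_ge0 ?invr_ge0//.
 rewrite ltr_pdivlMr ?ltr_wpDl// => h; apply: le_lt_trans h.
 by rewrite mulrC ler_wpM2l ?exprn_ge0 ?invr_ge0// lerDl.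
have [g' [[U1g' _] Sg' hg' rg']] := iter j.
apply: (le_trans rg'); rewrite addrC lerD//; last first.
 by apply: ltW; apply: (hr3 g') => //; [exact: U10|apply: le_lt_trans hj].
by rewrite ler_piMr ?mulr_ge0// lerBlDr lerDl exprn_ge0// invr_ge0.
Qed.

End covering.

(** * Differentiability of one-parameter groups of matrices *)

Section matrix_one_parameter.
Variable R : realType.

(** The window ]-2, 2[ leaves room for the shifts t + x with |t| < 1 and |x| < 1. *)
Lemma local_antiderivative (f : R -> R) : continuous f ->
 exists F : R -> R, forall x : R, -2 < x < 2 -> is_derive x 1 F (f x).
Proof.
move=> cf; exists (fun x => \int[lebesgue_measure]_(t in `[-2, x]) f t) => x /andP[x1 x2].
have hi : lebesgue_measure.-integrable `[-2, 2] (EFin \o f).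
 apply: continuous_compact_integrable; first exact: segment_compact.
 exact: continuous_subspaceT.
have [h1 h2] := continuous_FTC1_closed x2 hi x1 (cf x).
by refine (DeriveDef h1 _); rewrite -derive1E; exact: h2.
Qed.

Lemma is_derive_littleo (f : R -> R) (x d : R) : is_derive x 1 f d ->
 forall e, 0 < e -> \forall t \near (0 : R), `|f (x + t) - f x - t * d| <= e * `|t|.
Proof.
move=> [df dE] e e0; have : h^-1 *: (f (h *: 1 + x) - f x) @[h --> 0^'] --> d.
 by rewrite -dE; exact: df.
move=> /cvgrPdist_lt/(_ e e0) /nbhs_ballP[r /= r0 hr].
apply/nbhs_ballP; exists r => // t tr.
have [->|t0] := eqVneq t 0; first by rewrite addr0 subrr mul0r subrr normr0 mulr0.
have := hr t tr t0; rewrite /GRing.scale /= mulr1 (addrC t x) => h.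
have -> : f (x + t) - f x - t * d = - (t * (d - t^-1 * (f (x + t) - f x))).
 by field.
by rewrite normrN normrM mulrC ler_wpM2r// ltW.
Qed.

Variable n : nat.

(** The left kernel K satisfies K = - K (B - 1), so |K| <= |K| |B - 1| forces K = 0. *)
Lemma unitmx_near1 (B : 'M[R]_n) : mnorm (B - 1%:M) < 1 -> B \in unitmx.
Proof.
move=> h; rewrite -row_free_unit -kermx_eq0; apply/eqP/mnorm_eq0/eqP.
have e : kermx B = - (kermx B *m (B - 1%:M)).
 by rewrite mulmxBr mulmx_ker mulmx1 sub0r opprK.
have : mnorm (kermx B) <= mnorm (kermx B) * mnorm (B - 1%:M).
 by rewrite {1}e mnormN mnormM.
rewrite eq_le mnorm_ge0 andbT => h1; rewrite leNgt; apply/negP => k0.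
by move: h1; rewrite ler_pMr// leNgt h.
Qed.

(* A (t) M = \int_t^(t+a) A with M = \int_0^a A invertible for small a, so A is
  differentiable. *)
Lemma matrix_one_param_derive (A : R -> 'M[R]_n) : A 0 = 1%:M ->
 (forall s t, A (s + t) = A s *m A t) -> (forall i j, continuous (fun t => A t i j)) ->
 exists X, forall e, 0 < e ->
  \forall t \near (0 : R), mnorm (A t - 1%:M - t *: X) <= e * `|t|.
Proof.
move=> A0 AD cA.
have hex (ij : 'I_n * 'I_n) : exists F : R -> R, forall x : R, -2 < x < 2 ->
  is_derive x 1 F (A x ij.1 ij.2).
 exact: (local_antiderivative (cA ij.1 ij.2)).
have [F {hex}hF] := choice hex.
have n1 : 0 < n%:R ^+ 2 + 1 :> R by rewrite ltr_wpDl// exprn_ge0.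
have cont ij (a b : R) : -2 < a -> b < 2 -> {within `[a, b], continuous (F ij)}.
 move=> a2 b2; apply: derivable_within_continuous => x; rewrite in_itv /= => /andP[h1 h2].
 have h : -2 < x < 2 by rewrite (lt_le_trans a2 h1) (le_lt_trans h2 b2).
 by have [] := hF ij x h.
have [d d0 hd] : exists2 d : R, 0 < d & forall c, `|c| < d ->
  forall i j, `|A c i j - A 0 i j| <= (n%:R ^+ 2 + 1)^-1.
 have hij (ij : 'I_n * 'I_n) : \forall c \near (0 : R),
   `|A c ij.1 ij.2 - A 0 ij.1 ij.2| <= (n%:R ^+ 2 + 1)^-1.
  have /cvgrPdist_lt/(_ (n%:R ^+ 2 + 1)^-1) := cA ij.1 ij.2 0; rewrite invr_gt0 => /(_ n1).
  by apply: filterS => t; rewrite distrC => /ltW.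
 have := @filter_forall _ _ _ (nbhs (0 : R)) (nbhs_filter _) hij.
 move=> /nbhs_ballP[d /= d0 hd]; exists d => // c hc i j.
 by apply: (hd c _ (i, j)); rewrite /ball /= sub0r normrN.
(* On [0, a] every entry of A stays within 1 / (n^2 + 1) of that of the identity, so the mean a^-1 M
   is at distance less than 1 from it. *)
pose a := Num.min d 1 / 2.
have m0 : 0 < Num.min d 1 by rewrite lt_min d0 ltr01.
have m1 : Num.min d 1 <= 1 by rewrite ge_min lexx orbT.
have a0 : 0 < a by rewrite divr_gt0.
have a1 : a < 1 by rewrite /a; lra.
have ad : a < d.
 have : Num.min d 1 <= d by rewrite ge_min lexx.
 rewrite /a; lra.
have n20 : -2 < 0 :> R by lra.
have a2 : a < 2 by lra.
pose M := \matrix_(i, j) (F (i, j) a - F (i, j) 0).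
have uM : M \in unitmx.
 suff h : mnorm (a^-1 *: M - 1%:M) < 1.
  by have := unitmx_near1 h; rewrite unitmxZ// unitfE invr_neq0// gt_eqF.
 apply: (@le_lt_trans _ _ (n%:R ^+ 2 * (n%:R ^+ 2 + 1)^-1)); last first.
  by rewrite ltr_pdivrMr// mul1r ltrDl.
 apply: mnorm_le => i j.
 have [x|c cI e] := @MVT _ (F (i, j)) (fun x => A x i j) 0 a a0 _ (cont (i, j) 0 a n20 a2).
  rewrite in_itv /= => /andP[x1 x2]; apply: (hF (i, j)); apply/andP; split; lra.
 rewrite mxE mxE [M i j]mxE e subr0 mulrC mulfK ?gt_eqF// mxE -A0; apply: hd.
 by move: cI; rewrite in_itv /= => /andP[c0 ca]; rewrite gtr0_norm// (lt_trans ca).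
have AM t : `|t| < 1 -> A t *m M = \matrix_(i, j) (F (i, j) (t + a) - F (i, j) t).
 rewrite ltr_norml => /andP[t1 t2]; apply/matrixP => i j; rewrite !mxE.
 pose f x := (\sum_k A t i k * F (k, j) x) - F (i, j) (t + x).
 have df (x : R) : -1 < x < 1 -> is_derive x 1 f 0.
  move=> /andP[x1 x2].
  have hx : -2 < x < 2 by apply/andP; split; lra.
  have hx2 : -2 < t + x < 2 by apply/andP; split; lra.
  have d1 k : is_derive x 1 (fun x => A t i k * F (k, j) x) (A t i k * A x k j).
   have := hF (k, j) x hx => h.
   have := is_deriveZ (A t i k) h; rewrite /GRing.scale /=; exact.
  have d2 : is_derive x 1 (fun x => F (i, j) (t + x)) (A (t + x) i j).
   have h1 := hF (i, j) (t + x) hx2.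
   have h2 : is_derive x 1 (fun x => t + x) (1 : R).
    have := is_deriveD (is_derive_cst t x 1) (is_derive_id x (1 : R)).
    by rewrite add0r.
   have := @is_derive1_comp _ (F (i, j)) (fun x => t + x) x _ _ h1 h2.
   by rewrite mulr1.
  have d3 : is_derive x 1 (\sum_k (fun x => A t i k * F (k, j) x)) (\sum_k A t i k * A x k j).
   exact: is_derive_sum.
  have -> : f = \sum_k (fun x0 : R => A t i k * F (k, j) x0) - (fun x0 : R => F (i, j) (t + x0)).
   by apply/funext => y; rewrite /f -[RHS]/(_ y - _) fct_sumE.
  by have := is_deriveB d3 d2; rewrite AD mxE subrr.
 have cf : {within `[0, a], continuous f}.
  apply: derivable_within_continuous => x; rewrite in_itv /= => /andP[h1 h2].
  by have [] : is_derive x 1 f 0 by apply: df; apply/andP; split; lra.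
 have [x|c _] := @MVT _ f (fun=> 0) 0 a a0 _ cf.
  rewrite in_itv /= => /andP[h1 h2]; apply: df; apply/andP; split; lra.
 rewrite mul0r /f addr0 => /eqP; rewrite subr_eq0 => /eqP h.
 under eq_bigr do rewrite mxE mulrBr.
 by rewrite sumrB; move: h; lra.
exists ((A a - 1%:M) *m invmx M) => e e0.
have c0 : 0 < (n%:R ^+ 2 + 1) * (mnorm (invmx M) + 1) by rewrite mulr_gt0// ltr_wpDl ?mnorm_ge0.
pose e' := e / ((n%:R ^+ 2 + 1) * (mnorm (invmx M) + 1)).
have e'0 : 0 < e' by rewrite divr_gt0.
have hij (ij : 'I_n * 'I_n) : \forall t \near (0 : R),
  `|F ij (t + a) - F ij t - (F ij a - F ij 0) - t * (A a ij.1 ij.2 - A 0 ij.1 ij.2)| <= e' * `|t|.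
 have e2 : 0 < e' / 2 by rewrite divr_gt0.
 have h1 : is_derive a 1 (F ij) (A a ij.1 ij.2) by apply: hF; apply/andP; split; lra.
 have h2 : is_derive (0 : R) 1 (F ij) (A 0 ij.1 ij.2) by apply: hF; apply/andP; split; lra.
 apply: filterS2 (is_derive_littleo h1 e2) (is_derive_littleo h2 e2) => t.
 rewrite add0r (addrC a) => u1 u2.
 rewrite [X in `|X|](_ : _ = (F ij (t + a) - F ij a - t * A a ij.1 ij.2) -
   (F ij t - F ij 0 - t * A 0 ij.1 ij.2)); last by ring.
 by apply: le_trans (ler_normB _ _) _; move: u1 u2; lra.
have t1 : \forall t \near (0 : R), `|t| < 1.
 by apply: filterS (@near0_le R 2^-1 _) => [t h|]; [apply: le_lt_trans h _; rewrite invf_lt1// ltr1n|].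
apply: filterS2 (@filter_forall _ _ _ (nbhs (0 : R)) (nbhs_filter _) hij) t1 => t hk ht.
have eA s : `|s| < 1 -> A s = (\matrix_(i, j) (F (i, j) (s + a) - F (i, j) s)) *m invmx M.
 by move=> hs; rewrite -AM// mulmxK.
pose B := \matrix_(i, j) (F (i, j) (t + a) - F (i, j) t - (F (i, j) a - F (i, j) 0) -
  t * (A a i j - A 0 i j)).
have -> : A t - 1%:M - t *: ((A a - 1%:M) *m invmx M) = B *m invmx M.
 rewrite -A0 (eA t)// {1}(eA 0) ?normr0// -mulmxBl scalemxAl -mulmxBl; congr (_ *m _).
 by apply/matrixP => i j; rewrite !mxE add0r.
apply: le_trans (mnormM _ _) _.
have hB : mnorm B <= n%:R ^+ 2 * (e' * `|t|).
 by apply: mnorm_le => i j; rewrite mxE; exact: (hk (i, j)).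
apply: (@le_trans _ _ (((n%:R ^+ 2 + 1) * (e' * `|t|)) * (mnorm (invmx M) + 1))).
 rewrite ler_pM ?mnorm_ge0// ?lerDl//; apply: (le_trans hB).
 by rewrite ler_wpM2r ?lerDl// mulr_ge0// ltW.
apply: eq_ler; rewrite /e'; field.
by rewrite !gt_eqF// ltr_wpDl ?mnorm_ge0.
Qed.

End matrix_one_parameter.

(** * Orbit maps and smooth vectors *)

Section orbit_maps.
Variables (R : realType) (G : topGroupType) (V : hilbertType R) (p : unitary_rep G V).
Implicit Types (g h : G) (v w : V) (c : R -> G).

Lemma rep_rn g v : rn (p g v) = rn v.
Proof.
apply/eqP; rewrite -(@eqrXn2 _ 2) ?rn_ge0//.
by rewrite -!Re_inner_rn rep_inner.
Qed.
Lemma repK g v : p g^-1%g (p g v) = v.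
Proof. by rewrite -repM mulVg rep1. Qed.
Lemma repVK g v : p g (p g^-1%g v) = v.
Proof. by rewrite -repM mulgV rep1. Qed.
Lemma inner_repl g v w : inner (p g v) w = inner v (p g^-1%g w).
Proof. by rewrite -{1}(repVK g w) rep_inner. Qed.

(** The orbit map along c has derivative w at 0, in little-o form: this includes t = 0 and suits
    estimates better than the difference quotient, to which [dersP] relates it. *)
Definition ders c v w := forall e : R, 0 < e ->
 \forall t \near (0 : R), rn (p (c t) v - v - t%:C *: w) <= e * `|t|.

Lemma dersP c v w : c 0 = 1%g -> ders c v w <->
 (((t^-1)%:C *: (p (c t) v - v) : V) @[t --> (0 : R)^'] --> w).
Proof.
move=> c0.
have e1 (t : R) : t != 0 ->
  rn (p (c t) v - v - t%:C *: w) = `|t| * rn (w - (t^-1)%:C *: (p (c t) v - v)).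
 move=> t0; rewrite -rn_real -rnZ scalerBr scalerA -rmorphM /= mulfV// scale1r.
 by rewrite -rnN opprB.
rewrite cvg_rnP; split => h e e0.
 have e2 : 0 < e / 2 by rewrite divr_gt0.
 have hh : \forall t \near (0 : R), t != 0 -> rn (w - (t^-1)%:C *: (p (c t) v - v)) < e.
  apply: filterS (h _ e2) => t ht t0; move: ht; rewrite e1// mulrC ler_pM2r ?normr_gt0//.
  by move=> ht; apply: le_lt_trans ht _; rewrite half_lt.
 exact: hh.
have hh : \forall t \near (0 : R), t != 0 -> rn (w - (t^-1)%:C *: (p (c t) v - v)) < e.
 exact: (h _ e0).
apply: filterS hh => t ht; have [->|t0] := eqVneq t 0.
 by rewrite c0 rep1 subrr scale0r subrr rn0 normr0 mulr0.
by rewrite e1// mulrC ler_wpM2r// ltW// ht.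
Qed.

Lemma ders_unique c v w w' : ders c v w -> ders c v w' -> w = w'.
Proof.
move=> h h'; apply: rn_dist_eq => e e0.
have e2 : 0 < e / 2 by rewrite divr_gt0.
have [t [t0 ht ht']] : exists t : R, [/\ 0 < t, rn (p (c t) v - v - t%:C *: w) <= e / 2 * `|t| &
  rn (p (c t) v - v - t%:C *: w') <= e / 2 * `|t|].
 have [r r0 hr] := (near0E _).1 (h _ e2); have [r' r'0 hr'] := (near0E _).1 (h' _ e2).
 have m0 : 0 < Num.min r r' by rewrite lt_min r0.
 have m2 : `|Num.min r r' / 2| < Num.min r r'.
  by rewrite gtr0_norm ?divr_gt0// half_lt.
 exists (Num.min r r' / 2); rewrite lt_min in m2; have /andP[m3 m4] := m2.
 by split; [rewrite divr_gt0|exact: hr|exact: hr'].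
rewrite gtr0_norm// in ht ht'; rewrite -(@ler_pM2l _ t)//.
rewrite -{1}(gtr0_norm t0) -rn_real -rnZ scalerBr.
rewrite [X in rn X](_ : _ = (p (c t) v - v - t%:C *: w') - (p (c t) v - v - t%:C *: w)).
 by apply: le_trans (rnB _ _) _; move: ht ht'; lra.
lmod R V.
Qed.

Lemma ders_lin c v w v' w' a : ders c v w -> ders c v' w' ->
 ders c (a *: v + v') (a *: w + w').
Proof.
move=> h h' e e0; have c0 : 0 < rn a + 1 by rewrite ltr_wpDl ?rn_ge0.
have e1 : 0 < e / 2 / (rn a + 1) by rewrite !divr_gt0.
have e2 : 0 < e / 2 by rewrite divr_gt0.
apply: filterS2 (h _ e1) (h' _ e2) => t h1 h2.
rewrite linearP /= scalerDr !scalerA [t%:C * a]mulrC -scalerA.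
have -> : a *: p (c t) v + p (c t) v' - (a *: v + v') - (a *: (t%:C *: w) + t%:C *: w') =
  a *: (p (c t) v - v - t%:C *: w) + (p (c t) v' - v' - t%:C *: w').
 lmod R V.
apply: le_trans (rnD _ _) _; rewrite rnZ.
have h3 : rn a * rn (p (c t) v - v - t%:C *: w) <= e / 2 * `|t|.
 apply: (@le_trans _ _ ((rn a + 1) * (e / 2 / (rn a + 1) * `|t|))).
  by rewrite ler_pM ?rn_ge0// lerDl.
 by rewrite mulrA [_ * (e / 2 / _)]mulrC divfK ?gt_eqF.
lra.
Qed.

Lemma ders_act c g v w : ders c v w ->
 ders (fun t => g * c t * g^-1)%g (p g v) (p g w).
Proof.
move=> h e e0; apply: filterS (h e e0) => t.
by rewrite !repM repK -linearZ -!linearB /= rep_rn.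
Qed.

(** Unitarity carries c(t) to c(-t) on the other side of the inner product, whence the sign. *)
Lemma ders_adj c v w v' w' : one_parameter_subgroup c -> ders c v w -> ders c v' w' ->
 inner w v' = - inner v w'.
Proof.
move=> hc h h'; have c0 := one_param1 hc.
have h1 : (((t^-1)%:C *: (p (c t) v - v) : V) @[t --> (0 : R)^'] --> w) by exact/dersP.
have h2 : (((t^-1)%:C *: (p (c (- t)) v' - v') : V) @[t --> (0 : R)^'] --> - w').
 apply/(@dersP (fun t => c (- t))); first by rewrite oppr0.
 move=> e e0; have /near0E[r /= r0 hr] := h' e e0.
 apply/near0E; exists r => //= t tr.
 by rewrite scalerN -scaleNr -rmorphN /= -normrN; apply: hr; rewrite normrN.
apply: ctends_unique (cvg_innerl v' h1) _.
rewrite -innerNr => e e0; apply: filterS (cvg_innerr v h2 e0) => t.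
by rewrite innerZl_real innerZr_real one_paramN// innerBl innerBr inner_repl.
Qed.

Lemma rep_one_param_mul c v s m : one_parameter_subgroup c ->
 rn (p (c (s * m%:R)) v - v) <= m%:R * rn (p (c s) v - v).
Proof.
move=> hc; elim: m => [|m IH]; first by rewrite mulr0 (one_param1 hc) rep1 subrr rn0 mul0r.
rewrite -natr1 mulrDr mulr1 hc.2 repM mulrDl mul1r.
apply: (le_trans (rn_dist_triangle (p (c (s * m%:R)) v) _ _)).
by rewrite -linearB /= rep_rn addrC lerD.
Qed.

(** Cut [0, t] into m equal steps: by unitarity the displacement is at most m times that of one
    step, and a short step moves v by at most |t / m| (|w| + e). *)
Lemma ders_mean c v w t : one_parameter_subgroup c -> ders c v w ->
 rn (p (c t) v - v) <= `|t| * rn w.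
Proof.
move=> hc h; apply/ler_addgt0Pr => e e0.
have t1 : 0 < `|t| + 1 by rewrite ltr_wpDl.
have e1 : 0 < e / (`|t| + 1) by rewrite divr_gt0.
have /near0E[r /= r0 hr] := h _ e1.
pose m := (Num.truncn (`|t| / r)).+1.
have hm : `|t / m%:R| < r.
 have /andP[_ hm] : (Num.truncn (`|t| / r))%:R <= `|t| / r < m%:R.
  by apply: truncn_itv; rewrite divr_ge0// ltW.
 by rewrite normrM normfV normr_nat ltr_pdivrMr// mulrC -ltr_pdivrMr.
have := hr (t / m%:R) hm; set u := p _ v - v => hu.
have hu2 : rn u <= `|t / m%:R| * (rn w + e / (`|t| + 1)).
 rewrite -[u](subrK ((t / m%:R)%:C *: w)); apply: le_trans (rnD _ _) _.
 by rewrite rnZ rn_real mulrDr addrC lerD2l (mulrC `|_|).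
have := rep_one_param_mul v (t / m%:R) m hc; rewrite divfK ?pnatr_eq0// -/u => h1.
apply: (le_trans h1); apply: le_trans (ler_wpM2l (ler0n _ _) hu2) _.
rewrite normrM normfV normr_nat mulrA [m%:R * _]mulrC mulfVK ?pnatr_eq0// mulrDr lerD2l.
by rewrite mulrCA ler_piMr ?(ltW e0)// ler_pdivrMr// mul1r lerDl.
Qed.

Lemma orbit_cvg (T : Type) (F : set_system T) (FF : Filter F) (f : T -> V) l g :
 f t @[t --> F] --> l -> p g (f t) @[t --> F] --> p g l.
Proof.
move=> /cvg_rnP h; apply/cvg_rnP => e e0; apply: filterS (h _ e0) => t.
by rewrite -linearB /= rep_rn.
Qed.

Lemma orbit_diff_quotient c v g :
 diff_quotient c (fun g => p g v) g = fun t => p g ((t^-1)%:C *: (p (c t) v - v)).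
Proof. by apply/funext => t; rewrite /diff_quotient repM -linearB linearZ. Qed.

Lemma smooth_ders c v : one_parameter_subgroup c -> smooth_vector p v ->
 ders c v (infinitesimal p c v) /\ smooth_vector p (infinitesimal p c v).
Proof.
move=> hc hv.
have hd : cvg (((t^-1)%:C *: (p (c t) v - v) : V) @[t --> (0 : R)^']).
 have [_ /(_ _ hc)[/(_ 1%g) h _]] := hv 1%N.
 move: h; rewrite orbit_diff_quotient; under eq_fun do rewrite rep1.
 exact.
split; first by apply/dersP; [exact: one_param1|exact: hd].
move=> k; have [_ /(_ _ hc)[_]] := hv k.+1.
rewrite (_ : left_derivative _ _ = fun g => p g (infinitesimal p c v))//.
apply/funext => g; rewrite /left_derivative orbit_diff_quotient.
by apply: cvg_lim => //; apply: orbit_cvg; exact: hd.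
Qed.

(** The left derivative of the orbit map of v is the orbit map of w, and w is in P again; induction
    on the order gives all derivatives. *)
Lemma smooth_coind (P : set V) : (forall v c, P v -> one_parameter_subgroup c ->
 exists2 w, P w & ders c v w) -> forall v, P v -> smooth_vector p v.
Proof.
move=> h v Pv k; elim: k v Pv => [|k IH] v Pv /=; split => //; try exact: rep_continuous.
move=> c hc; have [w Pw hw] := h v c Pv hc.
have hd g : diff_quotient c (fun g => p g v) g @ 0^' --> p g w.
 by rewrite orbit_diff_quotient; apply: orbit_cvg; apply/dersP => //; exact: one_param1.
split => [g|]; first by apply/cvg_ex; exists (p g w); exact: hd.
rewrite (_ : left_derivative _ _ = fun g => p g w); first exact: IH.
by apply/funext => g; apply: cvg_lim => //; exact: hd.
Qed.

Lemma smooth_lin a v w : smooth_vector p v -> smooth_vector p w -> smooth_vector p (a *: v + w).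
Proof.
move=> hv hw; have [_ h] := smooth_submod_closed p.
by apply/asboolP/h; apply/asboolP.
Qed.
Lemma smooth0 : smooth_vector p 0.
Proof. by have [h _] := smooth_submod_closed p; exact/asboolP. Qed.
Lemma smoothZ a v : smooth_vector p v -> smooth_vector p (a *: v).
Proof. by move=> hv; rewrite -[_ *: _]addr0; apply: smooth_lin => //; exact: smooth0. Qed.
Lemma smoothD v w : smooth_vector p v -> smooth_vector p w -> smooth_vector p (v + w).
Proof. by move=> hv hw; rewrite -[v]scale1r; exact: smooth_lin. Qed.
Lemma smoothB v w : smooth_vector p v -> smooth_vector p w -> smooth_vector p (v - w).
Proof. by move=> hv hw; rewrite -scaleN1r; apply: smoothD => //; exact: smoothZ. Qed.
Lemma smooth_sum (I : Type) (r : seq I) (F : I -> V) :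
 (forall i, smooth_vector p (F i)) -> smooth_vector p (\sum_(i <- r) F i).
Proof.
move=> h; elim/big_ind: _ => //; [exact: smooth0|exact: smoothD].
Qed.
Lemma smooth_act_vec g v : smooth_vector p v -> smooth_vector p (p g v).
Proof.
move=> hv; have hv' : v \in smooth_pred p by exact/asboolP.
by have /asboolP := smooth_act_subproof g (SmoothVector hv').
Qed.

Lemma infinitesimal_eq c v w : one_parameter_subgroup c -> ders c v w -> infinitesimal p c v = w.
Proof.
by move=> hc h; apply: cvg_lim => //; apply/dersP => //; exact: one_param1.
Qed.

End orbit_maps.

Section rep_linear.
Variables (R : realType) (G : topGroupType) (V : hilbertType R) (p : unitary_rep G V) (g : G).

Lemma repD v w : p g (v + w) = p g v + p g w.
Proof. exact: linearD. Qed.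
Lemma repB v w : p g (v - w) = p g v - p g w.
Proof. exact: linearB. Qed.
Lemma repZ a v : p g (a *: v) = a *: p g v.
Proof. exact: linearZ. Qed.
Lemma rep0 : p g 0 = 0.
Proof. exact: linear0. Qed.
Lemma rep_sum (I : Type) (r : seq I) (F : I -> V) :
 p g (\sum_(i <- r) F i) = \sum_(i <- r) p g (F i).
Proof. exact: linear_sum. Qed.

End rep_linear.

(** * The derived representation of the Lie algebra *)

Section derived_rep.
Variables (R : realType) (n : nat) (G : topGroupType).
Variables (S : set 'M[R]_n) (pr : G -> 'M[R]_n) (gam : 'M[R]_n -> R -> G).
Hypotheses (CP : covering S pr) (hgam : lifting S pr gam).
Variables (V : hilbertType R) (p : unitary_rep G V).
Implicit Types (g h : G) (v w : V) (c : R -> G) (X Y Z : 'M[R]_n).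
Let GS : linear_group S := cov_group CP.
Notation sm := (smooth_vector p).

Lemma one_param_pr c : one_parameter_subgroup c -> exists2 X, lie S X &
 forall e : R, 0 < e -> \forall t \near (0 : R), mnorm (pr (c t) - 1%:M - t *: X) <= e * `|t|.
Proof.
move=> hc; have [|||X hX] := @matrix_one_param_derive R n (fun t => pr (c t)).
- by rewrite (one_param1 hc) (cov1 CP).
- by move=> s t; rewrite hc.2 (covM CP).
- move=> i j t; apply: (@continuous_comp _ _ _ (fun t => pr (c t)) (fun A : 'M[R]_n => A i j)).
  by apply: (@continuous_comp _ _ _ c pr); [exact: hc.1|exact: (cov_cont CP)].
 exact: coord_continuous.
exists X => //; apply: (lie_lim GS) => e e0.
have /near0E[r r0 hr] := hX e e0.
pose tau := Num.min e r / 2.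
have m0 : 0 < Num.min e r by rewrite lt_min e0.
have /andP[m3 m4] : (tau < e) && (tau < r).
 by rewrite -lt_min half_lt.
have tau0 : 0 < tau by rewrite divr_gt0.
exists (pr (c tau)), tau; split; [exact: (cov_in CP)|by rewrite tau0|].
by rewrite -{3}(gtr0_norm tau0); apply: hr; rewrite gtr0_norm.
Qed.

Variable bs : seq 'M[R]_n.
Hypotheses (bs_orth : morthonormal bs) (bs_in : forall b, b \in bs -> lie S b)
 (bs_span : forall X, lie S X -> X = \sum_(b <- bs) mdot X b *: b).

Definition C1 v := forall b, b \in bs -> exists w, ders p (gam b) v w.

Lemma gam_one X : lie S X -> one_parameter_subgroup (gam X).
Proof. by move=> /hgam[]. Qed.
Lemma pr_gam X t : lie S X -> pr (gam X t) = mexp (t *: X).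
Proof. by move=> /hgam[]. Qed.

(* The length function [g |-> |p g v - v|] is Lipschitz near 1. *)
Lemma rep_lipschitz_gen (S' : set 'M[R]_n) (bs' : seq 'M[R]_n) :
 linear_group S' -> S' `<=` S -> morthonormal bs' -> (forall b, b \in bs' -> lie S' b) ->
 (forall X, lie S' X -> X = \sum_(b <- bs') mdot X b *: b) ->
 exists (C : R) (U : set G), [/\ 0 <= C, nbhs (1%g : G) U & forall v (L : R), 0 <= L ->
 (forall b, b \in bs' -> exists2 w, ders p (gam b) v w & rn w <= L) ->
 forall g, U g -> S' (pr g) -> rn (p g v - v) <= C * mnorm (pr g - 1%:M) * L].
Proof.
move=> GS' S'S ob bL' spanB.
have [C [U [C0 hU H]]] := length_lipschitz CP hgam GS' S'S ob bL' spanB.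
exists C, U; split => // v L L0 hb g Ug Sg.
apply: (H (fun g => rn (p g v - v)) L) => //.
- move=> g1 g2 _ _; rewrite repM; apply: le_trans (rn_dist_triangle (p g1 v) _ _) _.
 by rewrite -linearB rep_rn addrC.
- by rewrite rep1 subrr rn0.
- move=> e e0; have /cvg_rnP h : p g0 v @[g0 --> (1%g : G)] --> p 1%g v.
  exact: rep_continuous.
 by apply: filterS (h e e0) => g0; rewrite rep1 rn_distC => ? _.
- move=> b t bB; have [w hw wL] := hb b bB.
 have lb : lie S b by move=> s; apply: S'S; exact: bL'.
 apply: (le_trans (ders_mean t (gam_one lb) hw)).
 by rewrite ler_wpM2l.
Qed.

Lemma rep_lipschitz v : C1 v -> exists2 C : R, 0 <= C &
 exists2 U, nbhs (1%g : G) U & forall g, U g -> rn (p g v - v) <= C * mnorm (pr g - 1%:M).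
Proof.
move=> hv.
have h (b : 'M[R]_n) : exists w, b \in bs -> ders p (gam b) v w.
 have [bB|nb] := boolP (b \in bs); last by exists 0.
 by have [w hw] := hv b bB; exists w.
have [f {}hv] := choice h; pose L := \sum_(b <- bs) rn (f b).
have L0 : 0 <= L by apply: sumr_ge0 => b _; exact: rn_ge0.
have [C [U [C0 hU H]]] := rep_lipschitz_gen GS (fun _ p => p) bs_orth bs_in bs_span.
exists (C * L); first exact: mulr_ge0.
exists U => // g Ug; rewrite mulrAC; apply: H => //; last exact: (cov_in CP).
move=> b bB; exists (f b); first exact: hv.
rewrite /L (bigD1_seq b)//=; last by case: bs_orth.
by rewrite lerDl; apply: sumr_ge0 => *; exact: rn_ge0.
Qed.

(** Write c(t) = gam_X(t) h(t). Then pr h(t) - 1 is o(t), and by the Lipschitz estimate so is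
    p(h(t)) v - v. Hence the derivative depends only on the tangent of c at 1. *)
Lemma ders_curve c X v w : lie S X -> C1 v -> ders p (gam X) v w ->
 c t @[t --> (0 : R)] --> (1%g : G) ->
 (forall e : R, 0 < e -> \forall t \near (0 : R), mnorm (pr (c t) - 1%:M - t *: X) <= e * `|t|) ->
 ders p c v w.
Proof.
move=> lX hv hw hc hpr e e0.
have [C C0 [U hU H]] := rep_lipschitz hv.
have [W [hW _ WU]] := nbhs1_divl hU.
have hg := gam_one lX.
have n1 : \forall t \near (0 : R), W (c t) by exact: hc.
have n2 : \forall t \near (0 : R), W (gam X t).
 by have := hg.1 0; rewrite /continuous_at (one_param1 hg); apply.
have e2 : 0 < e / 2 by rewrite divr_gt0.
pose B : R := mnorm (1%:M : 'M[R]_n) + mexp_c1 X.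
have B0 : 0 <= B by rewrite addr_ge0 ?mnorm_ge0 ?mexp_c1_ge0.
have [e1 [e10 e1C _ _]] : exists e1 : R, [/\ 0 < e1, C * (B * e1) <= e / 4, True & True].
 exists (e / 4 / (C * B + 1)); have h1 : 0 < C * B + 1 by rewrite ltr_wpDl ?mulr_ge0.
 split => //; first by rewrite !divr_gt0.
 rewrite mulrA mulrC mulrAC -mulrA ler_piMr ?ler_pdivrMr ?mul1r ?lerDl//.
 by rewrite divr_ge0// ltW.
have [tau [tau0 _ tau1 htau]] := pick_small (C * (B * mexp_c2 X)) (divr_gt0 e0 (ltr0n R 4)).
have n3 := near0_le tau0.
have n4 := hpr e1 e10; have n5 := hw _ e2.
apply: filterS2 (filterI n1 n2) (filterI n3 (filterI n4 n5)) => t [Wc Wg] [tt [h4 h5]].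
pose h := ((gam X t)^-1 * c t)%g; have Uh : U h by exact: WU.
have t0 := normr_ge0 t.
have t1 : `|t| <= 1 by exact: le_trans tt tau1.
have eh : pr h - 1%:M = mexp ((- t) *: X) *m (pr (c t) - mexp (t *: X)).
 rewrite /h (covM CP) (covV CP) pr_gam// invmx_mexp mulmxBr; congr (_ - _).
 by rewrite -mexpD addNr scale0r mexp0.
have hB : mnorm (mexp ((- t) *: X)) <= B.
 rewrite -[mexp _](subrK 1%:M); apply: le_trans (mnormD _ _) _; rewrite addrC lerD2l.
 apply: le_trans (mexp_est1 X _) _; first by rewrite normrN.
 by rewrite normrN ler_piMr ?mexp_c1_ge0.
have hD : mnorm (pr (c t) - mexp (t *: X)) <= e1 * `|t| + mexp_c2 X * `|t| ^+ 2.
 have -> : pr (c t) - mexp (t *: X) = (pr (c t) - 1%:M - t *: X) - (mexp (t *: X) - 1%:M - t *: X).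
  have aux (x y z u : 'M[R]_n) : x - y = (x - z - u) - (y - z - u).
   by apply/matrixP => i j; rewrite !mxE; ring.
  exact: aux.
 by apply: le_trans (mnormB _ _) _; rewrite lerD// mexp_est2.
have hh : rn (p h v - v) <= C * (B * (e1 * `|t| + mexp_c2 X * `|t| ^+ 2)).
 apply: (le_trans (H _ Uh)); rewrite ler_wpM2l// eh; apply: le_trans (mnormM _ _) _.
 by rewrite ler_pM ?mnorm_ge0.
have ec : c t = (gam X t * h)%g by rewrite /h mulVKg.
rewrite [X in rn X](_ : _ = p (gam X t) (p h v - v) + (p (gam X t) v - v - t%:C *: w)); last first.
 have -> : p (gam X t) (p h v - v) = p (c t) v - p (gam X t) v by rewrite linearB /= -repM -ec.
 by lmod R V.
apply: le_trans (rnD _ _) _; rewrite rep_rn.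
have k1 : C * (B * e1) * `|t| <= e / 4 * `|t| by rewrite ler_wpM2r.
have k2 : C * (B * mexp_c2 X) * `|t| * `|t| <= e / 4 * `|t|.
 rewrite ler_wpM2r//; apply: le_trans htau; rewrite ler_wpM2l//.
 exact: mulr_ge0 C0 (mulr_ge0 B0 (mexp_c2_ge0 X)).
apply: (le_trans (lerD hh h5)).
have -> : C * (B * (e1 * `|t| + mexp_c2 X * `|t| ^+ 2)) =
 C * (B * e1) * `|t| + C * (B * mexp_c2 X) * `|t| * `|t| by ring.
lra.
Qed.

(** Smoothness quantifies over all one-parameter subgroups; each has a tangent X, and the derivative
    along it is the one along the chosen lift [gam X]. *)
Lemma C1_lie_coind (P : set V) : (forall v X, P v -> lie S X ->
 exists2 w, P w & ders p (gam X) v w) -> forall v, P v -> sm v.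
Proof.
move=> h; apply: smooth_coind => v c Pv hc.
have [X lX hX] := one_param_pr hc.
have [w Pw hw] := h v X Pv lX; exists w => //.
apply: ders_curve lX _ hw _ hX; last first.
 by have := hc.1 0; rewrite /continuous_at (one_param1 hc).
by move=> b /bs_in lb; have [w' _ hw'] := h v b Pv lb; exists w'.
Qed.

Definition dr X v := infinitesimal p (gam X) v.

Lemma dr_ders X v : lie S X -> sm v -> ders p (gam X) v (dr X v).
Proof. by move=> lX hv; have [] := smooth_ders (gam_one lX) hv. Qed.
Lemma dr_smooth X v : lie S X -> sm v -> sm (dr X v).
Proof. by move=> lX hv; have [] := smooth_ders (gam_one lX) hv. Qed.
Lemma smooth_C1 v : sm v -> C1 v.
Proof. by move=> hv b bB; exists (dr b v); apply: dr_ders => //; exact: bs_in. Qed.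

Lemma dr_curve c X v : lie S X -> sm v -> c t @[t --> (0 : R)] --> (1%g : G) ->
 (forall e : R, 0 < e -> \forall t \near (0 : R), mnorm (pr (c t) - 1%:M - t *: X) <= e * `|t|) ->
 ders p c v (dr X v).
Proof. by move=> lX hv; apply: ders_curve => //; [exact: smooth_C1|exact: dr_ders]. Qed.

Lemma near0_sqr (C e : R) : 0 < e ->
 \forall t \near (0 : R), `|t| <= 1 /\ C * `|t| ^+ 2 <= e * `|t|.
Proof.
move=> e0; have [tau [tau0 _ tau1 htau]] := pick_small (`|C|) e0.
apply: filterS (near0_le tau0) => t tt; split; first exact: le_trans tau1.
rewrite expr2 mulrA ler_wpM2r//; apply: le_trans htau.
apply: (@le_trans _ _ (`|C| * `|t|)); first by rewrite ler_wpM2r// ler_norm.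
by rewrite ler_wpM2l.
Qed.

Lemma one_param_cvg1 c : one_parameter_subgroup c -> c t @[t --> (0 : R)] --> (1%g : G).
Proof. by move=> hc; have := hc.1 0; rewrite /continuous_at (one_param1 hc). Qed.

Lemma dr_one_param c X v : lie S X -> sm v -> one_parameter_subgroup c ->
 (forall t, pr (c t) = mexp (t *: X)) -> infinitesimal p c v = dr X v.
Proof.
move=> lX hv hc hX; apply: infinitesimal_eq => //; apply: dr_curve => //.
 exact: one_param_cvg1.
move=> e e0; apply: filterS (near0_sqr (mexp_c2 X) e0) => t [t1 ht].
by rewrite hX; apply: le_trans ht; exact: mexp_est2.
Qed.

Lemma dr_lin X a v w : lie S X -> sm v -> sm w -> dr X (a *: v + w) = a *: dr X v + dr X w.
Proof.
move=> lX hv hw; apply: infinitesimal_eq; first exact: gam_one.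
by apply: ders_lin; exact: dr_ders.
Qed.
Lemma dr0 X : lie S X -> dr X 0 = 0.
Proof.
move=> lX; have s0 := smooth0 p; have := dr_lin (-1) lX s0 s0.
by rewrite scaler0 addr0 scaleN1r addNr.
Qed.
Lemma drvZ X a v : lie S X -> sm v -> dr X (a *: v) = a *: dr X v.
Proof. by move=> lX hv; rewrite -[_ *: v]addr0 dr_lin//; [rewrite dr0// addr0|exact: smooth0]. Qed.
Lemma drvD X v w : lie S X -> sm v -> sm w -> dr X (v + w) = dr X v + dr X w.
Proof. by move=> lX hv hw; have := dr_lin 1 lX hv hw; rewrite !scale1r. Qed.

Lemma drv_sum X (I : Type) (r : seq I) (F : I -> V) : lie S X -> (forall i, sm (F i)) ->
 dr X (\sum_(i <- r) F i) = \sum_(i <- r) dr X (F i).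
Proof.
move=> lX hF; elim: r => [|i r IH]; first by rewrite !big_nil dr0.
by rewrite !big_cons drvD ?IH//; exact: smooth_sum.
Qed.

(** The derivative along gam_X(t) gam_Y(t) is computed twice: from its tangent X + Y, and by the
    product rule, where strong continuity replaces p(gam_X(t)) dr Y v by dr Y v. *)
Lemma drD X Y v : lie S X -> lie S Y -> sm v -> dr (X + Y) v = dr X v + dr Y v.
Proof.
move=> lX lY hv; pose c t := (gam X t * gam Y t)%g.
have h1 : ders p c v (dr (X + Y) v).
 apply: dr_curve => //; first exact: (lieD GS).
  move=> A hA; have [U hU UA] := nbhs1_mul hA.
  have u1 : \forall t \near (0 : R), U (gam X t) := one_param_cvg1 (gam_one lX) hU.
  have u2 : \forall t \near (0 : R), U (gam Y t) := one_param_cvg1 (gam_one lY) hU.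
  have u3 : \forall t \near (0 : R), A (c t) by apply: filterS2 u1 u2 => t v1 v2; exact: UA.
  exact: u3.
 move=> e e0; have [C C0 hC] := mexp_prod_est X Y.
 apply: filterS (near0_sqr C e0) => t [t1 ht].
 by rewrite (covM CP) !pr_gam//; apply: le_trans ht; exact: hC.
apply: ders_unique h1 _ => e e0.
have e3 : 0 < e / 3 by rewrite divr_gt0.
have /cvg_rnP n3 : p (gam X t) (dr Y v) @[t --> (0 : R)] --> dr Y v.
 rewrite -[X in _ --> X](rep1 p) -(one_param1 (gam_one lX)).
 apply: (@continuous_comp _ _ _ (gam X) (fun g => p g (dr Y v))).
  exact: (gam_one lX).1.
 exact: rep_continuous.
apply: filterS3 (dr_ders lX hv e3) (dr_ders lY hv e3) (n3 _ e3) => t h2 h3 h4.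
rewrite [X in rn X](_ : _ = p (gam X t) (p (gam Y t) v - v - t%:C *: dr Y v) +
 (p (gam X t) v - v - t%:C *: dr X v) - t%:C *: (dr Y v - p (gam X t) (dr Y v))); last first.
 by rewrite /c repM !repB repZ; lmod R V.
apply: le_trans (rnB _ _) _; rewrite rnZ rn_real.
apply: le_trans (lerD (rnD _ _) (ler_wpM2l (normr_ge0 t) (ltW h4))) _; rewrite rep_rn.
lra.
Qed.

Lemma drZ a X v : lie S X -> sm v -> dr (a *: X) v = a%:C *: dr X v.
Proof.
move=> lX hv; pose c t := gam X (a * t).
have hc : one_parameter_subgroup c.
 split => [t|s t]; last by rewrite /c mulrDr (gam_one lX).2.
 apply: (@continuous_comp _ _ _ (fun t => a * t) (gam X)); last exact: (gam_one lX).1.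
 exact: mulrl_continuous.
have hpr t : pr (c t) = mexp (t *: (a *: X)) by rewrite (pr_gam _ lX) scalerA mulrC.
rewrite -(dr_one_param (lieZ a lX) hv hc hpr).
apply: infinitesimal_eq => // e e0; have a1 : 0 < `|a| + 1 by rewrite ltr_wpDl.
have e1 : 0 < e / (`|a| + 1) by rewrite divr_gt0.
have /near0E[r r0 hr] := dr_ders lX hv e1.
apply/near0E; exists (r / (`|a| + 1)); first by rewrite divr_gt0.
move=> t; rewrite ltr_pdivlMr// => tr; rewrite scalerA -rmorphM /= [t * a]mulrC.
have at1 : `|a * t| <= `|t| * (`|a| + 1).
 by rewrite normrM mulrC ler_wpM2l// lerDl.
apply: le_trans (hr _ (le_lt_trans at1 tr)) _.
rewrite -mulrA ler_wpM2l ?(ltW e0)// mulrC ler_pdivrMr//.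
Qed.

Lemma drB X Y v : lie S X -> lie S Y -> sm v -> dr (X - Y) v = dr X v - dr Y v.
Proof.
move=> lX lY hv; have := drD (lieB GS lX lY) lY hv; rewrite subrK => ->.
by rewrite addrK.
Qed.

Lemma dr_sum (I : Type) (r : seq I) (F : I -> 'M[R]_n) v : (forall i, lie S (F i)) -> sm v ->
 dr (\sum_(i <- r) F i) v = \sum_(i <- r) dr (F i) v.
Proof.
move=> lF hv; elim: r => [|i r IH].
 have l0 : lie S 0 by exact: (lie0 GS).
 by rewrite !big_nil; have := drZ 0 l0 hv; rewrite !scale0r.
by rewrite !big_cons drD ?IH//; exact: (lie_sum GS).
Qed.

Lemma dr_basis X v : lie S X -> sm v -> dr X v = \sum_(b <- bs) (mdot X b)%:C *: dr b v.
Proof.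
move=> lX hv; pose F b := if b \in bs then mdot X b *: b else 0.
have e : X = \sum_(b <- bs) F b.
 by rewrite {1}(bs_span lX); apply: eq_big_seq => b; rewrite /F => ->.
have d0 : dr 0 v = 0.
 have l0 : lie S 0 by exact: (lie0 GS).
 by have := drZ 0 l0 hv; rewrite !scale0r.
rewrite {1}e dr_sum// => [|b]; last first.
 by rewrite /F; case: ifP => [/bs_in lb|_]; [exact: lieZ|exact: (lie0 GS)].
by apply: eq_big_seq => b bB; rewrite /F bB drZ//; exact: bs_in.
Qed.

Lemma dr_bound v : sm v -> exists2 C : R, 0 <= C & forall X, lie S X -> rn (dr X v) <= C * mnorm X.
Proof.
move=> hv; exists (\sum_(b <- bs) mnorm b * rn (dr b v)).
 by apply: sumr_ge0 => b _; rewrite mulr_ge0 ?mnorm_ge0 ?rn_ge0.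
move=> X lX; rewrite dr_basis//; apply: le_trans (rn_sum _ _ _) _.
rewrite mulr_suml; apply: ler_sum => b _; rewrite rnZ rn_real mulrAC ler_wpM2r ?rn_ge0//.
by rewrite mulrC mdot_le.
Qed.

(** g gam_X(t) g^-1 is a one-parameter subgroup with tangent Ad(pr g) X. *)
Lemma rep_dr g X v : lie S X -> sm v ->
 p g (dr X v) = dr (pr g *m X *m invmx (pr g)) (p g v).
Proof.
move=> lX hv; have Sg := cov_in CP g; have ug := lg_unit GS Sg.
have hc : one_parameter_subgroup (fun t => g * gam X t * g^-1)%g.
 split => [t|s t]; last by rewrite (gam_one lX).2 -!mulgA mulKg.
 apply: (@continuous_comp _ _ _ (fun t => g * gam X t)%g (fun h => h * g^-1)%g).
  apply: (@continuous_comp _ _ _ (gam X) (fun h => g * h)%g).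
   exact: (gam_one lX).1.
  exact: continuous_mulgl.
 exact: continuous_mulgr.
transitivity (infinitesimal p (fun t => g * gam X t * g^-1)%g (p g v)).
 by apply/esym/infinitesimal_eq => //; apply: (@ders_act _ _ _ p (gam X)); exact: dr_ders.
apply: dr_one_param => //.
- exact: (lie_conj GS).
- exact: smooth_act_vec.
- move=> t; rewrite !(covM CP) (covV CP) pr_gam//.
 rewrite (@mexp_conj _ _ (pr g) (t *: X) (t *: (pr g *m X *m invmx (pr g)))) ?mulmxK//.
 by rewrite -scalemxAl -scalemxAr mulmxKV.
Qed.

Lemma dr_skew X v w : lie S X -> sm v -> sm w -> inner (dr X v) w = - inner v (dr X w).
Proof. by move=> lX hv hw; apply: ders_adj (gam_one lX) _ _; exact: dr_ders. Qed.

End derived_rep.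

(** * Minimization in Hilbert spaces and Riesz representation *)

Section hilbert_minimization.
Variables (R : realType) (V : hilbertType R).

Definition dense_in (D : V -> Prop) := forall (y : V) (e : R), 0 < e -> exists2 z, D z & rn (y - z) < e.

Definition rcvg (u : nat -> V) w := forall e : R, 0 < e ->
 exists N, forall k, (N <= k)%N -> rn (u k - w) < e.

Lemma rcauchy_cvg (u : nat -> V) :
 (forall e : R, 0 < e -> exists N, forall k l, (N <= k)%N -> (N <= l)%N -> rn (u k - u l) < e) ->
 exists w, rcvg u w.
Proof.
move=> h; have : cauchy (u k @[k --> \oo]).
 apply/cauchy_exP => e e0; have := e0; rewrite ltcE /= => /andP[/eqP ei er].
 have [N hN] := h _ er; exists (u N); exists N => // k Nk.
 by rewrite /= -ball_normE /= rnE ltcE /= -ei eqxx hN.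
move=> /cauchy_cvgP/cvg_ex[w hw]; exists w => e e0.
have /cvg_rnP/(_ e e0)[N _ hN] := hw; exists N => k Nk.
by rewrite rn_distC; exact: hN.
Qed.

Lemma invS_small (e : R) : 0 < e -> exists N, forall k, (N <= k)%N -> (k.+1%:R : R)^-1 < e.
Proof.
move=> e0; exists (Num.truncn e^-1) => k Nk.
rewrite invf_plt ?posrE// ?ltr0n//.
have ei : 0 <= e^-1 by rewrite invr_ge0 ltW.
have /andP[_ h] := truncn_itv ei.
by apply: lt_le_trans h _; rewrite ler_nat.
Qed.

Lemma min_seq (T : Type) (D : set T) (J : T -> R) (b : R) : D !=set0 ->
 (forall x, D x -> b <= J x) ->
 exists m (x : nat -> T), (forall y, D y -> m <= J y) /\
  forall k, D (x k) /\ J (x k) <= m + (k.+1%:R)^-1.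
Proof.
move=> [x0 Dx0] hb; pose E := [set J x | x in D].
have hE : has_inf E by split; [exists (J x0), x0|exists b => _ [x Dx <-]; exact: hb].
have hx (k : nat) : exists x, D x /\ J x <= inf E + (k.+1%:R)^-1.
 have k0 : 0 < (k.+1%:R : R)^-1 by rewrite invr_gt0.
 by have [_ [x Dx <-] hx] := inf_adherent k0 hE; exists x; split => //; exact: ltW.
have [x {}hx] := choice hx; exists (inf E), x; split => // y Dy.
by apply: ge_inf; [exact: hE.2|exists y].
Qed.

(** The direct method: two values within 1/(k+1) and 1/(l+1) of the minimum leave a midpoint gap of
    at most the sum of these, which controls the distance of the images under phi. [T] is the space
    itself for Riesz and a type of weighted lists for the averages over K. *)
Lemma min_cvg (T : Type) (D : set T) (J : T -> R) (m : R) (x : nat -> T) (mid : T -> T -> T)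
  (phi : T -> V) (c : R) : (forall y, D y -> m <= J y) -> 0 <= c ->
 (forall k, D (x k) /\ J (x k) <= m + (k.+1%:R)^-1) ->
 (forall y z, D y -> D z -> D (mid y z)) ->
 (forall y z, D y -> D z -> rn (phi y - phi z) ^+ 2 <= c * (J y + J z - 2 * J (mid y z))) ->
 exists w, rcvg (fun k => phi (x k)) w.
Proof.
move=> hm c0 hx hD hphi; apply: rcauchy_cvg => e e0.
have c1 : 0 < c + 1 by rewrite ltr_wpDl.
have e1 : 0 < e ^+ 2 / (c + 1) / 2 by rewrite !divr_gt0// exprn_gt0.
have [N hN] := invS_small e1; exists N => k l Nk Nl.
rewrite -(@ltr_pXn2r _ 2) ?nnegrE ?rn_ge0 ?(ltW e0)//.
have [Dk hk] := hx k; have [Dl hl] := hx l.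
apply: (le_lt_trans (hphi _ _ Dk Dl)).
have hkl := hm _ (hD _ _ Dk Dl); have h1 := hN _ Nk; have h2 := hN _ Nl.
set j := J (x k) + J (x l) - 2 * J (mid (x k) (x l)).
have j1 : j < e ^+ 2 / (c + 1).
 move: h1 h2 hk hl; rewrite /j; set E := e ^+ 2 / _; set a := _^-1; set b := (l.+1%:R)^-1.
 by lra.
have [j0|j0] := ltP j 0.
 by apply: (@le_lt_trans _ _ 0); [rewrite mulr_ge0_le0// ltW|rewrite exprn_gt0].
apply: (@le_lt_trans _ _ ((c + 1) * j)); first by rewrite ler_wpM2r// lerDl.
by move: j1; rewrite ltr_pdivlMr// mulrC.
Qed.

(** The first order condition at a minimum: s = - d / (N + 1) makes the expression negative unless d
    = 0. *)
Lemma quadratic_ge0 (d N : R) : 0 <= N -> (forall s : R, 0 <= 2 * s * d + s ^+ 2 * N) -> d = 0.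
Proof.
move=> N0 h; have N1 : 0 < N + 1 by rewrite ltr_wpDl.
have := h (- d / (N + 1)).
have -> : 2 * (- d / (N + 1)) * d + (- d / (N + 1)) ^+ 2 * N = - (d ^+ 2 * (N + 2) / (N + 1) ^+ 2).
 by field; rewrite gt_eqF.
rewrite oppr_ge0 pmulr_lle0 ?invr_gt0 ?exprn_gt0// pmulr_lle0 ?ltr_wpDl// => h2.
by apply/eqP; rewrite -sqrf_eq0 eq_le h2 sqr_ge0.
Qed.

Lemma rcvg_inner (u : nat -> V) w z : rcvg u w -> forall e : R, 0 < e ->
 exists N, forall k, (N <= k)%N -> rn (inner (u k) z - inner w z) < e.
Proof.
move=> h e e0; have z1 : 0 < rn z + 1 by rewrite ltr_wpDl ?rn_ge0.
have e1 : 0 < e / (rn z + 1) by rewrite divr_gt0.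
have [N hN] := h _ e1; exists N => k /hN; rewrite ltr_pdivlMr// => hk.
rewrite -innerBl; apply: le_lt_trans (rn_inner_le _ _) _; apply: le_lt_trans hk.
by rewrite ler_wpM2l ?rn_ge0// lerDl.
Qed.

(** Minimizes |y|^2 - 2 Re l(y) over D, which need not be closed, so the representing vector is only
    found in the closure of D. The first order condition gives the real parts; the imaginary parts
    follow by replacing y by -i y. *)
Lemma riesz (D : V -> Prop) (l : V -> R[i]) (C : R) : D 0 ->
 (forall (a : R[i]) (x y : V), D x -> D y -> D (a *: x + y) /\ l (a *: x + y) = a * l x + l y) ->
 (forall x : V, D x -> rn (l x) <= C * rn x) ->
 exists w, (forall e : R, 0 < e -> exists2 z, D z & rn (w - z) < e) /\ forall y, D y -> l y = inner y w.
Proof.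
move=> D0 lD lC.
have l0 : l 0 = 0.
 by have [_] := lD (-1) 0 0 D0 D0; rewrite scaler0 addr0 mulN1r addNr.
have lZ a x : D x -> D (a *: x) /\ l (a *: x) = a * l x.
 by move=> Dx; have := lD a x 0 Dx D0; rewrite !addr0 l0 addr0.
have lA x y : D x -> D y -> D (x + y) /\ l (x + y) = l x + l y.
 by move=> Dx Dy; have := lD 1 x y Dx Dy; rewrite scale1r mul1r.
pose J y := rn y ^+ 2 - 2 * Re (l y).
have Jlow y : D y -> - C ^+ 2 <= J y.
 move=> Dy; have h : Re (l y) <= C * rn y by apply: le_trans (Re_le_rn _) (lC _ Dy).
 have := sqr_ge0 (rn y - C); rewrite /J; nra.
have [m [x [hm hx]]] := @min_seq V D J (- C ^+ 2) (ex_intro _ 0 D0) Jlow.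
pose mid y z : V := (2^-1)%:C *: (y + z).
have Dmid y z : D y -> D z -> D (mid y z).
 by move=> Dy Dz; apply: (lZ _ _ _).1; apply: (lA _ _ _ _).1.
have re_r (r : R) (a : R[i]) : Re (r%:C * a) = r * Re a.
 by case: a => a b /=; rewrite mul0r subr0.
have hmid y z : D y -> D z -> rn (y - z) ^+ 2 <= 2 * (J y + J z - 2 * J (mid y z)).
 move=> Dy Dz; rewrite /J /mid (lZ _ _ (lA _ _ Dy Dz).1).2 (lA _ _ Dy Dz).2.
 rewrite rnZ rn_real re_r !raddfD /= ger0_norm ?invr_ge0// exprMn.
 have := parallelogram y z; lra.
have [w hw] := min_cvg hm (ler0n R 2) hx Dmid hmid.
exists w; split => [e e0|y Dy].
 have [N hN] := hw e e0; exists (x N); first by case: (hx N).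
 by rewrite rn_distC hN.
have key z : D z -> Re (inner w z) = Re (l z).
 move=> Dz; apply/eqP; rewrite -subr_eq0; apply/eqP.
 apply: (@quadratic_ge0 _ (rn z ^+ 2)); first exact: sqr_ge0.
 move=> s; apply/ler_addgt0Pr => e e0.
 have s1 : 0 < 2 * `|s| + 1 by rewrite ltr_wpDl// mulr_ge0.
 have e2 : 0 < e / 2 by rewrite divr_gt0.
 have e3 : 0 < e / 2 / (2 * `|s| + 1) by rewrite divr_gt0.
 have [N1 h1] := invS_small e2; have [N2 h2] := rcvg_inner z hw e3.
 pose k := (N1 + N2)%N; have {h1} h1 := h1 k (leq_addr _ _).
 have {h2} h2 := h2 k (leq_addl _ _); have [Dk hk] := hx k.
 have [D1 E1] := lZ s%:C z Dz; have [D2 E2] := lA _ _ Dk D1.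
 have := hm _ D2; rewrite /J E2 E1 rn_sqrD rnZ rn_real innerZr_real re_r !raddfD /= re_r.
 rewrite exprMn real_normK ?num_real// => h3.
 have h4 : `|Re (inner (x k) z) - Re (inner w z)| * (2 * `|s|) <= e / 2.
  have h5 := le_lt_trans (absRe_le_rn _) h2; rewrite raddfB /= in h5.
  move: h5; rewrite ltr_pdivlMr// => /ltW; apply: le_trans.
  by rewrite ler_wpM2l// lerDl.
 have h6 : 2 * s * (Re (inner (x k) z) - Re (inner w z)) <= e / 2.
  by apply: le_trans h4; apply: le_trans (ler_norm _) _; rewrite !normrM mulrC normr_nat.
 move: hk h1; rewrite /J; set a := (k.+1%:R)^-1; lra.
have e1 : Re (l y) = Re (inner y w) by rewrite Re_innerC key.
have [Dy2 E2] := lZ (0 +i* (-1)) y Dy.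
have e2 := key _ Dy2; rewrite Re_innerC E2 innerZl in e2.
move: e1 e2; case: (l y) (inner y w) => a b [a' b'] /= -> h.
by congr (_ +i* _); lra.
Qed.

(** Riesz applied to the functional <., x> gives w in the closure of D with x - w orthogonal to D,
    hence x = w. *)
Lemma dense_of_orth (D : V -> Prop) : D 0 ->
 (forall (a : R[i]) (x y : V), D x -> D y -> D (a *: x + y)) ->
 (forall v, (forall u, D u -> inner u v = 0) -> v = 0) -> dense_in D.
Proof.
move=> D0 hD h x; have [|||w [aw hw]] := @riesz D (fun y => inner y x) (rn x) => //.
- by move=> a y z Dy Dz; split; [exact: hD|rewrite innerDl innerZl].
- by move=> y Dy; rewrite mulrC rn_inner_le.
suff -> : x = w by [].
apply/eqP; rewrite -subr_eq0; apply/eqP/h => u Du.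
by rewrite innerBr hw// subrr.
Qed.

Lemma dense_rn_le (D : V -> Prop) u (c : R) : dense_in D -> 0 <= c ->
 (forall y, D y -> Re (inner u y) <= c * rn y) -> rn u <= c.
Proof.
move=> dD c0 h; have [->|u0] := eqVneq u 0; first by rewrite rn0.
have hu : 0 < rn u by rewrite rn_gt0.
rewrite -(ler_pM2l hu); apply/ler_addgt0Pr => e e0.
have c1 : 0 < c + rn u + 1 by rewrite ltr_wpDl// addr_ge0// ltW.
have e1 : 0 < e / (c + rn u + 1) by rewrite divr_gt0.
have [z Dz hz] := dD u _ e1.
have h1 : rn u ^+ 2 <= Re (inner u z) + rn u * rn (u - z).
 rewrite -Re_inner_rn -{2}[u](subrK z) innerDr raddfD /= addrC lerD2l.
 exact: Re_inner_le.
have h2 : rn z <= rn u + rn (u - z).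
 by rewrite -{1}[z](subKr u); exact: rnB.
have h3 := h z Dz; rewrite ltr_pdivlMr// in hz.
have r0 := rn_ge0 (u - z).
have h4 : c * rn z <= c * (rn u + rn (u - z)) by rewrite ler_wpM2l.
rewrite -expr2; nra.
Qed.

End hilbert_minimization.

Section real_mean_value.
Variable R : realType.

Lemma littleo_is_derive (f : R -> R) (x d : R) :
 (forall e : R, 0 < e -> \forall t \near (0 : R), `|f (x + t) - f x - t * d| <= e * `|t|) ->
 is_derive x 1 f d.
Proof.
move=> h; have hc : h^-1 *: (f (h *: 1 + x) - f x) @[h --> 0^'] --> d.
 apply/cvgrPdist_lt => e e0; have e2 : 0 < e / 2 by rewrite divr_gt0.
 have hh : \forall t \near (0 : R), t != 0 -> `|d - t^-1 *: (f (t *: 1 + x) - f x)| < e.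
  apply: filterS (h _ e2) => t ht t0; rewrite /GRing.scale /= mulr1 (addrC t x).
  have -> : d - t^-1 * (f (x + t) - f x) = - (t^-1 * (f (x + t) - f x - t * d)) by field.
  rewrite normrN normrM normfV mulrC ltr_pdivrMr ?normr_gt0//.
  apply: le_lt_trans ht _; rewrite ltr_pM2r ?normr_gt0//.
  by rewrite half_lt.
 exact: hh.
by split; [apply/cvg_ex; exists d|apply: cvg_lim].
Qed.

Lemma mean_value_le (f df : R -> R) (t c : R) :
 (forall s : R, `|s| <= `|t| -> is_derive s 1 f (df s) /\ `|df s| <= c) ->
 `|f t - f 0| <= c * `|t|.
Proof.
move=> h.
have cont (a b : R) : (forall s : R, a <= s <= b -> `|s| <= `|t|) -> {within `[a, b], continuous f}.
 move=> hab; apply: derivable_within_continuous => s; rewrite in_itv /= => /hab /h[hs _].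
 by have [] := hs.
have der (a b : R) : (forall s : R, a <= s <= b -> `|s| <= `|t|) ->
  forall s, s \in `]a, b[ -> is_derive s 1 f (df s).
 by move=> hab s; rewrite in_itv /= => /andP[/ltW h1 /ltW h2]; apply: (h s _).1; apply: hab; rewrite h1.
have [t0|t0] := leP 0 t.
 have hab s : 0 <= s <= t -> `|s| <= `|t| by move=> /andP[h1 h2]; rewrite !ger0_norm.
 have [s /= sI ->] := MVT_segment t0 (der _ _ hab) (cont _ _ hab).
 rewrite subr0 normrM ler_wpM2r//; apply: (h s _).2; apply: hab; by move: sI; rewrite in_itv.
have hab s : t <= s <= 0 -> `|s| <= `|t|.
 by move=> /andP[h1 h2]; rewrite !ler0_norm ?lerN2// ltW.
have [s /= sI e] := MVT_segment (ltW t0) (der _ _ hab) (cont _ _ hab).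
rewrite distrC e sub0r normrM normrN ler_wpM2r//; apply: (h s _).2; apply: hab.
by move: sI; rewrite in_itv.
Qed.

End real_mean_value.

(** * Commutators and weak smoothness when smooth vectors are dense *)

Section dense_smooth.
Variables (R : realType) (n : nat) (G : topGroupType).
Variables (S : set 'M[R]_n) (pr : G -> 'M[R]_n) (gam : 'M[R]_n -> R -> G).
Hypotheses (CP : covering S pr) (hgam : lifting S pr gam).
Variables (V : hilbertType R) (p : unitary_rep G V).
Implicit Types (g h : G) (v w : V) (c : R -> G) (X Y Z : 'M[R]_n).
Let GS : linear_group S := cov_group CP.
Notation sm := (smooth_vector p).
Variable bs : seq 'M[R]_n.
Hypotheses (bs_orth : morthonormal bs) (bs_in : forall b, b \in bs -> lie S b)
 (bs_span : forall X, lie S X -> X = \sum_(b <- bs) mdot X b *: b).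
Hypothesis sm_dense : dense_in (smooth_vector p).
Notation dr := (dr gam p).

Let dr_smooth := dr_smooth hgam (p := p).
Let dr_skew := dr_skew hgam (p := p).

Lemma smooth_inner_eq v w : (forall y, sm y -> inner v y = inner w y) -> v = w.
Proof.
move=> h; apply/eqP; rewrite -subr_eq0; apply/eqP/(dense_inner_eq0 sm_dense).
by move=> z hz; rewrite innerBl h// subrr.
Qed.

(** With Yt = Ad(e^(tX)) Y one has p(gam_X(t)) dr Y v = dr Yt (p(gam_X(t)) v), and skew-adjointness
    of dr Yt pairs this with a smooth w. The terms of first order in t of the resulting identity are
    the claim paired with w, and density removes w. *)
Lemma dr_bracket X Y v : lie S X -> lie S Y -> sm v ->
 dr (X *m Y - Y *m X) v = dr X (dr Y v) - dr Y (dr X v).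
Proof.
move=> lX lY hv; set B := X *m Y - Y *m X.
have lB : lie S B by exact: (lie_bracket GS).
apply: smooth_inner_eq => w hw.
have sYv := dr_smooth lY hv; have sXv := dr_smooth lX hv; have sYw := dr_smooth lY hw.
have sBw := dr_smooth lB hw.
rewrite innerBl (dr_skew lB hv hw) (dr_skew lY sXv hw) opprK.
apply/esym/eqP; rewrite -subr_eq0 opprK; apply/eqP.
set s := inner (dr X (dr Y v)) w + inner (dr X v) (dr Y w) + inner v (dr B w).
apply: rn_le0; apply/ler_addgt0Pr => e e0; rewrite add0r.
have [Cw Cw0 hCw] := dr_bound CP hgam bs_orth bs_in bs_span hw.
have [C C0 hC] := mexp_conj_est X Y.
(* [K] collects the factors of the two o(t) errors d1 and d2; [L] below collects the terms of second
   order in t. *)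
pose K := rn w + rn (dr Y w) + rn (dr B w) + Cw * C + 1.
have K0 : 0 < K by rewrite ltr_wpDl// !addr_ge0 ?rn_ge0// mulr_ge0.
have e1 : 0 < e / 2 / K by rewrite !divr_gt0.
have e2 : 0 < e / 2 by rewrite divr_gt0.
pose L := rn v * (Cw * C) + rn (dr X v) * (rn (dr B w) + Cw * C).
have [r1 r10 hr1] := (near0E _).1 (dr_ders hgam lX sYv e1).
have [r2 r20 hr2] := (near0E _).1 (dr_ders hgam lX hv e1).
have [r3 r30 hr3] := (near0E _).1 (near0_sqr L e2).
pose t := Num.min r1 (Num.min r2 r3) / 2.
have m0 : 0 < Num.min r1 (Num.min r2 r3) by rewrite !lt_min r10 r20.
have t0 : 0 < t by rewrite divr_gt0.
have : t < Num.min r1 (Num.min r2 r3) by rewrite half_lt.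
rewrite !lt_min => /and3P[tr1 tr2 tr3].
have nt : `|t| = t by rewrite gtr0_norm.
clearbody t.
have := hr1 t; rewrite nt => /(_ tr1); set d1 := p _ _ - _ - _ => h1.
have := hr2 t; rewrite nt => /(_ tr2); set d2 := p _ _ - _ - _ => h2.
have := hr3 t; rewrite nt => /(_ tr3)[t1 h3].
pose Yt := mexp (t *: X) *m Y *m mexp ((- t) *: X).
have lYt : lie S Yt by rewrite /Yt -invmx_mexp; apply: (lie_conj GS) => //; exact: lX.
pose d3 := dr Yt w - dr Y w - t%:C *: dr B w.
have n3 : rn d3 <= Cw * (C * t ^+ 2).
 have -> : d3 = dr (Yt - Y - t *: B) w.
  have lYtY : lie S (Yt - Y) by exact: (lieB GS).
  have ltB : lie S (t *: B) by exact: lieZ.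
  rewrite (drB CP hgam bs_orth bs_in bs_span lYtY ltB hw).
  by rewrite (drB CP hgam bs_orth bs_in bs_span lYt lY hw) (drZ CP hgam bs_orth bs_in bs_span).
 apply: le_trans (hCw _ _) _.
  by apply: (lieB GS); [exact: (lieB GS)|exact: lieZ].
 by rewrite ler_wpM2l//; have := hC t; rewrite nt; apply.
have key : inner (p (gam X t) (dr Y v)) w + inner (p (gam X t) v) (dr Yt w) = 0.
 rewrite (rep_dr CP hgam bs_orth bs_in bs_span)// (pr_gam hgam)// invmx_mexp -/Yt.
 by rewrite (dr_skew lYt)//; [rewrite addNr|exact: smooth_act_vec].
have E1 : p (gam X t) (dr Y v) = dr Y v + t%:C *: dr X (dr Y v) + d1 by rewrite /d1; lmod R V.
have E2 : p (gam X t) v = v + t%:C *: dr X v + d2 by rewrite /d2; lmod R V.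
have E3 : dr Yt w = dr Y w + t%:C *: dr B w + d3 by rewrite /d3; lmod R V.
have E4 : t%:C * s = - (inner d1 w + inner v d3 + inner (t%:C *: dr X v) (t%:C *: dr B w + d3) +
  inner d2 (dr Y w + t%:C *: dr B w + d3)).
 move: key; rewrite E1 E2 E3 /s !innerDl !innerDr !innerZl_real !innerZr_real (dr_skew lY hv hw).
 by move=> /eqP; rewrite -subr_eq0 => /eqP h; apply/eqP; rewrite -subr_eq0 -h; apply/eqP; ring.
have hs : t * rn s <= rn d1 * rn w + rn v * rn d3 + t * rn (dr X v) * (t * rn (dr B w) + rn d3) +
  rn d2 * (rn (dr Y w) + t * rn (dr B w) + rn d3).
 rewrite -{1}nt -rn_real -rnM E4 rnN; apply: le_trans (rnD _ _) _.
 rewrite lerD//; last first.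
  apply: le_trans (rn_inner_le _ _) _; rewrite ler_wpM2l ?rn_ge0//.
  apply: le_trans (rnD _ _) _; rewrite lerD2r; apply: le_trans (rnD _ _) _.
  by rewrite lerD2l rnZ rn_real nt.
 apply: le_trans (rnD _ _) _; rewrite lerD//; last first.
  apply: le_trans (rn_inner_le _ _) _; rewrite rnZ rn_real nt ler_wpM2l ?mulr_ge0 ?rn_ge0 ?(ltW t0)//.
  by apply: le_trans (rnD _ _) _; rewrite lerD2r rnZ rn_real nt.
 by apply: le_trans (rnD _ _) _; rewrite lerD ?rn_inner_le.
have n3' : rn d3 <= Cw * C * t.
 by apply: (le_trans n3); rewrite -mulrA ler_wpM2l// ler_wpM2l// expr2 ler_piMl// (ltW t0).
have n3'' : rn d3 <= Cw * C.
 by apply: (le_trans n3'); rewrite ler_piMr// mulr_ge0.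
have b1 : rn d1 * rn w <= e / 2 / K * t * rn w by rewrite ler_wpM2r ?rn_ge0.
have b2 : rn v * rn d3 <= rn v * (Cw * C) * t ^+ 2.
 by apply: (le_trans (ler_wpM2l (rn_ge0 _) n3)); rewrite !mulrA.
have b3 : t * rn (dr X v) * (t * rn (dr B w) + rn d3) <= rn (dr X v) * (rn (dr B w) + Cw * C) * t ^+ 2.
 have -> : rn (dr X v) * (rn (dr B w) + Cw * C) * t ^+ 2 = t * rn (dr X v) * (t * rn (dr B w) + Cw * C * t).
  by ring.
 by rewrite ler_wpM2l ?mulr_ge0 ?rn_ge0 ?(ltW t0)// lerD2l.
have b4 : rn d2 * (rn (dr Y w) + t * rn (dr B w) + rn d3) <=
  e / 2 / K * t * (rn (dr Y w) + rn (dr B w) + Cw * C).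
 rewrite ler_pM ?rn_ge0 ?addr_ge0 ?mulr_ge0 ?rn_ge0 ?(ltW t0)// lerD// lerD2l.
 by rewrite ler_piMl ?rn_ge0.
have b5 : e / 2 / K * t * (rn w + rn (dr Y w) + rn (dr B w) + Cw * C) <= e / 2 * t.
 rewrite mulrAC ler_wpM2r ?(ltW t0)// mulrAC -mulrA ler_piMr ?(ltW e2)//.
 by rewrite ler_pdivrMr// mul1r /K lerDl.
rewrite -(ler_pM2l t0); apply: (le_trans hs).
have b6 : L * t ^+ 2 = rn v * (Cw * C) * t ^+ 2 + rn (dr X v) * (rn (dr B w) + Cw * C) * t ^+ 2.
 by rewrite /L mulrDl.
have b7 : e / 2 / K * t * (rn w + rn (dr Y w) + rn (dr B w) + Cw * C) =
 e / 2 / K * t * rn w + e / 2 / K * t * (rn (dr Y w) + rn (dr B w) + Cw * C) by ring.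
move: h3 b1 b2 b3 b4 b5 b6 b7; clear; lra.
Qed.

Definition word (l : seq 'M[R]_n) v := foldr dr v l.

Definition lwords (l : seq 'M[R]_n) := forall X, X \in l -> lie S X.

Lemma lwords_cons X l : lie S X -> lwords l -> lwords (X :: l).
Proof. by move=> lX hl Y; rewrite inE => /orP[/eqP->//|/hl]. Qed.

Lemma lwords1 X : lie S X -> lwords [:: X].
Proof. by move=> lX Y; rewrite inE => /eqP->. Qed.

Lemma lwords_head X l : lwords (X :: l) -> lie S X.
Proof. by apply; exact: mem_head. Qed.

Lemma lwords_tail X l : lwords (X :: l) -> lwords l.
Proof. by move=> h Y Yl; apply: h; rewrite inE Yl orbT. Qed.

Lemma word_smooth l v : lwords l -> sm v -> sm (word l v).
Proof.
by elim: l => //= X l IH hl hv; apply: dr_smooth; [exact: lwords_head hl|exact: IH (lwords_tail hl) hv].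
Qed.

Lemma conj_lie g X : lie S X -> lie S (pr g *m X *m invmx (pr g)).
Proof. by move=> lX; apply: (lie_conj GS) => //; exact: (cov_in CP). Qed.

Lemma word_act g l w : lwords l -> sm w ->
 p g (word l w) = word [seq pr g *m X *m invmx (pr g) | X <- l] (p g w).
Proof.
move=> hl hw; elim: l hl => //= X l IH hl; rewrite -IH; last exact: lwords_tail hl.
apply: (rep_dr CP hgam bs_orth bs_in bs_span); first exact: lwords_head hl.
by apply: word_smooth => //; exact: lwords_tail hl.
Qed.

(* [v] is in the domain of the adjoint of every differential operator of the
  enveloping algebra. *)
Definition weakly_smooth v := forall l, (forall X, X \in l -> lie S X) ->
 exists C : R, forall y, sm y -> rn (inner v (word l y)) <= C * rn y.

(** Riesz yields a weak derivative w of v along X, which is weakly smooth again. It is a strong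
    derivative: s |-> Re <p(gam_X(s)) v - v - s w, y> has derivative Re <p(gam_X(s)) w - w, y>, at
    most e |y| for small s, and the mean value inequality is uniform in y. *)
Lemma weakly_smooth_smooth v : weakly_smooth v -> sm v.
Proof.
apply: (C1_lie_coind CP hgam bs_orth bs_in bs_span) => {}v X hv lX.
have [|C hC] := hv [:: X]; first by move=> Y; rewrite inE => /eqP ->.
have [||w [_ hw]] := @riesz R V sm (fun y => inner (- dr X y) v) C (smooth0 p).
- move=> a x y hx hy; split; first exact: smooth_lin.
 by rewrite (dr_lin hgam)// !innerNl innerDl innerZl opprD mulrN.
- move=> y hy; rewrite innerNl rnN innerC rn_conj; exact: hC.
have {}hw y : sm y -> inner w y = - inner v (dr X y).
 by move=> hy; rewrite innerC -hw// innerNl rmorphN /= -innerC.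
exists w.
 move=> l hl; have [|C' hC'] := hv (X :: l).
  by move=> Y; rewrite inE => /orP[/eqP->//|/hl].
 by exists C' => y hy; rewrite hw ?rnN; [exact: hC'|exact: word_smooth].
have hg := gam_one hgam lX.
move=> e e0; have /near0E[r r0 hr] : \forall t \near (0 : R), rn (p (gam X t) w - w) <= e.
 have /cvg_rnP h : p g w @[g --> (1%g : G)] --> p 1%g w by exact: rep_continuous.
 have h2 : \forall g \near (1%g : G), rn (p g w - w) <= e.
  by apply: filterS (h e e0) => g; rewrite rep1 rn_distC => /ltW.
 exact: (one_param_cvg1 hg h2).
apply/near0E; exists r => // t tr.
apply: (dense_rn_le sm_dense); first by rewrite mulr_ge0// ltW.
move=> y hy; pose f s := Re (inner (p (gam X s) v - v - s%:C *: w) y).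
have re_r (a : R) (z : R[i]) : Re (a%:C * z) = a * Re z.
 by case: z => z1 z2 /=; rewrite mul0r subr0.
have fE s : f s = Re (inner v (p (gam X (- s)) y)) - Re (inner v y)
  - s * Re (inner w y).
 by rewrite /f !innerBl inner_repl -one_paramN// innerZl_real !raddfB /= re_r.
have -> : Re (inner (p (gam X t) v - v - t%:C *: w) y) = f t - f 0.
 have f0 : f 0 = 0 by rewrite fE oppr0 (one_param1 hg) rep1 mul0r subrr subr0.
 by rewrite f0 subr0.
rewrite mulrAC; apply: le_trans (ler_norm _) _.
apply: (@mean_value_le R f (fun s => Re (inner (p (gam X s) w - w) y))) => s st.
split; last first.
 apply: le_trans (absRe_inner_le _ _) _.
 by rewrite ler_wpM2r ?rn_ge0// hr// (le_lt_trans st).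
apply: littleo_is_derive => e1 e10.
pose ys := p (gam X (- s)) y; have hys : sm ys by exact: smooth_act_vec.
have v1 : 0 < rn v + 1 by rewrite ltr_wpDl ?rn_ge0.
have e2 : 0 < e1 / (rn v + 1) by rewrite divr_gt0.
have /near0E[r1 r10 hr1] := dr_ders hgam lX hys e2.
apply/near0E; exists r1 => // u ur; rewrite -normrN in ur.
have := hr1 _ ur; set d := p _ _ - _ - _ => hd.
have e3 : p (gam X (- (s + u))) y = ys - u%:C *: dr X ys + d.
 have -> : - (s + u) = - u + - s by rewrite opprD addrC.
 have nu : (- u)%:C = - u%:C :> R[i] by exact: (rmorphN (real_complex R)).
 by rewrite hg.2 repM -/ys /d nu; set a := p _ ys; lmod R V.
have -> : f (s + u) - f s - u * Re (inner (p (gam X s) w - w) y) =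
  Re (inner v d).
 rewrite !fE e3 innerBl inner_repl -one_paramN// -/ys (hw _ hys).
 rewrite !innerDr innerNr innerZr_real !(raddfD, raddfB, raddfN) /= re_r.
 ring.
apply: le_trans (absRe_inner_le _ _) _.
apply: (@le_trans _ _ ((rn v + 1) * (e1 / (rn v + 1) * `|u|))).
 by rewrite ler_pM ?rn_ge0 ?lerDl// -[X in _ <= _ * X]normrN.
by rewrite mulrA mulrCA mulfV ?mulr1// gt_eqF.
Qed.

(** Induction from the innermost letter, which is expanded in the basis. One constant serves all
    words of length m, so the bound survives conjugation of the letters by K. *)
Lemma word_bound v m : sm v -> exists2 C : R, 0 <= C & forall l, size l = m ->
 (forall X, X \in l -> lie S X) -> rn (word l v) <= C * \prod_(X <- l) mnorm X.
Proof.
elim: m v => [|m IH] v hv.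
 exists (rn v); first exact: rn_ge0.
 by move=> [|//] _ _; rewrite big_nil mulr1.
have h (b : 'M[R]_n) : exists C : R, 0 <= C /\ (b \in bs -> forall l, size l = m ->
  (forall X, X \in l -> lie S X) -> rn (word l (dr b v)) <= C * \prod_(X <- l) mnorm X).
 have [bB|nb] := boolP (b \in bs); last by exists 0.
 by have [C C0 hC] := IH (dr b v) (dr_smooth (bs_in bB) hv); exists C.
have [f hf] := choice h.
exists (\sum_(b <- bs) mnorm b * f b).
 by apply: sumr_ge0 => b _; rewrite mulr_ge0 ?mnorm_ge0//; case: (hf b).
case/lastP => // l X; rewrite size_rcons => -[sl] hl.
have lX : lie S X by apply: hl; rewrite mem_rcons mem_head.
have hl' Y : Y \in l -> lie S Y by move=> Yl; apply: hl; rewrite mem_rcons inE Yl orbT.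
have w_lin (a b : seq 'M[R]_n) (F : 'M[R]_n -> R[i]) : (forall Y, Y \in a -> lie S Y) ->
  (forall Y, Y \in b -> lie S Y) ->
  word a (\sum_(x <- b) F x *: dr x v) = \sum_(x <- b) F x *: word a (dr x v).
 move=> ha hb; elim: a ha => //= Y a IHa ha; rewrite IHa => [|Z Za]; last by apply: ha; rewrite inE Za orbT.
 have lY : lie S Y by apply: ha; exact: mem_head.
 have ha' Z : Z \in a -> lie S Z by move=> Za; apply: ha; rewrite inE Za orbT.
 pose F' (x : 'M[R]_n) : V := if x \in b then F x *: word a (dr x v) else 0.
 have sF (x : 'M[R]_n) : sm (F' x).
  rewrite /F'; case: ifP => [/hb lc|_]; last exact: smooth0.
  by apply: smoothZ; apply: word_smooth => //; exact: dr_smooth.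
 have -> : \sum_(x <- b) F x *: word a (dr x v) = \sum_(x <- b) F' x.
  by apply: eq_big_seq => x cb; rewrite /F' cb.
 rewrite (drv_sum hgam)//; apply: eq_big_seq => x cb; rewrite /F' cb.
 by rewrite (drvZ hgam)//; apply: word_smooth => //; apply: dr_smooth => //; exact: hb.
rewrite /word -cats1 foldr_cat /= -/(word _ _) (dr_basis CP hgam bs_orth bs_in bs_span lX hv).
rewrite w_lin//; apply: le_trans (rn_sum _ _ _) _.
rewrite big_cat big_seq1 /= mulr_suml; apply: ler_sum_seq => b bB.
rewrite rnZ rn_real.
have [f0 hfb] := hf b; have := hfb bB l sl hl' => h1.
have P0 : 0 <= \prod_(Y <- l) mnorm Y by apply: prodr_ge0 => Y _; exact: mnorm_ge0.
apply: (@le_trans _ _ ((mnorm X * mnorm b) * (f b * \prod_(Y <- l) mnorm Y))).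
 by rewrite ler_pM ?rn_ge0// mdot_le.
by apply: eq_ler; ring.
Qed.

End dense_smooth.

(** * Schur's lemma for symmetric operators, bounded and unbounded *)

Section schur.
Variables (R : realType) (G : topGroupType) (V : hilbertType R) (p : unitary_rep G V).
Hypothesis hp : irreducible_rep p.

Lemma re_im_eq (a b : R[i]) : Re a = Re b ->
 Re ((0 +i* (-1)) * a) = Re ((0 +i* (-1)) * b) -> a = b.
Proof. by case: a b => [a1 a2] [b1 b2] /= -> h; congr (_ +i* _); lra. Qed.

Lemma Re_realM (r : R) (a : R[i]) : Re (r%:C * a) = r * Re a.
Proof. by case: a => a b /=; rewrite mul0r subr0. Qed.

Definition adherent (D : V -> Prop) : set V :=
 [set v | forall e : R, 0 < e -> exists2 z, D z & rn (v - z) < e].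

Lemma adherent_sub (D : V -> Prop) v : D v -> adherent D v.
Proof. by move=> Dv e e0; exists v => //; rewrite subrr rn0. Qed.

Lemma adherent_idem (D : V -> Prop) v : adherent (adherent D) v -> adherent D v.
Proof.
move=> h e e0; have e2 : 0 < e / 2 by rewrite divr_gt0.
have [w hw vw] := h _ e2; have [z Dz wz] := hw _ e2; exists z => //.
by apply: le_lt_trans (rn_dist_triangle w _ _) _; lra.
Qed.

Lemma closed_adherent (D : V -> Prop) : closed (adherent D).
Proof.
move=> v cv; apply: adherent_idem => e e0.
have : nbhs v [set w | rn (v - w) < e].
 have /cvg_rnP/(_ e e0) : w @[w --> v] --> v by exact: cvg_id.
 exact.
by move=> /cv[w [hw vw]]; exists w.
Qed.

Lemma adherent_lin (D : V -> Prop) : (forall (a : R[i]) v w, D v -> D w -> D (a *: v + w)) ->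
 forall (a : R[i]) v w, adherent D v -> adherent D w -> adherent D (a *: v + w).
Proof.
move=> hD a v w hv hw e e0; have a1 : 0 < rn a + 1 by rewrite ltr_wpDl ?rn_ge0.
have e2 : 0 < e / 2 by rewrite divr_gt0.
have e1 : 0 < e / 2 / (rn a + 1) by rewrite divr_gt0.
have [v' Dv' hv'] := hv _ e1; have [w' Dw' hw'] := hw _ e2.
exists (a *: v' + w'); first exact: hD.
have -> : a *: v + w - (a *: v' + w') = a *: (v - v') + (w - w') by lmod R V.
apply: le_lt_trans (rnD _ _) _; rewrite rnZ; move: hv'; rewrite ltr_pdivlMr// => hv'.
have : rn a * rn (v - v') <= rn (v - v') * (rn a + 1).
 by rewrite mulrC ler_wpM2l ?rn_ge0// lerDl.
lra.
Qed.

(** The closure of D is an invariant closed subspace. It is enough that the group maps D into this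
    closure. *)
Lemma irreducible_adherent (D : V -> Prop) :
 (forall (a : R[i]) v w, D v -> D w -> D (a *: v + w)) ->
 (forall g v, D v -> adherent D (p g v)) -> (exists2 v, D v & v != 0) -> dense_in D.
Proof.
move=> hl hi [v0 Dv0 v00]; have [_ H] := hp.
have D0 : D 0 by have := hl (-1) v0 v0 Dv0 Dv0; rewrite scaleN1r addNr.
have [|||h|h] := H (adherent D) (@closed_adherent D).
- exact: adherent_sub.
- exact: adherent_lin.
- move=> g v hv; apply: adherent_idem => e e0; have [z Dz vz] := hv _ e0.
 by exists (p g z); [exact: hi|rewrite -repB rep_rn].
- have : adherent D v0 by exact: adherent_sub.
 by rewrite h /= => e; rewrite e eqxx in v00.
- by move=> y e e0; have hy : adherent D y; [rewrite h|exact: hy].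
Qed.

Record bounded_sym (N : V -> V) (c : R) : Prop := BoundedSym {
 bs_lin : forall (a : R[i]) x y, N (a *: x + y) = a *: N x + N y;
 bs_bound : forall x, rn (N x) <= c * rn x;
 bs_sym : forall x y, inner (N x) y = inner x (N y);
 bs_act : forall g x, N (p g x) = p g (N x);
}.

Lemma bs_D N c x y : bounded_sym N c -> N (x + y) = N x + N y.
Proof. by move=> h; have := bs_lin h 1 x y; rewrite !scale1r. Qed.
Lemma bs_B N c x y : bounded_sym N c -> N (x - y) = N x - N y.
Proof. by move=> h; have := bs_lin h (-1) y x; rewrite !scaleN1r addrC (addrC (- N y)). Qed.
Lemma bs_0 N c : bounded_sym N c -> N 0 = 0.
Proof. by move=> h; have := bs_B 0 0 h; rewrite !subrr. Qed.
Lemma bs_Z N c a x : bounded_sym N c -> N (a *: x) = a *: N x.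
Proof. by move=> h; have := bs_lin h a x 0; rewrite (bs_0 h) !addr0. Qed.

(** If N' is not 0 its range is invariant, hence dense, and <N x, N' y> = <x, N N' y> = 0. *)
Lemma bs_dichotomy N c N' c' : bounded_sym N c -> bounded_sym N' c' ->
 (forall x, N (N' x) = 0) -> (forall x, N x = 0) \/ (forall x, N' x = 0).
Proof.
move=> h h' NN'; have [|ne] := pselect (forall x, N' x = 0); first by right.
left; have [x0 hx0] : exists x, N' x != 0.
 apply: contrapT => ne'; apply: ne => x; apply: contrapT => hx.
 by apply: ne'; exists x; apply/eqP.
have dD : dense_in (fun y => exists x, y = N' x).
 apply: irreducible_adherent; last by exists (N' x0) => //; exists x0.
  by move=> a _ _ [x ->] [y ->]; exists (a *: x + y); rewrite (bs_lin h').
 by move=> g _ [x ->]; apply: adherent_sub; exists (p g x); rewrite (bs_act h').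
move=> x; apply: (dense_inner_eq0 dD) => _ [y ->].
by rewrite (bs_sym h) NN' inner0r.
Qed.

Section square_root.
Variable N : V -> V.
Hypothesis hN : bounded_sym N 1.
Let A x := x - N (N x).
(** Iteration for 1 - |N|: with A = 1 - N^2, the fixed point equation B = (A + B^2) / 2 says (1 -
    B)^2 = N^2. The scalar sequence [b] obeys the same recursion with A replaced by its norm bound
    1, and majorizes B and its increments. *)
Let B n : V -> V := iter n (fun F x => (2^-1)%:C *: (A x + F (F x))) (fun=> 0).
Let b n : R := iter n (fun z => 2^-1 * (1 + z ^+ 2)) 0.

Lemma sqrt_A_bound x : rn (A x) <= rn x.
Proof.
rewrite -(@ler_pXn2r _ 2) ?nnegrE ?rn_ge0// /A rn_sqrB.
have -> : Re (inner x (N (N x))) = rn (N x) ^+ 2.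
 by rewrite -Re_inner_rn (bs_sym hN).
have h : rn (N (N x)) ^+ 2 <= rn (N x) ^+ 2.
 by rewrite lerXn2r ?nnegrE ?rn_ge0//; have := bs_bound hN (N x); rewrite mul1r.
have := sqr_ge0 (rn (N x)); lra.
Qed.

Lemma sqrt_b_ge0 n : 0 <= b n <= 1.
Proof.
elim: n => [|n /andP[h1 h2]]; first by rewrite lexx ler01.
by rewrite /b iterS -/(b n); apply/andP; split; nra.
Qed.

Lemma sqrt_b_mono n : b n <= b n.+1.
Proof.
elim: n => [|n IH]; first by rewrite /b /= ; lra.
have /andP[h1 h2] := sqrt_b_ge0 n; have /andP[h3 h4] := sqrt_b_ge0 n.+1.
have bS m : b m.+1 = 2^-1 * (1 + b m ^+ 2) by [].
rewrite (bS n.+1) {1}(bS n); nra.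
Qed.

Lemma sqrt_B_sym n : bounded_sym (B n) (b n).
Proof.
elim: n => [|n IH].
 split; rewrite /B /b /= => *; rewrite ?scaler0 ?addr0 ?mul0r ?rn0 ?inner0l ?inner0r ?rep0//.
have e x : B n.+1 x = (2^-1)%:C *: (A x + B n (B n x)) by [].
split.
- move=> a x y; rewrite !e /A !(bs_lin hN) !(bs_lin IH); lmod R V.
- move=> x; rewrite e rnZ rn_real ger0_norm ?invr_ge0//.
 rewrite /b iterS -/(b n) -mulrA ler_wpM2l ?invr_ge0//.
 apply: le_trans (rnD _ _) _; rewrite mulrDl mul1r lerD ?sqrt_A_bound//.
 apply: le_trans (bs_bound IH _) _; rewrite expr2 -mulrA ler_wpM2l ?(bs_bound IH)//.
 by case/andP: (sqrt_b_ge0 n).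
- move=> x y; rewrite !e innerZl_real innerZr_real /A; congr (_ * _).
 by rewrite !innerDl !innerDr !innerNl !innerNr !(bs_sym IH) !(bs_sym hN).
- by move=> g x; rewrite !e repZ /A repD repB !(bs_act hN) !(bs_act IH).
Qed.

Lemma sqrt_B_comm n x : N (B n x) = B n (N x).
Proof.
elim: n x => [|n IH] x; first by rewrite /B /= (bs_0 hN).
have e y : B n.+1 y = (2^-1)%:C *: (A y + B n (B n y)) by [].
by rewrite !e (bs_Z _ _ hN) (bs_D _ _ hN) /A (bs_B _ _ hN) !IH.
Qed.

(** The difference of squares is split as B' (B' - B) + (B' - B) B for consecutive terms B and B',
    in parallel with b'^2 - b^2 = (b' - b) (b' + b). *)
Lemma sqrt_B_diff n x : rn (B n.+1 x - B n x) <= (b n.+1 - b n) * rn x.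
Proof.
elim: n x => [|n IH] x.
 have -> : B 1%N x - B 0%N x = (2^-1)%:C *: A x by rewrite /B /= subr0 addr0.
 rewrite rnZ rn_real ger0_norm ?invr_ge0// /b /= subr0 expr0n /= addr0 mulr1.
 by rewrite ler_wpM2l ?invr_ge0// sqrt_A_bound.
have e m y : B m.+1 y = (2^-1)%:C *: (A y + B m (B m y)) by [].
have -> : B n.+2 x - B n.+1 x = (2^-1)%:C *: (B n.+1 (B n.+1 x - B n x) +
  (B n.+1 (B n x) - B n (B n x))).
 by rewrite (bs_B _ _ (sqrt_B_sym n.+1)) (e n.+1 x) {2}(e n x); lmod R V.
rewrite rnZ rn_real ger0_norm ?invr_ge0//.
have -> : b n.+2 - b n.+1 = 2^-1 * ((b n.+1 - b n) * (b n.+1 + b n)).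
 by rewrite [b n.+2]/b iterS -/(b n.+1) {2}/b iterS -/(b n); ring.
rewrite -mulrA ler_wpM2l ?invr_ge0//; apply: le_trans (rnD _ _) _.
have h0 : 0 <= b n.+1 - b n by rewrite subr_ge0 sqrt_b_mono.
have /andP[h1 h2] := sqrt_b_ge0 n; have /andP[h3 h4] := sqrt_b_ge0 n.+1.
have k1 : rn (B n.+1 (B n.+1 x - B n x)) <= b n.+1 * ((b n.+1 - b n) * rn x).
 by apply: le_trans (bs_bound (sqrt_B_sym _) _) _; rewrite ler_wpM2l.
have k2 : rn (B n.+1 (B n x) - B n (B n x)) <= (b n.+1 - b n) * (b n * rn x).
 by apply: (le_trans (IH _)); rewrite ler_wpM2l// (bs_bound (sqrt_B_sym _)).
apply: (le_trans (lerD k1 k2)); apply: eq_ler; ring.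
Qed.

Lemma sqrt_B_cauchy k l x : rn (B (k + l) x - B k x) <= (b (k + l)%N - b k) * rn x.
Proof.
elim: l => [|l IH]; first by rewrite addn0 !subrr rn0 mul0r.
rewrite addnS; apply: le_trans (rn_dist_triangle (B (k + l) x) _ _) _.
apply: (le_trans (lerD (sqrt_B_diff _ _) IH)).
by rewrite -mulrDl addrA subrK.
Qed.

Lemma sqrt_b_cauchy (e : R) : 0 < e -> exists K, forall k l, (K <= k)%N -> b (k + l)%N - b k < e.
Proof.
move=> e0; have bm k l : b k <= b (k + l)%N.
 by elim: l => [|l IH]; rewrite ?addn0// addnS (le_trans IH)// sqrt_b_mono.
pose E := range b; have hE : has_sup E.
 split; first by exists (b 0%N), 0%N.
 by exists 1 => _ [k _ <-]; case/andP: (sqrt_b_ge0 k).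
have [_ [K _ <-] hK] := sup_adherent e0 hE.
exists K => k l Kk; have h1 : b (k + l)%N <= sup E by apply: ub_le_sup; [exact: hE.2|exists (k + l)%N].
by have h2 := bm K (k - K)%N; rewrite subnKC// in h2; lra.
Qed.

(** The B_n converge strongly, as the increments are dominated by those of the bounded monotone
    sequence [b]. The limit W satisfies the fixed point equation, has norm at most 1 and commutes
    with N, and S = 1 - W. *)
Lemma exists_sqrt : exists2 S : V -> V, (exists c, bounded_sym S c) &
 [/\ forall x, S (S x) = N (N x), forall x, S (N x) = N (S x) &
   forall x, 0 <= Re (inner (S x) x)].
Proof.
have hlim x : exists w, rcvg (fun k => B k x) w.
 apply: rcauchy_cvg => e e0; have x1 : 0 < rn x + 1 by rewrite ltr_wpDl ?rn_ge0.
 have e1 : 0 < e / (rn x + 1) by rewrite divr_gt0.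
 have [K hK] := sqrt_b_cauchy e1; exists K.
 have key k l : (K <= k)%N -> rn (B (k + l) x - B k x) < e.
  move=> Kk; apply: le_lt_trans (sqrt_B_cauchy _ _ _) _.
  have := hK k l Kk; rewrite ltr_pdivlMr// => h; apply: le_lt_trans h.
  rewrite ler_wpM2l ?lerDl// subr_ge0.
  by elim: l => [|l IH]; rewrite ?addn0// addnS (le_trans IH)// sqrt_b_mono.
 move=> k l Kk Kl; have [kl|lk] := leqP k l.
  by rewrite rn_distC -(subnKC kl); exact: key.
 by rewrite -(subnKC (ltnW lk)); exact: key.
have [W hW] := choice hlim.
have uniq (u : nat -> V) w w' : rcvg u w -> rcvg u w' -> w = w'.
 move=> h h'; apply: rn_dist_eq => e e0; have e2 : 0 < e / 2 by rewrite divr_gt0.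
 have [K hK] := h _ e2; have [K' hK'] := h' _ e2.
 have h1 := hK (K + K')%N (leq_addr _ _); have h2 := hK' (K + K')%N (leq_addl _ _).
 apply: le_trans (rn_dist_triangle (u (K + K')%N) _ _) _.
 by rewrite rn_distC; lra.
have cD (u v : nat -> V) (a : R[i]) w w' : rcvg u w -> rcvg v w' ->
  rcvg (fun k => a *: u k + v k) (a *: w + w').
 move=> h h' e e0; have a1 : 0 < rn a + 1 by rewrite ltr_wpDl ?rn_ge0.
 have e2 : 0 < e / 2 by rewrite divr_gt0.
 have e1 : 0 < e / 2 / (rn a + 1) by rewrite divr_gt0.
 have [K hK] := h _ e1; have [K' hK'] := h' _ e2; exists (K + K')%N => k Kk.
 have h1 := hK k (leq_trans (leq_addr _ _) Kk); have h2 := hK' k (leq_trans (leq_addl _ _) Kk).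
 have -> : a *: u k + v k - (a *: w + w') = a *: (u k - w) + (v k - w') by lmod R V.
 apply: le_lt_trans (rnD _ _) _; rewrite rnZ; move: h1; rewrite ltr_pdivlMr// => h1.
 have : rn a * rn (u k - w) <= rn (u k - w) * (rn a + 1) by rewrite mulrC ler_wpM2l ?rn_ge0// lerDl.
 lra.
have cF (F : V -> V) (u : nat -> V) w : bounded_sym F 1 -> rcvg u w -> rcvg (fun k => F (u k)) (F w).
 move=> hF h e e0; have [K hK] := h e e0; exists K => k /hK hk.
 by rewrite -(bs_B _ _ hF); apply: le_lt_trans (bs_bound hF _) _; rewrite mul1r.
have cI (u : nat -> V) w y z : rcvg u w -> (forall k, inner (u k) y = z) -> inner w y = z.
 move=> h h2; apply: rn_dist_eq => e e0; have [K hK] := rcvg_inner y h e0.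
 by have := hK K (leqnn K); rewrite h2 rn_distC => /ltW.
have B1 n : bounded_sym (B n) 1.
 have hB := sqrt_B_sym n; split; try by case: hB.
 move=> x; apply: le_trans (bs_bound hB x) _; rewrite ler_wpM2r ?rn_ge0//.
 by case/andP: (sqrt_b_ge0 n).
have WP : bounded_sym W 1.
 split.
 - move=> a x y; apply: uniq (hW _) _ => e e0; have [K hK] := cD _ _ a _ _ (hW x) (hW y) e e0.
  by exists K => k /hK; rewrite (bs_lin (B1 k)).
 - move=> x; apply/ler_addgt0Pr => e e0; have [K hK] := hW x e e0.
  have h1 := bs_bound (B1 K) x; have h2 := hK K (leqnn K).
  rewrite -[W x](subKr (B K x)); apply: le_trans (rnB _ _) _.
  by apply: lerD => //; exact: ltW.
 - move=> x y; apply: rn_dist_eq => e e0; have e2 : 0 < e / 2 by rewrite divr_gt0.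
  have [K hK] := rcvg_inner y (hW x) e2; have [K' hK'] := rcvg_inner x (hW y) e2.
  have h1 := hK (K + K')%N (leq_addr _ _); have h2 := hK' (K + K')%N (leq_addl _ _).
  have e3 : inner (B (K + K') x) y - inner x (W y) = (inner (B (K + K') y) x - inner (W y) x)^*.
   by rewrite (bs_sym (B1 _)) (innerC (B _ y) x) (innerC (W y) x) rmorphB.
  apply: le_trans (rn_dist_triangle (inner (B (K + K') x) y) _ _) _.
  by rewrite e3 rn_conj rn_distC; lra.
 - move=> g x; apply: uniq (hW _) _ => e e0; have [K hK] := hW x e e0.
  by exists K => k /hK; rewrite (bs_act (B1 k)) -repB rep_rn.
have Weq x : W x = (2^-1)%:C *: (A x + W (W x)).
 apply: uniq (hW x) _ => e e0.
 have [K hK] := hW (W x) e e0; have [K' hK'] := hW x e e0.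
 exists (K + K').+1 => -[//|k]; rewrite ltnS => Kk.
 have h1 := hK k (leq_trans (leq_addr _ _) Kk); have h2 := hK' k (leq_trans (leq_addl _ _) Kk).
 have e3 : B k.+1 x = (2^-1)%:C *: (A x + B k (B k x)) by [].
 rewrite e3 [X in rn X](_ : _ = (2^-1)%:C *: (B k (B k x - W x) + (B k (W x) - W (W x)))); last first.
  by rewrite (bs_B _ _ (B1 k)); lmod R V.
 rewrite rnZ rn_real ger0_norm ?invr_ge0//.
 have h3 := le_lt_trans (bs_bound (B1 k) (B k x - W x)) (ltac:(by rewrite mul1r) : 1 * rn (B k x - W x) < e).
 have := rnD (B k (B k x - W x)) (B k (W x) - W (W x)); lra.
have WN x : W (N x) = N (W x).
 apply: uniq (hW _) _ => e e0; have [K hK] := cF _ _ _ hN (hW x) e e0.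
 by exists K => k /hK; rewrite sqrt_B_comm.
exists (fun x => x - W x).
 exists 2; split.
 - by move=> a x y; rewrite (bs_lin WP); lmod R V.
 - move=> x; apply: le_trans (rnB _ _) _; have := bs_bound WP x; lra.
 - by move=> x y; rewrite innerBl innerBr (bs_sym WP).
 - by move=> g x; rewrite (bs_act WP) repB.
split.
- move=> x; rewrite (bs_B _ _ WP).
 have h := Weq x; have : W (W x) = (2 : R)%:C *: W x - A x.
  by rewrite [in RHS]h scalerA -rmorphM /= mulfV// scale1r; lmod R V.
 move=> ->; rewrite /A; have -> : (2 : R)%:C = 1 + 1 by rewrite -[2]/(1 + 1) rmorphD rmorph1.
 by lmod R V.
- by move=> x; rewrite WN (bs_B _ _ hN).
- move=> x; rewrite innerBl raddfB /= subr_ge0 Re_inner_rn.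
 apply: le_trans (Re_inner_le _ _) _; rewrite expr2 ler_wpM2r ?rn_ge0//.
 by have := bs_bound WP x; rewrite mul1r.
Qed.

End square_root.

(** After scaling to norm 1, take S >= 0 with S^2 = N^2 commuting with N. Then (S + N) (S - N) = 0,
    so N = S or N = - S by the dichotomy. *)
Lemma bs_sign N c : bounded_sym N c -> (forall x, 0 <= Re (inner (N x) x)) \/
 (forall x, Re (inner (N x) x) <= 0).
Proof.
move=> h; pose k := `|c| + 1; have k0 : 0 < k by rewrite ltr_wpDl.
pose N' x := (k^-1)%:C *: N x.
have hN' : bounded_sym N' 1.
 split.
 - by move=> a x y; rewrite /N' (bs_lin h); lmod R V.
 - move=> x; rewrite /N' rnZ rn_real normfV gtr0_norm// mulrC ler_pdivrMr// mul1r mulrC.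
  apply: le_trans (bs_bound h x) _; rewrite ler_wpM2r ?rn_ge0// /k.
  by apply: le_trans (ler_norm c) _; rewrite lerDl.
 - by move=> x y; rewrite /N' innerZl_real innerZr_real (bs_sym h).
 - by move=> g x; rewrite /N' (bs_act h) repZ.
have [S [c' hS] [SS SN S0]] := exists_sqrt hN'.
have hP : bounded_sym (fun x => S x + N' x) (c' + 1).
 split.
 - by move=> a x y; rewrite (bs_lin hS) (bs_lin hN'); lmod R V.
 - move=> x; apply: le_trans (rnD _ _) _.
  by rewrite mulrDl lerD ?(bs_bound hS)// (bs_bound hN').
 - by move=> x y; rewrite innerDl innerDr (bs_sym hS) (bs_sym hN').
 - by move=> g x; rewrite (bs_act hS) (bs_act hN') repD.
have hQ : bounded_sym (fun x => S x - N' x) (c' + 1).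
 split.
 - by move=> a x y; rewrite (bs_lin hS) (bs_lin hN'); lmod R V.
 - move=> x; apply: le_trans (rnB _ _) _.
  by rewrite mulrDl lerD ?(bs_bound hS)// (bs_bound hN').
 - by move=> x y; rewrite innerBl innerBr (bs_sym hS) (bs_sym hN').
 - by move=> g x; rewrite (bs_act hS) (bs_act hN') repB.
have PQ x : S (S x - N' x) + N' (S x - N' x) = 0.
 by rewrite (bs_B _ _ hS) (bs_B _ _ hN') SS SN; lmod R V.
have eN x : Re (inner (N x) x) = k * Re (inner (N' x) x).
 by rewrite /N' innerZl Re_realM mulrA mulfV ?gt_eqF// mul1r.
have [h1|h1] := bs_dichotomy hP hQ PQ; [right|left] => x.
 have := S0 x; have /eqP := h1 x; rewrite addr_eq0 => /eqP ->.
 by rewrite innerNl raddfN /= oppr_ge0 eN; move=> h2; rewrite pmulr_rle0.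
have := S0 x; have /eqP := h1 x; rewrite subr_eq0 => /eqP ->.
by rewrite eN; move=> h2; rewrite pmulr_rge0.
Qed.

(** The scalar is the largest l with N - l >= 0. For larger l the operator N - l has a sign, which
    is then negative, so N and the scalar have the same quadratic form; polarization finishes. *)
Lemma schur_bounded N c : bounded_sym N c -> exists l : R, forall x, N x = l%:C *: x.
Proof.
move=> h; have [[v0 v00] _] := hp; have r0 : 0 < rn v0 ^+ 2 by rewrite exprn_gt0// rn_gt0.
have cr x : `|Re (inner (N x) x)| <= `|c| * rn x ^+ 2.
 apply: le_trans (absRe_inner_le _ _) _.
 rewrite expr2 mulrA ler_wpM2r ?rn_ge0//; apply: le_trans (bs_bound h x) _.
 by rewrite ler_wpM2r ?rn_ge0// ler_norm.
pose E := [set l : R | forall x, l * rn x ^+ 2 <= Re (inner (N x) x)].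
have hE : has_sup E.
 split.
  exists (- `|c|) => x /=; rewrite mulNr lerNl; apply: le_trans (cr x).
  by rewrite -normrN ler_norm.
 exists `|c| => l /(_ v0) hl; rewrite -(ler_pM2r r0); apply: (le_trans hl).
 by apply: le_trans (cr v0); rewrite ler_norm.
have sE x : sup E * rn x ^+ 2 <= Re (inner (N x) x).
 apply/ler_addgt0Pr => e e0; have x1 : 0 < rn x ^+ 2 + 1 by rewrite ltr_wpDl ?exprn_ge0 ?rn_ge0.
 have e1 : 0 < e / (rn x ^+ 2 + 1) by rewrite divr_gt0.
 have [l El] := sup_adherent e1 hE; rewrite ltrBlDr => hl.
 apply: (@le_trans _ _ ((l + e / (rn x ^+ 2 + 1)) * rn x ^+ 2)).
  by rewrite ler_wpM2r ?exprn_ge0 ?rn_ge0// ltW.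
 rewrite mulrDl lerD ?(El x)//.
 by rewrite mulrAC -mulrA ler_piMr ?(ltW e0)// ler_pdivrMr// mul1r lerDl.
have form0 x : Re (inner (N x) x) = sup E * rn x ^+ 2.
 apply/eqP; rewrite eq_le sE andbT; apply/ler_addgt0Pr => e e0.
 have x1 : 0 < rn x ^+ 2 + 1 by rewrite ltr_wpDl ?exprn_ge0 ?rn_ge0.
 have e1 : 0 < e / (rn x ^+ 2 + 1) by rewrite divr_gt0.
 pose l := sup E + e / (rn x ^+ 2 + 1).
 have hl : bounded_sym (fun y => N y - l%:C *: y) (c + `|l|).
  split.
  - by move=> a y z; rewrite (bs_lin h); lmod R V.
  - move=> y; apply: le_trans (rnB _ _) _; rewrite rnZ rn_real mulrDl lerD2r.
   exact: (bs_bound h).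
  - by move=> y z; rewrite innerBl innerBr (bs_sym h) innerZl_real innerZr_real.
  - by move=> g y; rewrite (bs_act h) repB repZ.
 have fE y : Re (inner (N y - l%:C *: y) y) = Re (inner (N y) y) - l * rn y ^+ 2.
  by rewrite innerBl raddfB /= innerZl Re_realM Re_inner_rn.
 have [h1|h1] := bs_sign hl.
  have : E l by move=> y; have := h1 y; rewrite fE subr_ge0.
  by move=> /(ub_le_sup hE.2); rewrite /l gerDl leNgt e1.
 have := h1 x; rewrite fE subr_le0 => h2; apply: (le_trans h2).
 rewrite /l mulrDl lerD2l.
 by rewrite mulrAC -mulrA ler_piMr ?(ltW e0)// ler_pdivrMr// mul1r lerDl.
exists (sup E) => x; set s := sup E.
pose y := N x - s%:C *: x; apply/eqP; rewrite -subr_eq0 -rn_eq0 -sqrf_eq0 -Re_inner_rn -/y; apply/eqP.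
have yE : y = N x - s%:C *: x by [].
clearbody y.
have h1 := form0 (x + y); rewrite (bs_D _ _ h) !innerDl !innerDr !raddfD /= !form0 rn_sqrD -/s in h1.
have h2 : Re (inner (N y) x) = Re (inner (N x) y) by rewrite (bs_sym h) Re_innerC.
rewrite h2 in h1; rewrite {1}yE innerBl raddfB /= innerZl Re_realM; lra.
Qed.

Section unbounded.
Variables (D : V -> Prop) (Z : V -> V).
Hypotheses (D_dense : dense_in D) (D_lin : forall (a : R[i]) x y, D x -> D y -> D (a *: x + y))
 (D_act : forall g x, D x -> D (p g x)) (Z_in : forall x, D x -> D (Z x))
 (Z_lin : forall (a : R[i]) x y, D x -> D y -> Z (a *: x + y) = a *: Z x + Z y)
 (Z_sym : forall x y, D x -> D y -> inner (Z x) y = inner x (Z y))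
 (Z_act : forall g x, D x -> Z (p g x) = p g (Z x)).

Let D0 : D 0.
Proof.
have [z Dz _] := D_dense 0 ltr01; have := D_lin (-1) Dz Dz.
by rewrite scaleN1r addNr.
Qed.
Let Z0 : Z 0 = 0.
Proof. by have := Z_lin (-1) D0 D0; rewrite scaler0 addr0 scaleN1r addNr. Qed.
Let DZ a x : D x -> D (a *: x).
Proof. by move=> Dx; have := D_lin a Dx D0; rewrite addr0. Qed.
Let ZZ a x : D x -> Z (a *: x) = a *: Z x.
Proof. by move=> Dx; have := Z_lin a Dx D0; rewrite Z0 !addr0. Qed.
Let DD x y : D x -> D y -> D (x + y).
Proof. by move=> Dx Dy; have := D_lin 1 Dx Dy; rewrite scale1r. Qed.
Let ZD x y : D x -> D y -> Z (x + y) = Z x + Z y.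
Proof. by move=> Dx Dy; have := Z_lin 1 Dx Dy; rewrite !scale1r. Qed.

Let graph_adh b z := forall e : R, 0 < e -> exists x, [/\ D x, rn (b - x) < e & rn (z - Z x) < e].

Let graph_adh_lin a b z b' z' : graph_adh b z -> graph_adh b' z' ->
 graph_adh (a *: b + b') (a *: z + z').
Proof.
move=> h h' e e0; have a1 : 0 < rn a + 1 by rewrite ltr_wpDl ?rn_ge0.
have e2 : 0 < e / 2 by rewrite divr_gt0.
have e1 : 0 < e / 2 / (rn a + 1) by rewrite divr_gt0.
have [x [Dx h1 h2]] := h _ e1; have [x' [Dx' h1' h2']] := h' _ e2.
have key (c1 c2 y1 y2 : V) : rn (c1 - y1) < e / 2 / (rn a + 1) -> rn (c2 - y2) < e / 2 ->
  rn (a *: c1 + c2 - (a *: y1 + y2)) < e.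
 rewrite ltr_pdivlMr// => k1 k2.
 have -> : a *: c1 + c2 - (a *: y1 + y2) = a *: (c1 - y1) + (c2 - y2) by lmod R V.
 apply: le_lt_trans (rnD _ _) _; rewrite rnZ.
 have : rn a * rn (c1 - y1) <= rn (c1 - y1) * (rn a + 1) by rewrite mulrC ler_wpM2l ?rn_ge0// lerDl.
 lra.
exists (a *: x + x'); split; [exact: D_lin|exact: key|].
by rewrite Z_lin//; exact: key.
Qed.

Let graph_eq u z b y : (forall x, D x -> inner u x = inner z (Z x)) -> graph_adh b y ->
 inner u b = inner z y.
Proof.
move=> h hb; apply: rn_dist_eq => e e0.
have c0 : 0 < rn u + rn z + 1 by rewrite ltr_wpDl// addr_ge0 ?rn_ge0.
have e1 : 0 < e / (rn u + rn z + 1) by rewrite divr_gt0.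
have [x [Dx h1 h2]] := hb _ e1.
have -> : inner u b - inner z y = inner u (b - x) - inner z (y - Z x).
 by rewrite !innerBr (h x Dx); ring.
move: h1 h2; rewrite !ltr_pdivlMr// => h1 h2.
apply: le_trans (rnB _ _) _; apply: (le_trans (lerD (rn_inner_le _ _) (rn_inner_le _ _))).
have := rn_ge0 u; have := rn_ge0 z; have := rn_ge0 (b - x); have := rn_ge0 (y - Z x).
move: e0 h1 h2; move: (rn u) (rn z) (rn (b - x)) (rn (y - Z x)) => a1 a2 a3 a4; nra.
Qed.

(** Encodes b = (1 + Z* Z)^-1 v for the closure of Z: (b, z) is in the closure of the graph, and the
    second clause says v - b = Z* z. *)
Let rel v b z := graph_adh b z /\ forall y, D y -> inner (v - b) y = inner z (Z y).

(** Minimizes |v - x|^2 + |Z x|^2 over D. Both x and Z x converge along a minimizing sequence, and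
    the first order condition is the second clause of [rel]. *)
Let rel_exists v : exists bz, rel v bz.1 bz.2.
Proof.
pose J x := rn (v - x) ^+ 2 + rn (Z x) ^+ 2.
have J0 x : D x -> 0 <= J x by move=> _; rewrite addr_ge0 ?sqr_ge0.
have [m [x [hm hx]]] := @min_seq R V D J 0 (ex_intro _ 0 D0) J0.
pose mid y z : V := (2^-1)%:C *: (y + z).
have Dmid y z : D y -> D z -> D (mid y z) by move=> Dy Dz; apply: DZ; exact: DD.
have hmid y z : D y -> D z -> rn (y - z) ^+ 2 + rn (Z y - Z z) ^+ 2 <= 2 * (J y + J z - 2 * J (mid y z)).
 move=> Dy Dz; rewrite /J /mid ZZ ?ZD//; last exact: DD.
 have h1 := parallelogram (v - y) (v - z); have h2 := parallelogram (Z y) (Z z).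
 have e1 : v - y + (v - z) = (2 : R)%:C *: (v - (2^-1)%:C *: (y + z)).
  have h22 : (2 : R)%:C * (2^-1)%:C = 1 :> R[i] by rewrite -rmorphM /= mulfV.
  rewrite scalerBr scalerA h22 scale1r.
  have -> : (2 : R)%:C = 1 + 1 :> R[i] by rewrite -[2]/(1 + 1) rmorphD rmorph1.
  by lmod R V.
 have e2 : v - y - (v - z) = z - y by lmod R V.
 rewrite e1 e2 rnZ rn_real ger0_norm// exprMn (rn_distC z) in h1.
 rewrite rnZ rn_real ger0_norm ?invr_ge0// exprMn; lra.
have [b hb] : exists b, rcvg (fun k => x k) b.
 apply: (min_cvg (phi := id) hm (ler0n R 2) hx Dmid) => y z Dy Dz.
 by have := hmid y z Dy Dz; have := sqr_ge0 (rn (Z y - Z z)); lra.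
have [z hz] : exists z, rcvg (fun k => Z (x k)) z.
 apply: (min_cvg hm (ler0n R 2) hx Dmid) => y z Dy Dz.
 by have := hmid y z Dy Dz; have := sqr_ge0 (rn (y - z)); lra.
exists (b, z); split => [e e0|y Dy] /=.
 have [K hK] := hb e e0; have [K' hK'] := hz e e0; exists (x (K + K')%N).
 by split; [case: (hx (K + K')%N)|rewrite rn_distC hK ?leq_addr|rewrite rn_distC hK' ?leq_addl].
have key w : D w -> Re (inner z (Z w)) = Re (inner (v - b) w).
 move=> Dw; apply/eqP; rewrite -subr_eq0; apply/eqP.
 apply: (@quadratic_ge0 R _ (rn w ^+ 2 + rn (Z w) ^+ 2)); first by rewrite addr_ge0 ?sqr_ge0.
 move=> s; apply/ler_addgt0Pr => e e0.
 have s1 : 0 < 2 * `|s| + 1 by rewrite ltr_wpDl// mulr_ge0.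
 have e2 : 0 < e / 3 by rewrite divr_gt0.
 have e3 : 0 < e / 3 / (2 * `|s| + 1) by rewrite divr_gt0.
 have [N1 h1] := invS_small e2; have [N2 h2] := rcvg_inner w hb e3.
 have [N3 h3] := rcvg_inner (Z w) hz e3.
 pose k := (N1 + N2 + N3)%N.
 have {h1} h1 := h1 k (leq_trans (leq_addr _ _) (leq_addr _ _)).
 have {h2} h2 := h2 k (leq_trans (leq_addl _ _) (leq_addr _ _)).
 have {h3} h3 := h3 k (leq_addl _ _); have [Dk hk] := hx k.
 have small (a b' : R[i]) : rn (a - b') < e / 3 / (2 * `|s| + 1) ->
   `|2 * s * (Re a - Re b')| <= e / 3.
  rewrite ltr_pdivlMr// => /ltW; apply: le_trans; rewrite -raddfB /= !normrM normr_nat mulrC.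
  rewrite ler_pM ?mulr_ge0 ?absRe_le_rn// lerDl//.
 have := small _ _ h2; have := small _ _ h3; rewrite !ler_norml => /andP[k1 k2] /andP[k3 k4].
 have := hm _ (DD Dk (DZ s%:C Dw)); rewrite /J ZD ?ZZ//; last exact: DZ.
 have -> : v - (x k + s%:C *: w) = (v - x k) - s%:C *: w by lmod R V.
 rewrite rn_sqrB rn_sqrD !rnZ rn_real !innerZr_real !Re_realM !exprMn real_normK ?num_real//.
 move: hk h1; rewrite /J !innerBl !raddfB /=; set q := (k.+1%:R)^-1.
 lra.
apply: re_im_eq; first by rewrite key.
have Dy2 : D ((0 +i* 1) *: y) by exact: DZ.
have := key _ Dy2; rewrite ZZ// !innerZr.
by case: (inner z (Z y)) (inner (v - b) y) => a1 a2 [b1 b2] /=; lra.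
Qed.

(** B = (1 + Z* Z)^-1 is bounded, symmetric and commutes with the group, hence is a scalar l, which
    is not 0 since D is dense. So Z^2 = c on D with c = (1 - l) / l >= 0, and irreducibility decides
    between the two square roots of c. *)
Lemma schur_unbounded : exists l : R, forall x, D x -> Z x = l%:C *: x.
Proof.
have [[v0 v00] _] := hp.
have [f hf] := choice rel_exists.
pose B v := (f v).1; pose C v := (f v).2.
have rel_uniq v b z b' z' : rel v b z -> rel v b' z' -> b = b'.
 move=> [g1 h1] [g2 h2].
 have g3 := graph_adh_lin (-1) g2 g1; rewrite !scaleN1r in g3.
 have h3 y : D y -> inner (b' - b) y = inner (z - z') (Z y).
  move=> Dy; have -> : b' - b = (v - b) - (v - b') by lmod R V.
  by rewrite innerBl h1// h2// innerBl.
 have := graph_eq h3 g3; have -> : - b' + b = - (b' - b) by lmod R V.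
 have -> : - z' + z = z - z' by lmod R V.
 rewrite innerNr => /(congr1 (@Re R)); rewrite raddfN /= !Re_inner_rn => h4.
 have := sqr_ge0 (rn (b' - b)); have := sqr_ge0 (rn (z - z')) => k1 k2.
 have /eqP : rn (b' - b) ^+ 2 = 0 by lra.
 by rewrite sqrf_eq0 rn_eq0 subr_eq0 => /eqP.
have form v w : inner v (B w) = inner (B v) (B w) + inner (C v) (C w).
 have [g1 h1] := hf v; have [g2 h2] := hf w.
 by have := graph_eq h1 g2; rewrite innerBl => <-; ring.
have hB : bounded_sym B 1.
 split.
 - move=> a x y; apply: (rel_uniq (a *: x + y) _ (C (a *: x + y)) _ (a *: C x + C y)) => //.
  have [g1 h1] := hf x; have [g2 h2] := hf y; split; first exact: graph_adh_lin.
  move=> w Dw; have -> : a *: x + y - (a *: B x + B y) = a *: (x - B x) + (y - B y) by lmod R V.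
  by rewrite innerDl innerZl h1// h2// innerDl innerZl.
 - move=> x; rewrite mul1r; have := congr1 (@Re R) (form x x).
  rewrite raddfD /= !Re_inner_rn => h.
  have h2 := Re_inner_le x (B x); have h3 := sqr_ge0 (rn (C x)).
  have [->|bx] := eqVneq (B x) 0; first by rewrite rn0 rn_ge0.
  by rewrite -(@ler_pM2r _ (rn (B x))) ?rn_gt0// -expr2; lra.
 - move=> x y; rewrite form (innerC y (B x)) form.
  by rewrite rmorphD /= -!innerC.
 - move=> g x; apply: (rel_uniq (p g x) _ (C (p g x)) _ (p g (C x))) => //.
  have [g1 h1] := hf x; split => [e e0|y Dy].
   have [w [Dw k1 k2]] := g1 e e0; exists (p g w).
   by split; [exact: D_act|rewrite -repB rep_rn|rewrite Z_act// -repB rep_rn].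
  rewrite -repB !inner_repl h1; last exact: D_act.
  by rewrite Z_act.
have [l hl] := schur_bounded hB.
have l0 : l != 0.
 apply/eqP => l0; have B0 v : B v = 0 by rewrite hl l0 scale0r.
 have C0 v : C v = 0.
  have := form v v; rewrite B0 inner0r inner0l add0r => /esym/(congr1 (@Re R)).
  by rewrite Re_inner_rn /= => /eqP; rewrite sqrf_eq0 rn_eq0 => /eqP.
 suff : v0 = 0 by move/eqP; rewrite (negbTE v00).
 apply: (dense_inner_eq0 D_dense) => y Dy; have [_ h] := hf v0; have := h y Dy.
 by rewrite -/(B v0) -/(C v0) B0 C0 subr0 inner0l.
have CE x : D x -> C x = l%:C *: Z x.
 move=> Dx; apply/eqP; rewrite -subr_eq0; apply/eqP/(dense_inner_eq0 D_dense) => w Dw.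
 have [g _] := hf x; rewrite -/(B x) -/(C x) hl in g.
 have h1 u : D u -> inner (Z w) u = inner w (Z u) by move=> Du; exact: Z_sym.
 have h2 := graph_eq h1 g.
 rewrite innerBl (innerC w (C x)) -h2 -innerC -ZZ// Z_sym ?subrr//.
 exact: DZ.
pose c := (1 - l) / l.
have ZZc x : D x -> Z (Z x) = c%:C *: x.
 move=> Dx; apply/eqP; rewrite -subr_eq0; apply/eqP/(dense_inner_eq0 D_dense) => w Dw.
 have [_ h] := hf x; have := h w Dw; rewrite -/(B x) -/(C x) hl CE// => h2.
 rewrite innerBl Z_sym//; last exact: Z_in.
 have h3 : inner (Z x) (Z w) = (l^-1)%:C * inner (l%:C *: Z x) (Z w).
  by rewrite innerZl mulrA -rmorphM /= mulVf// mul1r.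
 rewrite h3 -h2 innerBl !innerZl /c; set q := inner x w.
 have -> : ((1 - l) / l)%:C = (l^-1)%:C * (1 - l%:C) :> R[i].
  by rewrite mulrC rmorphM rmorphB rmorph1.
 by ring.
have c0 : 0 <= c.
 have [y Dy hy] : exists2 y, D y & y != 0.
  have r0 : 0 < rn v0 by rewrite rn_gt0.
  have [y Dy hy] := D_dense v0 r0; exists y => //; apply/eqP => y0.
  by rewrite y0 subr0 ltxx in hy.
 have : Re (inner (Z (Z y)) y) = rn (Z y) ^+ 2.
  by rewrite Z_sym//; [rewrite Re_inner_rn|exact: Z_in].
 rewrite ZZc// innerZl Re_realM Re_inner_rn => h.
 by rewrite -(@pmulr_lge0 _ (rn y ^+ 2)) ?exprn_gt0 ?rn_gt0// h sqr_ge0.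
(* If Z is not s, the range of Z - s is nonzero and invariant, hence dense. There Z acts as - s
   because (Z + s) (Z - s) = Z^2 - c = 0, and symmetry extends this to D. *)
pose s := Num.sqrt c; have ss : s%:C * s%:C = c%:C :> R[i] by rewrite -rmorphM -expr2 sqr_sqrtr.
have [h1|h1] := pselect (forall x, D x -> Z x = s%:C *: x); first by exists s.
have [x0 Dx0 hx0] : exists2 x, D x & Z x - s%:C *: x != 0.
 apply: contrapT => ne; apply: h1 => x Dx; apply: contrapT => hx; apply: ne; exists x => //.
 by rewrite subr_eq0; apply/eqP.
pose D' y := exists2 x, D x & y = Z x - s%:C *: x.
have D'D y : D' y -> D y.
 by move=> [x Dx ->]; rewrite -scaleNr addrC; apply: D_lin => //; exact: Z_in.
have dD' : dense_in D'.
 apply: irreducible_adherent; last by exists (Z x0 - s%:C *: x0) => //; exists x0.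
  move=> a _ _ [x Dx ->] [y Dy ->]; exists (a *: x + y); first exact: D_lin.
  by rewrite Z_lin//; lmod R V.
 move=> g _ [x Dx ->]; apply: adherent_sub; exists (p g x); first exact: D_act.
 by rewrite Z_act// repB repZ.
exists (- s) => y Dy; apply/eqP; rewrite -subr_eq0; apply/eqP/(dense_inner_eq0 dD') => w D'w.
have Zw : Z w = (- s)%:C *: w.
 case: D'w => x Dx ->; rewrite -scaleNr addrC Z_lin//; last exact: Z_in.
 have ns : (- s)%:C = - s%:C :> R[i] by exact: (rmorphN (real_complex R)).
 by rewrite ZZc// -ss ns; lmod R V.
rewrite innerBl Z_sym//; last exact: D'D.
by rewrite Zw innerZl_real innerZr_real subrr.
Qed.

End unbounded.
End schur.

(** * Trace operators commuting with the group *)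

Section trace_operators.
Variables (R : realType) (n : nat) (G : topGroupType).
Variables (S : set 'M[R]_n) (pr : G -> 'M[R]_n) (gam : 'M[R]_n -> R -> G).
Hypotheses (SA : self_adjoint_algebraic_group S) (CP : covering S pr) (hgam : lifting S pr gam).
Variables (V : hilbertType R) (p : unitary_rep G V).
Hypothesis hp : irreducible_rep p.
Let GS : linear_group S := cov_group CP.
Notation sm := (smooth_vector p).
Variable bs : seq 'M[R]_n.
Hypotheses (bs_orth : morthonormal bs) (bs_in : forall b, b \in bs -> lie S b)
 (bs_span : forall X, lie S X -> X = \sum_(b <- bs) mdot X b *: b).
Notation dr := (dr gam p).
Let drZ := drZ CP hgam (p := p) bs_orth bs_in bs_span.
Let dr_smooth := dr_smooth hgam (p := p).
Let dr_skew := dr_skew hgam (p := p).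

Lemma smooth_dense : (exists2 v, sm v & v != 0) -> dense_in sm.
Proof.
apply: irreducible_adherent; first exact: hp.
- by move=> a v w; exact: smooth_lin.
- by move=> g v hv; apply: adherent_sub; exact: smooth_act_vec.
Qed.

Hypothesis sm_dense : dense_in sm.

(** A formal adjoint on the smooth vectors suffices: Z + Z' and i (Z - Z') are symmetric and commute
    with the group, and Z is a combination of them. *)
Lemma schur_adjoint (Z Z' : V -> V) : (forall v, sm v -> sm (Z v)) -> (forall v, sm v -> sm (Z' v)) ->
 (forall v w, sm v -> sm w -> inner (Z v) w = inner v (Z' w)) ->
 (forall g v, sm v -> Z (p g v) = p g (Z v)) ->
 exists c : R[i], forall v, sm v -> Z v = c *: v.
Proof.
move=> sZ sZ' adj act.
have adj' v w : sm v -> sm w -> inner (Z' v) w = inner v (Z w).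
 by move=> hv hw; rewrite innerC -adj// -innerC.
have eqS (v w : V) : (forall y, sm y -> inner v y = inner w y) -> v = w.
 exact: (smooth_inner_eq sm_dense).
have lin (F F' : V -> V) : (forall v w, sm v -> sm w -> inner (F v) w = inner v (F' w)) ->
  forall a v w, sm v -> sm w -> F (a *: v + w) = a *: F v + F w.
 move=> h a v w hv hw; apply: eqS => y hy; rewrite h//; last exact: smooth_lin.
 by rewrite !innerDl !innerZl !h.
have act' g v : sm v -> Z' (p g v) = p g (Z' v).
 move=> hv; apply: eqS => y hy; have hgv : sm (p g v) by exact: smooth_act_vec.
 rewrite adj'// -{1}(repVK p g y) act; last exact: smooth_act_vec.
 by rewrite rep_inner -adj'//; [rewrite inner_repl|exact: smooth_act_vec].
have key (W : V -> V) : (forall v, sm v -> sm (W v)) ->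
  (forall v w, sm v -> sm w -> inner (W v) w = inner v (W w)) ->
  (forall g v, sm v -> W (p g v) = p g (W v)) -> exists l : R, forall v, sm v -> W v = l%:C *: v.
 move=> h1 h2 h3; apply: (schur_unbounded hp sm_dense) => //.
 - by move=> a v w; exact: smooth_lin.
 - by move=> g v; exact: smooth_act_vec.
 - exact: (lin W W).
have [l1 hl1] : exists l : R, forall v, sm v -> Z v + Z' v = l%:C *: v.
 apply: (key (fun v => Z v + Z' v)) => [v hv|v w hv hw|g v hv].
 - by apply: smoothD; [exact: sZ|exact: sZ'].
 - by rewrite innerDl innerDr adj// adj'// addrC.
 - by rewrite act// act'// repD.
pose i : R[i] := 0 +i* 1.
have [l2 hl2] : exists l : R, forall v, sm v -> i *: (Z v - Z' v) = l%:C *: v.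
 apply: (key (fun v => i *: (Z v - Z' v))) => [v hv|v w hv hw|g v hv].
 - by apply: smoothZ; apply: smoothB; [exact: sZ|exact: sZ'].
 - rewrite innerZl innerZr innerBl innerBr adj// adj'//.
  by case: (inner v (Z w)) (inner v (Z' w)) => a b [a' b'] /=; congr (_ +i* _) => /=; ring.
 - by rewrite act// act'// -repB repZ.
exists ((2^-1)%:C * (l1%:C - i * l2%:C)) => v hv.
have i2 : i * i = -1 by rewrite /i; apply/eqP; rewrite eq_complex /=; apply/andP; split; apply/eqP; ring.
have h2 : (2^-1)%:C * (1 + 1) = 1 :> R[i].
 by rewrite -(rmorph1 (real_complex R)) -rmorphD -rmorphM /=; congr (_%:C); field.
have e : (1 + 1) *: Z v = l1%:C *: v - (i * l2%:C) *: v.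
 by rewrite -scalerA -(hl2 v hv) -(hl1 v hv) scalerA i2; lmod R V.
by rewrite -scalerA scalerBl -e scalerA h2 scale1r.
Qed.

(* [zop j M] is the sum over b_1, .., b_j in the basis [bs] of
  tr (M b_1^T .. b_j^T) b_1 .. b_j. *)
Fixpoint zop j (M : 'M[R]_n) v : V :=
 if j is j'.+1 then \sum_(b <- bs) dr b (zop j' (M *m b^T) v) else (\tr M)%:C *: v.
Fixpoint zadj j (M : 'M[R]_n) v : V :=
 if j is j'.+1 then \sum_(b <- bs) zadj j' (M *m b^T) (- dr b v) else (\tr M)%:C *: v.

Lemma smooth_sum_seq (F : 'M[R]_n -> V) : (forall b, b \in bs -> sm (F b)) ->
 sm (\sum_(b <- bs) F b).
Proof.
move=> h; rewrite big_seq; elim/big_ind: _ => //; [exact: smooth0|exact: smoothD].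
Qed.

Lemma smoothN v : sm v -> sm (- v).
Proof. by move=> hv; rewrite -scaleN1r; exact: smoothZ. Qed.

Lemma zop_smooth j M v : sm v -> sm (zop j M v).
Proof.
elim: j M => [|j IH] M hv /=; first exact: smoothZ.
by apply: smooth_sum_seq => b bB; apply: dr_smooth; [exact: bs_in|exact: IH].
Qed.

Lemma zadj_smooth j M v : sm v -> sm (zadj j M v).
Proof.
elim: j M v => [|j IH] M v hv /=; first exact: smoothZ.
apply: smooth_sum_seq => b bB; apply: IH; apply: smoothN.
by apply: dr_smooth => //; exact: bs_in.
Qed.

Lemma zop_adj j M v w : sm v -> sm w -> inner (zop j M v) w = inner v (zadj j M w).
Proof.
elim: j M v w => [|j IH] M v w hv hw /=; first by rewrite innerZl_real innerZr_real.
rewrite inner_suml inner_sumr; apply: eq_big_seq => b /bs_in lb.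
rewrite dr_skew//; last exact: zop_smooth.
by rewrite -innerNr IH//; apply: smoothN; exact: dr_smooth.
Qed.

Lemma dr_sum_seq X (F : 'M[R]_n -> V) : lie S X -> (forall b, b \in bs -> sm (F b)) ->
 dr X (\sum_(b <- bs) F b) = \sum_(b <- bs) dr X (F b).
Proof.
move=> lX hF; pose F' b := if b \in bs then F b else 0.
have sF b : sm (F' b) by rewrite /F'; case: ifP => [/hF//|_]; exact: smooth0.
have -> : \sum_(b <- bs) F b = \sum_(b <- bs) F' b by apply: eq_big_seq => b bB; rewrite /F' bB.
by rewrite (drv_sum hgam)//; apply: eq_big_seq => b bB; rewrite /F' bB.
Qed.

Lemma zop_linM j a M M' v : sm v -> zop j (a *: M + M') v = a%:C *: zop j M v + zop j M' v.
Proof.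
elim: j M M' => [|j IH] M M' hv /=; first by rewrite linearP /= rmorphD rmorphM scalerDl scalerA.
rewrite scaler_sumr -big_split; apply: eq_big_seq => b /bs_in lb.
rewrite mulmxDl -scalemxAl IH// (dr_lin hgam)//; exact: zop_smooth.
Qed.

Lemma zop_sumM j (I : Type) (r : seq I) (a : I -> R) (F : I -> 'M[R]_n) v : sm v ->
 zop j (\sum_(i <- r) a i *: F i) v = \sum_(i <- r) (a i)%:C *: zop j (F i) v.
Proof.
move=> hv; elim: r => [|i r IH]; last by rewrite !big_cons zop_linM// IH.
have := zop_linM j (-1) 0 0 hv; rewrite scaleN1r addNr !big_nil => ->.
by rewrite rmorphN1 scaleN1r addNr.
Qed.

(** With s = pr g, the coefficients <Ad(s) b, k> of Ad(s) b equal <Ad(s^T) k, b>. As S is stable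
    under transposition, they also expand Ad(s^T) k, and the sum over b reassembles s M s^-1 k^T
    inside the trace. *)
Lemma zop_act j M g v : sm v -> p g (zop j M v) = zop j (pr g *m M *m invmx (pr g)) (p g v).
Proof.
elim: j M => [|j IH] M hv /=.
 by rewrite repZ mxtrace_mulC mulmxA mulVmx ?mul1mx//; exact: lg_unit (cov_in CP g).
set s := pr g; have us : s \in unitmx by exact: lg_unit (cov_in CP g).
have hgv : sm (p g v) by exact: smooth_act_vec.
pose W b := zop j (s *m (M *m b^T) *m invmx s) (p g v).
transitivity (\sum_(b <- bs) \sum_(k <- bs) (mdot (s *m b *m invmx s) k)%:C *: dr k (W b)).
 rewrite rep_sum; apply: eq_big_seq => b /bs_in lb.
 rewrite (rep_dr CP hgam bs_orth bs_in bs_span)//; last exact: zop_smooth.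
 rewrite IH// -/(W b) (dr_basis CP hgam bs_orth bs_in bs_span)//; last exact: zop_smooth.
 exact: (lie_conj GS) (cov_in CP g) lb.
rewrite exchange_big /=; apply: eq_big_seq => k /bs_in lk.
pose Y := s^T *m k *m invmx s^T.
have lY : lie S Y.
 apply: (lie_conj GS) => //; case: SA => _ _ _ _; apply; exact: (cov_in CP).
have cf b : mdot (s *m b *m invmx s) k = mdot Y b.
 rewrite !mdot_tr /Y -[in RHS]mxtrace_tr !trmx_mul trmxK trmx_inv trmxK -!mulmxA.
 by rewrite mxtrace_mulC -!mulmxA.
have e1 : s *m M *m invmx s *m k^T = \sum_(b <- bs) mdot Y b *: (s *m (M *m b^T) *m invmx s).
 have eY : Y^T = \sum_(b <- bs) mdot Y b *: b^T.
  by rewrite {1}(bs_span lY) linear_sum; apply: eq_bigr => b _; rewrite linearZ.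
 transitivity (s *m (M *m Y^T) *m invmx s).
  by rewrite /Y !trmx_mul trmx_inv trmxK -!mulmxA mulmxV// mulmx1 !mulmxA.
 rewrite eY mulmx_sumr mulmx_sumr mulmx_suml; apply: eq_bigr => b _.
 by rewrite -!scalemxAr -scalemxAl.
rewrite e1 zop_sumM// dr_sum_seq//; last by move=> b bB; apply: smoothZ; exact: zop_smooth.
apply: eq_bigr => b _; rewrite cf (drvZ hgam)//; exact: zop_smooth.
Qed.

Lemma zop_scalar j : exists c : R[i], forall v, sm v -> zop j 1%:M v = c *: v.
Proof.
apply: (@schur_adjoint (zop j 1%:M) (zadj j 1%:M)).
- by move=> v; exact: zop_smooth.
- by move=> v; exact: zadj_smooth.
- by move=> v w; exact: zop_adj.
- move=> g v hv; rewrite zop_act// mulmx1 mulmxV//; exact: lg_unit (cov_in CP g).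
Qed.

End trace_operators.

(** * Orthonormal families and sums of rank one operators *)

Section orthonormal_families.
Variables (R : realType) (V : hilbertType R).
Implicit Types (es us : seq V).

Definition orthonormal es :=
 uniq es /\ forall e e', e \in es -> e' \in es -> inner e e' = (e == e')%:R :> R[i].

Definition oproj es (x : V) : V := \sum_(e <- es) inner x e *: e.

Definition subspace (D : V -> Prop) := D 0 /\ forall (a : R[i]) (x y : V), D x -> D y -> D (a *: x + y).

Lemma subspaceZ D a x : subspace D -> D x -> D (a *: x).
Proof. by move=> [D0 h] Dx; have := h a x 0 Dx D0; rewrite addr0. Qed.
Lemma subspaceD D x y : subspace D -> D x -> D y -> D (x + y).
Proof. by move=> [_ h] Dx Dy; have := h 1 x y Dx Dy; rewrite scale1r. Qed.
Lemma subspaceN D x : subspace D -> D x -> D (- x).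
Proof. by move=> hD Dx; rewrite -scaleN1r; exact: subspaceZ. Qed.
Lemma subspaceB D x y : subspace D -> D x -> D y -> D (x - y).
Proof. by move=> hD Dx Dy; apply: subspaceD => //; exact: subspaceN. Qed.
Lemma subspace_sum D (I : eqType) (r : seq I) (F : I -> V) : subspace D ->
 (forall i, i \in r -> D (F i)) -> D (\sum_(i <- r) F i).
Proof.
move=> hD h; rewrite big_seq; apply: (big_ind D) => //; first by case: hD.
by move=> x y; exact: subspaceD.
Qed.

Lemma rn_nat_eq1 (e : V) : inner e e = 1 :> R[i] -> rn e = 1.
Proof.
move=> /(congr1 (@Re R)); rewrite Re_inner_rn /= => h.
by apply/eqP; rewrite -(@eqrXn2 _ 2) ?rn_ge0// h expr1n.
Qed.

Lemma orthonormal_rn es e : orthonormal es -> e \in es -> rn e = 1.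
Proof. by move=> [_ h] ein; apply: rn_nat_eq1; rewrite h// eqxx. Qed.

Lemma inner_osum es (c : V -> R[i]) e : orthonormal es -> e \in es ->
 inner (\sum_(e' <- es) c e' *: e') e = c e.
Proof.
move=> [ues h] ein; rewrite inner_suml (bigD1_seq e)//= innerZl h// eqxx mulr1 big1_seq ?addr0//.
by move=> e' /andP[ne e'in]; rewrite innerZl h// (negbTE ne) mulr0.
Qed.

Lemma oproj_orth es x e : orthonormal es -> e \in es -> inner (x - oproj es x) e = 0.
Proof. by move=> oe ein; rewrite innerBl (inner_osum (inner x)) ?subrr. Qed.

Lemma oproj_sub es D x : subspace D -> (forall e, e \in es -> D e) -> D (oproj es x).
Proof. by move=> hD h; apply: subspace_sum => // e /h; exact: subspaceZ. Qed.

Lemma oproj_id es x : orthonormal es -> oproj es (oproj es x) = oproj es x.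
Proof.
by move=> oe; apply: eq_big_seq => e ein; rewrite (inner_osum (inner x)).
Qed.

Lemma oproj_lin es a x y : oproj es (a *: x + y) = a *: oproj es x + oproj es y.
Proof.
rewrite /oproj scaler_sumr -big_split /=; apply: eq_bigr => e _.
by rewrite innerDl innerZl scalerDl scalerA.
Qed.

Lemma oproj_sym es x y : inner (oproj es x) y = inner x (oproj es y).
Proof.
rewrite /oproj inner_suml inner_sumr; apply: eq_bigr => e _.
by rewrite innerZl innerZr mulrC; congr (_ * _); exact: innerC.
Qed.

Lemma parseval es (c : V -> R[i]) : orthonormal es ->
 rn (\sum_(e <- es) c e *: e) ^+ 2 = \sum_(e <- es) rn (c e) ^+ 2.
Proof.
move=> oe; rewrite -Re_inner_rn inner_sumr raddf_sum /=; apply: eq_big_seq => e ein.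
by rewrite innerZr (inner_osum c)// rn_sqr; case: (c e) => a b /=; ring.
Qed.

Lemma rn_oproj es x : orthonormal es -> rn (oproj es x) ^+ 2 = \sum_(e <- es) rn (inner x e) ^+ 2.
Proof. by move=> oe; rewrite /oproj (parseval (inner x)). Qed.

Lemma pythagoras es x : orthonormal es ->
 rn x ^+ 2 = rn (oproj es x) ^+ 2 + rn (x - oproj es x) ^+ 2.
Proof.
move=> oe; rewrite -{1}[x](subrK (oproj es x)) rn_sqrD addrC; set y := x - _.
suff -> : inner y (oproj es x) = 0 by rewrite /= mulr0 add0r addrC.
by rewrite /oproj inner_sumr big1_seq// => e /andP[_ ein]; rewrite innerZr oproj_orth// mulr0.
Qed.

Lemma bessel es x : orthonormal es -> \sum_(e <- es) rn (inner x e) ^+ 2 <= rn x ^+ 2.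
Proof. by move=> oe; rewrite -rn_oproj// (pythagoras x oe) lerDl sqr_ge0. Qed.

Lemma rn_oproj_le es x : orthonormal es -> rn (oproj es x) <= rn x.
Proof.
by move=> oe; rewrite -(@ler_pXn2r _ 2) ?nnegrE ?rn_ge0// rn_oproj// bessel.
Qed.

Lemma orthonormal_cons es y : orthonormal es -> rn y = 1 ->
 (forall e, e \in es -> inner y e = 0) -> orthonormal (y :: es).
Proof.
move=> [ues h] y1 hy; have yy : inner y y = 1 by rewrite inner_rn y1 expr1n.
have yn : y \notin es.
 by apply/negP => yin; have := hy y yin; rewrite yy => /eqP; rewrite oner_eq0.
split=> [|e e']; first by rewrite /= yn.
rewrite !inE => /orP[/eqP->|ein] /orP[/eqP->|e'in].
- by rewrite yy eqxx.
- by rewrite hy//; case: eqP => // ye; rewrite ye e'in in yn.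
- rewrite innerC hy// rmorph0; case: eqP => // ye; by rewrite -ye ein in yn.
- exact: h.
Qed.

Lemma gram_schmidt_step es x : orthonormal es -> x - oproj es x != 0 ->
 exists y : V, [/\ orthonormal (y :: es), exists a : R[i], y = a *: (x - oproj es x) &
  oproj (y :: es) x = x].
Proof.
set z := x - _ => oe z0; have rz : 0 < rn z by rewrite rn_gt0.
pose y := ((rn z)^-1)%:C *: z.
have ry : rn y = 1 by rewrite /y rnZ rn_real normfV gtr0_norm// mulVf// gt_eqF.
have hy e : e \in es -> inner y e = 0 by move=> ein; rewrite /y innerZl oproj_orth// mulr0.
have oy := orthonormal_cons oe ry hy; exists y; split => //; first by exists (((rn z)^-1)%:C).
rewrite /oproj big_cons -/(oproj es x).
have -> : inner x y = (rn z)%:C.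
 have -> : x = z + oproj es x by rewrite /z subrK.
 rewrite innerDl [X in _ + X](_ : _ = 0) ?addr0; last first.
  by rewrite /oproj inner_suml big1_seq// => e /andP[_ ein]; rewrite innerZl (innerC y e) hy// rmorph0 mulr0.
 rewrite /y innerZr_real inner_rn -rmorphM /=; congr (_%:C).
 by rewrite expr2 mulKf// gt_eqF.
by rewrite /y scalerA -rmorphM /= mulfV ?gt_eqF// scale1r /z subrK.
Qed.

Lemma oproj_cons_id es y x : orthonormal (y :: es) -> oproj es x = x -> oproj (y :: es) x = x.
Proof.
move=> oy hx; rewrite /oproj big_cons -/(oproj es x) hx.
suff -> : inner x y = 0 by rewrite scale0r add0r.
rewrite -hx /oproj inner_suml big1_seq// => e /andP[_ ein].
have [uy h] := oy; rewrite innerZl (h e y) ?inE ?eqxx ?ein ?orbT//.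
by case: eqP => [ey|]; [rewrite ey in ein; move: uy => /=; rewrite ein|rewrite mulr0].
Qed.

Lemma gram_schmidt es us (D : V -> Prop) : orthonormal es -> subspace D ->
 (forall e, e \in es -> D e) -> (forall u, u \in us -> D u) ->
 exists fs, [/\ orthonormal (fs ++ es), forall e, e \in fs -> D e,
  forall x, oproj es x = x -> oproj (fs ++ es) x = x &
  forall u, u \in us -> oproj (fs ++ es) u = u].
Proof.
move=> oe hD he; elim: us => [|u us IH] hu; first by exists [::].
have [v vin|fs [of_ hf hx hus]] := IH; first by apply: hu; rewrite inE vin orbT.
have [z0|z0] := eqVneq (u - oproj (fs ++ es) u) 0.
 exists fs; split => // v; rewrite inE => /orP[/eqP->|]; last exact: hus.
 by apply/esym/eqP; rewrite -subr_eq0 z0.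
have [y [oy [a ya] yu]] := gram_schmidt_step of_ z0.
exists (y :: fs); split => //.
- move=> e; rewrite inE => /orP[/eqP->|]; last exact: hf.
 rewrite ya; apply: subspaceZ => //; apply: subspaceB => //; first exact: hu (mem_head _ _).
 by apply: oproj_sub => // e'; rewrite mem_cat => /orP[/hf|/he].
- by move=> x /hx; exact: oproj_cons_id.
- move=> v; rewrite inE => /orP[/eqP->//|/hus]; exact: oproj_cons_id.
Qed.

Lemma onb_exists (D : V -> Prop) N : subspace D ->
 (forall es, orthonormal es -> (forall e, e \in es -> D e) -> (size es <= N)%N) ->
 exists es, [/\ orthonormal es, forall e, e \in es -> D e & forall x, D x -> oproj es x = x].
Proof.
move=> hD hN.
pose P m := `[< exists es, [/\ orthonormal es, forall e, e \in es -> D e & size es = m] >].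
have P0 : exists m, P m.
 by exists 0%N; apply/asboolP; exists [::]; split.
have Pb m : P m -> (m <= N)%N by move=> /asboolP[es [oe De <-]]; exact: hN.
case: (ex_maxnP P0 Pb) => m /asboolP[es [oe De sE]] mmax; exists es; split => // x Dx.
apply/esym/eqP; rewrite -subr_eq0; apply: contrapT => /negP z0.
have [y [oy [a ya] _]] := gram_schmidt_step oe z0.
suff : P m.+1 by move=> /mmax; rewrite ltnn.
apply/asboolP; exists (y :: es); split => //; last by rewrite /= sE.
move=> e; rewrite inE => /orP[/eqP->|]; last exact: De.
by rewrite ya; apply: subspaceZ => //; apply: subspaceB => //; exact: oproj_sub.
Qed.

End orthonormal_families.

Section rank_one_sums.
Variables (R : realType) (V : hilbertType R).
Implicit Types (d : seq (R * V)) (x y : V).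

Lemma sum_cauchy_schwarz (I : Type) (r : seq I) (a b : I -> R) :
 (\sum_(i <- r) a i * b i) ^+ 2 <= (\sum_(i <- r) a i ^+ 2) * (\sum_(i <- r) b i ^+ 2).
Proof.
elim: r => [|i r IH]; first by rewrite !big_nil expr0n mul0r.
rewrite !big_cons; move: IH.
have : 0 <= \sum_(j <- r) a j ^+ 2 by exact: sum_sqr_ge0.
have : 0 <= \sum_(j <- r) b j ^+ 2 by exact: sum_sqr_ge0.
move: (\sum_(j <- r) _) (\sum_(j <- r) _) (\sum_(j <- r) _) (a i) (b i) => A Q P u w Q0 P0 h.
suff : 2 * A * (u * w) <= P * u ^+ 2 + Q * w ^+ 2 by lra.
have h1 : 0 <= P * u ^+ 2 + Q * w ^+ 2 by apply: addr_ge0; apply: mulr_ge0 => //; exact: sqr_ge0.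
rewrite leNgt; apply/negP => h2.
have : (P * u ^+ 2 + Q * w ^+ 2) ^+ 2 < (2 * A * (u * w)) ^+ 2.
 by rewrite ltrXn2r// ?nnegrE// ltW// (le_lt_trans h1).
have h3 := sqr_ge0 (P * u ^+ 2 - Q * w ^+ 2).
have : (u * w) ^+ 2 * A ^+ 2 <= (u * w) ^+ 2 * (Q * P) by rewrite ler_wpM2l ?sqr_ge0.
by move: h3; rewrite !exprMn; lra.
Qed.

Definition rank1_sum d x : V := \sum_(a <- d) (a.1%:C * inner x a.2) *: a.2.
(** The Hilbert-Schmidt inner product of [rank1_sum d] and [rank1_sum d'], written through the
    vectors so that no trace over V has to converge. *)
Definition hs_form d d' : R := \sum_(a <- d) \sum_(b <- d') a.1 * b.1 * rn (inner a.2 b.2) ^+ 2.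

Lemma rank1_sum_lin d (a : R[i]) x y : rank1_sum d (a *: x + y) = a *: rank1_sum d x + rank1_sum d y.
Proof.
rewrite /rank1_sum scaler_sumr -big_split /=; apply: eq_bigr => c _.
by rewrite innerDl innerZl mulrDr scalerDl scalerA mulrCA.
Qed.

Lemma rank1_sum_sym d x y : inner (rank1_sum d x) y = inner x (rank1_sum d y).
Proof.
rewrite /rank1_sum inner_suml inner_sumr; apply: eq_bigr => a _.
rewrite innerZl -scalerA innerZr_real innerZr -mulrA; congr (_ * _); rewrite mulrC.
by congr (_ * _); exact: innerC.
Qed.

Lemma rank1_sum_form d x : inner (rank1_sum d x) x = (\sum_(a <- d) a.1 * rn (inner x a.2) ^+ 2)%:C.
Proof.
rewrite /rank1_sum inner_suml rmorph_sum /=; apply: eq_bigr => a _.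
rewrite innerZl -mulrA rmorphM; congr (_ * _); rewrite (innerC x a.2) rn_sqr.
by case: (inner x a.2) => u w; apply/eqP; rewrite eq_complex /=; apply/andP; split; apply/eqP; ring.
Qed.

(** Gram-Schmidt on the vectors of d gives a finite orthonormal family es whose span contains them,
    so the Hilbert-Schmidt norm is the sum of |T e|^2 over es; Cauchy-Schwarz and Bessel then bound
    the operator norm. *)
Lemma hs_bound d x : rn (rank1_sum d x) ^+ 2 <= hs_form d d * rn x ^+ 2.
Proof.
have hT : subspace (fun _ : V => True) by [].
have o0 : orthonormal ([::] : seq V) by [].
have [es [oe _ _ hes]] := @gram_schmidt R V [::] [seq a.2 | a <- d] _ o0 hT (fun _ _ => I) (fun _ _ => I).
have {}hes a : a \in d -> oproj es a.2 = a.2.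
 by move=> ad; have := hes a.2; rewrite cats0; apply; apply: map_f.
rewrite cats0 in oe.
have E a y : a \in d -> inner y a.2 = \sum_(e <- es) inner y e * inner e a.2.
 move=> ad; rewrite -{1}(hes a ad) -oproj_sym /oproj inner_suml; apply: eq_bigr => e _.
 by rewrite innerZl.
have qE : hs_form d d = \sum_(e <- es) rn (rank1_sum d e) ^+ 2.
 apply: (@complexI R); rewrite /hs_form rmorph_sum /= big_seq.
 under eq_bigr => a ad.
  rewrite rmorph_sum /= big_seq; under eq_bigr => b bd.
   have -> : (a.1 * b.1 * rn (inner a.2 b.2) ^+ 2)%:C =
     \sum_(e <- es) (a.1%:C * inner e a.2) * (b.1%:C * inner b.2 e * inner a.2 b.2).
    rewrite (eq_bigr (fun e => a.1%:C * b.1%:C * inner a.2 b.2 * (inner b.2 e * inner e a.2))); last by move=> e _; ring.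
    rewrite -mulr_sumr -(E a b.2 ad) rmorphM (rmorphM _ a.1) -[RHS]mulrA; congr (_ * _).
    rewrite (innerC a.2 b.2) rn_sqr; case: (inner a.2 b.2) => u w.
    by apply/eqP; rewrite eq_complex /=; apply/andP; split; apply/eqP; ring.
   over.
  over.
 rewrite -big_seq (eq_bigr (fun a => \sum_(b <- d) \sum_(e <- es)
   (a.1%:C * inner e a.2) * (b.1%:C * inner b.2 e * inner a.2 b.2))); last first.
  by move=> a _; rewrite -big_seq.
 under eq_bigr do rewrite exchange_big /=.
 rewrite exchange_big rmorph_sum /=; apply: eq_bigr => e _.
 rewrite -inner_rn {1}/rank1_sum inner_suml; apply: eq_bigr => a _.
 rewrite innerZl /rank1_sum inner_sumr mulr_sumr; apply: eq_bigr => b _.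
 rewrite -[(_ * inner e b.2) *: b.2]scalerA innerZr_real innerZr; set q := inner e a.2.
 set q1 := inner a.2 b.2; have -> : inner b.2 e = (inner e b.2)^* by exact: innerC.
 by rewrite -[_ * q1]mulrA.
have TE : rank1_sum d x = \sum_(e <- es) inner x e *: rank1_sum d e.
 rewrite /rank1_sum big_seq; under eq_bigr => a ad do rewrite (E a x ad) mulr_sumr scaler_suml.
 rewrite -big_seq exchange_big /=; apply: eq_bigr => e _; rewrite scaler_sumr.
 by apply: eq_bigr => a _; rewrite scalerA mulrCA.
have h1 : rn (rank1_sum d x) <= \sum_(e <- es) rn (inner x e) * rn (rank1_sum d e).
 by rewrite TE; apply: le_trans (rn_sum _ _ _) _; apply: ler_sum => e _; rewrite rnZ.
apply: (@le_trans _ _ ((\sum_(e <- es) rn (inner x e) * rn (rank1_sum d e)) ^+ 2)).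
 by rewrite lerXn2r ?nnegrE ?rn_ge0// sumr_ge0// => e _; rewrite mulr_ge0 ?rn_ge0.
apply: le_trans (sum_cauchy_schwarz _ _ _) _; rewrite qE mulrC ler_wpM2l ?bessel//.
by apply: sumr_ge0 => e _; exact: sqr_ge0.
Qed.

Lemma hs_form_catl d1 d2 d : hs_form (d1 ++ d2) d = hs_form d1 d + hs_form d2 d.
Proof. by rewrite /hs_form big_cat. Qed.
Lemma hs_formC d d' : hs_form d d' = hs_form d' d.
Proof.
rewrite /hs_form exchange_big; apply: eq_bigr => a _; apply: eq_bigr => b _.
by rewrite innerC rn_conj mulrAC mulrC mulrA.
Qed.
Definition scale1 (c : R) d : seq (R * V) := [seq (c * a.1, a.2) | a <- d].
Lemma hs_form_scalel c d d' : hs_form (scale1 c d) d' = c * hs_form d d'.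
Proof.
rewrite /hs_form big_map mulr_sumr; apply: eq_bigr => a _ /=.
by rewrite mulr_sumr; apply: eq_bigr => b _; rewrite !mulrA.
Qed.
Lemma rank1_sum_cat d1 d2 x : rank1_sum (d1 ++ d2) x = rank1_sum d1 x + rank1_sum d2 x.
Proof. by rewrite /rank1_sum big_cat. Qed.
Lemma rank1_sum_scale c d x : rank1_sum (scale1 c d) x = c%:C *: rank1_sum d x.
Proof.
rewrite /rank1_sum big_map scaler_sumr; apply: eq_bigr => a _ /=.
by rewrite rmorphM -mulrA scalerA.
Qed.

(* Parallelogram identity of the Hilbert-Schmidt norm. *)
Lemma rank1_sum_diff d d' x :
 rn (rank1_sum d x - rank1_sum d' x) ^+ 2 <= 2 * rn x ^+ 2 *
 (hs_form d d + hs_form d' d' - 2 * hs_form (scale1 2^-1 (d ++ d')) (scale1 2^-1 (d ++ d'))).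
Proof.
have := hs_bound (d ++ scale1 (-1) d') x.
rewrite rank1_sum_cat rank1_sum_scale rmorphN1 scaleN1r => h; apply: (le_trans h).
rewrite !hs_form_scalel (hs_formC _ (scale1 _ _)) !hs_form_scalel !hs_form_catl.
rewrite !(hs_formC _ (_ ++ _)) !hs_form_catl !hs_form_scalel !(hs_formC _ (scale1 _ _)) !hs_form_scalel.
rewrite (hs_formC d' d) le_eqVlt; by apply/orP; left; apply/eqP; field.
Qed.

End rank_one_sums.

(** * The maximal compact subgroup *)

Section maximal_compact.
Variables (R : realType) (n : nat) (G : topGroupType).
Variables (S : set 'M[R]_n) (pr : G -> 'M[R]_n).
Hypotheses (SA : self_adjoint_algebraic_group S) (CP : covering S pr).
Let GS : linear_group S := cov_group CP.

Lemma orth_mulT (s : 'M[R]_n) : orth_part S s -> s *m s^T = 1%:M.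
Proof. by move=> [_ h]; exact: mulmx1C. Qed.

Lemma orth_inv (s : 'M[R]_n) : orth_part S s -> invmx s = s^T.
Proof.
move=> [Ss h]; have us := lg_unit GS Ss.
by rewrite -[LHS]mul1mx -h mulmxK.
Qed.

Lemma orth_entry (s : 'M[R]_n) i j : orth_part S s -> `|s i j| <= 1.
Proof.
move=> [_ /matrixP/(_ j j)]; rewrite !mxE eqxx [true%:R]/(1 : R) => h.
rewrite -(@ler_pXn2r _ 2) ?nnegrE// expr1n -h (bigD1 i)//= mxE real_normK ?num_real// expr2 lerDl.
by apply: sumr_ge0 => k _; rewrite mxE -expr2 sqr_ge0.
Qed.

Lemma orth_mnorm (s : 'M[R]_n) : orth_part S s -> mnorm s <= n%:R ^+ 2.
Proof. by move=> hs; rewrite -[leRHS]mulr1; apply: mnorm_le => i j; exact: orth_entry. Qed.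

Lemma orth_linear_group : linear_group (orth_part S).
Proof.
have [_ _ _ _ ST] := SA; split.
- by move=> s [Ss _]; exact: lg_unit Ss.
- by split; [exact: lg1|rewrite trmx1 mul1mx].
- move=> s u [Ss hs] [Su hu]; split; first exact: lgM.
 by rewrite trmx_mul -mulmxA (mulmxA s^T) hs mul1mx.
- move=> s hs; have [Ss _] := hs; split; first exact: lgV.
 by rewrite orth_inv// trmxK orth_mulT.
- move=> A uA hA; split.
  by apply: (lg_closed GS) => // e e0; have [s [Ss _] sA] := hA e e0; exists s.
 apply/eqP; rewrite -subr_eq0; apply/eqP/mnorm_eq0/eqP; rewrite eq_le mnorm_ge0 andbT.
 apply/ler_addgt0Pr => e e0; rewrite add0r.
 have c0 : 0 < n%:R ^+ 2 + mnorm A + 1 by rewrite ltr_wpDl// addr_ge0 ?mnorm_ge0.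
 have [s hs sA] := hA _ (divr_gt0 e0 c0).
 have -> : A^T *m A - 1%:M = (A - s)^T *m A + s^T *m (A - s).
  by rewrite linearB /= mulmxBl mulmxBr hs.2 addrA subrK.
 apply: le_trans (mnormD _ _) _; apply: (le_trans (lerD (mnormM _ _) (mnormM _ _))).
 rewrite !mnorm_tr mnorm_distC; move: sA; rewrite ltr_pdivlMr//.
 have := orth_mnorm hs; have := mnorm_ge0 A; have := mnorm_ge0 (s - A); have := mnorm_ge0 s.
 move: (mnorm _) (mnorm _) (mnorm _) (n%:R ^+ 2) => a b c d; nra.
Qed.

Lemma mexp_inj (X Y : 'M[R]_n) : (forall t : R, mexp (t *: X) = mexp (t *: Y)) -> X = Y.
Proof.
move=> h; apply/eqP; rewrite -subr_eq0; apply/eqP/mnorm_eq0/eqP; rewrite eq_le mnorm_ge0 andbT.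
apply/ler_addgt0Pr => e e0; rewrite add0r.
have [t [t0 _ t1 ht]] := pick_small (mexp_c2 X + mexp_c2 Y) e0.
have nt : `|t| = t by rewrite gtr0_norm.
have h1 := @mexp_est2 R n X t; have h2 := @mexp_est2 R n Y t.
rewrite nt in h1 h2; have {}h1 := h1 t1; have {}h2 := h2 t1.
have : t * mnorm (X - Y) <= e * t.
 rewrite -{1}nt -mnormZ.
 have -> : t *: (X - Y) = (mexp (t *: Y) - 1%:M - t *: Y) - (mexp (t *: X) - 1%:M - t *: X).
  have aux (a b c d : 'M[R]_n) : t *: (a - b) = c - d - t *: b - (c - d - t *: a).
   by apply/matrixP => i j; rewrite !mxE; ring.
  by rewrite h; exact: aux.
 apply: le_trans (mnormB _ _) _; apply: (le_trans (lerD h2 h1)).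
 by rewrite -mulrDl addrC expr2 mulrA ler_wpM2r// ltW.
by rewrite mulrC ler_pM2r.
Qed.

(** Orthogonality of e^(tX) for all t says that X^T and - X have the same exponentials, and these
    determine the matrix. *)
Lemma lie_orth (X : 'M[R]_n) : lie (orth_part S) X <-> lie_k S X.
Proof.
split=> [h|[lX XT] t].
 split; first by move=> t; case: (h t).
 apply: mexp_inj => t; rewrite -linearZ /= -mexp_tr -(orth_inv (h t)) invmx_mexp.
 by rewrite scaleNr scalerN.
split; first exact: lX.
by rewrite mexp_tr linearZ /= XT scalerN -scaleNr -mexpD addNr scale0r mexp0.
Qed.

Definition inK (g : G) := orth_part S (pr g).

Lemma inK1 : inK 1%g.
Proof. by rewrite /inK (cov1 CP); exact: lg1 orth_linear_group. Qed.
Lemma inKM g h : inK g -> inK h -> inK (g * h)%g.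
Proof. by rewrite /inK (covM CP); exact: lgM orth_linear_group _ _. Qed.
Lemma inKV g : inK g -> inK g^-1%g.
Proof. by rewrite /inK (covV CP); exact: lgV orth_linear_group _. Qed.

(* Cells of mesh 1/N on the bounded set of orthogonal matrices, times the finite
  kernel of the covering. *)
Lemma K_net (U : set G) : nbhs (1%g : G) U -> exists2 C : R, 0 <= C & forall r : R, 0 < r <= 1 ->
 exists ks : seq G, [/\ forall k, k \in ks -> inK k, (size ks)%:R <= C * r^-1 ^+ (n * n) &
  forall k, inK k -> exists k' u, [/\ k' \in ks, U u, inK u, mnorm (pr u - 1%:M) < r &
   k = (k' * u)%g]].
Proof.
move=> hU; have [r0 r00 hr0] := cov_lift CP hU.
have [ker kerE] : exists ker : seq G, forall z, pr z = 1%:M -> z \in ker.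
 have /finite_seqP[s sE] := cov_ker CP; exists s => z hz.
 by have : [set` s] z by rewrite -sE.
pose m := Num.min r0 1; have m0 : 0 < m by rewrite lt_min r00 ltr01.
have m1 : m <= 1 by rewrite ge_min lexx orbT.
(* For two orthogonal matrices k, k' in one cell of mesh 1/N, |k'^-1 k - 1| <= n^4 / N: the factor
   n^2 bounds |k'^T| and n^2 / N bounds |k - k'|. N is taken just above n^4 / (m r). *)
pose D : R := (n ^ 4)%:R / m + 1.
have D0 : 0 < D by rewrite ltr_wpDl// divr_ge0// ltW.
exists ((size ker)%:R * (4 * D) ^+ (n * n)) => [|r /andP[rp r1]].
 by rewrite mulr_ge0// exprn_ge0// mulr_ge0// ltW.
pose N := (Num.truncn ((n ^ 4)%:R / (m * r))).+1.
have mr0 : 0 < m * r by rewrite mulr_gt0.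
have hN : (n ^ 4)%:R / N%:R < m * r.
 have q0 : 0 <= (n ^ 4)%:R / (m * r) by rewrite divr_ge0// ltW.
 have /andP[_ h] := truncn_itv q0.
 by rewrite ltr_pdivrMr ?ltr0n// mulrC -ltr_pdivrMr.
have NC : N%:R <= D / r.
 have q0 : 0 <= (n ^ 4)%:R / (m * r) by rewrite divr_ge0// ltW.
 have /andP[h _] := truncn_itv q0.
 rewrite /N -natr1 /D mulrDl mul1r lerD//; first by rewrite -mulrA -invfM.
 by rewrite invf_ge1.
pose cell (A : 'M[R]_n) (i j : 'I_n) := Num.truncn ((A i j + 1) * N%:R).
have cellB (A : 'M[R]_n) i j : orth_part S A -> (cell A i j < (2 * N).+1)%N.
 move=> hA; have := orth_entry i j hA; rewrite ler_norml => /andP[a1 a2].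
 have q0 : 0 <= (A i j + 1) * N%:R by rewrite mulr_ge0//; lra.
 have /andP[h _] := truncn_itv q0; rewrite ltnS -(@ler_nat R) natrM.
 by apply: (le_trans h); rewrite ler_wpM2r//; lra.
pose cl (A : 'M[R]_n) : {ffun 'I_n * 'I_n -> 'I_(2 * N).+1} := [ffun ij => inord (cell A ij.1 ij.2)].
(* A cell that meets K is represented by one of its points, an empty cell by 1. *)
have [rep hrep] : exists rep : {ffun 'I_n * 'I_n -> 'I_(2 * N).+1} -> G, forall c,
  inK (rep c) /\ forall k, inK k -> cl (pr k) = c -> cl (pr (rep c)) = c.
 have h (c : {ffun 'I_n * 'I_n -> 'I_(2 * N).+1}) : exists g, inK g /\ forall k, inK k -> cl (pr k) = c -> cl (pr g) = c.
  have [[k [hk ck]]|ne] := pselect (exists k, inK k /\ cl (pr k) = c); first by exists k.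
  exists 1%g; split; first exact: inK1.
  by move=> k hk ck; case: ne; exists k.
 by have [f hf] := choice h; exists f.
pose ks := [seq (rep c * z)%g | c <- enum {: {ffun 'I_n * 'I_n -> 'I_(2 * N).+1}}, z <- [seq z <- ker | `[< pr z = 1%:M >] ]].
exists ks; split.
- move=> k /allpairsP[[c z] /= [_ hz ->]]; apply: inKM; first by case: (hrep c).
 move: hz; rewrite mem_filter => /andP[/asboolP hz _].
 by rewrite /inK hz; exact: lg1 orth_linear_group.
- rewrite size_allpairs -cardE card_ffun card_prod !card_ord natrM mulrC.
 rewrite -mulrA ler_pM ?ler_nat ?size_filter ?count_size// natrX -exprMn.
 rewrite lerXn2r ?nnegrE ?mulr_ge0 ?invr_ge0 ?(ltW D0) ?(ltW rp)//.
 have : (2 * N).+1%:R <= 4 * N%:R :> R.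
  by rewrite -natrM ler_nat /N; move: (Num.truncn _) => q; clear; lia.
 by move=> h; apply: (le_trans h); rewrite -mulrA ler_wpM2l.
move=> k hk; pose c := cl (pr k); have [hg hc] := hrep c; have {}hc := hc k hk erefl.
pose h := ((rep c)^-1 * k)%g.
have hKh : inK h by apply: inKM => //; exact: inKV.
have small : mnorm (pr h - 1%:M) < m * r.
 apply: le_lt_trans hN; rewrite /h (covM CP) (covV CP) (orth_inv hg).
 have -> : (pr (rep c))^T *m pr k - 1%:M = (pr (rep c))^T *m (pr k - pr (rep c)).
  by rewrite mulmxBr hg.2.
 apply: le_trans (mnormM _ _) _; rewrite mnorm_tr.
 have -> : (n ^ 4)%:R / N%:R = n%:R ^+ 2 * (n%:R ^+ 2 * N%:R^-1) :> R.
  by rewrite natrX (_ : 4 = 2 + 2)%N// exprD mulrA.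
 rewrite ler_pM ?mnorm_ge0 ?orth_mnorm//; apply: mnorm_le => i j.
 have e : cell (pr k) i j = cell (pr (rep c)) i j.
  have /ffunP/(_ (i, j)) := hc; rewrite /c !ffunE /= => /(congr1 (@nat_of_ord _)).
  by rewrite !inordK ?cellB// => ->.
 have nonneg (A : 'M[R]_n) : orth_part S A -> 0 <= (A i j + 1) * N%:R.
  move=> hA; rewrite mulr_ge0//; have := orth_entry i j hA; rewrite ler_norml => /andP[]; lra.
 have /andP[k1 k2] := truncn_itv (nonneg _ hk); have /andP[k3 k4] := truncn_itv (nonneg _ hg).
 rewrite -/(cell _ i j) e in k1 k2; rewrite -/(cell _ i j) in k3 k4.
 have N0 : 0 < N%:R :> R by rewrite ltr0n.
 rewrite [_ i j]mxE [X in _ + X]mxE -(@ler_pM2r _ N%:R)// mulVf ?gt_eqF//.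
 rewrite -{1}(ger0_norm (ltW N0)) -normrM ler_norml; rewrite -natr1 in k2 k4.
 apply/andP; split; lra.
have mr : m * r <= r by rewrite ler_piMl// ltW.
have mr' : m * r <= r0.
 apply: (@le_trans _ _ m); first by rewrite ler_piMr// ltW.
 by rewrite ge_min lexx.
have [u Uu pu] := hr0 (pr h) (cov_in CP h) (lt_le_trans small mr').
pose z := (h * u^-1)%g.
have hz : pr z = 1%:M.
 by rewrite /z (covM CP) (covV CP) pu mulmxV//; exact: lg_unit (cov_in CP h).
exists (rep c * z)%g, u; split => //.
- apply/allpairsP; exists (c, z); split => //=; first by rewrite mem_enum.
 by rewrite mem_filter kerE// andbT; exact/asboolP.
- by rewrite /inK pu.
- by rewrite pu; exact: lt_le_trans small mr.
- by rewrite /z /h -!mulgA mulVg mulg1 mulVKg.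
Qed.

End maximal_compact.

(** * Averages of rank one operators over the maximal compact subgroup *)

Section averaging.
Variables (R : realType) (n : nat) (G : topGroupType).
Variables (S : set 'M[R]_n) (pr : G -> 'M[R]_n) (gam : 'M[R]_n -> R -> G).
Hypotheses (SA : self_adjoint_algebraic_group S) (CP : covering S pr) (hgam : lifting S pr gam).
Variables (V : hilbertType R) (p : unitary_rep G V).
Let GS : linear_group S := cov_group CP.
Notation sm := (smooth_vector p).
Notation inK := (inK S pr).
Variable bs : seq 'M[R]_n.
Hypotheses (bs_orth : morthonormal bs) (bs_in : forall b, b \in bs -> lie S b)
 (bs_span : forall X, lie S X -> X = \sum_(b <- bs) mdot X b *: b).
Hypothesis sm_dense : dense_in sm.
Notation dr := (dr gam p).
Variable v : V.
Hypotheses (sv : sm v) (v0 : v != 0).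

(** Finitely supported probability measures on K. *)
Let conv (s : seq (R * G)) := (forall a, a \in s -> 0 <= a.1 /\ inK a.2) /\ \sum_(a <- s) a.1 = 1.
Let vec (s : seq (R * G)) : seq (R * V) := [seq (a.1, p a.2 v) | a <- s].
Let T s x := rank1_sum (vec s) x.
Let J s := hs_form (vec s) (vec s).
Let mid (s s' : seq (R * G)) := [seq (2^-1 * a.1, a.2) | a <- s ++ s'].

Let vec_mid s s' : vec (mid s s') = scale1 2^-1 (vec s ++ vec s').
Proof. by rewrite /vec /mid /scale1 -map_cat -!map_comp. Qed.

Let conv_mid s s' : conv s -> conv s' -> conv (mid s s').
Proof.
move=> [h1 h2] [h1' h2']; split; last first.
 rewrite big_map -mulr_sumr big_cat /= h2 h2'; lra.
move=> _ /mapP[a ain ->] /=; suff [a0 ak] : 0 <= a.1 /\ inK a.2 by rewrite mulr_ge0// invr_ge0.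
by move: ain; rewrite mem_cat => /orP[/h1|/h1'].
Qed.

Let T_diff s s' x : rn (T s x - T s' x) ^+ 2 <= 2 * rn x ^+ 2 * (J s + J s' - 2 * J (mid s s')).
Proof. by rewrite /J vec_mid; exact: rank1_sum_diff. Qed.

Let shift k (s : seq (R * G)) := [seq (a.1, (k * a.2)%g) | a <- s].

Let conv_shift k s : inK k -> conv s -> conv (shift k s).
Proof.
move=> hk [h1 h2]; split; last by rewrite big_map.
by move=> _ /mapP[a ain ->] /=; have [a0 ak] := h1 a ain; split => //; exact: inKM.
Qed.

Let J_shift k s : J (shift k s) = J s.
Proof.
rewrite /J /hs_form !big_map; apply: eq_bigr => a _; rewrite !big_map.
by apply: eq_bigr => b _ /=; rewrite !repM rep_inner.
Qed.

Let T_shift k s x : T (shift k s) (p k x) = p k (T s x).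
Proof.
rewrite /T /rank1_sum !big_map rep_sum; apply: eq_bigr => a _ /=.
by rewrite repM rep_inner repZ.
Qed.

Let J_ge0 s : conv s -> 0 <= J s.
Proof.
move=> [h _]; rewrite /J /hs_form !big_map big_seq; apply: sumr_ge0 => a ain.
rewrite big_map big_seq; apply: sumr_ge0 => b bin /=.
by rewrite mulr_ge0 ?sqr_ge0// mulr_ge0//; [case: (h a ain)|case: (h b bin)].
Qed.

Let conv1 : conv [:: (1, 1%g)].
Proof.
split; last by rewrite big_seq1.
by move=> a; rewrite inE => /eqP -> /=; split => //; exact: (inK1 SA CP).
Qed.

Let T_bound s x : conv s -> rn (T s x) <= rn v ^+ 2 * rn x.
Proof.
move=> [h h1]; rewrite /T /rank1_sum big_map; apply: le_trans (rn_sum _ _ _) _.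
rewrite -[leRHS]mul1r -h1 mulr_suml; apply: ler_sum_seq => a ain.
have [a0 _] := h a ain; rewrite rnZ rnM rn_real ger0_norm// rep_rn -mulrA ler_wpM2l//.
rewrite expr2 -mulrA mulrC ler_wpM2l ?rn_ge0// mulrC.
by apply: le_trans (rn_inner_le _ _) _; rewrite rep_rn.
Qed.

(** [T s] is the average over s of the operators <., k v> k v. By the parallelogram identity,
    operators whose Hilbert-Schmidt norm is close to the infimum m are close to each other in
    operator norm, so all near-minimizers share one limit A. *)
Lemma average_exists : exists A : V -> V, exists m : R, [/\ forall s, conv s -> m <= J s,
 forall e : R, 0 < e -> exists s, conv s /\ J s <= m + e &
 forall s e, 0 <= e -> conv s -> J s <= m + e -> forall x, rn (T s x - A x) ^+ 2 <= 2 * e * rn x ^+ 2].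
Proof.
have [m [x [hm hx]]] := @min_seq R _ conv J 0 (ex_intro _ _ conv1) J_ge0.
have hA y : exists w, rcvg (fun k => T (x k) y) w.
 apply: (min_cvg (phi := fun s => T s y) hm _ hx conv_mid) => [|s s' hs hs'].
  by apply: (@mulr_ge0 R 2 (rn y ^+ 2)); rewrite ?sqr_ge0.
 exact: T_diff.
have [A {}hA] := choice hA; exists A, m; split=> [//|e e0|s e e0 hs Js y].
 have [N hN] := invS_small e0; exists (x N); have [h1 h2] := hx N; split => //.
 by apply: (le_trans h2); rewrite lerD2l ltW// hN.
(* The comparison goes through a late term of the minimizing sequence, at the price of d; the next
   lines let d tend to 0 under the square root. *)
suff h d : 0 < d -> rn (T s y - A y) <= Num.sqrt (2 * (e + d) * rn y ^+ 2) + d.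
 have pos (a b : R) : 0 <= a -> 0 <= 2 * a * b ^+ 2.
  by move=> a0; apply: mulr_ge0; [exact: mulr_ge0|exact: sqr_ge0].
 have e1 := pos e (rn y) e0.
 apply/ler_addgt0Pr => d d0; pose B := rn y ^+ 2.
 have B0 : 0 <= B by exact: sqr_ge0.
 rewrite leNgt; apply/negP => hlt.
 have f0 : 0 <= rn (T s y - A y) by exact: rn_ge0.
 have c0 : 0 < 2 * B + 1 + 2 * rn (T s y - A y) + 1.
  by lra.
 pose d' := Num.min 1 (d / (2 * B + 1 + 2 * rn (T s y - A y) + 1)).
 have d'0 : 0 < d' by rewrite lt_min ltr01 divr_gt0.
 have d'1 : d' <= 1 by rewrite ge_min lexx.
 have d'd : d' * (2 * B + 1 + 2 * rn (T s y - A y) + 1) <= d.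
  by rewrite -ler_pdivlMr// ge_min lexx orbT.
 have := h d' d'0; rewrite -lerBlDr => h1.
 have g0 := pos _ (rn y) (addr_ge0 e0 (ltW d'0)).
 have [q0|q0] := leP 0 (rn (T s y - A y) - d').
  have := lerXn2r 2 q0 (sqrtr_ge0 _) h1; rewrite sqr_sqrtr//.
  by move: hlt d'd B0 f0; rewrite -/B; move: (rn (T s y - A y)) => f; nra.
 by move: hlt q0 e1 d'd B0 f0; rewrite -/B; move: (rn (T s y - A y)) => f; nra.
move=> d0; have [N hN] := hA y d d0; have [M hM] := invS_small d0.
have h1 := hN (N + M)%N (leq_addr _ _); have h2 := hM (N + M)%N (leq_addl _ _).
apply: le_trans (rn_dist_triangle (T (x (N + M)%N) y) _ _) _; rewrite lerD//; last exact: ltW.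
have [c1 c2] := hx (N + M)%N.
rewrite -[leLHS]ger0_norm ?rn_ge0// -sqrtr_sqr ler_wsqrtr//.
apply: (le_trans (T_diff _ _ _)); rewrite [leLHS]mulrAC ler_wpM2r ?sqr_ge0// ler_wpM2l//.
have := hm _ (conv_mid hs c1); move: h2 c2; set q := _^-1; lra.
Qed.

Let rn_lim0 (x : V) (c : R) : (forall e : R, 0 < e -> rn x ^+ 2 <= e * c) -> x = 0.
Proof.
move=> h; apply/eqP; rewrite -rn_eq0 -sqrf_eq0 eq_le sqr_ge0 andbT.
apply/ler_addgt0Pr => e e0; rewrite add0r; have c0 : 0 < `|c| + 1 by rewrite ltr_wpDl.
apply: (le_trans (h _ (divr_gt0 e0 c0))); rewrite mulrAC -mulrA ler_piMr ?(ltW e0)//.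
by rewrite ler_pdivrMr// mul1r; apply: le_trans (ler_norm _) _; rewrite lerDl.
Qed.

(** Translating a measure by k in K keeps the Hilbert-Schmidt norm, so near-minimizers go to
    near-minimizers, and these have the same limit; this is why A commutes with K. *)
Lemma average_operator : exists A : V -> V,
 [/\ forall a x y, A (a *: x + y) = a *: A x + A y, forall x y, inner (A x) y = inner x (A y),
  forall k x, inK k -> A (p k x) = p k (A x) &
  forall e : R, 0 < e -> exists2 s : seq (R * G),
   (forall a, a \in s -> 0 <= a.1 /\ inK a.2) /\ \sum_(a <- s) a.1 = 1 &
   forall x, rn (rank1_sum [seq (a.1, p a.2 v) | a <- s] x - A x) <= e * rn x].
Proof.
have [A [m [hm hex hA]]] := average_exists.
have app (e : R) : 0 < e -> exists2 s, conv s & forall x, rn (T s x - A x) <= e * rn x.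
 move=> e0; have e1 : 0 < e ^+ 2 / 2 by rewrite divr_gt0// exprn_gt0.
 have [s [cs Js]] := hex _ e1; exists s => // x.
 rewrite -(@ler_pXn2r _ 2) ?nnegrE ?mulr_ge0 ?rn_ge0 ?(ltW e0)// exprMn.
 have := hA s _ (ltW e1) cs Js x; have -> : 2 * (e ^+ 2 / 2) = e ^+ 2 by field.
 exact.
have A_lin a x y : A (a *: x + y) = a *: A x + A y.
 apply/eqP; rewrite -subr_eq0; apply/eqP.
 apply: (@rn_lim0 _ ((rn (a *: x + y) + rn a * rn x + rn y) ^+ 2)) => e e0.
 pose f := Num.sqrt e; have f0 : 0 < f by rewrite sqrtr_gt0.
 have [s cs hs] := app f f0.
 rewrite -[e]sqr_sqrtr ?(ltW e0)// -exprMn lerXn2r ?nnegrE ?rn_ge0//.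
  by rewrite mulr_ge0 ?addr_ge0 ?mulr_ge0 ?rn_ge0// ltW.
 have -> : A (a *: x + y) - (a *: A x + A y) = a *: (T s x - A x) + (T s y - A y)
   - (T s (a *: x + y) - A (a *: x + y)).
  by rewrite /T rank1_sum_lin; lmod R V.
 apply: le_trans (rnB _ _) _; apply: (le_trans (lerD (rnD _ _) (hs _))).
 rewrite rnZ; have h1 : rn a * rn (T s x - A x) <= rn a * (f * rn x) by rewrite ler_wpM2l ?rn_ge0.
 have := hs y; rewrite -/f; nra.
have A_sym x y : inner (A x) y = inner x (A y).
 apply: rn_dist_eq => e e0.
 have c0 : 0 < 2 * (rn x * rn y) + 1 by rewrite ltr_wpDl// mulr_ge0// mulr_ge0 ?rn_ge0.
 have [s cs hs] := app _ (divr_gt0 e0 c0).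
 have -> : inner (A x) y - inner x (A y) = inner x (T s y - A y) - inner (T s x - A x) y.
  by rewrite innerBl innerBr rank1_sum_sym; ring.
 apply: le_trans (rnB _ _) _; apply: (le_trans (lerD (rn_inner_le _ _) (rn_inner_le _ _))).
 have h1 := ler_wpM2l (rn_ge0 x) (hs y); have h2 := ler_wpM2r (rn_ge0 y) (hs x).
 apply: (le_trans (lerD h1 h2)).
 have -> : rn x * (e / (2 * (rn x * rn y) + 1) * rn y) + e / (2 * (rn x * rn y) + 1) * rn x * rn y =
  e * ((2 * (rn x * rn y)) / (2 * (rn x * rn y) + 1)) by field; rewrite gt_eqF.
 by rewrite ler_piMr ?(ltW e0)// ler_pdivrMr// mul1r lerDl.
have A_act k x : inK k -> A (p k x) = p k (A x).
 move=> hk; apply/eqP; rewrite -subr_eq0; apply/eqP.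
 apply: (@rn_lim0 _ (8 * rn x ^+ 2)) => e e0.
 have [s [cs Js]] := hex e e0.
 have := hA _ e (ltW e0) (conv_shift hk cs) (_ : J (shift k s) <= m + e).
 rewrite J_shift => /(_ Js (p k x)); rewrite T_shift rep_rn => h1.
 have h2 := hA _ e (ltW e0) cs Js x.
 have -> : A (p k x) - p k (A x) = p k (T s x - A x) - (p k (T s x) - A (p k x)) by rewrite repB; lmod R V.
 have h3 := parallelogram (p k (T s x - A x)) (p k (T s x) - A (p k x)).
 rewrite rep_rn in h3; have h4 := sqr_ge0 (rn (p k (T s x - A x) + (p k (T s x) - A (p k x)))).
 lra.
by exists A.
Qed.

(** The space is the top eigenspace of A. A is positive, nonzero and a norm limit of finite rank
    operators, so the eigenspace is nonzero; a trace bound makes it finite-dimensional; its vectors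
    are smooth because A w is a limit of combinations of the p k v, on which words are bounded
    uniformly in k. *)
Lemma finite_dim_K_invariant : exists ws : seq V, [/\ orthonormal ws, ws != [::],
 forall w, w \in ws -> sm w &
 forall k w, inK k -> oproj ws w = w -> oproj ws (p k w) = p k w].
Proof.
have [A [A_lin A_sym A_act app]] := average_operator.
have A_B x y : A (x - y) = A x - A y.
 by have := A_lin (-1) y x; rewrite !scaleN1r addrC (addrC (- A y)).
have A_Z a x : A (a *: x) = a *: A x.
 have A0 : A 0 = 0 by have := A_B 0 0; rewrite !subrr.
 by have := A_lin a x 0; rewrite A0 !addr0.
have A_ge0 x : 0 <= Re (inner (A x) x).
 apply/ler_addgt0Pr => e e0; have c0 : 0 < rn x ^+ 2 + 1 by rewrite ltr_wpDl ?sqr_ge0.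
 have [s cs hs] := app _ (divr_gt0 e0 c0).
 have h1 : 0 <= Re (inner (T s x) x).
  rewrite rank1_sum_form /= big_map big_seq; apply: sumr_ge0 => a ain /=.
  by rewrite mulr_ge0 ?sqr_ge0//; case: cs => h _; case: (h a ain).
 have h2 : Re (inner (T s x - A x) x) <= e.
  apply: le_trans (Re_inner_le _ _) _; apply: (le_trans (ler_wpM2r (rn_ge0 x) (hs x))).
  rewrite -mulrA -expr2 mulrAC -mulrA ler_piMr ?(ltW e0)//.
  by rewrite ler_pdivrMr// mul1r lerDl.
 by move: h2; rewrite innerBl raddfB /=; lra.
have A_bound x : rn (A x) <= rn v ^+ 2 * rn x.
 apply/ler_addgt0Pr => e e0; have c0 : 0 < rn x + 1 by rewrite ltr_wpDl ?rn_ge0.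
 have [s cs hs] := app _ (divr_gt0 e0 c0).
 rewrite -[A x](subKr (T s x)); apply: le_trans (rnB _ _) _.
 rewrite lerD ?T_bound//; apply: (le_trans (hs x)).
 by rewrite mulrAC -mulrA ler_piMr ?(ltW e0)// ler_pdivrMr// mul1r lerDl.
(* A is not 0: each k in K is close to one of finitely many net points, so the sum over the net of
   the forms of [T s] at the translates of v is at least (|v|^2 / 2)^2, whatever s. *)
have [y0 hy0] : exists y, 0 < Re (inner (A y) y).
 have rv : 0 < rn v by rewrite rn_gt0.
 have hU : nbhs (1%g : G) [set u | rn (p u v - v) < rn v / 2].
  have /cvg_rnP h : p u v @[u --> (1%g : G)] --> p 1%g v by exact: rep_continuous.
  by apply: filterS (h _ (divr_gt0 rv (ltr0n R 2))) => u; rewrite rep1 rn_distC.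
 have [C _ hC] := K_net SA CP hU.
 have [|ks [_ _ hks]] := hC 1; first by rewrite ltr01 lexx.
 pose c := (rn v ^+ 2 / 2) ^+ 2.
 have c0 : 0 < c by rewrite exprn_gt0// divr_gt0// exprn_gt0.
 have low s : conv s -> c <= \sum_(k <- ks) Re (inner (T s (p k v)) (p k v)).
  move=> [h h1]; under eq_bigr do rewrite rank1_sum_form /= big_map.
  rewrite exchange_big /= -[leLHS]mul1r -h1 mulr_suml; apply: ler_sum_seq => a ain; have [a0 ak] := h a ain.
  have [k' [u [kin uU _ _ e]]] := hks _ ak.
  rewrite -mulr_sumr ler_wpM2l// (big_rem k')//= -[leLHS]addr0 lerD//; last first.
   by apply: sumr_ge0 => k _; exact: sqr_ge0.
  rewrite e repM rep_inner lerXn2r ?nnegrE ?rn_ge0//; first by rewrite divr_ge0// exprn_ge0// ltW.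
  have : rn v ^+ 2 <= rn (inner v (p u v)) + rn v * (rn v / 2).
   rewrite -Re_inner_rn -{2}[v](subKr (p u v)) innerBr raddfB /=.
   apply: lerD; first exact: Re_le_rn.
   apply: le_trans (ler_norm _) _; rewrite normrN.
   by apply: le_trans (absRe_inner_le _ _) _; rewrite ler_wpM2l ?rn_ge0// ltW.
  by rewrite expr2; lra.
 apply: contrapT => ne; have A0 y : Re (inner (A y) y) = 0.
  apply/eqP; rewrite eq_le A_ge0 andbT leNgt; apply/negP => hy; apply: ne; by exists y.
 pose D := \sum_(k <- ks) rn v ^+ 2; have D0 : 0 <= D by exact: sum_sqr_ge0.
 have D1 : 0 < D + 1 by rewrite ltr_wpDl.
 have [s cs hs] := app _ (divr_gt0 c0 D1).
 have := low s cs; rewrite leNgt => /negP; apply.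
 apply: (@le_lt_trans _ _ (\sum_(k <- ks) c / (D + 1) * rn v ^+ 2)).
  apply: ler_sum => k _; have := A0 (p k v).
  have : Re (inner (T s (p k v) - A (p k v)) (p k v)) <= c / (D + 1) * rn v ^+ 2.
   apply: le_trans (Re_inner_le _ _) _; apply: (le_trans (ler_wpM2r (rn_ge0 _) (hs _))).
   by rewrite !rep_rn; apply: eq_ler; ring.
  by rewrite innerBl raddfB /=; lra.
 have hq : D / (D + 1) < 1 by rewrite ltr_pdivrMr// mul1r ltrDl.
 have -> : \sum_(k <- ks) c / (D + 1) * rn v ^+ 2 = c * (D / (D + 1)).
  by rewrite -(mulr_sumr ks _ _ (c / (D + 1))) -/D; ring.
 by rewrite -[ltRHS]mulr1 ltr_pM2l.
pose E := [set Re (inner (A x) x) | x in [set x : V | rn x <= 1]].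
have hE : has_sup E.
 split; first by exists (Re (inner (A 0) 0)), 0 => //=; rewrite rn0.
 exists (rn v ^+ 2) => _ [x /= hx <-]; apply: le_trans (Re_inner_le _ _) _.
 apply: (le_trans (ler_wpM2r (rn_ge0 x) (A_bound x))).
 rewrite -mulrA ler_piMr ?sqr_ge0//.
 by have := rn_ge0 x; nra.
pose l := sup E.
have El x : Re (inner (A x) x) <= l * rn x ^+ 2.
 have [->|x0] := eqVneq x 0; first by rewrite inner0r rn0 expr0n mulr0.
 have rx : 0 < rn x by rewrite rn_gt0.
 have h : E (Re (inner (A (((rn x)^-1)%:C *: x)) (((rn x)^-1)%:C *: x))).
  exists (((rn x)^-1)%:C *: x) => //=; rewrite rnZ rn_real normfV gtr0_norm// mulVf ?gt_eqF//.
 have := ub_le_sup hE.2 h; rewrite A_Z innerZl_real innerZr_real !Re_realM -/l.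
 rewrite mulrA -expr2 exprVn mulrC ler_pdivrMr ?exprn_gt0//.
have l0 : 0 < l.
 have := lt_le_trans hy0 (El y0); rewrite pmulr_lgt0// exprn_gt0// rn_gt0.
 by apply: contraTneq hy0 => ->; rewrite inner0r ltxx.
have Anorm x : rn (A x) ^+ 2 <= l * Re (inner (A x) x).
 have := A_ge0 (x - (l^-1)%:C *: A x); have := El (A x).
 rewrite A_B A_Z !innerBl !innerBr !innerZl_real !innerZr_real !raddfB /= !Re_realM.
 have -> : Re (inner (A (A x)) x) = rn (A x) ^+ 2 by rewrite A_sym Re_inner_rn.
 rewrite Re_inner_rn => h1 h2.
 have : l^-1 * (l^-1 * Re (inner (A (A x)) (A x))) <= l^-1 * rn (A x) ^+ 2.
  rewrite ler_wpM2l ?invr_ge0 ?(ltW l0)// mulrC ler_pdivrMr// mulrC //.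
 move: h2; set a := Re _; set b := rn _ ^+ 2; set q := l^-1 * (_ * _).
 move=> h2 h3; have h4 : l^-1 * b <= a by lra.
 by move: h4; rewrite mulrC ler_pdivrMr// mulrC.
have [x hx] : exists x : nat -> V, forall k, rn (x k) <= 1 /\
  l - (k.+1%:R)^-1 <= Re (inner (A (x k)) (x k)).
 have h (k : nat) : exists x, rn x <= 1 /\ l - (k.+1%:R)^-1 <= Re (inner (A x) x).
  have k0 : 0 < (k.+1%:R : R)^-1 by rewrite invr_gt0.
  by have [_ [x xr <-] hx] := sup_adherent k0 hE; exists x; split => //; exact: ltW.
 by have [f hf] := choice h; exists f.
have [U [UU Uoo]] := nat_ultra.
have UF : ProperFilter U by exact: ultra_proper.
(* A maximizing sequence converges weakly along the ultrafilter, against all y at once. The finite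
   rank approximations of A turn this into norm convergence of A (x k). *)
have wk (y : V) : exists c : R[i], forall e : R, 0 < e -> \forall k \near U, rn (inner (x k) y - c) < e.
 have b1 k : `|Re (inner (x k) y)| <= rn y.
  apply: le_trans (absRe_inner_le _ _) _.
  by rewrite ler_piMl ?rn_ge0//; case: (hx k).
 have b2 k : `|complex.Im (inner (x k) y)| <= rn y.
  apply: le_trans (absIm_le_rn _) _; apply: le_trans (rn_inner_le _ _) _.
  by rewrite ler_piMl ?rn_ge0//; case: (hx k).
 have [c1 h1] := ultra_bounded_cvg UU b1; have [c2 h2] := ultra_bounded_cvg UU b2.
 exists (c1 +i* c2) => e e0; have e2 : 0 < e / 2 by rewrite divr_gt0.
 apply: filterS2 (h1 _ e2) (h2 _ e2) => k k1 k2.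
 rewrite -(@ltr_pXn2r _ 2) ?nnegrE ?rn_ge0 ?(ltW e0)// rn_sqr.
 move: k1 k2; case: (inner (x k) y) => a b /=; rewrite !ltr_norml => /andP[? ?] /andP[? ?]; nra.
have Tcv s : exists y, forall e : R, 0 < e -> \forall k \near U, rn (T s (x k) - y) < e.
 rewrite /T; elim: (vec s) => [|a d [y hy]].
  exists 0 => e e0; apply: nearW => k; by rewrite /rank1_sum big_nil subrr rn0.
 have [c hc] := wk a.2; exists ((a.1%:C * c) *: a.2 + y) => e e0.
 have c0 : 0 < `|a.1| * rn a.2 + 1 by rewrite ltr_wpDl// mulr_ge0 ?rn_ge0.
 have e1 : 0 < e / 2 / (`|a.1| * rn a.2 + 1) by rewrite !divr_gt0.
 have e2 : 0 < e / 2 by rewrite divr_gt0.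
 apply: filterS2 (hc _ e1) (hy _ e2) => k h1 h2.
 have -> : rank1_sum (a :: d) (x k) = (a.1%:C * inner (x k) a.2) *: a.2 + rank1_sum d (x k).
  by rewrite /rank1_sum big_cons.
 have -> : (a.1%:C * inner (x k) a.2) *: a.2 + rank1_sum d (x k) - ((a.1%:C * c) *: a.2 + y) =
   (a.1%:C * (inner (x k) a.2 - c)) *: a.2 + (rank1_sum d (x k) - y) by lmod R V.
 apply: le_lt_trans (rnD _ _) _; rewrite rnZ rnM rn_real.
 move: h1; rewrite ltr_pdivlMr// => h1.
 have : `|a.1| * rn (inner (x k) a.2 - c) * rn a.2 <= rn (inner (x k) a.2 - c) * (`|a.1| * rn a.2 + 1).
  by rewrite mulrAC mulrC ler_wpM2l ?rn_ge0// lerDl.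
 lra.
have [z hz] : exists z, forall e : R, 0 < e -> \forall k \near U, rn (A (x k) - z) < e.
 have : cauchy (A (x k) @[k --> U]).
  apply/cauchy_exP => e e0; have := e0; rewrite ltcE /= => /andP[/eqP ei er].
  have [s cs hs] := app _ (divr_gt0 er (ltr0n R 3)).
  have [y hy] := Tcv s; exists y.
  have h3 : \forall k \near U, ball y e (A (x k)).
   apply: filterS (hy _ (divr_gt0 er (ltr0n R 3))) => k hk.
   rewrite -ball_normE /= rnE ltcE /= -ei eqxx /=.
   apply: le_lt_trans (rn_dist_triangle (T s (x k)) _ _) _; rewrite rn_distC.
   have h1 := hs (x k); have [h2 _] := hx k.
   have : Re e / 3 * rn (x k) <= Re e / 3.
    by rewrite ler_piMr// divr_ge0// ltW.
   lra.
  exact: h3.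
 move=> /cauchy_cvgP/cvg_ex[z hz]; exists z => e e0.
 have /cvg_rnP/(_ e e0) h := hz; by apply: filterS h => k; rewrite rn_distC.
(* Almost maximal vectors are almost eigenvectors, by |A x|^2 <= l <A x, x>. *)
have xA (e : R) : 0 < e -> \forall k \near U, rn (A (x k) - l%:C *: x k) < e.
 move=> e0; have e1 : 0 < e ^+ 2 / l by rewrite divr_gt0// exprn_gt0.
 have [N hN] := invS_small e1.
 have hU : \forall k \near U, (N <= k)%N by apply: Uoo; exists N.
 apply: filterS hU => k /hN hk; rewrite -(@ltr_pXn2r _ 2) ?nnegrE ?rn_ge0 ?(ltW e0)//.
 have [h1 h2] := hx k; have h3 := Anorm (x k).
 rewrite rn_sqrB innerZr_real Re_realM rnZ rn_real gtr0_norm// exprMn.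
 move: hk; rewrite ltr_pdivlMr// => hk.
 have h4 : rn (x k) ^+ 2 <= 1 by rewrite expr_le1// rn_ge0.
 have : l ^+ 2 * rn (x k) ^+ 2 <= l ^+ 2 by rewrite ler_piMr ?sqr_ge0.
 have := ler_wpM2l (ltW l0) h2; rewrite mulrBr -expr2; move: hk; set q := (k.+1%:R)^-1; lra.
have Az : A z = l%:C *: z.
 apply/eqP; rewrite -subr_eq0; apply/eqP.
 apply: (@rn_lim0 _ ((rn v ^+ 2 + rn v ^+ 2 + l) ^+ 2)) => e e0.
 pose f := Num.sqrt e; have f0 : 0 < f by rewrite sqrtr_gt0.
 have [k [h1 h2]] := @filter_ex _ U UF _ (filterI (hz f f0) (xA f f0)).
 rewrite -[e]sqr_sqrtr ?(ltW e0)// -exprMn lerXn2r ?nnegrE ?rn_ge0//.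
  by rewrite mulr_ge0 ?addr_ge0 ?sqr_ge0// ltW.
 have -> : A z - l%:C *: z = A (A (x k) - l%:C *: x k) - A (A (x k) - z) + l%:C *: (A (x k) - z).
  by rewrite !A_B A_Z; lmod R V.
 apply: le_trans (rnD _ _) _; apply: (le_trans (lerD (rnB _ _) (lexx _))).
 rewrite rnZ rn_real gtr0_norm//.
 have k1 := A_bound (A (x k) - l%:C *: x k); have k2 := A_bound (A (x k) - z).
 have k3 := ler_wpM2l (sqr_ge0 (rn v)) (ltW h2); have k4 := ler_wpM2l (sqr_ge0 (rn v)) (ltW h1).
 have k5 := ler_wpM2l (ltW l0) (ltW h1); rewrite -/f; lra.
have z0 : z != 0.
 apply/eqP => z0.
 have l2 : 0 < l / 2 by rewrite divr_gt0.
 have [N hN] := invS_small l2.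
 have hU : \forall k \near U, (N <= k)%N by apply: Uoo; exists N.
 have [k [h1 h2]] := @filter_ex _ U UF _ (filterI (hz _ l2) hU).
 rewrite z0 subr0 in h1; have [h3 h4] := hx k; have h5 := hN k h2.
 have := Re_inner_le (A (x k)) (x k); have : rn (A (x k)) * rn (x k) <= rn (A (x k)) by rewrite ler_piMr ?rn_ge0.
 move: h4 h5; set q := (k.+1%:R)^-1; lra.
pose D w := A w = l%:C *: w.
have sD : subspace D.
 split; first by have := A_B 0 0; rewrite /D !subrr scaler0.
 by move=> a w w' hw hw'; rewrite /D A_lin hw hw'; lmod R V.
have smD w : D w -> sm w.
 move=> Dw; apply: (weakly_smooth_smooth CP hgam bs_orth bs_in bs_span sm_dense) => ls hls.
 pose n2 : R := n%:R ^+ 2.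
 have [Cw Cw0 hCw] := word_bound CP hgam bs_orth bs_in bs_span (size ls) sv.
 pose B := Cw * \prod_(X <- ls) (n2 * mnorm X * n2).
 have n20 : 0 <= n2 by exact: sqr_ge0.
 have B0 : 0 <= B by rewrite mulr_ge0// prodr_ge0// => X _; rewrite !mulr_ge0 ?mnorm_ge0.
 have word_adj us x1 y1 : lwords S us -> sm x1 -> sm y1 ->
   rn (inner x1 (word gam p us y1)) = rn (inner (word gam p (rev us) x1) y1).
  elim: us x1 => [|X us IH] x1 hus hx1 hy1; first by [].
  have lX := lwords_head hus; have hus' := lwords_tail hus.
  rewrite /= -rnN -(dr_skew hgam lX hx1 (word_smooth hgam hus' hy1)) IH//; last exact: (dr_smooth hgam).
  by rewrite rev_cons /word -cats1 foldr_cat.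
 (* Moved to the other side the word is reversed; moving p k out then conjugates each letter, which
    multiplies its norm by at most n^4, whatever k in K. *)
 have wb k y : inK k -> sm y -> rn (inner (p k v) (word gam p ls y)) <= B * rn y.
  move=> hk hy; rewrite word_adj//; last exact: smooth_act_vec.
  apply: le_trans (rn_inner_le _ _) _; rewrite ler_wpM2r ?rn_ge0//.
  have hr : lwords S (rev ls) by move=> X; rewrite mem_rev; exact: hls.
  have hk' := inKV SA CP hk; rewrite -(rep_rn p k^-1%g).
  rewrite (word_act CP hgam bs_orth bs_in bs_span)//; last exact: smooth_act_vec.
  rewrite -repM mulVg rep1; apply: (le_trans (hCw _ _ _)); first by rewrite size_map size_rev.
   by move=> Y /mapP[Y' /hr lY ->]; exact: (conj_lie CP).
  rewrite /B ler_wpM2l// big_map big_rev /=; apply: ler_prod => X _.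
  rewrite mnorm_ge0 /=; apply: le_trans (mnormM _ _) _; rewrite ler_pM ?mnorm_ge0//.
   by apply: le_trans (mnormM _ _) _; rewrite ler_wpM2r ?mnorm_ge0// (orth_mnorm hk').
  by rewrite (orth_inv CP hk') mnorm_tr (orth_mnorm hk').
 exists (l^-1 * (rn w * rn v * B)) => y hy.
 have ewl : inner w (word gam p ls y) = (l^-1)%:C * inner (A w) (word gam p ls y).
  by rewrite Dw innerZl_real mulrA -rmorphM /= mulVf ?gt_eqF// mul1r.
 rewrite ewl rnM rn_real normfV gtr0_norm// -[leRHS]mulrA ler_wpM2l ?invr_ge0 ?(ltW l0)//.
 apply/ler_addgt0Pr => e e0; pose Y := word gam p ls y.
 have c0 : 0 < rn w * rn Y + 1 by rewrite ltr_wpDl// mulr_ge0 ?rn_ge0.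
 have [s [hs1 hs2] hs] := app _ (divr_gt0 e0 c0).
 rewrite -[A w](subKr (T s w)) innerBl; apply: le_trans (rnB _ _) _; rewrite lerD//; last first.
  apply: le_trans (rn_inner_le _ _) _; apply: (le_trans (ler_wpM2r (rn_ge0 _) (hs w))).
  by rewrite -mulrA mulrAC -mulrA ler_piMr ?(ltW e0)// ler_pdivrMr// mul1r lerDl.
 rewrite /T /rank1_sum big_map inner_suml; apply: le_trans (rn_sum _ _ _) _.
 rewrite -[leRHS]mul1r -hs2 mulr_suml; apply: ler_sum_seq => a ain.
 have [a0 ak] := hs1 a ain; rewrite innerZl rnM rnM rn_real ger0_norm// -mulrA ler_wpM2l//.
 rewrite -[leRHS]mulrA ler_pM ?rn_ge0 ?wb//.
 by apply: le_trans (rn_inner_le _ _) _; rewrite rep_rn.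
(* Each unit vector of D contributes at least l / 2 to the trace of a good approximation [T s],
   whose trace is at most |v|^2. *)
have fin es : orthonormal es -> (forall e, e \in es -> D e) -> (size es <= Num.truncn (2 * rn v ^+ 2 / l))%N.
 move=> oe De; have l2 : 0 < l / 2 by rewrite divr_gt0.
 have [s [hs1 hs2] hs] := app _ l2.
 rewrite truncn_ge_nat; last first.
  by apply: mulr_ge0; [apply: mulr_ge0; [|exact: sqr_ge0]|rewrite invr_ge0 ltW].
 rewrite ler_pdivlMr//.
 have h1 : (size es)%:R * (l / 2) <= \sum_(e <- es) Re (inner (T s e) e).
  have -> : (size es)%:R * (l / 2) = \sum_(e <- es) l / 2.
   by rewrite big_const_seq count_predT iter_addr_0 mulr_natl.
  apply: ler_sum_seq => e ein.
  have re := orthonormal_rn oe ein; have := hs e; rewrite re mulr1 => h.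
  have := Re_inner_le (A e - T s e) e; rewrite re mulr1 rn_distC innerBl raddfB /=.
  have eA : A e = l%:C *: e by exact: De.
  rewrite {1}eA innerZl_real Re_realM Re_inner_rn re expr1n mulr1; lra.
 have h2 : \sum_(e <- es) Re (inner (T s e) e) <= rn v ^+ 2.
  under eq_bigr do rewrite rank1_sum_form /= big_map.
  rewrite exchange_big /= -[leRHS]mul1r -hs2 mulr_suml; apply: ler_sum_seq => a ain; have [a0 ak] := hs1 a ain.
  rewrite -mulr_sumr ler_wpM2l// -(rep_rn p a.2 v); apply: le_trans (bessel _ oe).
  by apply: ler_sum => e _; rewrite innerC rn_conj.
 by have := le_trans h1 h2; lra.
have [ws [ow Dw hw]] := onb_exists sD fin.
exists ws; split => //.
- apply/eqP => w0; have := hw z Az; rewrite w0 /oproj big_nil => /esym/eqP; by rewrite (negbTE z0).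
- by move=> w /Dw /smD.
- move=> k w hk ew; apply: hw; rewrite /D A_act// (_ : A w = l%:C *: w) ?repZ//.
 by rewrite -ew; have : D (oproj ws w) by apply: oproj_sub.
Qed.

End averaging.

(** * Newton's identities *)

Lemma deriv_prod (C : comNzRingType) (I : eqType) (r : seq I) (F : I -> {poly C}) : uniq r ->
 (\prod_(i <- r) F i)^`() = \sum_(i <- r) (F i)^`() * \prod_(j <- r | j != i) F j.
Proof.
elim: r => [|i r IH]; first by rewrite !big_nil derivC.
move=> /= /andP[ir ur]; rewrite !big_cons derivM IH// eqxx /=; congr (_ + _).
 congr (_ * _); rewrite [RHS]big_seq_cond [LHS]big_seq; apply: eq_bigl => j.
 by case: (boolP (j \in r)) => //= jr; apply/esym; apply: contraNneq ir => <-.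
rewrite mulr_sumr [LHS]big_seq [RHS]big_seq; apply: eq_bigr => j jr; rewrite big_cons.
have ij : i != j by apply: contraNneq ir => ->.
by rewrite ij mulrCA.
Qed.

(* With E = prod_i (1 - x_i X) and E_i = E / (1 - x_i X), Newton's identities come
  from E' = - sum_i x_i E_i; modulo the power sums the coefficients of E vanish,
  those of E_i become the powers of x_i, and E_i has degree < n. *)
Lemma newton_nilpotent (C : comNzRingType) n (x : 'I_n -> C) (I : C -> Prop) :
 I 0 -> (forall a b c, I b -> I c -> I (a * b + c)) -> (forall k y, I (y *+ k.+1) -> I y) ->
 (forall j, I (\sum_i x i ^+ j.+1)) -> forall i, I (x i ^+ n).
Proof.
move=> I0 IM Idiv Ip.
pose L i : {poly C} := 1 - x i *: 'X.
pose E := \prod_(i <- index_enum 'I_n) L i.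
pose F i := \prod_(j <- index_enum 'I_n | j != i) L j.
have uI : uniq (index_enum 'I_n) by exact: index_enum_uniq.
have EF i : E = F i - x i *: ('X * F i).
 rewrite /E (bigD1_seq i) ?mem_index_enum//= -/(F i) /L mulrBl mul1r; congr (_ - _).
 by rewrite -scalerAl.
have F0 i : (F i)`_0 = E`_0 by rewrite (EF i) coefB coefZ coefXM /= mulr0 subr0.
have FS i k : (F i)`_k.+1 = E`_k.+1 + x i * (F i)`_k.
 by rewrite {1}(EF i) coefB coefZ coefXM /= subrK.
have dE : E^`() = - \sum_i x i *: F i.
 rewrite /E deriv_prod// -sumrN; apply: eq_bigr => i _; rewrite -/(F i) /L derivB derivZ derivX.
 by rewrite derivC sub0r mulNr -scalerAl mul1r.
have FE i k : (F i)`_k = \sum_(j < k.+1) x i ^+ j * E`_(k - j).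
 elim: k => [|k IH]; first by rewrite F0 big_ord_recl big_ord0 expr0 mul1r addr0.
 rewrite FS IH [RHS]big_ord_recl expr0 mul1r; congr (_ + _); rewrite mulr_sumr.
 by apply: eq_bigr => j _; rewrite exprS mulrA.
have ID a b : I a -> I b -> I (a + b) by move=> ha hb; rewrite -[a]mul1r; exact: IM.
have IMl a b : I b -> I (a * b) by move=> hb; rewrite -[_ * _]addr0; exact: IM.
have Isum (J : Type) (r : seq J) (G : J -> C) : (forall j, I (G j)) -> I (\sum_(j <- r) G j).
 by move=> h; elim/big_ind: _ => // a b; exact: ID.
have IE k : I E`_k.+1.
 apply: (Idiv k); rewrite -coef_deriv dE coefN coef_sum.
 have -> : - \sum_i (x i *: F i)`_k = \sum_(j < k.+1) - E`_(k - j) * \sum_i x i ^+ j.+1.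
  rewrite -sumrN; under eq_bigr do rewrite coefZ FE mulr_sumr -sumrN.
  rewrite exchange_big /=; apply: eq_bigr => j _; rewrite mulr_sumr; apply: eq_bigr => i _.
  by rewrite exprS mulNr; congr (- _); rewrite mulrA mulrC.
 by apply: Isum => j; apply: IMl.
have E0 : E`_0 = 1.
 rewrite -horner_coef0 horner_prod big1// => i _.
 by rewrite horner_coef0 /L coefB coefZ coefX mulr0 subr0 coef1.
have IF i k : I (x i ^+ k - (F i)`_k).
 elim: k => [|k IH]; first by rewrite F0 E0 subrr.
 have -> : x i ^+ k.+1 - (F i)`_k.+1 = x i * (x i ^+ k - (F i)`_k) + (-1) * E`_k.+1.
  by rewrite FS exprS; ring.
 by apply: ID; apply: IMl.
move=> i; have := IF i n; rewrite [(F i)`_n]nth_default ?subr0//.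
have szF (r : seq 'I_n) : (size (\prod_(j <- r | j != i) L j)%R <= (count (predC1 i) r).+1)%N.
 elim: r => [|j r IH]; first by rewrite big_nil size_poly1.
 rewrite big_cons /=; case: eqP => //= _; apply: leq_trans (size_polyMleq _ _) _.
 have s2 : (size (L j) <= 2)%N.
  apply: leq_trans (size_polyD _ _) _; rewrite size_polyN geq_max size_poly1 /=.
  by apply: leq_trans (size_scale_leq _ _) _; rewrite size_polyX.
 by case: (_ + _)%N (leq_add s2 IH) => [|m].
apply: leq_trans (szF _) _.
have := count_predC (pred1 i) (index_enum 'I_n).
have -> : size (index_enum 'I_n) = n by rewrite -sum1_size big_const_ord iter_addn_0 mul1n.
rewrite count_uniq_mem// mem_index_enum (@eq_count _ (predC (pred1 i)) (predC1 i))//; lia.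
Qed.

Import (canonicals, coercions) mpoly.

(** [phi] extends to a linear form on polynomials that sees only degree d. The polynomials all of
    whose multiples it kills form an ideal, which contains the power sums and hence each x_i^n. *)
Lemma power_sum_multinom (F : numFieldType) n (phi : mpoly.multinom n -> F) d :
 (forall m j, (0 < j)%N -> (mpoly.mdeg m + j)%N = d ->
   \sum_i phi (mpoly.mnm_add m (mpoly.mnm_muln (mpoly.mnm1 i) j)) = 0) ->
 forall m i, (mpoly.mdeg m + n)%N = d ->
   phi (mpoly.mnm_add m (mpoly.mnm_muln (mpoly.mnm1 i) n)) = 0.
Proof.
move=> h.
pose ev (q : mpoly.mpoly n F) : F :=
 \sum_(m : mpoly.bmultinom n d.+1 | mpoly.mdeg m == d) mpoly.mcoeff m q * phi m.
have evD q q' : ev (q + q') = ev q + ev q'.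
 by rewrite /ev -big_split /=; apply: eq_bigr => m _; rewrite mpoly.mcoeffD mulrDl.
have evZ a q : ev (a *: q) = a * ev q.
 by rewrite /ev mulr_sumr; apply: eq_bigr => m _; rewrite mpoly.mcoeffZ mulrA.
have ev0 : ev 0 = 0 by have := evZ 0 0; rewrite scale0r mul0r.
have ev_sum (I : Type) (r : seq I) (G : I -> mpoly.mpoly n F) : ev (\sum_(i <- r) G i) = \sum_(i <- r) ev (G i).
 by elim: r => [|i r IH]; rewrite ?big_nil// !big_cons evD IH.
have evX m : ev (mpoly.mpolyX F m) = (mpoly.mdeg m == d)%:R * phi m.
 case: eqP => md; last first.
  rewrite mul0r /ev big1// => m' /eqP e; rewrite mpoly.mcoeffX.
  by case: eqP => [e'|_]; [rewrite e' in md; rewrite e in md|rewrite mul0r].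
 have md' : (mpoly.mdeg m < d.+1)%N by rewrite md.
 rewrite mul1r /ev (bigD1 (mpoly.BMultinom md')) /= ?md// mpoly.mcoeffX eqxx mul1r big1 ?addr0//.
 move=> m' /andP[_ ne]; rewrite mpoly.mcoeffX; case: eqP => [e|_]; last by rewrite mul0r.
 by case/negP: ne; apply/eqP/val_inj; rewrite /= e.
clearbody ev.
pose I q := forall a, ev (a * q) = 0.
have key i : I (mpoly.mpolyX F (mpoly.mnm1 i) ^+ n).
 apply: (@newton_nilpotent _ n (fun i => mpoly.mpolyX F (mpoly.mnm1 i)) I) => [a|a b c hb hc q|k y hy a|j q].
 - by rewrite mulr0.
 - by rewrite mulrDr evD mulrA hb hc addr0.
 - have := hy a; rewrite mulrnAr -scaler_nat evZ => /eqP; rewrite mulf_eq0 pnatr_eq0 /= => /eqP; exact.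
 rewrite [q]mpoly.mpolyE mulr_suml ev_sum big1// => m _.
 rewrite -scalerAl evZ mulr_sumr ev_sum.
 under eq_bigr do rewrite mpoly.mpolyXn -mpoly.mpolyXD evX mpoly.mdegD mpoly.mdegMn mpoly.mdeg1 mul1n.
 rewrite -mulr_sumr; case: eqP => [e|_]; last by rewrite mul0r mulr0.
 by rewrite h// mulr0 mulr0.
move=> m i md; have := key i (mpoly.mpolyX F m).
by rewrite mpoly.mpolyXn -mpoly.mpolyXD evX mpoly.mdegD mpoly.mdegMn mpoly.mdeg1 mul1n md eqxx mul1r.
Qed.

(** * A Cartan subspace and a decomposition of the Lie algebra *)

Section cartan_subspace.
Variables (R : realType) (n : nat) (S : set 'M[R]_n).
Hypotheses (SA : self_adjoint_algebraic_group S) (GS : linear_group S).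
Implicit Types (X Y Z P : 'M[R]_n).

(** The chosen e exceeds every quotient |d_i - d_j| / |b_i - b_j|, and an accidental coincidence of
    two entries of d + e b would make e equal to one of them. *)
Lemma generic_coefficient (d b : 'rV[R]_n) : exists e : R, forall i j,
 d 0 i + e * b 0 i = d 0 j + e * b 0 j -> d 0 i = d 0 j /\ b 0 i = b 0 j.
Proof.
pose q i j := `|(d 0 i - d 0 j) / (b 0 i - b 0 j)|.
pose T := \sum_i \sum_j q i j; exists (1 + T) => i j h.
have T0 : 0 <= T by apply: sumr_ge0 => *; apply: sumr_ge0 => *; exact: normr_ge0.
have qT : q i j <= T.
 rewrite /T (bigD1 i)//= (bigD1 j)//= -addrA lerDl addr_ge0//; apply: sumr_ge0 => *; first exact: normr_ge0.
 by apply: sumr_ge0 => *; exact: normr_ge0.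
have e : d 0 i - d 0 j = - (1 + T) * (b 0 i - b 0 j).
 by move: h; set x := (1 + T); move=> h; lra.
have [bij|bn] := eqVneq (b 0 i) (b 0 j).
 by split => //; move: e; rewrite bij subrr mulr0 => /eqP; rewrite subr_eq0 => /eqP.
move: qT; rewrite /q e mulfK ?subr_eq0// normrN ger0_norm ?addr_ge0// gerDr => h1; lra.
Qed.

Lemma lie_p_subspace : msubspace (lie_p S).
Proof.
split=> [|X Y [lX sX] [lY sY]|c X [lX sX]].
- by split; [exact: lie0|rewrite trmx0].
- by split; [exact: (lieD GS)|rewrite linearD /= sX sY].
- by split; [exact: lieZ|rewrite linearZ /= sX].
Qed.

Lemma lie_k_subspace : msubspace (lie_k S).
Proof.
split=> [|X Y [lX sX] [lY sY]|c X [lX sX]].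
- by split; [exact: lie0|rewrite trmx0 oppr0].
- by split; [exact: (lieD GS)|rewrite linearD /= sX sY opprD].
- by split; [exact: lieZ|rewrite linearZ /= sX scalerN].
Qed.

(** A commuting orthonormal family in p of maximal size; a nonzero element of p commuting with it
    and orthogonal to it could be added. *)
Lemma maximal_commuting : exists bsa : seq 'M[R]_n, [/\ morthonormal bsa, forall b, b \in bsa -> lie_p S b,
 forall b c, b \in bsa -> c \in bsa -> b *m c = c *m b &
 forall X, lie_p S X -> (forall b, b \in bsa -> X *m b = b *m X) -> X = \sum_(b <- bsa) mdot X b *: b].
Proof.
have [_ pD pZ] := lie_p_subspace.
pose C B := [/\ morthonormal B, forall b, b \in B -> lie_p S b & forall b c, b \in B -> c \in B -> b *m c = c *m b].
pose P m := `[< exists2 B, C B & size B = m >].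
have P0 : exists m, P m by exists 0%N; apply/asboolP; exists [::] => //; split => //; split.
have Pb m : P m -> (m <= n * n)%N by move=> /asboolP[B [oB _ _] <-]; exact: morthonormal_size.
case: (ex_maxnP P0 Pb) => m /asboolP[B [oB pB cB] sB] mmax; exists B; split => // X pX cX.
pose L := [set Y | [/\ lie_p S Y, forall b, b \in B -> Y *m b = b *m Y & forall b, b \in B -> mdot Y b = 0]].
have LS : msubspace L.
 split.
 - split=> [|b _|b _]; [by case: lie_p_subspace|by rewrite mul0mx mulmx0|exact: mdot0l].
 - move=> Y Z [pY cY oY] [pZ' cZ oZ]; split=> [|b bB|b bB]; first exact: pD.
   by rewrite mulmxDl mulmxDr cY// cZ.
  by rewrite mdotDl oY// oZ// addr0.
 - move=> c Y [pY cY oY]; split=> [|b bB|b bB]; first exact: pZ.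
   by rewrite -scalemxAl -scalemxAr cY.
  by rewrite mdotZl oY// mulr0.
have [[|y D] [oD DL DX]] := msubspace_basis LS; last first.
 have [py cy oy] := DL _ (mem_head y D).
 suff : P m.+1 by move=> /mmax; rewrite ltnn.
 apply/asboolP; exists (y :: B); last by rewrite /= sB.
 have o1 : morthonormal [:: y].
  split => // b c; rewrite !inE => /eqP-> /eqP->.
  by have [_ h] := oD; rewrite h ?mem_head.
 split.
 - by apply: (morthonormal_cat o1 oB) => b c; rewrite inE => /eqP-> cB'; exact: oy.
 - by move=> b; rewrite inE => /orP[/eqP->//|]; exact: pB.
 - move=> b c; rewrite !inE => /orP[/eqP->|bB] /orP[/eqP->|cB'] //; [exact: cy|by rewrite cy|exact: cB].
apply/eqP; rewrite -subr_eq0; apply/eqP; rewrite [LHS]DX ?big_nil//; split.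
- apply: (pD) => //; rewrite -scaleN1r; apply: (pZ); rewrite big_seq; apply: (big_ind (lie_p S)) => // [|b bB].
  by case: lie_p_subspace.
 by apply: (pZ); exact: pB.
- move=> b bB; rewrite mulmxBl mulmxBr cX// mulmx_suml mulmx_sumr; congr (_ - _).
 by apply: eq_big_seq => c cB'; rewrite -scalemxAl -scalemxAr cB.
- by move=> b bB; exact: mproj_orth.
Qed.

Lemma codiagonalize (bsa : seq 'M[R]_n) : (forall b, b \in bsa -> b^T = b) ->
 (forall b c, b \in bsa -> c \in bsa -> b *m c = c *m b) ->
 exists P, P \in unitmx /\ exists d : 'M[R]_n -> 'rV[R]_n,
  forall b, b \in bsa -> b = invmx P *m diag_mx (d b) *m P.
Proof.
move=> hs hc; have [|P Pu /allP hP] := (codiagonalizableP bsa).1.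
 split=> [b c bin cin|b /hs /real_symmetric_diag[P [d [Pu e]]]]; first exact: hc.
 by exists P => //; apply/(diagonalizable_forLR Pu); exists d; rewrite (mxpoly.conjVmx _ Pu).
exists P; split => //.
have h b : exists d, b \in bsa -> b = invmx P *m diag_mx d *m P.
 have [/hP /(diagonalizable_forLR Pu)[d e]|] := boolP (b \in bsa); last by exists 0.
 by exists d => _; rewrite {1}e (mxpoly.conjVmx _ Pu).
by have [d hd] := choice h; exists d.
Qed.

Lemma diag_comm P (d : 'rV[R]_n) Z : P \in unitmx ->
 (Z *m (invmx P *m diag_mx d *m P) = invmx P *m diag_mx d *m P *m Z) <->
 (forall i j, (P *m Z *m invmx P) i j * d 0 j = d 0 i * (P *m Z *m invmx P) i j).
Proof.
move=> Pu; set W := P *m Z *m invmx P.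
have ZW : Z = invmx P *m W *m P by rewrite /W !mulmxA mulVmx// mul1mx -mulmxA mulVmx// mulmx1.
have e : (forall i j, W i j * d 0 j = d 0 i * W i j) <-> W *m diag_mx d = diag_mx d *m W.
 split=> [h|/matrixP h i j]; first by apply/matrixP => i j; rewrite mul_mx_diag mul_diag_mx [LHS]mxE [RHS]mxE h.
 by have := h i j; rewrite mul_mx_diag mul_diag_mx [LHS]mxE [RHS]mxE.
apply: iff_trans (iff_sym e); split => h.
 have := congr1 (fun M => P *m M *m invmx P) h; rewrite /W !mulmxA.
 by rewrite mulmxK// mulmxV// mul1mx.
by clearbody W; rewrite ZW !mulmxA !mulmxK//; congr (_ *m _); rewrite -!mulmxA h.
Qed.

(** The basis elements are added one by one with generic coefficients, so two eigenvalues of H0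
    agree only where those of all basis elements agree. Commuting with H0 then means commuting with
    each of them. *)
Lemma generic_element (bsa : seq 'M[R]_n) P (d : 'M[R]_n -> 'rV[R]_n) : P \in unitmx ->
 (forall b, b \in bsa -> lie_p S b) -> (forall b, b \in bsa -> b = invmx P *m diag_mx (d b) *m P) ->
 exists H0, [/\ lie_p S H0, forall b, b \in bsa -> b *m H0 = H0 *m b &
  forall Z, Z *m H0 = H0 *m Z -> forall b, b \in bsa -> Z *m b = b *m Z].
Proof.
move=> Pu pb hd; have [p0 pD pZ] := lie_p_subspace.
suff [H0 [d0 [pH e h]]] : exists H0 (d0 : 'rV[R]_n), [/\ lie_p S H0, H0 = invmx P *m diag_mx d0 *m P &
  forall i j, d0 0 i = d0 0 j -> forall b, b \in bsa -> d b 0 i = d b 0 j].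
 exists H0; split => // [b bin|Z].
  rewrite (hd b bin) e !mulmxA !mulmxK//; congr (_ *m _); rewrite -!mulmxA; congr (_ *m _).
  by rewrite !mulmx_diag; congr diag_mx; apply/rowP => i; rewrite !mxE mulrC.
 rewrite e => /(diag_comm d0 Z Pu) hZ b bin; rewrite (hd b bin); apply/(diag_comm (d b) Z Pu) => i j.
 have := hZ i j; set w := (_ *m _) i j => hw.
 have [dij|/eqP dij] := eqVneq (d0 0 i) (d0 0 j); first by rewrite (h _ _ dij b bin) mulrC.
 have -> : w = 0; last by rewrite mul0r mulr0.
 apply/eqP; move: hw; rewrite mulrC => /eqP; rewrite -subr_eq0 -mulrBl mulf_eq0 subr_eq0 => /orP[/eqP e'|//].
 by case: dij.
elim: bsa pb hd => [|b r IH] pb hd.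
 exists 0, 0; split => //; first by rewrite linear0 mulmx0 mul0mx.
have [|x xr|H0 [d0 [pH e h]]] := IH; first by move=> x xr; apply: pb; rewrite inE xr orbT.
 by apply: hd; rewrite inE xr orbT.
have [t ht] := generic_coefficient d0 (d b); have bb := mem_head b r.
exists (H0 + t *: b), (d0 + t *: d b); split.
- by apply: (pD) => //; apply: (pZ); exact: pb.
- by rewrite linearD linearZ /= mulmxDr mulmxDl -e -scalemxAr -scalemxAl -hd.
- move=> i j; rewrite !mxE => /ht[h1 h2] x; rewrite inE => /orP[/eqP->//|xr]; exact: h.
Qed.

(** Z - Z^T lies in k and is orthogonal to Z and to Z^T, hence to itself. *)
Lemma sym_of_orth_lie_k Z : lie S Z -> (forall Y, lie_k S Y -> mdot Z Y = 0) -> Z^T = Z.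
Proof.
move=> lZ hZ; pose K := Z - Z^T.
have kK : lie_k S K.
 split; first by apply: (lieB GS) => //; exact: (lie_tr SA).
 by rewrite linearB /= trmxK opprB.
apply/eqP; rewrite eq_sym -subr_eq0; apply/eqP/mdot_eq0; rewrite -/K {1}/K mdotBl hZ//.
rewrite -mdot_trT trmxK kK.2 mdotC mdotNl mdotC hZ//; by rewrite oppr0 subr0.
Qed.

(** Let Z be orthogonal to k + Ad(a0)^-1 k. Orthogonality to k makes Z symmetric, and orthogonality
    to the conjugate makes a0^-1 Z a0 symmetric. So Z commutes with a0^2, hence with H0, hence with
    [a] by genericity, and lies in [a] by maximality. *)
Lemma iwasawa_like : exists (bsa bsq : seq 'M[R]_n) (H0 : 'M[R]_n), 
 [/\ morthonormal (bsa ++ bsq), lie_p S H0,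
   forall b, b \in bsq -> exists Y1 Y2, [/\ lie_k S Y1, lie_k S Y2 &
    b = Y1 + invmx (mexp H0) *m Y2 *m mexp H0],
   forall X, lie S X -> X = \sum_(b <- bsa ++ bsq) mdot X b *: b &
   (forall b, b \in bsa -> lie_p S b) /\ exists P, P \in unitmx /\ exists d : 'M[R]_n -> 'rV[R]_n,
     forall b, b \in bsa -> b = invmx P *m diag_mx (d b) *m P].
Proof.
have [bsa [oa pa ca maxa]] := maximal_commuting.
have [P [Pu [d hd]]] := codiagonalize (fun b bin => (pa b bin).2) ca.
have [H0 [pH hH gH]] := generic_element Pu pa hd.
have [lH sH] := pH; set a0 := mexp H0.
have a0u : a0 \in unitmx by exact: mexp_unit.
have Sa0 : S a0 by have := lH 1; rewrite scale1r.
have a0T : a0^T = a0 by rewrite /a0 mexp_tr sH.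
pose cj Y := invmx a0 *m Y *m a0.
have lcj Y : lie S Y -> lie S (cj Y).
 by move=> lY; have := lie_conj GS (lgV GS Sa0) lY; rewrite invmxK.
have mcj Z Y : mdot Z (cj Y) = mdot (cj Z) Y.
 rewrite !mdot_tr /cj !trmx_mul trmx_inv a0T !mulmxA mxtrace_mulC !mulmxA.
 by rewrite -!mulmxA.
have [kL0 kD kZ] := lie_k_subspace.
pose L := [set X | exists Y1 Y2, [/\ lie_k S Y1, lie_k S Y2 & X = Y1 + cj Y2]].
have LS : msubspace L.
 split.
 - by exists 0, 0; split => //; rewrite /cj mulmx0 mul0mx addr0.
 - move=> X X' [Y1 [Y2 [h1 h2 ->]]] [Z1 [Z2 [h3 h4 ->]]]; exists (Y1 + Z1), (Y2 + Z2).
  by split; [exact: kD|exact: kD|rewrite /cj mulmxDr mulmxDl addrACA].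
 - move=> c X [Y1 [Y2 [h1 h2 ->]]]; exists (c *: Y1), (c *: Y2).
  by split; [exact: kZ|exact: kZ|rewrite /cj -scalemxAr -scalemxAl scalerDr].
have [bsq [oq Lq spq]] := msubspace_basis LS.
have kL Y : lie_k S Y -> L Y by move=> kY; exists Y, 0; split => //; rewrite /cj mulmx0 mul0mx addr0.
have cL Y : lie_k S Y -> L (cj Y) by move=> kY; exists 0, Y; split => //; rewrite add0r.
have ak b Y : b \in bsa -> lie_k S Y -> mdot b Y = 0.
 move=> /pa[_ sb] [_ sY]; have : mdot b Y = - mdot b Y by rewrite -[LHS]mdot_trT sb sY mdotC mdotNl mdotC.
 lra.
have aL b X : b \in bsa -> L X -> mdot b X = 0.
 move=> ba [Y1 [Y2 [h1 h2 ->]]]; rewrite mdotDr mcj.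
 have -> : cj b = b by rewrite /cj -mulmxA (mexp_conj (hH b ba)) mulKmx.
 by rewrite !ak// addr0.
have oaq : morthonormal (bsa ++ bsq).
 by apply: morthonormal_cat => // b c ba cq; apply: aL => //; exact: Lq.
exists bsa, bsq, H0; split => //; last by split => //; exists P; split => //; exists d.
 move=> X lX; pose Z := X - \sum_(b <- bsq) mdot X b *: b.
 have lZ : lie S Z.
  apply: (lieB GS lX); rewrite big_seq; apply: (big_ind (lie S)) => [|A B|b /Lq[Y1 [Y2 [h1 h2 ->]]]].
  - exact: lie0.
  - exact: (lieD GS).
  - by apply: lieZ; apply: (lieD GS); [exact: h1.1|exact: (lcj _ h2.1)].
 have ZL Y : L Y -> mdot Z Y = 0.
  move=> LY; rewrite (spq Y LY) mdotC mdot_suml big1_seq// => b /andP[_ bq].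
  by rewrite mdotZl (mdotC b) mproj_orth// mulr0.
 have ZT : Z^T = Z by apply: sym_of_orth_lie_k => // Y kY; apply: ZL; exact: kL.
 have cZT : (cj Z)^T = cj Z.
  by apply: sym_of_orth_lie_k => [|Y kY]; [exact: lcj|rewrite -mcj; apply: ZL; exact: cL].
 have cZ : Z *m H0 = H0 *m Z.
  apply: mexp_sym_comm => //; rewrite -/a0.
  have := congr1 (fun M => a0 *m M *m a0) cZT.
  by rewrite /cj !trmx_mul trmx_inv a0T ZT !mulmxA mulmxV// mul1mx mulmxKV.
 have eZ : Z = \sum_(b <- bsa) mdot X b *: b.
  rewrite [LHS]maxa; [|by split|exact: gH].
  apply: eq_big_seq => b ba; congr (_ *: _).
  rewrite /Z mdotBl mdot_suml big1_seq ?subr0// => c /andP[_ cq].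
  by rewrite mdotZl (mdotC c) (aL b)// ?mulr0//; exact: Lq.
 by rewrite big_cat /= -eZ /Z subrK.
Qed.

End cartan_subspace.

(** * Spectral theorem on finite-dimensional spans, and growth estimates *)

Section spectral_theorem.
Variables (R : realType) (V : hilbertType R).
Implicit Types (es : seq V).

Lemma oproj_mem es e : orthonormal es -> e \in es -> oproj es e = e.
Proof.
move=> [ue h] ein; rewrite /oproj (bigD1_seq e)//= h// eqxx scale1r big1_seq ?addr0//.
by move=> e' /andP[ne e'in]; rewrite h// eq_sym (negbTE ne) scale0r.
Qed.

Lemma oprojB es x y : oproj es (x - y) = oproj es x - oproj es y.
Proof. by have := oproj_lin es (-1) y x; rewrite !scaleN1r addrC (addrC (- oproj es y)). Qed.

Lemma lin_comb_map (A : V -> V) (I : Type) (r : seq I) (c : I -> R[i]) (F : I -> V) :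
 (forall a x y, A (a *: x + y) = a *: A x + A y) ->
 A (\sum_(i <- r) c i *: F i) = \sum_(i <- r) c i *: A (F i).
Proof.
move=> lA; elim: r => [|i r IH]; last by rewrite !big_cons lA IH.
by rewrite !big_nil; have := lA (-1) 0 0; rewrite scaler0 addr0 scaleN1r addNr.
Qed.

(** [A] is linear and symmetric only on the span and may leave it: the eigenvectors are those of its
    compression, given by the Hermitian matrix of the <A e_i, e_j>. *)
Lemma spectral_span es (A : V -> V) : orthonormal es ->
 (forall a x y, oproj es x = x -> oproj es y = y -> A (a *: x + y) = a *: A x + A y) ->
 (forall x y, oproj es x = x -> oproj es y = y -> inner (A x) y = inner x (A y)) ->
 exists es', [/\ orthonormal es', size es' = size es, forall x, oproj es' x = oproj es x &
  forall e, e \in es' -> oproj es (A e) = (Re (inner (A e) e))%:C *: e].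
Proof.
move=> oes linA symA; pose N := size es; pose e (i : 'I_N) := nth 0 es i.
pose A' x := A (oproj es x).
have linA' a x y : A' (a *: x + y) = a *: A' x + A' y.
 by rewrite /A' oproj_lin linA// oproj_id.
have ein i : e i \in es by exact: mem_nth.
have Pe i : oproj es (e i) = e i by exact: oproj_mem.
have eE i j : inner (e i) (e j) = (i == j)%:R :> R[i].
 by have [ue h] := oes; rewrite h// nth_uniq.
have projE x : oproj es x = \sum_i inner x (e i) *: e i.
 by rewrite /oproj (big_nth 0) big_mkord.
pose M : 'M[R[i]]_N := \matrix_(i, j) inner (A (e i)) (e j).
have MH : M \is hermsymmx.
 apply/is_hermitianmxP; rewrite expr0 scale1r; apply/matrixP => i j.
 by rewrite !mxE symA//; exact: innerC.
have MN := hermitian_normalmx MH.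
pose P := spectralmx M; pose d := spectral_diag M.
have sim : P *m M = diag_mx d *m P.
 rewrite {1}(orthomx_spectralP MN) !mulmxA mulmxV; last exact: spectral_unit.
 by rewrite mul1mx.
have /unitarymxP PP := spectral_unitarymx M; rewrite -/P in PP.
have PP' := mulmx1C PP.
pose f i := \sum_j P i j *: e j.
have Pf i : oproj es (f i) = f i by rewrite /f (lin_comb_map _ _ _ (@oproj_lin R V es)); apply: eq_bigr => j _; rewrite Pe.
have fe i j : inner (f i) (e j) = P i j.
 rewrite /f inner_suml (bigD1 j)//= innerZl eE eqxx mulr1 big1 ?addr0// => k kj.
 by rewrite innerZl eE (negbTE kj) mulr0.
have fE i k : inner (f i) (f k) = (i == k)%:R :> R[i].
 have /matrixP/(_ i k) := PP; rewrite !mxE => <-.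
 by rewrite {2}/f inner_sumr; apply: eq_bigr => j _; rewrite innerZr fe !mxE mulrC.
have finj : injective f.
 move=> i k ik; have := fE i k; rewrite ik fE eqxx; case: eqP => // _ /eqP.
 by rewrite oner_eq0.
have of' : orthonormal [seq f i | i <- enum 'I_N].
 split; first by rewrite map_inj_uniq ?enum_uniq.
 by move=> _ _ /mapP[i _ ->] /mapP[k _ ->]; rewrite fE (inj_eq finj).
exists [seq f i | i <- enum 'I_N]; split => // [|x|_ /mapP[i _ ->]].
- by rewrite size_map size_enum_ord.
- rewrite [LHS]/oproj big_map big_enum /= projE.
 transitivity (\sum_i \sum_j \sum_k (inner x (e j) * ((P i j)^* * P i k)) *: e k).
  apply: eq_bigr => i _; rewrite /f inner_sumr scaler_suml; apply: eq_bigr => j _.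
  rewrite innerZr scaler_sumr; apply: eq_bigr => k _.
  by rewrite scalerA mulrA (mulrC (inner _ _)).
 rewrite exchange_big /=; apply: eq_bigr => j _; rewrite exchange_big /= (bigD1 j)//=.
 have hk k : \sum_i (inner x (e j) * ((P i j)^* * P i k)) *: e k = (inner x (e j) * (j == k)%:R) *: e k.
  rewrite -scaler_suml -mulr_sumr; congr ((_ * _) *: _).
  by have /matrixP/(_ j k) := PP'; rewrite !mxE => <-; apply: eq_bigr => i _; rewrite !mxE.
 rewrite hk eqxx mulr1 big1 ?addr0// => k kj.
 by rewrite hk eq_sym (negbTE kj) mulr0 scale0r.
have AfE k : inner (A (f i)) (e k) = d 0 i * P i k.
 have -> : A (f i) = A' (f i) by rewrite /A' Pf.
 rewrite /f (lin_comb_map _ _ _ linA') inner_suml.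
 have /matrixP/(_ i k) := sim; rewrite mul_diag_mx [in X in _ = X -> _]mxE => <-.
 by rewrite mxE; apply: eq_bigr => j _; rewrite innerZl mxE /A' Pe.
have AfP : oproj es (A (f i)) = d 0 i *: f i.
 by rewrite projE /f scaler_sumr; apply: eq_bigr => k _; rewrite AfE scalerA.
rewrite AfP; congr (_ *: _).
have dE : inner (A (f i)) (f i) = d 0 i.
 by rewrite -{2}Pf -oproj_sym AfP innerZl fE eqxx mulr1.
have : inner (A (f i)) (f i) = (inner (A (f i)) (f i))^* by rewrite {1}symA//; exact: innerC.
rewrite dE; case: (d 0 i) => a b [] /= h; congr (_ +i* _); lra.
Qed.

End spectral_theorem.

(** Log-convexity makes the ratios f(j+1) / f(j) nondecreasing; if the first exceeded B, f would
    outgrow A B^j. *)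
Lemma log_convex_bound (R : realType) (f : nat -> R) (A B : R) : 0 < B -> (forall j, 0 <= f j) ->
 (forall j, f j.+1 ^+ 2 <= f j * f j.+2) -> (forall j, f j <= A * B ^+ j) -> f 1%N <= B * f 0%N.
Proof.
move=> B0 f0 hc hA; rewrite leNgt; apply/negP => h.
have [z|z] := eqVneq (f 0%N) 0.
 have := hc 0%N; rewrite z mul0r => h1; rewrite z mulr0 in h.
 have : 0 < f 1%N ^+ 2 by rewrite exprn_gt0.
 by rewrite ltNge h1.
have z0 : 0 < f 0%N by rewrite lt_def z f0.
pose r := f 1%N / f 0%N; have rB : B < r by rewrite ltr_pdivlMr.
have r0 : 0 < r by exact: lt_trans rB.
have key j : 0 < f j /\ r * f j <= f j.+1.
 elim: j => [|j [h1 h2]]; first by split => //; rewrite divfK.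
 have h3 : 0 < f j.+1 by apply: lt_le_trans h2; rewrite mulr_gt0.
 split => //; rewrite -(ler_pM2l h1); apply: le_trans (hc j).
 by rewrite mulrA expr2 ler_wpM2r ?(ltW h3)// mulrC.
have low j : r ^+ j * f 0%N <= f j.
 elim: j => [|j IH]; first by rewrite expr0 mul1r.
 by apply: le_trans (key j).2; rewrite exprS -mulrA ler_wpM2l// ltW.
have q1 : `|B / r| < 1 by rewrite ger0_norm ?divr_ge0 ?(ltW B0) ?(ltW r0)// ltr_pdivrMr// mul1r.
have A1 : 0 < `|A| + 1 by rewrite ltr_wpDl.
have := cvg_expr q1 => /cvgrPdist_lt/(_ (f 0%N / (`|A| + 1)) (divr_gt0 z0 A1)) [N _ hN].
have := hN N (leqnn N); rewrite /= sub0r normrN ger0_norm ?exprn_ge0 ?divr_ge0 ?(ltW B0) ?(ltW r0)//.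
rewrite expr_div_n ltr_pdivlMr// mulrAC ltr_pdivrMr ?exprn_gt0// => h1.
have h2 := le_trans (low N) (hA N).
have h3 : A * B ^+ N <= (`|A| + 1) * B ^+ N.
 rewrite ler_wpM2r ?exprn_ge0 ?(ltW B0)//; apply: le_trans (ler_norm _) _; by rewrite lerDl.
move: h1; rewrite ltNge => /negP; apply; rewrite mulrC.
by apply: (le_trans h2); apply: (le_trans h3); rewrite mulrC.
Qed.

(** Integrates a one-sided bound on the derivative. Iterated, it is Taylor's estimate for a function
    whose derivatives vanish at 0. *)
Lemma monomial_bound (R : realType) (f df : R -> R) (M t : R) (J : nat) : 0 <= t -> f 0 = 0 ->
 (forall s : R, 0 <= s <= t -> is_derive s 1 f (df s)) ->
 (forall s : R, 0 <= s <= t -> df s <= M * s ^+ J / J`!%:R) -> f t <= M * t ^+ J.+1 / J.+1`!%:R.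
Proof.
move=> t0 f0 hd hb.
have [t00|tn] := eqVneq t 0; first by rewrite t00 f0 expr0n mulr0 mul0r.
have tp : 0 < t by rewrite lt_def tn.
pose g s : R := M * s ^+ J.+1 / J.+1`!%:R - f s.
have dg s : 0 <= s <= t -> is_derive s 1 g (M * s ^+ J / J`!%:R - df s).
 move=> hs; have h1 := hd s hs.
 have h2 : is_derive s 1 (fun s : R => s ^+ J.+1) (J.+1%:R * s ^+ J).
  have := @is_deriveX _ _ id J.+1 s 1 1 (is_derive_id _ _).
  have -> : (id : R -> R) ^+ J.+1 = (fun s : R => s ^+ J.+1).
   by elim: (J.+1) => [|j IH]; [apply/funext => u; rewrite !expr0|rewrite exprS IH; apply/funext => u; rewrite exprS].
  by rewrite /GRing.scale /= mulr1.
 have h3 := is_deriveZ (M / J.+1`!%:R) h2.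
 have h4 := is_deriveB h3 h1.
 have -> : g = (M / J.+1`!%:R *: (fun s : R => s ^+ J.+1)) - f.
  by apply/funext => u; rewrite /g -[RHS]/(M / J.+1`!%:R * u ^+ J.+1 - f u) mulrAC.
 have -> : M * s ^+ J / J`!%:R = (M / J.+1`!%:R) *: (J.+1%:R * s ^+ J : R).
  rewrite /GRing.scale /= factS natrM.
  have n1 : J.+1%:R != 0 :> R by rewrite pnatr_eq0.
  have n2 : J`!%:R != 0 :> R by rewrite pnatr_eq0 gtn_eqF ?fact_gt0.
  by move: n1 n2; move: (J.+1%:R : R) (J`!%:R : R) => x y n1 n2; field; rewrite n1 n2.
 exact: h4.
have cg : {within `[0, t], continuous g}.
 apply: derivable_within_continuous => s; rewrite in_itv /= => hs.
 by have [] := dg s hs.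
have [s|s sI e] := @MVT _ g (fun s => M * s ^+ J / J`!%:R - df s) 0 t tp _ cg.
 by rewrite in_itv /= => /andP[/ltW h1 /ltW h2]; apply: dg; rewrite h1.
have hs : 0 <= s <= t by move: sI; rewrite in_itv /= => /andP[/ltW -> /ltW ->].
have g0 : g 0 = 0 by rewrite /g f0 expr0n mulr0 mul0r subr0.
have : 0 <= g t.
 have -> : g t = (M * s ^+ J / J`!%:R - df s) * t by move: e; rewrite g0 !subr0.
 by rewrite mulr_ge0// subr_ge0 hb.
by rewrite /g subr_ge0.
Qed.

Definition spanned (R : realType) (V : hilbertType R) (es : seq V) w := oproj es w = w.

Lemma spanned_subspace (R : realType) (V : hilbertType R) (es : seq V) : subspace (spanned es).
Proof.
split=> [|a x y hx hy]; rewrite /spanned.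
 by rewrite /oproj big1// => e _; rewrite inner0l scale0r.
by rewrite oproj_lin hx hy.
Qed.

Lemma dense_orth0 (R : realType) (V : hilbertType R) (D : V -> Prop) y :
 dense_in D -> (forall u, D u -> inner u y = 0) -> y = 0.
Proof.
move=> hD h; apply/eqP; rewrite -rn_eq0 eq_le rn_ge0 andbT leNgt; apply/negP => y0.
have [z Dz yz] := hD y _ y0; have := rn_inner_le (y - z) y.
rewrite innerBl (h _ Dz) subr0 inner_rn rn_real expr2 normrM (gtr0_norm y0) ler_pM2r//.
by rewrite leNgt yz.
Qed.

Section multinom_words.
Variable n : nat.
Implicit Types (m : mpoly.multinom n) (s : seq 'I_n).

(** The sorted word with exponents m, which links commutative monomials to words in the enveloping
    algebra. *)
Definition mseq m : seq 'I_n := flatten [seq nseq (m i) i | i <- enum 'I_n].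

Lemma count_mseq m i : count_mem i (mseq m) = m i.
Proof.
rewrite count_flatten -map_comp sumnE big_map (bigD1_seq i) ?mem_enum ?enum_uniq//= count_nseq /= eqxx mul1n.
by rewrite big1 ?addn0// => j ji; rewrite count_nseq /= (negbTE ji).
Qed.

Lemma size_mseq m : size (mseq m) = mpoly.mdeg m.
Proof.
rewrite size_flatten /shape -map_comp sumnE big_map mpoly.mdegE big_enum /=.
by apply: eq_bigr => i _; rewrite size_nseq.
Qed.

Lemma mseq_count s : exists2 m, perm_eq s (mseq m) & forall i, m i = count_mem i s.
Proof.
exists (mpoly.Multinom [tuple count_mem i s | i < n]) => [|i]; last by rewrite mpoly.mnm_tnth tnth_mktuple.
apply/allP => i _ /=; rewrite count_mseq; apply/eqP.
by rewrite mpoly.mnm_tnth tnth_mktuple.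
Qed.

Lemma mseqD m i j :
 perm_eq (mseq (mpoly.mnm_add m (mpoly.mnm_muln (mpoly.mnm1 i) j))) (mseq m ++ nseq j i).
Proof.
apply/allP => k _ /=; rewrite count_cat !count_mseq count_nseq mpoly.mnmDE mpoly.mulmnE mpoly.mnm1E.
by rewrite mulnC.
Qed.

End multinom_words.

Lemma cvg_seq_sum (R : realType) (V : hilbertType R) (T : Type) (F : set_system T) (FF : Filter F)
 (I : eqType) (r : seq I) (f : I -> T -> V) (l : I -> V) : (forall i, i \in r -> f i x @[x --> F] --> l i) ->
 (\sum_(i <- r) f i x) @[x --> F] --> \sum_(i <- r) l i.
Proof.
elim: r => [|i r IH] h.
 have -> : (fun x => \sum_(i <- [::]) f i x) = fun=> 0 by apply/funext => x; rewrite big_nil.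
 by rewrite big_nil; exact: cvg_cst.
have -> : (fun x => \sum_(j <- i :: r) f j x) = (fun x => f i x + \sum_(j <- r) f j x).
 by apply/funext => x; rewrite big_cons.
rewrite big_cons; apply: cvgD; first by apply: h; exact: mem_head.
by apply: IH => j jr; apply: h; rewrite inE jr orbT.
Qed.

Lemma orthonormal_cat (R : realType) (V : hilbertType R) (s1 s2 : seq V) : orthonormal s1 -> orthonormal s2 ->
 (forall a b, a \in s1 -> b \in s2 -> inner a b = 0 :> R[i]) -> orthonormal (s1 ++ s2).
Proof.
move=> [u1 h1] [u2 h2] h.
have dis b : b \in s1 -> b \in s2 -> False.
 by move=> b1 b2; have := h b b b1 b2; rewrite h1// eqxx => /eqP; rewrite oner_eq0.
split.
 rewrite cat_uniq u1 u2 andbT /=; apply/hasPn => b b2; apply/negP => b1; exact: (dis b).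
have conj0 (z : R[i]) : z = 0 -> forall x y : V, inner x y = z -> inner y x = 0 :> R[i].
 by move=> -> x y e; rewrite innerC e; apply/eqP; rewrite eq_complex /= oppr0 !eqxx.
move=> b c; rewrite !mem_cat => /orP[b1|b2] /orP[c1|c2].
- exact: h1.
- by rewrite h//; case: eqP => // bc; exfalso; apply: (dis b) => //; rewrite bc.
- rewrite (conj0 0 erefl c b (h c b c1 b2)); case: eqP => // bc; exfalso; apply: (dis c) => //; by rewrite -bc.
- exact: h2.
Qed.

Lemma orthonormal_sub (R : realType) (V : hilbertType R) (s1 s2 : seq V) : orthonormal s2 -> uniq s1 ->
 {subset s1 <= s2} -> orthonormal s1.
Proof. by move=> [u h] u1 sub; split => // e e' /sub h1 /sub h2; exact: h. Qed.

(** * The enveloping algebra acting on a K-invariant space *)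

Section casimir_operators.
Variables (R : realType) (n : nat) (G : topGroupType).
Variables (S : set 'M[R]_n) (pr : G -> 'M[R]_n) (gam : 'M[R]_n -> R -> G).
Hypotheses (SA : self_adjoint_algebraic_group S) (CP : covering S pr) (hgam : lifting S pr gam).
Variables (V : hilbertType R) (p : unitary_rep G V).
Hypothesis hp : irreducible_rep p.
Let GS : linear_group S := cov_group CP.
Notation sm := (smooth_vector p).
Notation inK := (inK S pr).
Variables bsk bsp : seq 'M[R]_n.
Hypotheses (bs_orth : morthonormal (bsk ++ bsp))
 (bsk_in : forall b, b \in bsk -> lie_k S b) (bsp_in : forall b, b \in bsp -> lie_p S b)
 (bs_span : forall X, lie S X -> X = \sum_(b <- bsk ++ bsp) mdot X b *: b).
Hypothesis sm_dense : dense_in sm.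
Notation dr := (dr gam p).
Notation word := (word gam p).
Variable ws : seq V.
Hypotheses (ws_orth : orthonormal ws) (ws_ne : ws != [::]) (ws_sm : forall w, w \in ws -> sm w)
 (ws_act : forall k w, inK k -> oproj ws w = w -> oproj ws (p k w) = p k w).
Notation inW := (spanned ws).

Let bs_in b : b \in bsk ++ bsp -> lie S b.
Proof. by rewrite mem_cat => /orP[/bsk_in[]|/bsp_in[]]. Qed.
Let dr_smooth := dr_smooth hgam (p := p).
Let dr_skew := dr_skew hgam (p := p).
Let drvD := drvD hgam (p := p).
Let drvZ := drvZ hgam (p := p).
Let drZ := drZ CP hgam bs_orth bs_in bs_span (p := p).
Let dr_sum := dr_sum CP hgam bs_orth bs_in bs_span (p := p).
Let dr_basis := dr_basis CP hgam bs_orth bs_in bs_span (p := p).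
Let rep_dr := rep_dr CP hgam bs_orth bs_in bs_span (p := p).

Lemma subspace_smooth : subspace (smooth_vector p).
Proof. by split; [exact: smooth0|move=> a x y; exact: smooth_lin]. Qed.

Lemma inW_smooth w : inW w -> sm w.
Proof. by move=> <-; apply: oproj_sub ws_sm; exact: subspace_smooth. Qed.

Lemma gam_inK Y t : lie_k S Y -> inK (gam Y t).
Proof.
move=> kY; have [lY _] := kY; have [_ e] := hgam lY; rewrite /inK e; have [_ h] := lie_orth CP Y; exact: h.
Qed.

(** The part of dr Y w outside W, multiplied by t, is the part outside W of the remainder d up to
    sign, since p(gam_Y(t)) w - w is in W; and d is o(t). *)
Lemma dr_inW Y w : lie_k S Y -> inW w -> inW (dr Y w).
Proof.
move=> kY hw; have [lY _] := kY; apply/esym/eqP; rewrite -subr_eq0 -rn_eq0 eq_le rn_ge0 andbT.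
apply/ler_addgt0Pr => e e0; rewrite add0r; have e2 : 0 < e / 2 by rewrite divr_gt0.
have /near0E[r r0 hr] := dr_ders hgam lY (inW_smooth hw) e2.
have r2 : 0 < r / 2 by rewrite divr_gt0.
have rr : `|r / 2| < r by rewrite gtr0_norm// half_lt.
have := hr _ rr; rewrite (gtr0_norm r2); move: r2; set t := r / 2 => t0; set d := p _ w - w - _ => hd.
have hd2 : inW (p (gam Y t) w - w).
 by apply: subspaceB; [exact: spanned_subspace|apply: ws_act => //; exact: gam_inK|].
have e1 : t%:C *: (dr Y w - oproj ws (dr Y w)) = oproj ws d - d.
 have := oproj_lin ws (- t%:C) (dr Y w) (p (gam Y t) w - w); rewrite hd2 => h.
 have -> : oproj ws d = - t%:C *: oproj ws (dr Y w) + (p (gam Y t) w - w).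
  by rewrite -h; congr oproj; rewrite /d; lmod R V.
 by rewrite /d; lmod R V.
have : t * rn (dr Y w - oproj ws (dr Y w)) <= e * t.
 rewrite -{1}(gtr0_norm t0) -rn_real -rnZ e1; apply: le_trans (rnB _ _) _.
 have := rn_oproj_le d ws_orth; lra.
by rewrite mulrC ler_pM2r.
Qed.

Notation lwords := (lwords S).
Let word_sm := word_smooth hgam (p := p).

(* U_m (g) W for the enveloping algebra filtered by the degree. *)
Definition usp m (u : V) := exists s : seq (seq 'M[R]_n * V),
 (forall a, a \in s -> [/\ (size a.1 <= m)%N, lwords a.1 & inW a.2]) /\
 u = \sum_(a <- s) word a.1 a.2.

Lemma word_lin l a x y : lwords l -> sm x -> sm y ->
 word l (a *: x + y) = a *: word l x + word l y.
Proof.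
move=> hl hx hy; elim: l hl => //= X l IH hl.
have hl' := lwords_tail hl; rewrite IH// (dr_lin hgam)//; try exact: word_sm.
exact: lwords_head hl.
Qed.

Lemma wordZ l a x : lwords l -> sm x -> word l (a *: x) = a *: word l x.
Proof.
elim: l => //= X l IH hl sx; have hl' := lwords_tail hl.
by rewrite IH// drvZ//; [exact: lwords_head hl|exact: word_sm].
Qed.

Lemma usp_word m l w : (size l <= m)%N -> lwords l -> inW w -> usp m (word l w).
Proof.
by move=> h1 h2 h3; exists [:: (l, w)]; split; [move=> a; rewrite inE => /eqP->|rewrite big_seq1].
Qed.

Lemma usp_subspace m : subspace (usp m).
Proof.
split; first by exists [::]; split => //; rewrite big_nil.
move=> a x y [s [hs ->]] [s' [hs' ->]].
exists ([seq (b.1, a *: b.2) | b <- s] ++ s'); split.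
 move=> b; rewrite mem_cat => /orP[/mapP[c cs ->] /=|/hs'//].
 by have [h1 h2 h3] := hs c cs; split => //; apply: subspaceZ => //; exact: spanned_subspace.
rewrite big_cat big_map /= scaler_sumr; congr (_ + _); apply: eq_big_seq => c cs /=.
have [_ h2 h3] := hs c cs; have hc := inW_smooth h3.
by rewrite wordZ.
Qed.

Lemma usp_leq m m' u : (m <= m')%N -> usp m u -> usp m' u.
Proof.
move=> mm [s [hs ->]]; exists s; split => // a /hs[h1 h2 h3]; split => //.
exact: leq_trans mm.
Qed.

Lemma usp_smooth m u : usp m u -> sm u.
Proof.
move=> [s [hs ->]]; apply: subspace_sum; first exact: subspace_smooth.
by move=> a /hs[_ h2 h3]; apply: word_sm => //; exact: inW_smooth.
Qed.

Lemma usp_dr m X u : lie S X -> usp m u -> usp m.+1 (dr X u).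
Proof.
move=> lX [s [hs ->]]; pose F (a : seq 'M[R]_n * V) := if a \in s then word a.1 a.2 else 0.
have sF a : sm (F a).
 rewrite /F; case: ifP => [/hs[_ h2 h3]|_]; last exact: smooth0.
 by apply: word_sm => //; exact: inW_smooth.
have -> : \sum_(a <- s) word a.1 a.2 = \sum_(a <- s) F a by apply: eq_big_seq => a ain; rewrite /F ain.
rewrite (drv_sum hgam)//; apply: subspace_sum; first exact: usp_subspace.
move=> a ain; rewrite /F ain; have [h1 h2 h3] := hs a ain.
by apply: (@usp_word m.+1 (X :: a.1)) => //; exact: lwords_cons.
Qed.

Lemma usp_act m k u : inK k -> usp m u -> usp m (p k u).
Proof.
move=> hk [s [hs ->]]; rewrite rep_sum; apply: subspace_sum; first exact: usp_subspace.
move=> a /hs[h1 h2 h3]; rewrite (word_act CP hgam bs_orth bs_in bs_span)//; last exact: inW_smooth.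
apply: usp_word; rewrite ?size_map//; last exact: ws_act.
by move=> Y /mapP[X /h2 lX ->]; exact: (conj_lie CP).
Qed.

(** The words of the Leibniz rule for the bracket with Y, one for each letter. *)
Fixpoint ad_word Y (l : seq 'M[R]_n) : seq (seq 'M[R]_n) := match l with
 | [::] => [::] | X :: l' => ((Y *m X - X *m Y) :: l') :: [seq X :: l2 | l2 <- ad_word Y l'] end.

Lemma ad_word_size Y l : size (ad_word Y l) = size l.
Proof. by elim: l => //= X l IH; rewrite size_map IH. Qed.

Lemma ad_word_in Y l l' : lie S Y -> lwords l -> l' \in ad_word Y l ->
 [/\ size l' = size l, lwords l' &
  \prod_(X <- l') mnorm X <= 2 * mnorm Y * \prod_(X <- l) mnorm X].
Proof.
move=> lY; elim: l l' => //= X l IH l' hl; have lX := lwords_head hl; have hl' := lwords_tail hl.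
have P0 (r : seq 'M[R]_n) : 0 <= \prod_(X <- r) mnorm X by apply: prodr_ge0 => *; exact: mnorm_ge0.
rewrite inE => /orP[/eqP->|/mapP[l2 /(IH _ hl')[h1 h2 h3] ->]].
 split => //; first exact: lwords_cons (lie_bracket GS lY lX) hl'.
 rewrite !big_cons mulrA ler_wpM2r//; apply: le_trans (mnormB _ _) _.
 apply: (le_trans (lerD (mnormM _ _) (mnormM _ _))).
 by apply: eq_ler; ring.
split; [by rewrite /= h1|exact: lwords_cons|].
by rewrite !big_cons mulrCA ler_wpM2l ?mnorm_ge0.
Qed.

Lemma dr_word Y l w : lie S Y -> lwords l -> sm w ->
 dr Y (word l w) = word l (dr Y w) + \sum_(l' <- ad_word Y l) word l' w.
Proof.
move=> lY hl hw; elim: l hl => [|X l IH] hl; first by rewrite big_nil addr0.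
have lX := lwords_head hl; have hl' := lwords_tail hl.
have sw := word_sm hl' hw.
have br := dr_bracket CP hgam bs_orth bs_in bs_span sm_dense lY lX sw.
have e1 : dr Y (dr X (word l w)) = dr X (dr Y (word l w)) + dr (Y *m X - X *m Y) (word l w).
 by rewrite br addrC subrK.
rewrite /= e1 IH// big_cons big_map /=.
have s1 : sm (word l (dr Y w)) by apply: word_sm => //; exact: dr_smooth.
have s2 : sm (\sum_(l' <- ad_word Y l) word l' w).
 apply: subspace_sum; first exact: subspace_smooth.
 by move=> l' /(ad_word_in lY hl')[_ h _]; exact: word_sm.
rewrite drvD// -addrA; congr (_ + _); rewrite addrC; congr (_ + _).
pose F (l' : seq 'M[R]_n) := if l' \in ad_word Y l then word l' w else 0.
have sF l' : sm (F l').
 by rewrite /F; case: ifP => [/(ad_word_in lY hl')[_ h _]|_]; [exact: word_sm|exact: smooth0].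
have -> : \sum_(l' <- ad_word Y l) word l' w = \sum_(l' <- ad_word Y l) F l'.
 by apply: eq_big_seq => l' h; rewrite /F h.
by rewrite (drv_sum hgam)//; apply: eq_big_seq => l' h; rewrite /F h.
Qed.

Lemma word_nseqS Y j u : word (nseq j.+1 Y) u = word (nseq j Y) (dr Y u).
Proof. by elim: j => //= j IH; rewrite -IH. Qed.

Lemma lwords_nseq j Y : lie S Y -> lwords (nseq j Y).
Proof. by move=> lY X /nseqP[-> _]. Qed.

Lemma word_sum_seq l (I : eqType) (r : seq I) (F : I -> V) : lwords l ->
 (forall i, i \in r -> sm (F i)) -> word l (\sum_(i <- r) F i) = \sum_(i <- r) word l (F i).
Proof.
move=> hl; elim: r => [|i r IH] hF.
 by rewrite !big_nil; have := wordZ 0 hl (smooth0 p); rewrite !scale0r.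
have hr j : j \in r -> sm (F j) by move=> jr; apply: hF; rewrite inE jr orbT.
have := word_lin 1 hl (hF i (mem_head _ _)) (subspace_sum subspace_smooth hr).
by rewrite !big_cons !scale1r IH.
Qed.

Lemma dr_bound_inW Y : lie_k S Y -> exists2 C : R, 0 <= C & forall w, inW w -> rn (dr Y w) <= C * rn w.
Proof.
move=> [lY _]; exists (\sum_(e <- ws) rn (dr Y e)); first by apply: sumr_ge0 => *; exact: rn_ge0.
move=> w hw; rewrite -{1}hw.
have -> : dr Y (oproj ws w) = \sum_(e <- ws) inner w e *: dr Y e.
 have hs e : e \in ws -> sm (inner w e *: e) by move=> /ws_sm; exact: smoothZ.
 have lw : lwords [:: Y] by exact: lwords1.
 have := word_sum_seq lw hs; rewrite /= /oproj => ->.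
 by apply: eq_big_seq => e /ws_sm h; rewrite drvZ.
apply: le_trans (rn_sum _ _ _) _; rewrite mulr_suml; apply: ler_sum_seq => e ein; rewrite rnZ mulrC ler_wpM2l ?rn_ge0//.
by apply: le_trans (rn_inner_le _ _) _; rewrite (orthonormal_rn ws_orth ein) mulr1.
Qed.

Lemma word_bound_inW m : exists2 C : R, 0 <= C & forall l w, (size l <= m)%N -> lwords l -> inW w ->
 rn (word l w) <= C * \prod_(X <- l) mnorm X * rn w.
Proof.
have h (em : V * nat) : exists C : R, 0 <= C /\ (em.1 \in ws -> forall l, size l = em.2 -> lwords l ->
  rn (word l em.1) <= C * \prod_(X <- l) mnorm X).
 have [/ws_sm hs|_] := boolP (em.1 \in ws); last by exists 0.
 by have [C C0 hC] := word_bound CP hgam bs_orth bs_in bs_span em.2 hs; exists C.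
have [f hf] := choice h.
have f0 em : 0 <= f em by case: (hf em).
exists (\sum_(e <- ws) \sum_(i < m.+1) f (e, nat_of_ord i)).
 by apply: sumr_ge0 => e _; apply: sumr_ge0.
move=> l w lm hl hw; rewrite -{1}hw word_sum_seq//; last by move=> e /ws_sm; exact: smoothZ.
apply: le_trans (rn_sum _ _ _) _; rewrite !mulr_suml; apply: ler_sum_seq => e ein; have se := ws_sm ein.
rewrite wordZ// rnZ mulrC ler_pM ?rn_ge0//; last first.
 by apply: le_trans (rn_inner_le _ _) _; rewrite (orthonormal_rn ws_orth ein) mulr1.
have [_ h1] := hf (e, size l); apply: (le_trans (h1 ein l erefl hl)).
rewrite ler_wpM2r//; first by apply: prodr_ge0 => *; exact: mnorm_ge0.
have lm' : (size l < m.+1)%N by [].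
by rewrite (bigD1 (Ordinal lm'))//= lerDl; apply: sumr_ge0.
Qed.

(* Powers of Y grow on the word vector at most like the powers of the norm of Y
  on W (x) g^(x m); as Y is skew-adjoint this bounds Y itself. *)
Lemma word_iter_bound Y : lie_k S Y -> exists2 B : R, 0 < B & forall m, exists2 K : R, 0 <= K &
 forall j l w, (size l <= m)%N -> lwords l -> inW w ->
  rn (word (nseq j Y) (word l w)) <= K * \prod_(X <- l) mnorm X * rn w * (B * m.+1%:R) ^+ j.
Proof.
move=> kY; have [lY _] := kY; have [C0 C00 hC0] := dr_bound_inW kY.
pose B := C0 + 2 * mnorm Y + 1.
have Y0 := mnorm_ge0 Y.
have B0 : 0 < B by rewrite ltr_wpDl// addr_ge0// mulr_ge0.
exists B => // m; have [K K0 hK] := word_bound_inW m; exists K => // j.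
have P0 (r : seq 'M[R]_n) : 0 <= \prod_(X <- r) mnorm X by apply: prodr_ge0 => *; exact: mnorm_ge0.
elim: j => [|j IH] l w lm hl hw; first by rewrite expr0 mulr1 /=; exact: hK.
have sw := inW_smooth hw.
rewrite word_nseqS dr_word//.
have ln := @lwords_nseq j Y lY.
have s1 : sm (word l (dr Y w)) by apply: word_sm => //; exact: dr_smooth.
have hs l' : l' \in ad_word Y l -> sm (word l' w).
 by move=> /(ad_word_in lY hl)[_ h _]; exact: word_sm.
have -> : word (nseq j Y) (word l (dr Y w) + \sum_(l' <- ad_word Y l) word l' w) =
  word (nseq j Y) (word l (dr Y w)) + \sum_(l' <- ad_word Y l) word (nseq j Y) (word l' w).
 rewrite -[X in word _ (X + _)]scale1r word_lin//; last by apply: subspace_sum => //; exact: subspace_smooth.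
 by rewrite scale1r word_sum_seq.
set P := \prod_(X <- l) mnorm X; have hP : 0 <= P by exact: P0.
have q0 : 0 <= (B * m.+1%:R) ^+ j by rewrite exprn_ge0// mulr_ge0// ltW.
apply: le_trans (rnD _ _) _.
have h1 : rn (word (nseq j Y) (word l (dr Y w))) <= K * P * rn w * (B * m.+1%:R) ^+ j * C0.
 apply: (le_trans (IH _ _ lm hl (dr_inW kY hw))); rewrite -/P [leRHS]mulrAC ler_wpM2r//.
 by rewrite -[leRHS]mulrA ler_wpM2l ?mulr_ge0// mulrC hC0.
have h2 : rn (\sum_(l' <- ad_word Y l) word (nseq j Y) (word l' w)) <=
  m%:R * (K * P * rn w * (B * m.+1%:R) ^+ j * (2 * mnorm Y)).
 apply: le_trans (rn_sum _ _ _) _.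
 apply: (@le_trans _ _ (\sum_(l' <- ad_word Y l) K * P * rn w * (B * m.+1%:R) ^+ j * (2 * mnorm Y))).
  apply: ler_sum_seq => l' /(ad_word_in lY hl)[e1 e2 e3].
  apply: (le_trans (IH _ _ _ e2 hw)); first by rewrite e1.
  rewrite -/P in e3; have := ler_wpM2l K0 e3 => e4.
  have := ler_wpM2r q0 (ler_wpM2r (rn_ge0 w) e4); move=> h; apply: (le_trans h).
  by apply: eq_ler; ring.
 rewrite big_const_seq count_predT iter_addr_0 ad_word_size -[leLHS]mulr_natl ler_wpM2r ?ler_nat//.
 by rewrite !mulr_ge0 ?rn_ge0.
apply: (le_trans (lerD h1 h2)); rewrite exprS.
have -> : K * P * rn w * (B * m.+1%:R * (B * m.+1%:R) ^+ j) =
 K * P * rn w * (B * m.+1%:R) ^+ j * (B * m.+1%:R) by ring.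
have -> : K * P * rn w * (B * m.+1%:R) ^+ j * C0 + m%:R * (K * P * rn w * (B * m.+1%:R) ^+ j * (2 * mnorm Y)) =
 K * P * rn w * (B * m.+1%:R) ^+ j * (C0 + m%:R * (2 * mnorm Y)) by ring.
rewrite ler_wpM2l ?mulr_ge0 ?rn_ge0// -natr1 /B.
have m0 : 0 <= m%:R :> R by [].
have : 0 <= m%:R * C0 by rewrite mulr_ge0.
have : 0 <= m%:R * mnorm Y by rewrite mulr_ge0.
lra.
Qed.

(** f(j) = |Y^j u| is log-convex since Y is skew-adjoint, and grows at most like (B (m+1))^j; hence
    already |Y u| <= B (m+1) |u|. Linearity in m is what makes these vectors analytic. *)
Lemma skew_bound_usp Y : lie_k S Y -> exists2 B : R, 0 < B & forall m u, usp m u ->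
 rn (dr Y u) <= B * m.+1%:R * rn u.
Proof.
move=> kY; have [lY _] := kY; have [B B0 hB] := word_iter_bound kY; exists B => // m u hu.
have su := usp_smooth hu; have [K K0 hK] := hB m.
have [s [hs us]] := hu.
pose A := \sum_(a <- s) K * \prod_(X <- a.1) mnorm X * rn a.2.
pose f j := rn (word (nseq j Y) u).
have mB : 0 < B * m.+1%:R by rewrite mulr_gt0// ltr0n.
apply: (@log_convex_bound R f A _ mB) => [j|j|j].
- exact: rn_ge0.
- have sj := word_sm (@lwords_nseq j Y lY) su; have sj1 := word_sm (@lwords_nseq j.+1 Y lY) su.
 rewrite /f -Re_inner_rn -{1}/(dr Y (word (nseq j Y) u)) dr_skew//.
 rewrite raddfN /=; apply: le_trans (ler_norm _) _; rewrite normrN.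
 by apply: le_trans (absRe_le_rn _) _; exact: rn_inner_le.
- rewrite /f us word_sum_seq; [|exact: lwords_nseq|]; last first.
  by move=> a /hs[_ h2 h3]; apply: word_sm => //; exact: inW_smooth.
 apply: le_trans (rn_sum _ _ _) _; rewrite /A mulr_suml big_seq [leRHS]big_seq.
 by apply: ler_sum => a /hs[h1 h2 h3]; exact: hK.
Qed.

(** As b^T is - b on k and b on p, orthonormality reduces the trace operator of degree 2 to the sum
    of the squares over p minus that over k, and it is a scalar. This controls p by k up to a
    multiple of |u|^2. *)
Lemma casimir2 : exists c : R, forall u, sm u ->
 \sum_(b <- bsp) rn (dr b u) ^+ 2 = \sum_(b <- bsk) rn (dr b u) ^+ 2 + c * rn u ^+ 2.
Proof.
have [c hc] := zop_scalar SA CP hgam hp bs_orth bs_in bs_span sm_dense 2.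
exists (- Re c) => u su; have := hc u su; rewrite /=.
have [ub hb] := bs_orth.
pose eps (b : 'M[R]_n) : R := if b \in bsk then -1 else 1.
have sb b : b \in bsk ++ bsp -> b^T = eps b *: b.
 rewrite mem_cat /eps; case: ifP => [/bsk_in[_ ->] _|_ /= /bsp_in[_ ->]]; first by rewrite scaleN1r.
 by rewrite scale1r.
have -> : \sum_(b <- bsk ++ bsp) dr b (\sum_(b0 <- bsk ++ bsp)
  dr b0 ((\tr (1%:M *m b^T *m b0^T))%:C *: u)) = \sum_(b <- bsk ++ bsp) (eps b)%:C *: dr b (dr b u).
 apply: eq_big_seq => b bin; have lb := bs_in bin.
 have -> : \sum_(b0 <- bsk ++ bsp) dr b0 ((\tr (1%:M *m b^T *m b0^T))%:C *: u) = (eps b)%:C *: dr b u.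
  rewrite (bigD1_seq b)//= big1_seq ?addr0 => [|d /andP[db din]].
   rewrite mul1mx drvZ// sb// -scalemxAl mxtraceZ -sb// -mdot_tr hb// eqxx mulr1 //.
  have ld := bs_in din; rewrite drvZ// mul1mx (sb b bin) -scalemxAl mxtraceZ -mdot_tr hb// eq_sym (negbTE db).
  by rewrite mulr0 scale0r.
 by rewrite drvZ//; exact: dr_smooth.
move=> /(congr1 (fun y => Re (inner y u))).
rewrite innerZl inner_suml raddf_sum /=.
have -> : Re (c * inner u u) = Re c * rn u ^+ 2.
 by rewrite inner_rn; case: (c) => a b /=; rewrite mulr0 subr0.
have -> : \sum_(b <- bsk ++ bsp) Re (inner ((eps b)%:C *: dr b (dr b u)) u) =
  \sum_(b <- bsk ++ bsp) - eps b * rn (dr b u) ^+ 2.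
 apply: eq_big_seq => b bin; have lb := bs_in bin.
 rewrite innerZl_real Re_realM dr_skew//; last exact: dr_smooth.
 by rewrite raddfN /= Re_inner_rn mulrN mulNr.
rewrite big_cat /=.
have -> : \sum_(b <- bsk) - eps b * rn (dr b u) ^+ 2 = \sum_(b <- bsk) rn (dr b u) ^+ 2.
 by apply: eq_big_seq => b bin; rewrite /eps bin opprK mul1r.
have -> : \sum_(b <- bsp) - eps b * rn (dr b u) ^+ 2 = - \sum_(b <- bsp) rn (dr b u) ^+ 2.
 rewrite -sumrN; apply: eq_big_seq => b bin; rewrite /eps ifF ?mulN1r//.
 apply/negP => bk; have := ub; rewrite cat_uniq => /and3P[_ /hasPn h _].
 by have := h b bin; rewrite bk.
lra.
Qed.

(** Letters of k are bounded by [skew_bound_usp], those of p through [casimir2], and a general X by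
    expansion in the basis. *)
Lemma dr_bound_usp : exists2 C : R, 0 < C & forall m u X, usp m u -> lie S X ->
 rn (dr X u) <= C * mnorm X * m.+1%:R * rn u.
Proof.
have h (b : 'M[R]_n) : exists B : R, 0 < B /\ (b \in bsk -> forall m u, usp m u ->
  rn (dr b u) <= B * m.+1%:R * rn u).
 have [/bsk_in kb|nb] := boolP (b \in bsk); last by exists 1.
 by have [B B0 hB] := skew_bound_usp kb; exists B.
have [f hf] := choice h.
have f0 b : 0 <= f b by case: (hf b) => /ltW.
have [c hc] := casimir2.
pose D := \sum_(b <- bsk) f b ^+ 2 + `|c|.
have D0 : 0 <= D by rewrite addr_ge0//; exact: sum_sqr_ge0.
have key m u b : usp m u -> b \in bsk ++ bsp -> rn (dr b u) <= Num.sqrt D * m.+1%:R * rn u.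
 move=> hu bin; have su := usp_smooth hu.
 have m1 : 1 <= m.+1%:R :> R by rewrite ler1n.
 rewrite -(@ler_pXn2r _ 2) ?nnegrE ?mulr_ge0 ?sqrtr_ge0 ?rn_ge0// !exprMn sqr_sqrtr//.
 have h1 : \sum_(b <- bsk) rn (dr b u) ^+ 2 <= (\sum_(b <- bsk) f b ^+ 2) * m.+1%:R ^+ 2 * rn u ^+ 2.
  rewrite !mulr_suml; apply: ler_sum_seq => d din.
  by rewrite -!exprMn lerXn2r ?nnegrE ?mulr_ge0 ?rn_ge0//; have [_] := hf d; apply.
 have h2 : \sum_(b <- bsk) rn (dr b u) ^+ 2 + `|c| * rn u ^+ 2 <= D * m.+1%:R ^+ 2 * rn u ^+ 2.
  rewrite /D !mulrDl lerD// ler_wpM2r ?sqr_ge0// ler_peMr// expr_ge1//.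
 apply: le_trans h2; move: bin; rewrite mem_cat => /orP[bk|bp].
  rewrite (big_rem b)//= -addrA lerDl addr_ge0 ?(mulr_ge0 (normr_ge0 _) (sqr_ge0 _))//.
  exact: sum_sqr_ge0.
 apply: (@le_trans _ _ (\sum_(b <- bsp) rn (dr b u) ^+ 2)).
  by rewrite (big_rem b)//= lerDl; exact: sum_sqr_ge0.
 by rewrite hc// lerD2l ler_wpM2r ?sqr_ge0// ler_norm.
pose E := \sum_(b <- bsk ++ bsp) mnorm b.
have E0 : 0 <= E by apply: sumr_ge0 => *; exact: mnorm_ge0.
exists (E * Num.sqrt D + 1); first by rewrite ltr_wpDl// mulr_ge0// sqrtr_ge0.
move=> m u X hu lX; have su := usp_smooth hu.
rewrite (dr_basis lX su).
apply: le_trans (rn_sum _ _ _) _.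
apply: (@le_trans _ _ (E * Num.sqrt D * mnorm X * m.+1%:R * rn u)); last first.
 by rewrite !ler_wpM2r ?rn_ge0 ?mnorm_ge0// lerDl.
rewrite /E !mulr_suml; apply: ler_sum_seq => b bin.
rewrite rnZ rn_real.
have -> : mnorm b * Num.sqrt D * mnorm X * m.+1%:R * rn u = (mnorm X * mnorm b) * (Num.sqrt D * m.+1%:R * rn u) by ring.
by rewrite ler_pM ?rn_ge0 ?mdot_le// key.
Qed.

(** The bound gives |X^J u| <= B^J (m+J)! / m! |u|. All derivatives of <p(c(t)) u, v> vanish at 0,
    so Taylor's formula bounds it by a multiple of binom(m+J, m) (B t)^J, which tends to 0 for t <=
    1 / (2B). This radius depends neither on m nor on u, so the argument can be repeated. *)
Lemma orth_analytic c X : one_parameter_subgroup c -> lie S X ->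
 (forall u, sm u -> ders p c u (dr X u)) ->
 exists2 t0 : R, 0 < t0 & forall v, (forall m u, usp m u -> inner u v = 0) ->
  forall t, 0 <= t <= t0 -> forall m u, usp m u -> inner (p (c t) u) v = 0.
Proof.
move=> hc lX hX; have [C C0 hC] := dr_bound_usp.
pose B := C * mnorm X + 1; have B0 : 0 < B by rewrite ltr_wpDl// mulr_ge0 ?mnorm_ge0 ?ltW.
have hB m u : usp m u -> rn (dr X u) <= B * m.+1%:R * rn u.
 by move=> hu; apply: (le_trans (hC _ _ _ hu lX)); rewrite !ler_wpM2r ?rn_ge0// lerDl.
exists ((2 * B)^-1); first by rewrite invr_gt0 mulr_gt0.
move=> v hv.
have tay J m u (z : R[i]) t : usp m u -> 0 <= t ->
  Re (z * inner (p (c t) u) v) <= rn z * rn v * rn (word (nseq J X) u) * t ^+ J / J`!%:R.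
 elim: J m u t => [|J IH] m u t hu t0.
  rewrite expr0 mulr1 divr1 /=; apply: le_trans (Re_le_rn _) _; rewrite rnM -mulrA.
  rewrite ler_wpM2l ?rn_ge0// mulrC; apply: le_trans (rn_inner_le _ _) _; by rewrite rep_rn.
 have hu1 := usp_dr lX hu.
 apply: (@monomial_bound R (fun t => Re (z * inner (p (c t) u) v))
  (fun t => Re (z * inner (p (c t) (dr X u)) v))) => //.
 - by rewrite (one_param1 hc) rep1 (hv _ _ hu) mulr0.
 - move=> s hs; apply: littleo_is_derive => e e0.
  have zv : 0 < rn z * rn v + 1 by rewrite ltr_wpDl// mulr_ge0 ?rn_ge0.
  apply: filterS (hX u (usp_smooth hu) _ (divr_gt0 e0 zv)) => a ha.
  have -> : Re (z * inner (p (c (s + a)) u) v) - Re (z * inner (p (c s) u) v) -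
    a * Re (z * inner (p (c s) (dr X u)) v) =
    Re (z * inner (p (c s) (p (c a) u - u - a%:C *: dr X u)) v).
   rewrite hc.2 repM !repB repZ !innerBl innerZl_real -Re_realM -!raddfB /=; congr Re.
   by ring.
  apply: le_trans (absRe_le_rn _) _; rewrite rnM.
  apply: (@le_trans _ _ ((rn z * rn v) * (e / (rn z * rn v + 1) * `|a|))).
   rewrite -mulrA ler_wpM2l ?rn_ge0// mulrC; apply: le_trans (rn_inner_le _ _) _.
   by rewrite rep_rn ler_wpM2r ?rn_ge0.
  rewrite mulrA ler_wpM2r// mulrCA ler_piMr ?(ltW e0)// ler_pdivrMr// mul1r lerDl//.
 - by move=> s /andP[s0 _]; rewrite word_nseqS; exact: IH hu1 s0.
move=> t /andP[t0 tB] m u hu.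
have wb J : rn (word (nseq J X) u) <= B ^+ J * ((m + J)`!%:R / m`!%:R) * rn u /\ usp (m + J)%N (word (nseq J X) u).
 elim: J => [|J [IH1 IH2]].
  by rewrite addn0 expr0 mul1r divff ?mul1r// pnatr_eq0 gtn_eqF ?fact_gt0.
 split; last by rewrite addnS; exact: usp_dr.
 rewrite /=; apply: (le_trans (hB _ _ IH2)).
 apply: (le_trans (ler_wpM2l _ IH1)); first by rewrite mulr_ge0// ltW.
 rewrite addnS factS natrM exprS; apply: eq_ler; ring.
have bnd J (z : R[i]) : Re (z * inner (p (c t) u) v) <= rn z * rn v * rn u * ('C(m + J, m)%:R / 2 ^+ J).
 apply: (le_trans (tay J m u z t hu t0)).
 have -> : 'C(m + J, m)%:R = (m + J)`!%:R / (m`!%:R * J`!%:R) :> R.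
  rewrite -natrM -(@bin_fact (m + J) m) ?leq_addr// addKn natrM mulfK// natrM mulf_neq0// pnatr_eq0 gtn_eqF ?fact_gt0.

 have h1 : t ^+ J <= (2 * B)^-1 ^+ J by rewrite lerXn2r ?nnegrE ?invr_ge0 ?mulr_ge0 ?(ltW B0).
 have [h2 _] := wb J.
 have f0 k : 0 < k`!%:R :> R by rewrite ltr0n fact_gt0.
 apply: (@le_trans _ _ (rn z * rn v * (B ^+ J * ((m + J)`!%:R / m`!%:R) * rn u) * (2 * B)^-1 ^+ J / J`!%:R)).
  rewrite ler_wpM2r ?invr_ge0 ?(ltW (f0 _))// ler_pM ?exprn_ge0 ?mulr_ge0 ?rn_ge0// ler_wpM2l ?mulr_ge0 ?rn_ge0//.
 rewrite exprVn exprMn; apply: eq_ler; field.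
 by rewrite !expf_neq0 ?gt_eqF.
have small (e : R) : 0 < e -> exists J, 'C(m + J, m)%:R / 2 ^+ J < e.
 move=> e0; have h1 : `|(2^-1 : R)| < 1 by rewrite ger0_norm ?invr_ge0// invf_lt1// ltr1n.
 have : exists A : R, forall J, 'C(m + J, m)%:R * (2^-1 : R) ^+ J <= A * (3 / 4) ^+ J.
  pose q J : R := 'C(m + J, m)%:R * (2^-1) ^+ J.
  (* The ratio of consecutive terms is (m + J + 1) / (2 (J + 1)), at most 3/4 once 2m <= J + 1. *)
  have qS J : (2 * m <= J.+1)%N -> q J.+1 <= 3 / 4 * q J.
   move=> hJ; have hb : (J.+1%:R : R) * 'C(m + J.+1, m)%:R = (m + J.+1)%:R * 'C(m + J, m)%:R.
    rewrite -!natrM; congr (_%:R); have := mul_bin_down (m + J).+1 m.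
    by rewrite addnS /= => ->; congr (_ * _)%N; clear; lia.
   have J0 : 0 < J.+1%:R :> R by rewrite ltr0n.
   rewrite /q exprS -(ler_pM2l J0) (mulrA (J.+1%:R : R) ('C(m + J.+1, m)%:R : R)) hb.
   have c0 : 0 <= 'C(m + J, m)%:R * (2^-1 : R) ^+ J by rewrite mulr_ge0// exprn_ge0// invr_ge0.
   have -> : (m + J.+1)%:R * 'C(m + J, m)%:R * (2^-1 * 2^-1 ^+ J) =
    ((m + J.+1)%:R * 2^-1) * ('C(m + J, m)%:R * (2^-1 : R) ^+ J) by ring.
   rewrite (mulrA J.+1%:R) ler_wpM2r//.
   have : (2 * m)%:R <= J.+1%:R :> R by rewrite ler_nat.
   by rewrite natrM natrD; lra.
  pose M := (2 * m)%N.
  have hq J : q (M + J)%N <= q M * (3 / 4) ^+ J.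
   elim: J => [|J IH]; first by rewrite addn0 expr0 mulr1.
   rewrite addnS; apply: (le_trans (qS _ _)); first by rewrite /M; clear; lia.
   by rewrite exprS [leRHS]mulrCA ler_wpM2l//; lra.
  have q0 J : 0 <= q J by rewrite mulr_ge0// exprn_ge0// invr_ge0.
  have p34 J : 0 < (3 / 4 : R) ^+ J by rewrite exprn_gt0// divr_gt0.
  exists ((\sum_(i < M.+1) q i) * (4 / 3) ^+ M) => J; rewrite -/(q J).
  have sq i : (i <= M)%N -> q i <= \sum_(i < M.+1) q i.
   by move=> iM; rewrite (bigD1 (inord i))//= inordK// lerDl; apply: sumr_ge0.
  have e43 : (4 / 3) ^+ M * (3 / 4) ^+ M = 1 :> R.
   by rewrite -exprMn (_ : 4 / 3 * (3 / 4) = 1 :> R) ?expr1n//; field.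
  have s0 : 0 <= \sum_(i < M.+1) q i by apply: sumr_ge0.
  have [JM|MJ] := leqP J M.
   apply: (le_trans (sq J JM)); rewrite -mulrA ler_peMr//.
   rewrite -[leLHS]e43 ler_wpM2l ?exprn_ge0 ?divr_ge0//.
   by rewrite ler_wiXn2l// ?divr_ge0//; lra.
  rewrite -(subnKC (ltnW MJ)); apply: (le_trans (hq _)).
  by rewrite exprD mulrA -(mulrA _ ((4/3)^+M)) e43 mulr1 ler_wpM2r ?(ltW (p34 _))// sq.
 move=> [A hA]; have A1 : 0 < `|A| + 1 by rewrite ltr_wpDl.
 have q1 : `|(3 / 4 : R)| < 1 by rewrite ger0_norm ?divr_ge0//; lra.
 have := cvg_expr q1 => /cvgrPdist_lt/(_ (e / (`|A| + 1)) (divr_gt0 e0 A1)) [N _ hN].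
 exists N; have := hN N (leqnn N); rewrite /= sub0r normrN ger0_norm ?exprn_ge0 ?divr_ge0//.
 rewrite ltr_pdivlMr// => h2; rewrite -exprVn; apply: le_lt_trans (hA N) _.
 apply: le_lt_trans h2; rewrite mulrC ler_wpM2l ?exprn_ge0 ?divr_ge0//.
 by apply: le_trans (ler_norm _) _; rewrite lerDl.
set x := inner (p (c t) u) v.
apply/eqP; rewrite -rn_eq0 -sqrf_eq0 eq_le sqr_ge0 andbT; apply/ler_addgt0Pr => e e0; rewrite add0r.
have c1 : 0 < rn x^* * rn v * rn u + 1 by rewrite ltr_wpDl// !mulr_ge0 ?rn_ge0.
have [J hJ] := small _ (divr_gt0 e0 c1).
have := bnd J x^*; rewrite -/x.
have -> : Re (x^* * x) = rn x ^+ 2 by rewrite rn_sqr; case: (x) => a b /=; ring.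
move=> h; apply: (le_trans h); move: hJ; rewrite ltr_pdivlMr// => /ltW; apply: le_trans.
by rewrite mulrC ler_wpM2l ?lerDl// divr_ge0// exprn_ge0.
Qed.

Definition uspan u := exists m, usp m u.

(** The orthogonal complement of U(g) W is stable under the one-parameter subgroups, by steps of the
    uniform length t0, and under K; the polar decomposition gives all of G. By irreducibility it
    would be dense if it were nonzero, yet it is orthogonal to W. *)
Lemma uspan_dense : dense_in uspan.
Proof.
have uD : forall (a : R[i]) (x y : V), uspan x -> uspan y -> uspan (a *: x + y).
 move=> a x y [m hx] [m' hy]; exists (m + m')%N.
 by apply: (usp_subspace _).2; [apply: usp_leq hx; rewrite leq_addr|apply: usp_leq hy; rewrite leq_addl].
have u0 : uspan 0 by exists 0%N; exact: (usp_subspace _).1.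
apply: dense_of_orth => // v0 hv0.
pose W := [set y : V | forall m u, usp m u -> inner u y = 0].
have one c X : one_parameter_subgroup c -> lie S X -> (forall u, sm u -> ders p c u (dr X u)) ->
  forall t, 0 <= t -> forall y, W y -> W (p (c t)^-1%g y).
 move=> hc lX hX; have [t0 t00 ht0] := orth_analytic hc lX hX.
 have st t y : 0 <= t <= t0 -> W y -> W (p (c t)^-1%g y).
  by move=> tt Wy m u hu; rewrite -inner_repl; exact: ht0 hu.
 have iter N : forall t y, 0 <= t <= t0 *+ N -> W y -> W (p (c t)^-1%g y).
  elim: N => [|N IH] t y; rewrite ?mulr0n => /andP[h1 h2] Wy.
   by apply: st => //; rewrite h1 (le_trans h2)// ltW.
  have [tt|tt] := leP t t0; first by apply: st => //; rewrite h1.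
  have -> : t = t0 + (t - t0) by rewrite addrC subrK.
  rewrite -(one_paramN _ hc) opprD addrC hc.2 !(one_paramN _ hc) repM; apply: IH; first by rewrite subr_ge0 (ltW tt) lerBlDr -mulrSr.
  by apply: st => //; rewrite (ltW t00) lexx.
 move=> t tp y; apply: (iter (Num.truncn (t / t0)).+1); rewrite tp /=.
 have := truncnS_gt (t / t0); rewrite ltr_pdivrMr// mulr_natl; exact: ltW.
have gamW X t y : lie S X -> W y -> W (p (gam X t) y).
 move=> lX Wy; have [hc hcE] := hgam lX; have hX u : sm u -> ders p (gam X) u (dr X u) by move=> su; exact: (dr_ders hgam lX su).
 have gV s : (gam X s)^-1%g = gam X (- s) by rewrite (one_paramN _ hc).
 have [tp|tn] := leP 0 t; last first.
  have tm : 0 <= - t by rewrite oppr_ge0 ltW.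
  by have := one _ _ hc lX hX (- t) tm y Wy; rewrite gV opprK.
 pose c s := gam X (- s).
 have cc : one_parameter_subgroup c.
  split=> [x|s s']; last by rewrite /c opprD hc.2.
  by apply: (@continuous_comp _ _ _ (fun s : R => - s) (gam X)); [exact: opp_continuous|exact: hc.1].
 have cX u : sm u -> ders p c u (dr (- X) u).
  move=> su e e0; rewrite -(scaleN1r X) drZ//.
  have /near0E[r r0 hr] := dr_ders hgam lX su e0; apply/near0E; exists r => // s sr.
  have := hr (- s); rewrite normrN => /(_ sr); rewrite scalerA; apply: le_trans.
  by rewrite -(rmorphM (real_complex R)) mulrN1.
 by have := one _ _ cc (lieN lX) cX t tp y Wy; rewrite /c gV opprK.
apply/eqP/negPn/negP => v00.
have dW : dense_in W.
 apply: (irreducible_adherent hp) => [a x y hx hy m u hu|g y Wy|]; last by exists v0 => // m u hu; apply: hv0; exists m.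
  by rewrite innerDr innerZr (hx _ _ hu) (hy _ _ hu) mulr0 addr0.
 apply: adherent_sub; have [k [P [kS [lP _] e]]] := polar SA (cov_in CP g).
 have [hc hcE] := hgam lP.
 have -> : g = (g * (gam P 1)^-1 * gam P 1)%g by rewrite mulgVK.
 rewrite repM; set h := (g * _)%g.
 have Kh : inK h.
  by rewrite /inK (covM CP) (covV CP) hcE scale1r e mulmxK// mexp_unit.
 move=> m u hu; have := gamW P 1 y lP Wy m (p h^-1%g u).
 rewrite (inner_repl p h^-1%g) invgK; apply; apply: usp_act => //; exact: (inKV SA CP Kh).
have [w win] : exists w, w \in ws by case: ws ws_ne => // w r _; exists w; exact: mem_head.
have Ww : inW w.
 have [uw h] := ws_orth; rewrite /spanned /oproj (bigD1_seq w)//= h// eqxx scale1r big1_seq ?addr0//.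
 by move=> e /andP[ew ein]; rewrite h// eq_sym (negbTE ew) scale0r.
have rw := orthonormal_rn ws_orth win.
have [z hz wz] := dW w 1 ltr01.
have h1 : inner w z = 0 by apply: (hz 0%N); exact: (@usp_word 0%N [::]).
have := rn_inner_le w (w - z); rewrite innerBr h1 subr0 inner_rn rn_real rw expr1n normr1 mul1r.
by rewrite leNgt wz.
Qed.

(** * Reduction of words modulo the trace operators *)

Section reduction.
Variables (bsa bsq : seq 'M[R]_n) (H0 : 'M[R]_n) (P : 'M[R]_n) (dd : 'M[R]_n -> 'rV[R]_n).
Let a0 := mexp H0.
Hypotheses (aq_orth : morthonormal (bsa ++ bsq)) (pH0 : lie_p S H0)
 (bsq_in : forall b, b \in bsq -> exists Y1 Y2, [/\ lie_k S Y1, lie_k S Y2 & b = Y1 + invmx a0 *m Y2 *m a0])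
 (aq_span : forall X, lie S X -> X = \sum_(b <- bsa ++ bsq) mdot X b *: b)
 (bsa_in : forall b, b \in bsa -> lie_p S b) (Pu : P \in unitmx)
 (bsa_diag : forall b, b \in bsa -> b = invmx P *m diag_mx (dd b) *m P).

(** The conjugate Ad(a0)^-1 k. Words in it, kept at the far left, become words in k once a lift of
    a0 is applied. *)
Definition kc X := exists2 Y, lie_k S Y & X = invmx a0 *m Y *m a0.
Definition kcwords (l : seq 'M[R]_n) := forall X, X \in l -> kc X.
(** The element of [a] dual, for the trace form, to the i-th diagonal coordinate. These n elements
    span [a] and may be dependent; with them the trace operators become power sums in n letters. *)
Definition coroot (i : 'I_n) : 'M[R]_n := \sum_(b <- bsa) dd b 0 i *: b.

Lemma kc_lie X : kc X -> lie S X.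
Proof.
move=> [Y [lY _] ->]; have Sa0 : S a0 by have := pH0.1 1; rewrite scale1r.
by have := lie_conj GS (lgV GS Sa0) lY; rewrite invmxK.
Qed.

Lemma kcwords_lie l : kcwords l -> lwords l.
Proof. by move=> h X /h; exact: kc_lie. Qed.

Lemma lwords_cat l1 l2 : lwords l1 -> lwords l2 -> lwords (l1 ++ l2).
Proof. by move=> h1 h2 X; rewrite mem_cat => /orP[/h1|/h2]. Qed.

Lemma bsq_lie b : b \in bsq -> lie S b.
Proof.
by move=> /bsq_in[Y1 [Y2 [h1 h2 ->]]]; apply: (lieD GS); [exact: h1.1|apply: kc_lie; exists Y2].
Qed.

Lemma aq_in b : b \in bsa ++ bsq -> lie S b.
Proof. by rewrite mem_cat => /orP[/bsa_in[]|/bsq_lie]. Qed.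

Lemma coroot_lie i : lie S (coroot i).
Proof.
rewrite /coroot big_seq; apply: (big_ind (lie S)) => [|X Y|b /bsa_in[h _]].
- exact: lie0.
- exact: (lieD GS).
- exact: lieZ.
Qed.

Lemma bsa_coroot b : b \in bsa -> b = \sum_i dd b 0 i *: coroot i.
Proof.
move=> ba; have [lb sb] := bsa_in ba.
rewrite {1}(aq_span lb) big_cat /= [X in _ + X]big1_seq ?addr0; last first.
 move=> c /andP[_ cq]; have [ua ha] := aq_orth.
 rewrite ha ?mem_cat ?ba ?cq ?orbT//; case: eqP => [bc|_]; last by rewrite scale0r.
 move: ua; rewrite cat_uniq => /and3P[_ /hasPn/(_ c cq)] /=; by rewrite -bc ba.
rewrite /coroot; under [RHS]eq_bigr do rewrite scaler_sumr.
rewrite exchange_big /=; apply: eq_big_seq => c ca.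
under eq_bigr do rewrite scalerA.
rewrite -scaler_suml; congr (_ *: _).
rewrite mdot_tr (bsa_in ca).2 {1}(bsa_diag ba) {1}(bsa_diag ca) !mulmxA mulmxK//.
rewrite mxtrace_mulC !mulmxA mulmxV// mul1mx mulmx_diag mxtrace_diag.
by apply: eq_bigr => i _; rewrite mxE.
Qed.

Lemma letter_decomp X : lie S X -> exists (c : 'I_n -> R) Y Y',
 [/\ lie_k S Y, kc Y' & X = \sum_i c i *: coroot i + (Y + Y')].
Proof.
have [kL0 kD kZ] := lie_k_subspace GS.
pose L Z := exists (c : 'I_n -> R) Y Y2,
 [/\ lie_k S Y, lie_k S Y2 & Z = \sum_i c i *: coroot i + (Y + invmx a0 *m Y2 *m a0)].
move=> lX; suff [c [Y [Y2 [h1 h2 e]]]] : L X.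
 by exists c, Y, (invmx a0 *m Y2 *m a0); split => //; exists Y2.
have L0 : L 0.
 exists (fun=> 0), 0, 0; split => //; rewrite big1 => [|i _]; last by rewrite scale0r.
 by rewrite mulmx0 mul0mx !addr0.
have LD c Z Z' : L Z -> L Z' -> L (c *: Z + Z').
 move=> [c1 [Y1 [Y2 [h1 h2 ->]]]] [c2 [Z1 [Z2 [h3 h4 ->]]]].
 exists (fun i => c * c1 i + c2 i), (c *: Y1 + Z1), (c *: Y2 + Z2).
 split; [by apply: (kD) => //; exact: kZ|by apply: (kD) => //; exact: kZ|].
 rewrite mulmxDr mulmxDl -scalemxAr -scalemxAl.
 under [in RHS]eq_bigr do rewrite scalerDl -scalerA.
 rewrite big_split /= -scaler_sumr !scalerDr -!addrA; congr (_ + _).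
 rewrite (addrCA (c *: (invmx a0 *m Y2 *m a0))) addrCA; congr (_ + (_ + _)); exact: addrCA.
rewrite (aq_span lX) big_seq; apply: (big_ind L) => // [Z Z'|b].
 by move=> h1 h2; have := LD 1 _ _ h1 h2; rewrite scale1r.
have LZ c Z : L Z -> L (c *: Z) by move=> h; have := LD c _ _ h L0; rewrite addr0.
rewrite mem_cat => /orP[ba|/bsq_in[Y1 [Y2 [h1 h2 ->]]]]; apply: LZ.
 exists (dd b 0), 0, 0; split => //; rewrite {1}(bsa_coroot ba) mulmx0 mul0mx !addr0.
 by [].
exists (fun=> 0), Y1, Y2; split => //; rewrite big1 ?add0r// => i _; by rewrite scale0r.
Qed.

(** For M = 1 this is the power sum of degree j in the coroots; a general M diagonal in the same
    basis is carried along for the induction. *)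
Lemma zop_coroot j (M : 'M[R]_n) (mu : 'rV[R]_n) v : sm v -> M = invmx P *m diag_mx mu *m P ->
 zop gam p bsa j M v = \sum_i (mu 0 i)%:C *: word (nseq j (coroot i)) v.
Proof.
move=> sv; elim: j M mu => [|j IH] M mu eM /=.
 rewrite eM mxtrace_mulC mulmxA mulmxV// mul1mx mxtrace_diag raddf_sum /= -scaler_suml.
 by [].
have sw i : sm (word (nseq j (coroot i)) v).
 by apply: word_sm => //; apply: lwords_nseq; exact: coroot_lie.
transitivity (\sum_(b <- bsa) \sum_i ((mu 0 i)%:C * (dd b 0 i)%:C) *: dr b (word (nseq j (coroot i)) v)).
 apply: eq_big_seq => b ba; have [lb sb] := bsa_in ba.
 rewrite (IH _ (\row_i (mu 0 i * dd b 0 i))); last first.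
  rewrite eM sb {1}(bsa_diag ba) !mulmxA mulmxK//; congr (_ *m _).
  by rewrite -mulmxA mulmx_diag.
 rewrite (drv_sum hgam)//; last by move=> i; apply: smoothZ.
 by apply: eq_bigr => i _; rewrite drvZ// mxE rmorphM.
rewrite exchange_big /=; apply: eq_bigr => i _.
rewrite (eq_bigr (fun b => (mu 0 i)%:C *: ((dd b 0 i)%:C *: dr b (word (nseq j (coroot i)) v)))); last first.
 by move=> b _; rewrite scalerA.
rewrite -scaler_sumr; congr (_ *: _); move: (word _ v) (sw i) => u su.
pose F b := if b \in bsa then dd b 0 i *: b else 0.
have lF b : lie S (F b) by rewrite /F; case: ifP => [/bsa_in[h _]|_]; [exact: lieZ|exact: lie0].
have -> : coroot i = \sum_(b <- bsa) F b by apply: eq_big_seq => b ba; rewrite /F ba.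
rewrite dr_sum//.
apply: eq_big_seq => b ba; rewrite /F ba drZ//.
exact: (bsa_in ba).1.
Qed.

Variable y : V.
Hypothesis monomials_orth : forall l0 (m : mpoly.multinom n) w, kcwords l0 -> inW w -> (forall i, (m i < n)%N) ->
 inner (word (l0 ++ map coroot (mseq m)) w) y = 0.

Lemma word_cat l1 l2 v : word (l1 ++ l2) v = word l1 (word l2 v).
Proof. exact: foldr_cat. Qed.

Section degree.
Variable d : nat.
Hypothesis IHd : forall l0 l w, kcwords l0 -> lwords l -> inW w -> (size l < d)%N ->
 inner (word (l0 ++ l) w) y = 0.
Variables (l0 : seq 'M[R]_n) (w : V).
Hypotheses (hl0 : kcwords l0) (hw : inW w).
Let sw : sm w := inW_smooth hw.
(** Studied on words of length d. A commutator leaves d - 1 letters and vanishes by [IHd], so on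
    these words val depends only on the letters and not on their order. *)
Let val l := inner (word (l0 ++ l) w) y.

Lemma val_lin l1 X (c : R) Y l2 : lwords l1 -> lwords l2 -> lie S X -> lie S Y ->
 val (l1 ++ (c *: X + Y) :: l2) = c%:C * val (l1 ++ X :: l2) + val (l1 ++ Y :: l2).
Proof.
move=> h1 h2 lX lY; rewrite /val !catA !(word_cat (l0 ++ l1)) /=.
have sl := word_sm h2 sw.
have h01 : lwords (l0 ++ l1) by exact: lwords_cat (kcwords_lie hl0) h1.
rewrite (drD CP hgam bs_orth bs_in bs_span)//; last exact: lieZ.
rewrite drZ// word_lin//; try exact: dr_smooth.
by rewrite innerDl innerZl.
Qed.

Lemma val_swap l1 X Y l2 : lwords (l1 ++ X :: Y :: l2) -> size (l1 ++ X :: Y :: l2) = d ->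
 val (l1 ++ X :: Y :: l2) = val (l1 ++ Y :: X :: l2).
Proof.
move=> hl hd; have h1 : lwords l1 by move=> Z Zl; apply: hl; rewrite mem_cat Zl.
have lX : lie S X by apply: hl; rewrite mem_cat mem_head orbT.
have lY : lie S Y by apply: hl; rewrite mem_cat !inE eqxx !orbT.
have h2 : lwords l2 by move=> Z Zl; apply: hl; rewrite mem_cat !inE Zl !orbT.
have sl := word_sm h2 sw.
have br := dr_bracket CP hgam bs_orth bs_in bs_span sm_dense lX lY sl.
have lb : lie S (X *m Y - Y *m X) by exact: (lie_bracket GS).
have := @IHd l0 (l1 ++ (X *m Y - Y *m X) :: l2) w hl0 _ hw.
rewrite !catA !(word_cat (l0 ++ l1)) /= br.
have h01 : lwords (l0 ++ l1) by exact: lwords_cat (kcwords_lie hl0) h1.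
have s1 : sm (dr X (dr Y (word l2 w))) by apply: dr_smooth => //; exact: dr_smooth.
have s2 : sm (dr Y (dr X (word l2 w))) by apply: dr_smooth => //; exact: dr_smooth.
have := word_lin (-1) h01 s2 s1; rewrite !scaleN1r ![- _ + _]addrC => ->; rewrite innerBl => h.
rewrite /val !catA !(word_cat (l0 ++ l1)) /=; apply/eqP; rewrite -subr_eq0; apply/eqP; apply: h.
 exact: lwords_cat h1 (lwords_cons lb h2).
by rewrite -hd !size_cat /= ltn_add2l.
Qed.

Lemma val_perm l l' : lwords l -> size l = d -> perm_eq l l' -> val l = val l'.
Proof.
move=> hl hd hpe.
suff h pre s s' : lwords (pre ++ s) -> size (pre ++ s) = d -> perm_eq s s' -> val (pre ++ s) = val (pre ++ s').
 exact: (h [::]).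
have mv s1 pre' X s2 : lwords (pre' ++ s1 ++ X :: s2) -> size (pre' ++ s1 ++ X :: s2) = d ->
  val (pre' ++ s1 ++ X :: s2) = val (pre' ++ X :: s1 ++ s2).
 elim: s1 pre' => [//|a s1 IH] pre' h1 h2.
 have := IH (rcons pre' a); rewrite !cat_rcons => -> //; apply: val_swap.
  move=> Z; rewrite mem_cat !inE mem_cat => hZ; apply: h1; rewrite mem_cat !inE mem_cat !inE.
  by move: hZ => /or4P[->|->|->|/orP[->|->]]; rewrite ?orbT.
 by rewrite -h2 !size_cat /= !size_cat /= !addnS.
elim: s' pre s => [|X s' IH] pre s h1 h2 hs; first by rewrite (perm_nilP hs).
have Xs : X \in s by rewrite (perm_mem hs) mem_head.
case/splitPr: Xs h1 h2 hs => s1 s2 h1 h2 hs; rewrite mv//.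
have := IH (rcons pre X) (s1 ++ s2); rewrite !cat_rcons; apply.
- move=> Z hZ; apply: h1; move: hZ; rewrite !mem_cat !inE !mem_cat.
 by move=> /or4P[->|->|->|->]; rewrite ?orbT.
- by rewrite -h2 !size_cat /= size_cat !addnS.
- by rewrite -(perm_cons X); apply: perm_trans hs; rewrite perm_sym -cat1s perm_catCA.
Qed.

(** Moved to the far right, a letter of k is absorbed by W, and a shorter word remains. *)
Lemma val_k l1 Y l2 : lwords l1 -> lwords l2 -> lie_k S Y -> size (l1 ++ Y :: l2) = d ->
 val (l1 ++ Y :: l2) = 0.
Proof.
move=> h1 h2 kY hd; have lY := kY.1.
rewrite (@val_perm _ ((l1 ++ l2) ++ [:: Y]))//; first last.
- by rewrite -catA perm_cat2l perm_sym cats1 perm_rcons.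
- by apply: lwords_cat => //; exact: lwords_cons.
rewrite /val catA word_cat /=; apply: IHd => //.
- exact: lwords_cat.
- exact: dr_inW.
- by rewrite -hd !size_cat /= addnS.
Qed.

(** Moved to the far left, a letter of Ad(a0)^-1 k joins the prefix l0, and a shorter word
    remains. *)
Lemma val_kc l1 X l2 : lwords l1 -> lwords l2 -> kc X -> size (l1 ++ X :: l2) = d ->
 val (l1 ++ X :: l2) = 0.
Proof.
move=> h1 h2 kX hd; have lX := kc_lie kX.
rewrite (@val_perm _ (X :: l1 ++ l2))//; first last.
- by rewrite -cat1s perm_catCA.
- by apply: lwords_cat => //; exact: lwords_cons.
rewrite /val -cat_rcons; apply: IHd => //.
- by move=> Z; rewrite mem_rcons inE => /orP[/eqP->//|/hl0].
- exact: lwords_cat.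
- by rewrite -hd !size_cat /= addnS.
Qed.

Lemma val_bsq l1 b l2 : lwords l1 -> lwords l2 -> b \in bsq -> size (l1 ++ b :: l2) = d ->
 val (l1 ++ b :: l2) = 0.
Proof.
move=> h1 h2 /bsq_in[Y1 [Y2 [k1 k2 ->]]] hd.
have kc2 : kc (invmx a0 *m Y2 *m a0) by exists Y2.
rewrite -[Y1]scale1r val_lin//; [|exact: k1.1|exact: kc_lie].
by rewrite val_k// ?val_kc// ?mulr0 ?addr0// -?hd !size_cat.
Qed.

(* Expanding the Casimir operators in the adapted basis, all the words with a letter
  in the span of k and its conjugate vanish. *)
Lemma val_zop j M l : lwords l -> (size l + j)%N = d ->
 (forall l', lwords l' -> size l' = j -> val (l ++ l') = 0) ->
 inner (word (l0 ++ l) (zop gam p (bsa ++ bsq) j M w)) y = 0.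
Proof.
elim: j M l => [|j IH] M l hl hd h /=.
 have h0l : lwords (l0 ++ l) by exact: lwords_cat (kcwords_lie hl0) hl.
 have := h [::] (fun _ h => ltac:(by []) ) erefl; rewrite cats0 wordZ// innerZl /val => ->.
 by rewrite mulr0.
have sz M' : sm (zop gam p (bsa ++ bsq) j M' w) by apply: (zop_smooth hgam) => //; exact: aq_in.
have h0l : lwords (l0 ++ l) by exact: lwords_cat (kcwords_lie hl0) hl.
rewrite (word_sum_seq h0l); last by move=> b bin; apply: dr_smooth => //; exact: aq_in.
rewrite inner_suml big1_seq// => b /andP[_ bin]; have lb := aq_in bin.
have hlb : lwords (l ++ [:: b]) by exact: lwords_cat hl (lwords1 lb).
have := IH (M *m b^T) (l ++ [:: b]) hlb; rewrite catA word_cat /=; apply.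
 by rewrite size_cat /= -hd addn1 addnS.
move=> l' hl' sl'; rewrite -catA /=; apply: h; last by rewrite /= sl'.
exact: lwords_cons.
Qed.

Lemma val_zop_a j M l : lwords l -> (size l + j)%N = d ->
 inner (word (l0 ++ l) (zop gam p (bsa ++ bsq) j M w)) y =
 inner (word (l0 ++ l) (zop gam p bsa j M w)) y.
Proof.
elim: j M l => [//|j IH] M l hl hd /=.
have sz M' : sm (zop gam p (bsa ++ bsq) j M' w) by apply: (zop_smooth hgam) => //; exact: aq_in.
have sz' M' : sm (zop gam p bsa j M' w) by apply: (zop_smooth hgam) => // b /bsa_in[].
have h0l : lwords (l0 ++ l) by exact: lwords_cat (kcwords_lie hl0) hl.
rewrite (word_sum_seq h0l); last by move=> b bin; apply: dr_smooth => //; exact: aq_in.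
rewrite (word_sum_seq h0l); last by move=> b /bsa_in[h _]; apply: dr_smooth.
have hlb b : lie S b -> lwords (l ++ [:: b]).
 by move=> lb; exact: lwords_cat hl (lwords1 lb).
rewrite !inner_suml big_cat /= [X in _ + X]big1_seq ?addr0 => [|b /andP[_ bq]].
 apply: eq_big_seq => b /bsa_in[lb _].
 have := IH (M *m b^T) (l ++ [:: b]) (hlb _ lb); rewrite catA !word_cat /=; apply.
 by rewrite size_cat /= -hd addn1 addnS.
have lb := bsq_lie bq.
have := @val_zop j (M *m b^T) (l ++ [:: b]) (hlb _ lb); rewrite catA !word_cat /=; apply.
 by rewrite size_cat /= -hd addn1 addnS.
move=> l' hl' sl'; rewrite -catA /=; apply: val_bsq => //.
by rewrite size_cat /= sl' -hd.
Qed.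

(** The trace operator is a scalar and leaves the shorter word l, hence 0. Computed in the basis
    adapted to [a] and k + Ad(a0)^-1 k, only its letters in [a] survive, and they form the power
    sum. *)
Lemma val_power_sum j l : (0 < j)%N -> lwords l -> (size l + j)%N = d ->
 \sum_i val (l ++ nseq j (coroot i)) = 0.
Proof.
move=> j0 hl hd; have h0l : lwords (l0 ++ l) by exact: lwords_cat (kcwords_lie hl0) hl.
have [c hc] := zop_scalar SA CP hgam hp aq_orth aq_in aq_span sm_dense j.
have := val_zop_a 1%:M hl hd; rewrite hc//.
have -> : inner (word (l0 ++ l) (c *: w)) y = 0.
 rewrite wordZ// innerZl IHd// ?mulr0//; lia.
have e1 : 1%:M = invmx P *m diag_mx (const_mx 1) *m P :> 'M[R]_n.
 by rewrite diag_const_mx mulmx1 mulVmx.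
rewrite (zop_coroot j sw e1) (word_sum_seq h0l) => [h|i _]; last first.
 by apply: smoothZ; apply: word_sm => //; apply: lwords_nseq; exact: coroot_lie.
rewrite [RHS]h inner_suml; apply: eq_bigr => i _.
by rewrite mxE scale1r /val catA word_cat.
Qed.

(** If an exponent is at least n, the monomial is a multiple of some x_i^n, which the vanishing on
    power sums kills; otherwise it is one of the monomials assumed orthogonal. *)
Lemma val_coroots s : size s = d -> val (map coroot s) = 0.
Proof.
move=> hs; have hl (r : seq 'I_n) : lwords (map coroot r) by move=> X /mapP[i _ ->]; exact: coroot_lie.
have [m hm _] := mseq_count s.
rewrite (@val_perm _ (map coroot (mseq m))) ?size_map//; last exact: perm_map.
have dm : mpoly.mdeg m = d by rewrite -size_mseq -hs (perm_size hm).
have [i ni|small] := pickP (fun i => (n <= m i)%N); last first.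
 by apply: monomials_orth => // i; rewrite ltnNge small.
pose phi m' := val (map coroot (mseq m')).
have pU m' i' j : (mpoly.mdeg m' + j)%N = d ->
  phi (mpoly.mnm_add m' (mpoly.mnm_muln (mpoly.mnm1 i') j)) = val (map coroot (mseq m') ++ nseq j (coroot i')).
 move=> dj; rewrite /phi (@val_perm _ (map coroot (mseq m' ++ nseq j i'))).
 - by rewrite map_cat map_nseq.
 - exact: hl.
 - by rewrite size_map (perm_size (mseqD _ _ _)) size_cat size_nseq size_mseq.
 - by apply: perm_map; exact: mseqD.
pose m' := mpoly.mnm_sub m (mpoly.mnm_muln (mpoly.mnm1 i) n).
have em : m = mpoly.mnm_add m' (mpoly.mnm_muln (mpoly.mnm1 i) n).
 apply/mpoly.mnmP => k; rewrite mpoly.mnmDE mpoly.mnmBE mpoly.mulmnE mpoly.mnm1E.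
 by case: eqP => [<-|_]; rewrite ?mul0n ?mul1n; lia.
rewrite -/(phi m) em; apply: (@power_sum_multinom _ n phi d).
 move=> m1 j j0 dj; under eq_bigr do rewrite pU//.
 by apply: val_power_sum => //; rewrite size_map size_mseq.
by rewrite -dm [in RHS]em mpoly.mdegD mpoly.mdegMn mpoly.mdeg1 mul1n.
Qed.

Lemma val_word l : lwords l -> size l = d -> val l = 0.
Proof.
suff h l2 s : lwords l2 -> size (map coroot s ++ l2) = d -> val (map coroot s ++ l2) = 0.
 by move=> hl hd; exact: (h l [::]).
have hlr (r : seq 'I_n) : lwords (map coroot r) by move=> X /mapP[i _ ->]; exact: coroot_lie.
elim: l2 s => [|X l2 IH] s hl hd; first by rewrite cats0; apply: val_coroots; rewrite -hd cats0 size_map.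
have lX := lwords_head hl; have hl2 := lwords_tail hl.
have [c [Y [Y' [kY kY' ->]]]] := letter_decomp lX.
have lY' := kc_lie kY'.
have sz Z : size (map coroot s ++ Z :: l2) = d by rewrite -hd !size_cat.
have hsum (r : seq 'I_n) Z : lie S Z -> val (map coroot s ++ Z :: l2) = 0 ->
  val (map coroot s ++ (\sum_(i <- r) c i *: coroot i + Z) :: l2) = 0.
 move=> lZ hZ; elim: r => [|i r IHr]; first by rewrite big_nil add0r.
 have lr : lie S (\sum_(j <- r) c j *: coroot j + Z).
  by apply: (lieD GS _ lZ); apply: (lie_sum GS) => k; apply: lieZ; exact: coroot_lie.
 rewrite big_cons -addrA (val_lin _ (hlr s) hl2 (coroot_lie i) lr).
 rewrite IHr addr0 -cat_rcons -map_rcons IH ?mulr0//.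
 by rewrite map_rcons cat_rcons.
apply: hsum; first by apply: (lieD GS) => //; exact: kY.1.
rewrite -[Y]scale1r val_lin//; last exact: kY.1.
by rewrite val_k// val_kc// mulr0 addr0.
Qed.

End degree.

Lemma reduction_orth l0 l w : kcwords l0 -> lwords l -> inW w -> inner (word (l0 ++ l) w) y = 0.
Proof.
move=> hl0 hl hw; move: {-1}(size l) (erefl (size l)) => d; elim/ltn_ind: d l0 l w hl0 hl hw => d IH l0 l w hl0 hl hw hd.
apply: (val_word (d := d)) => // l0' l' w' h1 h2 h3 h4.
exact: (IH (size l')).
Qed.

End reduction.

(** Derivation of <p(k gam_Y(t)) z, y> = 0 at t = 0, letter by letter. *)
Lemma word_K_orth z y l : sm z -> (forall k, inK k -> inner (p k z) y = 0) ->
 (forall Y, Y \in l -> lie_k S Y) -> forall k, inK k -> inner (p k (word l z)) y = 0.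
Proof.
move=> sz hz; elim: l => [//|Y l IH] hl.
have kY : lie_k S Y by apply: hl; exact: mem_head.
have hl' X : X \in l -> lie_k S X by move=> Xl; apply: hl; rewrite inE Xl orbT.
have sw : sm (word l z) by apply: word_sm => // X /hl'[].
move=> k Kk /=; apply/eqP; rewrite -rn_eq0 eq_le rn_ge0 andbT.
apply/ler_addgt0Pr => e e0; rewrite add0r.
have y1 : 0 < rn y + 1 by rewrite ltr_wpDl// rn_ge0.
have /near0E[r r0 hr] := dr_ders hgam kY.1 sw (divr_gt0 e0 y1).
have r2 : 0 < r / 2 by rewrite divr_gt0.
have rr : `|r / 2| < r by rewrite gtr0_norm// half_lt.
have := hr _ rr; rewrite (gtr0_norm r2); move: r2; set t := r / 2 => t0; set u := p _ _ - _ - _ => hu.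
have e1 : inner (p k u) y = - (t%:C * inner (p k (dr Y (word l z))) y).
 rewrite /u !repB repZ !innerBl innerZl IH// -repM IH// ?sub0r ?subr0//; last first.
  by apply: (inKM SA CP) => //; exact: gam_inK.
 by rewrite oppr0 sub0r.
have : t * rn (inner (p k (dr Y (word l z))) y) <= t * e.
 rewrite -{1}(gtr0_norm t0) -rn_real -rnM -rnN -e1; apply: le_trans (rn_inner_le _ _) _.
 rewrite rep_rn; apply: (le_trans (ler_wpM2r (rn_ge0 y) hu)).
 rewrite [leRHS]mulrC -(mulrA e) -(mulrA e) ler_wpM2l ?(ltW e0)// mulrAC ler_piMl ?(ltW t0)//.
 by rewrite mulrC ler_pdivrMr// mul1r lerDl.
by rewrite ler_pM2l.
Qed.

(** The generators are the n^n monomials of coroots with exponents below n, applied to W and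
    translated by a lift [al] of a0. Translating y by al^-1 as well turns prefixes from Ad(a0)^-1 k
    into derivatives along K, so orthogonality to the K-orbits of the generators is what the
    reduction asks for. *)
Lemma K_cyclic : exists fs : seq V, (forall f, f \in fs -> sm f) /\
 forall y, (forall f k, f \in fs -> inK k -> inner (p k f) y = 0) -> y = 0.
Proof.
have [bsa [bsq [H0 [aq_orth pH0 bsq_in aq_span [bsa_in [P [Pu [dd bsa_diag]]]]]]]] := iwasawa_like SA GS.
pose al := gam H0 1; have pral : pr al = mexp H0 by have [_ ->] := hgam pH0.1; rewrite scale1r.
have a0u := mexp_unit H0.
pose mo (g : {ffun 'I_n -> 'I_n}) : mpoly.multinom n := mpoly.Multinom [tuple (g i : nat) | i < n].
pose mw (m : mpoly.multinom n) := map (coroot bsa dd) (mseq m).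
have lmw m : lwords (mw m).
 by move=> X /mapP[i _ ->]; exact: (coroot_lie dd bsa_in).
exists [seq p al (word (mw (mo g)) w) | g <- enum {ffun 'I_n -> 'I_n}, w <- ws]; split.
 move=> f /allpairsP[[g w] /= [_ wws ->]]; apply: smooth_act_vec.
 by apply: word_sm => //; exact: ws_sm.
move=> y hy; pose y' := p al^-1%g y.
have -> : y = p al y' by rewrite /y' -repM mulgV rep1.
have -> : y' = 0; last exact: rep0.
 apply: (dense_orth0 uspan_dense).
 move=> u [m [s [hs ->]]]; rewrite inner_suml big1_seq// => a /andP[_ /hs[_ h2 h3]].
 have red y0 := reduction_orth
  aq_orth pH0 bsq_in aq_span bsa_in Pu bsa_diag (y := y0).
 apply: (red y' _ [::]) => //.
 move=> l0 q w hl0 hw hq; rewrite word_cat -/(mw q).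
 pose g : {ffun 'I_n -> 'I_n} := [ffun i => Ordinal (hq i)].
 have -> : q = mo g by apply/mpoly.mnmP => i; rewrite mpoly.mnm_tnth /mo mpoly.mnm_tnth tnth_mktuple ffunE.
 have sw := inW_smooth hw.
 rewrite /y' -inner_repl (word_act CP hgam bs_orth bs_in bs_span)//; first last.
 - by apply: word_sm.
 - by move=> X /hl0; exact: (kc_lie pH0).
 rewrite -[X in inner X _](rep1 p); apply: word_K_orth; last exact: inK1.
 - by apply: smooth_act_vec; apply: word_sm.
 - move=> k Kk; rewrite -hw /oproj (word_sum_seq (lmw _)); last by move=> e /ws_sm; exact: smoothZ.
  rewrite !rep_sum inner_suml big1_seq// => e /andP[_ ein].
  rewrite (wordZ _ (lmw (mo g)) (ws_sm ein)) !repZ innerZl hy ?mulr0//; apply/allpairsP; exists (g, e); split => //=.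
  by rewrite mem_enum.
 move=> Y /mapP[X /hl0[Z kZ ->] ->]; rewrite pral !mulmxA mulmxV// mul1mx mulmxK//.
Qed.

(** * The Casimir operator of K and its eigenvectors *)

Let bsk_lie b : b \in bsk -> lie S b. Proof. by move=> /bsk_in[]. Qed.

Lemma bsk_span X : lie_k S X -> X = \sum_(b <- bsk) mdot X b *: b.
Proof.
move=> [lX sX]; rewrite [LHS](bs_span lX) big_cat /= [X in _ + X]big1_seq ?addr0// => b /andP[_ bp].
suff -> : mdot X b = 0 by rewrite scale0r.
have [_ sb] := bsp_in bp.
have : mdot X b = - mdot X b by rewrite -[LHS]mdot_trT sb sX mdotNl.
lra.
Qed.

(** Minus the sum of squares over an orthonormal basis of k: the Casimir operator of K with the sign
    that makes it nonnegative, by [Om_form]. *)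
Definition Om u : V := - \sum_(b <- bsk) dr b (dr b u).
Definition Lam u : V := u + Om u.

Lemma sm_seq_sum (I : eqType) (r : seq I) (F : I -> V) : (forall i, i \in r -> sm (F i)) ->
 sm (\sum_(i <- r) F i).
Proof. by move=> h; apply: subspace_sum => //; exact: subspace_smooth. Qed.

Lemma Om_smooth u : sm u -> sm (Om u).
Proof.
move=> su; apply: smoothN; apply: sm_seq_sum => b bk.
by apply: dr_smooth; [exact: bsk_lie|apply: dr_smooth => //; exact: bsk_lie].
Qed.

Lemma Om_lin a u w : sm u -> sm w -> Om (a *: u + w) = a *: Om u + Om w.
Proof.
move=> su sw; rewrite /Om scalerN -opprD scaler_sumr -big_split /=; congr (- _).
apply: eq_big_seq => b /bsk_lie lb.
by rewrite (dr_lin hgam)// (dr_lin hgam)//; exact: dr_smooth.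
Qed.

Lemma Om_sym u w : sm u -> sm w -> inner (Om u) w = inner u (Om w).
Proof.
move=> su sw; rewrite /Om innerNl innerNr inner_suml inner_sumr; congr (- _).
apply: eq_big_seq => b /bsk_lie lb.
rewrite dr_skew//; last exact: dr_smooth.
by rewrite dr_skew ?opprK//; exact: dr_smooth.
Qed.

Lemma Om_form u : sm u -> inner (Om u) u = (\sum_(b <- bsk) rn (dr b u) ^+ 2)%:C.
Proof.
move=> su; rewrite /Om innerNl inner_suml -sumrN rmorph_sum; apply: eq_big_seq => b /bsk_lie lb.
rewrite dr_skew//; last exact: dr_smooth.
by rewrite opprK inner_rn.
Qed.

Lemma dr_combination (I : eqType) (r : seq I) (c : I -> R) (X : I -> 'M[R]_n) v : sm v ->
 (forall i, i \in r -> lie S (X i)) ->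
 dr (\sum_(i <- r) c i *: X i) v = \sum_(i <- r) (c i)%:C *: dr (X i) v.
Proof.
move=> sv hX; pose F i := if i \in r then c i *: X i else 0.
have lF i : lie S (F i) by rewrite /F; case: ifP => [/hX h|_]; [exact: lieZ|exact: lie0].
have -> : \sum_(i <- r) c i *: X i = \sum_(i <- r) F i by apply: eq_big_seq => i ir; rewrite /F ir.
rewrite dr_sum//; apply: eq_big_seq => i ir.
by rewrite /F ir drZ//; exact: hX.
Qed.

(** Ad(pr k) is orthogonal for the trace form on k, so it does not change the sum of squares over an
    orthonormal basis. *)
Lemma Om_act k u : inK k -> sm u -> Om (p k u) = p k (Om u).
Proof.
move=> Kk su; have [Sk kk] := Kk; set s := pr k in Sk kk.
have su' : s \in unitmx := lg_unit GS Sk.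
have sV : invmx s = s^T by rewrite -[RHS]mulmx1 -(mulmxV su') mulmxA kk mul1mx.
pose cj X := s *m X *m s^T.
have kcj X : lie_k S X -> lie_k S (cj X).
 move=> [lX sX]; split; first by have := lie_conj GS Sk lX; rewrite sV.
 by rewrite /cj !trmx_mul trmxK sX mulNmx mulmxN mulmxA.
have mcj X Y : mdot (cj X) Y = mdot X (s^T *m Y *m s).
 by rewrite !mdot_tr /cj !trmx_mul trmxK -!mulmxA mxtrace_mulC !mulmxA.
have kcj' X : lie_k S X -> lie_k S (s^T *m X *m s).
 move=> [lX sX]; split; first by have := lie_conj GS (lgV GS Sk) lX; rewrite invmxK sV.
 by rewrite !trmx_mul trmxK sX mulNmx mulmxN mulmxA.
have su2 := smooth_act_vec k su.
have e1 b : b \in bsk -> p k (dr b (dr b u)) =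
  \sum_(c <- bsk) \sum_(d <- bsk) ((mdot (cj b) c * mdot (cj b) d)%:C *: dr c (dr d (p k u))).
 move=> bk; have lb := bsk_lie bk; have kb := kcj _ (bsk_in bk).
 rewrite rep_dr//; last exact: dr_smooth.
 rewrite rep_dr// -/s sV -/(cj b).
 have sdb : sm (dr (cj b) (p k u)) by apply: dr_smooth => //; exact: kb.1.
 rewrite {1}(bsk_span kb) dr_combination//.
  apply: eq_big_seq => c /bsk_lie lc.
  have -> : dr (cj b) (p k u) = \sum_(d <- bsk) (mdot (cj b) d)%:C *: dr d (p k u).
   by rewrite {1}(bsk_span kb) dr_combination.
  have sd d : d \in bsk -> sm ((mdot (cj b) d)%:C *: dr d (p k u)).
   by move=> /bsk_lie ld; apply: smoothZ; exact: dr_smooth.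
  have lw : lwords [:: c] by exact: lwords1.
  have := word_sum_seq lw sd; rewrite /= => ->.
  rewrite scaler_sumr; apply: eq_big_seq => d /bsk_lie ld.
  by rewrite drvZ//; [rewrite scalerA -rmorphM|exact: dr_smooth].
have repN x : p k (- x) = - p k x by rewrite -scaleN1r repZ scaleN1r.
rewrite /Om repN rep_sum; congr (- _); rewrite [RHS](eq_big_seq _ e1) exchange_big /=.
apply: eq_big_seq => c ck; rewrite exchange_big /=.
have e2 d : d \in bsk -> \sum_(b <- bsk) (mdot (cj b) c * mdot (cj b) d)%:C *: dr c (dr d (p k u)) =
  (c == d)%:R *: dr c (dr d (p k u)).
 move=> dk; rewrite -scaler_suml -rmorph_sum; congr (_ *: _).
 have -> : \sum_(b <- bsk) mdot (cj b) c * mdot (cj b) d = mdot (s^T *m c *m s) (s^T *m d *m s).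
  rewrite {1}(bsk_span (kcj' _ (bsk_in ck))) mdot_suml; apply: eq_bigr => b _.
  by rewrite mdotZl !mcj mdotC.
 rewrite -mcj /cj !mulmxA -(mulmxA (s *m s^T *m c)) -sV mulmxV// mul1mx mulmx1.
 by have [_ h] := bs_orth; rewrite h ?mem_cat ?ck ?dk//; case: eqP => _; rewrite ?rmorph1 ?rmorph0.
rewrite (eq_big_seq _ e2) (bigD1_seq c)//=; last by have [] := bs_orth; rewrite cat_uniq => /andP[].
by rewrite eqxx scale1r big1 ?addr0// => d dc; rewrite eq_sym (negbTE dc) scale0r.
Qed.

Lemma Lam_smooth u : sm u -> sm (Lam u).
Proof. by move=> su; apply: smoothD => //; exact: Om_smooth. Qed.

Lemma iter_Lam_smooth m u : sm u -> sm (iter m Lam u).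
Proof. by move=> su; elim: m => //= m IH; exact: Lam_smooth. Qed.

Lemma Lam_lin a u w : sm u -> sm w -> Lam (a *: u + w) = a *: Lam u + Lam w.
Proof. by move=> su sw; rewrite /Lam Om_lin// scalerDr addrACA. Qed.

Lemma iter_Lam_lin m a u w : sm u -> sm w -> iter m Lam (a *: u + w) = a *: iter m Lam u + iter m Lam w.
Proof. by move=> su sw; elim: m => //= m ->; rewrite Lam_lin//; exact: iter_Lam_smooth. Qed.

Lemma iter_Lam_sym m u w : sm u -> sm w -> inner (iter m Lam u) w = inner u (iter m Lam w).
Proof.
move=> su; elim: m w => [//|m IH] w sw; rewrite iterS [in RHS]iterSr -IH; last exact: Lam_smooth.
rewrite /Lam innerDl innerDr Om_sym//; exact: iter_Lam_smooth.
Qed.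

Lemma iter_Lam_words N : exists s : seq (seq 'M[R]_n),
 (forall l, l \in s -> (size l <= 2 * N)%N /\ lwords l) /\
 forall u, sm u -> iter N Lam u = \sum_(l <- s) word l u.
Proof.
elim: N => [|N [s [hs he]]].
 by exists [:: [::]]; split => [l|u _]; [rewrite inE => /eqP->|rewrite big_seq1].
exists (s ++ [seq [:: b, - b & l] | b <- bsk, l <- s]); split.
 move=> l; rewrite mem_cat => /orP[/hs[h1 h2]|/allpairsP[[b l'] /= [bk /hs[h1 h2] ->]]].
  by split => //; lia.
 split; first by rewrite mulnS.
 by apply: lwords_cons; [exact: bsk_lie|apply: lwords_cons => //; apply: lieN; exact: bsk_lie].
move=> u su; rewrite big_cat big_allpairs_dep /= /Lam -he//; congr (_ + _).
rewrite /Om -sumrN; apply: eq_big_seq => b /bsk_lie lb.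
have si := iter_Lam_smooth N su.
have hsm l : l \in s -> sm (word l u) by move=> /hs[_ h2]; exact: word_sm.
have lw : lwords [:: b; - b] by exact: lwords_cons lb (lwords1 (lieN lb)).
have := word_sum_seq lw hsm; rewrite -he// /= => <-.
have -> : dr (- b) (iter N Lam u) = - dr b (iter N Lam u).
 rewrite -[in LHS](scaleN1r b) drZ//.
 by rewrite (rmorphN (real_complex R)) rmorph1 scaleN1r.
have sdi : sm (dr b (iter N Lam u)) by exact: dr_smooth.
by have := drvZ (-1) lb sdi; rewrite !scaleN1r.
Qed.

(** Moving p g out past the innermost letter conjugates that letter; its coefficients in the basis
    depend continuously on g, and a shorter word remains. The empty word is strong continuity. *)
Lemma word_act_cvg l u : lwords l -> sm u -> word l (p g u) @[g --> (1%g : G)] --> word l u.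
Proof.
elim/last_ind: l u => [|l X IH] u hl su.
 by have := @rep_continuous _ _ _ p u 1%g; rewrite /continuous_at rep1.
have hl' : lwords l by move=> Y Yl; apply: hl; rewrite mem_rcons inE Yl orbT.
have lX : lie S X by apply: hl; rewrite mem_rcons mem_head.
pose ad g := invmx (pr g) *m X *m pr g.
have lad g : lie S (ad g).
 by have := lie_conj GS (lgV GS (cov_in CP g)) lX; rewrite invmxK.
have e g : word (rcons l X) (p g u) =
  \sum_(b <- bsk ++ bsp) (mdot (ad g) b)%:C *: word l (p g (dr b u)).
 rewrite -cats1 word_cat /=.
 have -> : dr X (p g u) = p g (dr (ad g) u).
  rewrite (rep_dr g (lad g) su); congr (dr _ _).
  by rewrite /ad !mulmxA mulmxV ?(lg_unit GS (cov_in CP g))// mul1mx mulmxK// (lg_unit GS (cov_in CP g)).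
 rewrite (dr_basis (lad g) su) rep_sum (word_sum_seq hl').
  apply: eq_big_seq => b bin; rewrite repZ.
  have sb : sm (p g (dr b u)) by apply: smooth_act_vec; apply: dr_smooth => //; exact: bs_in.
  exact: wordZ.
 by move=> b bin; apply: smooth_act_vec; apply: smoothZ; apply: dr_smooth => //; exact: bs_in.
have -> : word (rcons l X) u = \sum_(b <- bsk ++ bsp) (mdot (ad 1%g) b)%:C *: word l (dr b u).
 by rewrite -{1}(rep1 p u) e; apply: eq_bigr => b _; rewrite rep1.
under eq_cvg do rewrite e.
have key b : b \in bsk ++ bsp ->
  (mdot (ad g) b)%:C *: word l (p g (dr b u)) @[g --> (1%g : G)] --> (mdot (ad 1%g) b)%:C *: word l (dr b u).
 move=> bin; apply: cvgZ; last by apply: IH => //; apply: dr_smooth => //; exact: bs_in.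
 apply/cvg_rnP => e0 e00; pose m := 2 * (mnorm (1%:M : 'M[R]_n) + 1) * mnorm X * mnorm b + 1.
 have X0 := mnorm_ge0 X; have b0 := mnorm_ge0 b; have I0 := mnorm_ge0 (1%:M : 'M[R]_n).
 have m0 : 0 < m by rewrite ltr_wpDl// !mulr_ge0// addr_ge0.
 apply: filterS2 (cov_nbhs1 CP (divr_gt0 e00 m0)) (nbhs1_inv (cov_nbhs1 CP ltr01)) => g /=.
 rewrite (covV CP) ltr_pdivlMr// => h1 h2; rewrite -(rmorphB (real_complex R)) rn_real -mdotBl.
 set Q := invmx (pr g); set B := pr g - 1%:M in h1.
 have -> : ad 1%g - ad g = Q *m (B *m X - X *m B).
  rewrite /ad (cov1 CP) invmx1 mul1mx mulmx1 -/Q !(mulmxBr, mulmxBl) !mulmx1 !mul1mx.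
  by rewrite mulKmx ?(lg_unit GS (cov_in CP g))// !mulmxA opprB addrA subrK.
 have hQ : mnorm Q <= mnorm (1%:M : 'M[R]_n) + 1.
  by rewrite -(subrK 1%:M Q) addrC (le_trans (mnormD _ _))// lerD2l ltW.
 have hX : mnorm (B *m X - X *m B) <= 2 * mnorm X * mnorm B.
  by apply: le_trans (mnormB _ _) _; have := mnormM B X; have := mnormM X B; lra.
 apply: le_lt_trans (mdot_le _ _) _; apply: le_lt_trans h1.
 apply: (@le_trans _ _ ((mnorm (1%:M : 'M[R]_n) + 1) * (2 * mnorm X * mnorm B) * mnorm b)).
  rewrite ler_wpM2r//; apply: le_trans (mnormM _ _) _; apply: ler_pM => //; exact: mnorm_ge0.
 by have := mnorm_ge0 B; rewrite /m; set x := mnorm B; nra.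
apply: cvg_seq_sum; exact: key.
Qed.

Lemma iter_Lam_act_cvg N u : sm u -> iter N Lam (p g u) @[g --> (1%g : G)] --> iter N Lam u.
Proof.
move=> su; have [s [hs he]] := iter_Lam_words N; rewrite he//.
have e g : iter N Lam (p g u) = \sum_(l <- s) word l (p g u) by rewrite he//; exact: smooth_act_vec.
under eq_cvg do rewrite e; apply: cvg_seq_sum => l /hs[_ hl]; exact: word_act_cvg.
Qed.

Let usp_sub := usp_subspace.

(** A finite generating family of U_d(g) W, to which Gram-Schmidt can be applied. *)
Fixpoint usp_gen d : seq V :=
 if d is d'.+1 then usp_gen d' ++ [seq dr b u | b <- bsk ++ bsp, u <- usp_gen d'] else ws.

Lemma usp_gen_in d u : u \in usp_gen d -> usp d u.
Proof.
elim: d u => [|d IH] u /=.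
 by move=> uw; apply: (@usp_word 0%N [::]) => //; exact: oproj_mem.
rewrite mem_cat => /orP[/IH|/allpairsP[[b v] /= [bin vin ->]]]; first exact: usp_leq.
by apply: usp_dr (bs_in bin) (IH _ vin).
Qed.

Lemma usp_gen_span d (P : V -> Prop) : subspace P -> (forall u, u \in usp_gen d -> P u) ->
 forall u, usp d u -> P u.
Proof.
move=> hP hb; suff h l w : (size l <= d)%N -> lwords l -> inW w -> P (word l w).
 by move=> u [s [hs ->]]; apply: subspace_sum => // a /hs[h1 h2 h3]; exact: h.
elim: d P hP hb l w => [|d IH] P hP hb [|X l] w //= hl lw hw.
- by rewrite -hw; exact: oproj_sub.
- by rewrite -hw; apply: oproj_sub => // e ein; apply: hb; elim: (d.+1) => //= m h; rewrite mem_cat h.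
- have lX := lwords_head lw; have lw' := lwords_tail lw.
 have : sm (word l w) /\ P (dr X (word l w)); last by case.
 apply: (IH (fun u => sm u /\ P (dr X u))) => //.
  split; first by split; [exact: smooth0|rewrite (dr0 hgam)//; case: hP].
  move=> a x y [sx Px] [sy Py]; split; first exact: smooth_lin.
  by rewrite (dr_lin hgam)//; case: hP => _; apply.
 move=> u uin; have su := usp_smooth (usp_gen_in uin); split => //.
 rewrite (dr_basis lX su); apply: subspace_sum => // b bin.
 apply: subspaceZ => //; apply: hb; rewrite /= mem_cat; apply/orP; right.
 by apply/allpairsP; exists (b, u).
Qed.

Lemma usp_drk d Y u : lie_k S Y -> usp d u -> usp d (dr Y u).
Proof.
move=> kY [s [hs ->]]; have lY := kY.1.
have lw : lwords [:: Y] by exact: lwords1.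
have hsm a : a \in s -> sm (word a.1 a.2).
 by move=> /hs[_ h2 h3]; apply: word_sm => //; exact: inW_smooth.
have := word_sum_seq lw hsm; rewrite /= => ->; apply: subspace_sum => // a ain.
have [h1 h2 h3] := hs a ain; have sa := inW_smooth h3.
rewrite dr_word//; apply: subspaceD => //.
 by apply: usp_word => //; exact: dr_inW.
apply: subspace_sum => // l' /(ad_word_in lY h2)[e1 e2 _].
by apply: usp_word => //; rewrite e1.
Qed.

Lemma usp_Om d u : usp d u -> usp d (Om u).
Proof.
move=> hu; apply: subspaceN => //; apply: subspace_sum => // b /bsk_in kb.
by apply: usp_drk => //; exact: usp_drk.
Qed.

Definition casimir_value e : R := Re (inner (Om e) e).
Definition eigenlist (es : seq V) := orthonormal es /\
 forall e, e \in es -> sm e /\ Om e = (casimir_value e)%:C *: e.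

(** Gram-Schmidt completes es to a basis of U_d(g) W. [Om] preserves this space and is symmetric
    with eigenvectors es, so it preserves the complement of es, where it is diagonalized. *)
Lemma eigenlist_extend d es : eigenlist es -> (forall e, e \in es -> usp d e) ->
 exists fs, [/\ eigenlist (fs ++ es), forall e, e \in fs ++ es -> usp d e &
  forall u, usp d u -> oproj (fs ++ es) u = u].
Proof.
move=> [oes hes] esd.
have [gs [ogs gsd hpres hfix]] := gram_schmidt oes (usp_subspace d) esd (@usp_gen_in d).
have fixd u : usp d u -> oproj (gs ++ es) u = u.
 exact: (@usp_gen_span d (fun u => oproj (gs ++ es) u = u) (spanned_subspace _) hfix).
have ug : uniq gs by case: ogs; rewrite cat_uniq => /and3P[].
have og : orthonormal gs by apply: orthonormal_sub ogs ug _ => x xg; rewrite mem_cat xg.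
have ge g e : g \in gs -> e \in es -> inner g e = 0.
 move=> gg ee; have [u h] := ogs; rewrite h ?mem_cat ?gg ?ee ?orbT//; case: eqP => // e1.
 by move: u; rewrite cat_uniq => /and3P[_ /hasPn/(_ e ee)] /=; rewrite -e1 gg.
have spd x : oproj gs x = x -> usp d x by move=> <-; exact: oproj_sub.
have sps x : oproj gs x = x -> sm x by move=> /spd; exact: usp_smooth.
have [fs [ofs _ Pfs eig]] := @spectral_span R V gs Om og
 (fun a x y hx hy => Om_lin a (sps x hx) (sps y hy))
 (fun x y hx hy => Om_sym (sps x hx) (sps y hy)).
have gf e : e \in fs -> oproj gs e = e by move=> ef; rewrite -Pfs (oproj_mem ofs).
have fe f e : f \in fs -> e \in es -> inner f e = 0.
 move=> ff ee; rewrite -(gf f ff) /oproj inner_suml big1_seq// => g /andP[_ gg].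
 by rewrite innerZl (ge g e)// mulr0.
have Pcat x : oproj (fs ++ es) x = oproj (gs ++ es) x.
 by have := Pfs x; rewrite /oproj !big_cat /= => ->.
exists fs; split; last by move=> u hu; rewrite Pcat fixd.
- split; first by apply: orthonormal_cat.
 move=> e; rewrite mem_cat => /orP[ef|/hes//]; have ue := spd e (gf e ef); have se := usp_smooth ue.
 split => //; rewrite -[LHS]fixd; last exact: usp_Om.
 rewrite {1}/oproj big_cat /= -/(oproj gs _) -/(oproj es _) eig// [X in _ + X]big1_seq ?addr0// => e' /andP[_ e'in].
 have [se' ee'] := hes e' e'in.
 by rewrite Om_sym// ee' innerZr_real fe// mulr0 scale0r.
- move=> e; rewrite mem_cat => /orP[ef|]; [exact: (spd e (gf e ef))|exact: esd].
Qed.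

(** New eigenvectors are prepended, so each list is a suffix of all later ones and sums over B d are
    partial sums of one series. *)
Lemma eigenlist_sequence : exists B F : nat -> seq V, (forall d, B d.+1 = F d ++ B d) /\
 forall d, [/\ eigenlist (B d), forall e, e \in B d -> usp d e & forall u, usp d u -> oproj (B d) u = u].
Proof.
have h (x : nat * seq V) : exists fs, eigenlist x.2 -> (forall e, e \in x.2 -> usp x.1 e) ->
  [/\ eigenlist (fs ++ x.2), forall e, e \in fs ++ x.2 -> usp x.1 e &
   forall u, usp x.1 u -> oproj (fs ++ x.2) u = u].
 have [[h1 h2]|nh] := pselect (eigenlist x.2 /\ forall e, e \in x.2 -> usp x.1 e).
  by have [fs hfs] := eigenlist_extend h1 h2; exists fs.
 by exists [::] => h1 h2; exfalso; apply: nh.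
have [st hst] := choice h.
pose B := fix B d := if d is d'.+1 then st (d, B d') ++ B d' else st (0%N, [::]) ++ [::].
exists B, (fun d => st (d.+1, B d)); split => // d; elim: d => [|d [h1 h2 h3]].
 by apply: (hst (0%N, [::])) => //; split => //.
by apply: (hst (d.+1, B d)) => //= e /h2; exact: usp_leq.
Qed.

Variable D : R.
Hypotheses (D0 : 0 <= D) (hgrowth : forall (es : seq V) (L : R), 0 <= L -> orthonormal es ->
 (forall e, e \in es -> sm e) ->
 (forall k x, inK k -> oproj es x = x -> oproj es (p k x) = p k x) ->
 (forall b x, b \in bsk -> oproj es x = x -> rn (dr b x) <= L * rn x) ->
 (size es)%:R <= D * (1 + L) ^+ (n * n)).

Lemma casimir_value_ge0 e : sm e -> 0 <= casimir_value e.
Proof.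
by move=> se; rewrite /casimir_value Om_form//=; exact: sum_sqr_ge0.
Qed.

(** [Om] commutes with K, so the eigenvectors of value at most x span a K-invariant space. On it
    each b in k has norm at most sqrt x, since the sum of the |b y|^2 is <Om y, y>. *)
Lemma eigen_count d es x : eigenlist es -> (forall e, e \in es -> usp d e) ->
 (forall u, usp d u -> oproj es u = u) -> 0 <= x ->
 (count (fun e => casimir_value e <= x) es)%:R <= D * (1 + Num.sqrt x) ^+ (n * n).
Proof.
move=> [oes hes] esd fixd x0; rewrite -size_filter; set fs := [seq e <- es | casimir_value e <= x].
have fes e : e \in fs -> e \in es /\ casimir_value e <= x by rewrite mem_filter => /andP[].
have ofs : orthonormal fs.
 by apply: (orthonormal_sub oes); [apply: filter_uniq; case: oes|move=> e /fes[]].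
have fsm e : e \in fs -> sm e by move=> /fes[/hes[]].
apply: hgrowth => //.
- move=> k y Kk hy; rewrite -hy /oproj rep_sum; apply: (subspace_sum (D := spanned fs)) => [|e ein].
  exact: spanned_subspace.
 rewrite repZ; apply: subspaceZ; first exact: spanned_subspace.
 have [ees ex] := fes e ein; have [se ee] := hes e ees.
 have uk : usp d (p k e) by apply: usp_act => //; exact: esd.
 rewrite /spanned -[RHS](fixd _ uk) /oproj big_filter [RHS](bigID (fun e => casimir_value e <= x)) /=.
 rewrite [X in _ = _ + X]big1_seq ?addr0// => e' /andP[/negP ne' e'in].
 have [se' ee'] := hes e' e'in; have [->|in0] := eqVneq (inner (p k e) e') 0; first by rewrite scale0r.
 exfalso; apply: ne'; suff -> : casimir_value e' = casimir_value e by [].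
 have := Om_sym (smooth_act_vec k se) se'.
 rewrite Om_act// ee ee' repZ innerZl innerZr_real.
 by move=> /(mulIf in0)[].
- move=> b y bk hy; have sy : sm y by rewrite -hy; apply: oproj_sub; [exact: subspace_smooth|exact: fsm].
 rewrite -(@ler_pXn2r _ 2) ?nnegrE ?mulr_ge0 ?rn_ge0 ?sqrtr_ge0// exprMn sqr_sqrtr//.
 apply: (@le_trans _ _ (\sum_(b <- bsk) rn (dr b y) ^+ 2)).
  by rewrite (big_rem b)//= lerDl; exact: sum_sqr_ge0.
 have := Om_form sy => /(congr1 (@Re R)) /= <-.
 have -> : inner (Om y) y = \sum_(e <- fs) (casimir_value e * rn (inner y e) ^+ 2)%:C.
  rewrite -{2}hy /oproj inner_sumr; apply: eq_big_seq => e ein.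
  have [ees ex] := fes e ein; have [se ee] := hes e ees.
  rewrite innerZr Om_sym// ee innerZr_real mulrCA rmorphM; congr (_ * _).
  by rewrite rn_sqr mulrC; case: (inner y e) => a c /=; congr (_ +i* _); ring.
 rewrite raddf_sum /= -{2}hy rn_oproj// mulr_sumr big_seq [leRHS]big_seq.
 by apply: ler_sum => e /fes[_ ex]; rewrite ler_wpM2r ?sqr_ge0.
Qed.

(** Telescoping with 1/(a+1)^2 <= 1/a - 1/(a+1). *)
Lemma sum_inv_sqr J : \sum_(j < J) ((j.+1%:R : R) ^+ 2)^-1 <= 2.
Proof.
suff h m : \sum_(j < m.+1) ((j.+1%:R : R) ^+ 2)^-1 <= 2 - (m.+1%:R)^-1.
 by case: J => [|m]; [rewrite big_ord0|apply: (le_trans (h m)); rewrite lerBlDr lerDl invr_ge0].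
elim: m => [|m IH]; first by rewrite big_ord1 expr1n invr1; lra.
rewrite big_ord_recr /=; apply: (le_trans (lerD IH (lexx _))).
have a0 : 0 < m.+1%:R :> R by rewrite ltr0n.
have -> : m.+2%:R = m.+1%:R + 1 :> R by rewrite -natr1.
move: (m.+1%:R : R) a0 => a a0; have a1 : 0 < a + 1 by lra.
rewrite -subr_ge0.
have -> : 2 - (a + 1)^-1 - (2 - a^-1 + ((a + 1) ^+ 2)^-1) = (a * (a + 1) ^+ 2)^-1.
 by field; rewrite !gt_eqF.
by rewrite invr_ge0 mulr_ge0 ?exprn_ge0// ltW.
Qed.

(** Eigenvalues are grouped by integer part i: at most D (2 (i+1))^(n^2) of them, each of weight at
    most (i+1)^-(2 n^2 + 2). The exponent leaves at least two spare powers, hence a convergent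
    sum. *)
Lemma eigen_sum d es : eigenlist es -> (forall e, e \in es -> usp d e) ->
 (forall u, usp d u -> oproj es u = u) ->
 \sum_(e <- es) (1 + casimir_value e)^-1 ^+ (2 * (n * n).+1) <= D * 2 ^+ (n * n) * 2.
Proof.
move=> heig esd fixd; have [oes hes] := heig.
pose j e := Num.truncn (casimir_value e).
have c0 e : e \in es -> 0 <= casimir_value e by move=> /hes[se _]; exact: casimir_value_ge0.
pose J := (\sum_(e <- es) j e).+1; set N2 := (2 * _)%N.
have jJ e : e \in es -> (j e < J)%N by move=> ein; rewrite /J (big_rem e)//= ltnS leq_addr.
pose f (i : nat) : R := (i.+1%:R)^-1 ^+ N2.
apply: (@le_trans _ _ (\sum_(e <- es) \sum_(i < J) (j e == i)%:R * f i)).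
 apply: ler_sum_seq => e ein.
 rewrite (bigD1 (Ordinal (jJ e ein)))//= eqxx mul1r -[leLHS]addr0 lerD//; last first.
  by apply: sumr_ge0 => i _; rewrite mulr_ge0// exprn_ge0// invr_ge0.
 rewrite /f lerXn2r ?nnegrE ?invr_ge0 ?addr_ge0 ?c0// lef_pV2 ?posrE ?ltr0n// ?ltr_wpDr ?c0//.
 by rewrite -natr1 addrC lerD2l; have /andP[] := truncn_itv (c0 e ein).
rewrite exchange_big /=.
apply: (@le_trans _ _ (\sum_(i < J) (D * 2 ^+ (n * n)) * ((i.+1%:R : R) ^+ 2)^-1)); last first.
 by rewrite -mulr_sumr ler_wpM2l ?sum_inv_sqr// mulr_ge0// exprn_ge0.
apply: ler_sum => i _; rewrite -mulr_suml.
have i0 : 0 < i.+1%:R :> R by rewrite ltr0n.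
have cnt : \sum_(e <- es) (j e == i)%:R <= D * (2 * i.+1%:R) ^+ (n * n).
 apply: (@le_trans _ _ (count (fun e => casimir_value e <= i.+1%:R) es)%:R).
  rewrite -sum1_count natr_sum [leRHS]big_mkcond /=; apply: ler_sum_seq => e ein.
  case: eqP => [ji|_]; last by case: ifP.
  by rewrite ifT// -ji ltW//; exact: truncnS_gt.
 apply: (le_trans (eigen_count heig esd fixd (ltW i0))); rewrite ler_wpM2l//.
 rewrite lerXn2r ?nnegrE ?addr_ge0 ?mulr_ge0 ?sqrtr_ge0//.
 have i1 : 1 <= i.+1%:R :> R by rewrite ler1n.
 have : Num.sqrt (i.+1%:R : R) <= i.+1%:R.
  rewrite -{2}[i.+1%:R]ger0_norm// -sqrtr_sqr ler_wsqrtr// expr2 ler_peMr//.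
 lra.
apply: (le_trans (ler_wpM2r _ cnt)); first by rewrite exprn_ge0// invr_ge0 ltW.
rewrite exprMn -!mulrA ler_wpM2l// ler_wpM2l ?exprn_ge0// /f exprVn /N2.
have -> : (2 * (n * n).+1 = n * n + (2 + n * n))%N by lia.
rewrite exprD invfM mulrA mulfV ?expf_neq0 ?gt_eqF// mul1r exprD invfM ler_piMr ?invr_ge0 ?exprn_ge0// ?(ltW i0)//.
by rewrite invf_le1 ?exprn_gt0// exprn_ege1// ler1n.
Qed.

End casimir_operators.

(** * Polynomial growth of K-invariant spaces of smooth vectors *)

Section growth.
Variables (R : realType) (n : nat) (G : topGroupType).
Variables (S : set 'M[R]_n) (pr : G -> 'M[R]_n) (gam : 'M[R]_n -> R -> G).
Hypotheses (SA : self_adjoint_algebraic_group S) (CP : covering S pr) (hgam : lifting S pr gam).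
Variables (V : hilbertType R) (p : unitary_rep G V).
Notation sm := (smooth_vector p).
Notation inK := (inK S pr).
Variables bsk : seq 'M[R]_n.
Hypotheses (bsk_orth : morthonormal bsk)
 (bsk_in : forall b, b \in bsk -> lie_k S b)
 (bsk_span : forall X, lie_k S X -> X = \sum_(b <- bsk) mdot X b *: b).
Notation dr := (dr gam p).

Definition is_average f (A : V -> V) :=
 [/\ forall a x y, A (a *: x + y) = a *: A x + A y, forall x y, inner (A x) y = inner x (A y),
  forall k x, inK k -> A (p k x) = p k (A x) &
  forall e : R, 0 < e -> exists2 s : seq (R * G),
   (forall a, a \in s -> 0 <= a.1 /\ inK a.2) /\ \sum_(a <- s) a.1 = 1 &
   forall x, rn (rank1_sum [seq (a.1, p a.2 f) | a <- s] x - A x) <= e * rn x].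

(** <A e, e> is in effect the mean over K of |<k f, e>|^2, and a set whose translates by the net
    cover K carries at least the fraction 1 / size ks of it. *)
Lemma average_lower f A k ks (U : set G) (delta : R) e : is_average f A -> inK k ->
 (forall g, inK g -> exists k' u, [/\ k' \in ks, U u, inK u & g = (k' * u)%g]) -> 0 <= delta ->
 (forall u, U u -> inK u -> delta <= rn (inner (p u (p k f)) e)) ->
 delta ^+ 2 <= (size ks)%:R * Re (inner (A e) e).
Proof.
move=> [_ _ Aact Aapp] Kk hks d0 hU; apply/ler_addgt0Pr => eps eps0.
have c0 : 0 < (size ks)%:R * rn e ^+ 2 + 1 by rewrite ltr_wpDl// mulr_ge0// sqr_ge0.
have [s [hs s1] hT] := Aapp _ (divr_gt0 eps0 c0).
set T := rank1_sum _ in hT.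
(* Summing over the net, every vector k_j f meets some translate of e. *)
have low : delta ^+ 2 <= \sum_(h <- [seq h <- ks | `[< inK h >]]) Re (inner (T (p h e)) (p h e)).
 under eq_bigr do rewrite rank1_sum_form /= big_map.
 rewrite exchange_big /= -[leLHS]mul1r -s1 mulr_suml; apply: ler_sum_seq => a ain; have [a0 ak] := hs a ain.
 have Kk' : inK (a.2 * k^-1)%g by apply: (inKM SA CP) => //; exact: (inKV SA CP).
 have [h [u [hin uU Ku hu]]] := hks _ Kk'.
 have Kh : inK h.
  have -> : h = (a.2 * k^-1 * u^-1)%g by rewrite hu mulgK.
  by apply: (inKM SA CP) => //; exact: (inKV SA CP).
 rewrite -mulr_sumr ler_wpM2l// (big_rem h) /=; last by rewrite mem_filter hin andbT; apply/asboolP.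
 rewrite -[leLHS]addr0 lerD//; last exact: sum_sqr_ge0.
 have -> : a.2 = (h * u * k)%g by rewrite -hu mulgVK.
 rewrite -mulgA !repM rep_inner lerXn2r ?nnegrE ?rn_ge0//; apply: le_trans (hU u uU Ku) _.
 by rewrite innerC rn_conj.
have up h : inK h -> Re (inner (T (p h e)) (p h e)) <=
  Re (inner (A e) e) + eps / ((size ks)%:R * rn e ^+ 2 + 1) * rn e ^+ 2.
 move=> Kh; have -> : inner (A e) e = inner (A (p h e)) (p h e) by rewrite Aact// rep_inner.
 have : Re (inner (T (p h e) - A (p h e)) (p h e)) <= eps / ((size ks)%:R * rn e ^+ 2 + 1) * rn e ^+ 2.
  apply: le_trans (Re_inner_le _ _) _; apply: (le_trans (ler_wpM2r (rn_ge0 _) (hT _))).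
  by rewrite !rep_rn -[leLHS]mulrA -expr2.
 by rewrite innerBl raddfB /=; lra.
have Ae0 : 0 <= Re (inner (A e) e) + eps / ((size ks)%:R * rn e ^+ 2 + 1) * rn e ^+ 2.
 apply: le_trans (up _ (inK1 SA CP)); rewrite rank1_sum_form /= big_map big_seq.
 by apply: sumr_ge0 => a /hs[a0 _] /=; rewrite mulr_ge0 ?sqr_ge0.
apply: (le_trans low); apply: (@le_trans _ _ (\sum_(h <- [seq h <- ks | `[< inK h >]])
  (Re (inner (A e) e) + eps / ((size ks)%:R * rn e ^+ 2 + 1) * rn e ^+ 2))).
 apply: ler_sum_seq => h.
 by rewrite mem_filter => /andP[/asboolP Kh _]; exact: up.
rewrite big_const_seq count_predT iter_addr_0 -[leLHS]mulr_natl.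
apply: (le_trans (ler_wpM2r Ae0 (_ : _ <= (size ks)%:R))).
 by rewrite ler_nat size_filter count_size.
rewrite mulrDr lerD2l.
have -> : (size ks)%:R * (eps / ((size ks)%:R * rn e ^+ 2 + 1) * rn e ^+ 2) =
 eps * ((size ks)%:R * rn e ^+ 2) / ((size ks)%:R * rn e ^+ 2 + 1) by field; rewrite gt_eqF.
by rewrite ler_pdivrMr// ler_wpM2l ?(ltW eps0)// lerDl.
Qed.

Lemma average_ge0 f A e : is_average f A -> 0 <= Re (inner (A e) e).
Proof.
move=> hA; have [C _ hC] := K_net SA CP (@filterT _ (nbhs (1%g : G)) _).
have [|ks [_ _ hks]] := hC 1; first by rewrite ltr01 lexx.
have := @average_lower f A 1%g ks setT 0 e hA (inK1 SA CP) _ (lexx 0) (fun u _ _ => rn_ge0 _).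
rewrite expr0n /= => h.
have {}h : 0 <= (size ks)%:R * Re (inner (A e) e).
 by apply: h => g /hks[k' [u [h1 h2 h3 _ h4]]]; exists k', u.
have ks0 : 0 < (size ks)%:R :> R.
 by rewrite ltr0n; have [k' [u [h1 _ _ _ _]]] := hks _ (inK1 SA CP); case: (ks) h1.
by rewrite -(pmulr_rge0 _ ks0).
Qed.

(** The complement of an invariant span is invariant because the action is unitary. *)
Lemma oproj_comm (es : seq V) k x : orthonormal es ->
 (forall k x, inK k -> oproj es x = x -> oproj es (p k x) = p k x) -> inK k ->
 oproj es (p k x) = p k (oproj es x).
Proof.
move=> oes hE Kk; rewrite -{1}[x](subrK (oproj es x)) repD.
have -> : oproj es (p k (x - oproj es x) + p k (oproj es x)) =
  oproj es (p k (x - oproj es x)) + oproj es (p k (oproj es x)).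
 by have := oproj_lin es 1 (p k (x - oproj es x)) (p k (oproj es x)); rewrite !scale1r.
rewrite [X in _ + X]hE ?oproj_id//.
rewrite [X in X + _]/oproj big1_seq ?add0r// => e /andP[_ ein].
have e1 : oproj es (p k^-1%g e) = p k^-1%g e by apply: hE; [exact: (inKV SA CP)|exact: oproj_mem].
by rewrite inner_repl -e1 -oproj_sym oprojB oproj_id// subrr inner0l scale0r.
Qed.

Variable fs : seq V.
Hypothesis hcyc : forall y, (forall f k, f \in fs -> inK k -> inner (p k f) y = 0) -> y = 0.

(** Let P project onto the span of es and let A be the sum over fs of the averages; PAP is positive
    definite there because fs is K-cyclic. The trace of (PAP)^-1 PAP gives dim <= sum of the s f,
    where s f = |(PAP)^(-1/2) P f|^2, and each s f is at most 4 times the size of a net of K of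
    radius about 1 / (1 + L). *)
Lemma growth : exists2 D : R, 0 <= D & forall (es : seq V) (L : R), 0 <= L -> orthonormal es ->
 (forall e, e \in es -> sm e) ->
 (forall k x, inK k -> oproj es x = x -> oproj es (p k x) = p k x) ->
 (forall b x, b \in bsk -> oproj es x = x -> rn (dr b x) <= L * rn x) ->
 (size es)%:R <= D * (1 + L) ^+ (n * n).
Proof.
have GK := orth_linear_group SA CP.
have SK : orth_part S `<=` S by move=> x [].
have bsk_lie b : b \in bsk -> lie (orth_part S) b by move=> /bsk_in h; have [_] := lie_orth CP b; exact.
have bsk_sp X : lie (orth_part S) X -> X = \sum_(b <- bsk) mdot X b *: b.
 by move=> h; have [h1 _] := lie_orth CP X; exact: (bsk_span (h1 h)).
have [C [U [C0 hU hC]]] := rep_lipschitz_gen CP hgam p GK SK bsk_orth bsk_lie bsk_sp.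
have [C' C'0 hK] := K_net SA CP hU.
exists ((size fs)%:R * (4 * (C' * (2 * C + 1) ^+ (n * n)))).
 by rewrite !mulr_ge0// exprn_ge0// addr_ge0// mulr_ge0.
move=> es L L0 oes es_sm esK esL.
have [Af hAf] := choice (fun f : V => average_operator SA CP p f).
have {}hAf f : is_average f (Af f) by [].
have linAf f : forall a x y, Af f (a *: x + y) = a *: Af f x + Af f y by case: (hAf f).
pose A x := \sum_(f <- fs) Af f x.
have linA a x y : A (a *: x + y) = a *: A x + A y.
 by rewrite /A scaler_sumr -big_split /=; apply: eq_bigr => f _; exact: linAf.
have symA x y : inner (A x) y = inner x (A y).
 by rewrite /A inner_suml inner_sumr; apply: eq_bigr => f _; case: (hAf f).
have actA k x : inK k -> A (p k x) = p k (A x).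
 by move=> Kk; rewrite /A rep_sum; apply: eq_bigr => f _; case: (hAf f) => _ _ h _; exact: h.
have [es' [oes' szes' Pes' eig]] := @spectral_span R V es A oes (fun a x y _ _ => linA a x y) (fun x y _ _ => symA x y).
rewrite -szes'; pose al e := Re (inner (A e) e);
have inE e : e \in es' -> oproj es e = e by move=> ein; rewrite -Pes' (oproj_mem oes').
have eig' e : e \in es' -> oproj es' (A e) = (al e)%:C *: e.
 by move=> ein; rewrite Pes'; exact: eig.
have AlE e : al e = \sum_(f <- fs) Re (inner (Af f e) e).
 by rewrite /al /A inner_suml raddf_sum.
(* If al e = 0 then every <A_f e, e> is 0, and [average_lower] on a small neighbourhood makes e
   orthogonal to all K-translates of fs. *)
have al0 e : e \in es' -> 0 < al e.
 move=> ein; rewrite lt_def; apply/andP; split; last first.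
  by rewrite AlE; apply: sumr_ge0 => f _; exact: average_ge0.
 apply/eqP => ale; have := orthonormal_rn oes' ein.
 suff -> : e = 0 by rewrite rn0 => /eqP; rewrite eq_sym oner_eq0.
 apply: hcyc => f k fin Kk; apply/eqP; rewrite -rn_eq0; apply: contraT => zn.
 have z0 : 0 < rn (inner (p k f) e) by rewrite lt_def zn rn_ge0.
 have Afe : Re (inner (Af f e) e) = 0.
  have := ale; rewrite AlE (big_rem f)//= => h.
  have h1 := average_ge0 e (hAf f).
  have h2 : 0 <= \sum_(f' <- rem f fs) Re (inner (Af f' e) e).
   by apply: sumr_ge0 => f' _; exact: average_ge0.
  lra.
 pose d := rn (inner (p k f) e) / 2; have d0 : 0 < d by rewrite divr_gt0.
 have hW : nbhs (1%g : G) [set u | rn (p u (p k f) - p k f) < d].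
  have /cvg_rnP h : p u (p k f) @[u --> (1%g : G)] --> p 1%g (p k f) by exact: rep_continuous.
  by apply: filterS (h _ d0) => u; rewrite rep1 rn_distC.
 have [D _ hD] := K_net SA CP hW; have [|ks [_ _ hks]] := hD 1; first by rewrite ltr01 lexx.
 have := average_lower (hAf f) Kk _ (ltW d0) (e := e) (ks := ks) (U := [set u | rn (p u (p k f) - p k f) < d]).
 rewrite Afe mulr0 => h; have : d ^+ 2 <= 0.
  apply: h => [g /hks[k' [u [h1 h2 h3 _ h4]]]|u uW _]; first by exists k', u.
  have := rn_inner_le (p u (p k f) - p k f) e; rewrite (orthonormal_rn oes' ein) mulr1 innerBl => h1.
  have h2 := rnB (inner (p u (p k f)) e) (inner (p u (p k f)) e - inner (p k f) e).
  rewrite opprB addrCA subrr addr0 in h2; rewrite /= in uW; rewrite /d in uW *; lra.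
 by rewrite leNgt exprn_gt0.
have es'K k x : inK k -> oproj es' x = x -> oproj es' (p k x) = p k x by rewrite !Pes'; exact: esK.
(* The functions of A on the span of es commute with K. *)
pose h (phi : R -> R) x := \sum_(e <- es') ((phi (al e))%:C * inner x e) *: e.
have hin phi x : oproj es' (h phi x) = h phi x.
 apply: (subspace_sum (D := spanned es')) => [|e ein]; first exact: spanned_subspace.
 by apply: subspaceZ; [exact: spanned_subspace|exact: oproj_mem].
have hK' phi k x : inK k -> h phi (p k x) = p k (h phi x).
 move=> Kk; rewrite -[LHS]hin -[RHS](es'K _ _ Kk (hin phi x)); apply: eq_big_seq => e ein; congr (_ *: _).
 rewrite (inner_osum (fun e => (phi (al e))%:C * inner (p k x) e))//.
 have KkV := inKV SA CP Kk; rewrite !inner_repl; set y := p k^-1%g e.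
 have yE : oproj es' y = y by apply: es'K => //; exact: oproj_mem.
 have PAy : oproj es' (A y) = (al e)%:C *: y.
  by rewrite /y actA// (oproj_comm _ oes' es'K KkV) eig'// repZ.
 rewrite -{1}yE -{2}yE /oproj !inner_sumr mulr_sumr; apply: eq_big_seq => e' e'in.
 rewrite !innerZr (inner_osum (fun e => (phi (al e))%:C * inner x e))// mulrCA [RHS]mulrCA.
 have [yn|/eqP yn] := eqVneq (inner y e') 0.
  rewrite yn; case: (inner x e') => a b; apply/eqP; rewrite eq_complex /=.
  by apply/andP; split; apply/eqP; ring.
 suff -> : al e = al e' by exact: mulrCA.
 have : inner (oproj es' (A y)) e' = (al e')%:C * inner y e'.
  by rewrite oproj_sym (oproj_mem oes')// symA -{1}yE oproj_sym eig'// innerZr_real.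
 by rewrite PAy innerZl => /(mulIf (introN eqP yn)) [].
have hsym phi x y : inner (h phi x) y = inner x (h phi y).
 rewrite /h inner_suml inner_sumr; apply: eq_bigr => e _.
 by rewrite innerZl innerZr -mulrA; case: (inner x e) (innerC e y) => a b; case: (inner e y) => c d -> /=; case: (inner y e) => c' d' /=; congr (_ +i* _); ring.
pose ph (a : R) := (Num.sqrt a)^-1.
have ph2 e : e \in es' -> ph (al e) ^+ 2 = (al e)^-1.
 by move=> /al0 a0; rewrite /ph exprVn sqr_sqrtr// ltW.
pose s f := rn (h ph f) ^+ 2.
have sE f : s f = \sum_(e <- es') (al e)^-1 * rn (inner f e) ^+ 2.
 rewrite /s (parseval (fun e => (ph (al e))%:C * inner f e))//; apply: eq_big_seq => e ein.
 by rewrite rnM exprMn rn_real real_normK ?num_real// ph2.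
(* Every translate a f with a in K contributes |(PAP)^(-1/2) P a f|^2 = s f, since functions of PAP
   commute with K; so the average does too. *)
have tr_le f : \sum_(e <- es') (al e)^-1 * Re (inner (Af f e) e) <= s f.
 have [_ _ _ app] := hAf f; apply/ler_addgt0Pr => eps eps0.
 pose B := \sum_(e <- es') (al e)^-1.
 have B0 : 0 <= B by rewrite /B big_seq; apply: sumr_ge0 => e /al0 a0; rewrite invr_ge0 ltW.
 have B1 : 0 < B + 1 by rewrite ltr_wpDl.
 have [q [hq q1] hT] := app _ (divr_gt0 eps0 B1).
 set T := rank1_sum _ in hT.
 have e1 : \sum_(e <- es') (al e)^-1 * Re (inner (T e) e) = s f.
  under eq_bigr do rewrite rank1_sum_form /= big_map mulr_sumr.
  rewrite exchange_big /= -[RHS]mul1r -q1 mulr_suml; apply: eq_big_seq => a ain.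
  have [_ ak] := hq a ain; rewrite {1}/s -(rep_rn p a.2) -hK'// -/(s _) sE mulr_sumr.
  by apply: eq_bigr => e _; rewrite mulrCA [in RHS]innerC rn_conj.
 rewrite -e1 -lerBlDl -sumrB; apply: (@le_trans _ _ (\sum_(e <- es') (al e)^-1 * (eps / (B + 1)))).
  apply: ler_sum_seq => e ein; rewrite -mulrBr ler_wpM2l ?invr_ge0 ?(ltW (al0 _ ein))//.
  rewrite -raddfB -innerBl -opprB innerNl raddfN /=; apply: le_trans (ler_norm _) _; rewrite normrN.
  apply: le_trans (absRe_inner_le _ _) _.
  by have := hT e; rewrite (orthonormal_rn oes' ein) !mulr1.
 rewrite -mulr_suml -/B mulrCA ler_piMr ?(ltW eps0)// ler_pdivrMr// mul1r lerDl//.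
have tr : (size es')%:R <= \sum_(f <- fs) s f.
 have -> : (size es')%:R = \sum_(e <- es') (al e)^-1 * al e :> R.
  rewrite -sum1_size natr_sum; apply: eq_big_seq => e /al0 a0; rewrite mulVf// gt_eqF//.
 rewrite (eq_bigr (fun e => \sum_(f <- fs) (al e)^-1 * Re (inner (Af f e) e))) => [|e _]; last first.
  by rewrite -mulr_sumr -AlE.
 by rewrite exchange_big; apply: ler_sum => f _; exact: tr_le.
(* For u in K with |pr u - 1| < r, the vector v = (PAP)^(-1/2) P f moves by at most C r L |v| <= |v|
   / 2. *)
pose r := (2 * C * L + 1)^-1.
have q0 : 0 <= 2 * C * L by rewrite !mulr_ge0.
have r0 : 0 < r <= 1 by rewrite invr_gt0 ltr_wpDl//= invf_le1 ?lerDr// ltr_wpDl.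
have [ks [ksK szks hks]] := hK r r0.
(* With e = (PAP)^-1 P f, <p u f, e> = <p u v, v> has modulus at least s f / 2 near 1. Hence (s f /
   2)^2 <= size ks <A_f e, e> <= size ks <A e, e> = size ks s f. *)
have s4 f : f \in fs -> s f <= 4 * (size ks)%:R.
 move=> fin; pose v := h ph f; pose e := h ph v.
 have hv : oproj es v = v by rewrite -Pes' hin.
 have sv : sm v by rewrite -hv; apply: oproj_sub es_sm; exact: subspace_smooth.
 have low : (s f / 2) ^+ 2 <= (size ks)%:R * Re (inner (Af f e) e).
  apply: (average_lower (hAf f) (inK1 SA CP) (U := [set u | U u /\ mnorm (pr u - 1%:M) < r])).
  - by move=> g /hks[k' [u [h1 h2 h3 h4 h5]]]; exists k', u.
  - by rewrite divr_ge0// sqr_ge0.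
  move=> u [Uu ur] Ku; rewrite rep1 -hsym hK'// -/v.
  have := hC v (L * rn v) (mulr_ge0 L0 (rn_ge0 v)).
  move=> /(_ _ u Uu Ku) hb.
  have {}hb : rn (p u v - v) <= rn v / 2.
   apply: (le_trans (hb _)) => [b bin|].
    by exists (dr b v); [apply: (dr_ders hgam) => //; case: (bsk_in bin)|exact: esL].
   rewrite mulrA [leRHS]mulrC ler_wpM2r ?rn_ge0//.
   have : C * mnorm (pr u - 1%:M) * L <= C * r * L.
    by rewrite ler_wpM2r// ler_wpM2l// ltW.
   move=> h1; apply: (le_trans h1).
   rewrite /r mulrAC ler_pdivrMr ?ltr_wpDl//; lra.
  apply: le_trans (Re_le_rn _); rewrite -[p u v](subrK v) innerDl raddfD /= Re_inner_rn -/(s f).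
  have h2 := absRe_le_rn (inner (p u v - v) v); have h3 := rn_inner_le (p u v - v) v.
  have h4 := ler_wpM2r (rn_ge0 v) hb; have h5 := ler_norm (- Re (inner (p u v - v) v)).
  rewrite normrN in h5; have : s f = rn v * rn v by rewrite /s expr2.
  rewrite mulrAC in h4; lra.
 have up : Re (inner (Af f e) e) <= s f.
  apply: (@le_trans _ _ (al e)).
   rewrite AlE (big_rem f)//= lerDl; apply: sumr_ge0 => f' _; exact: average_ge0.
  have eE : oproj es' e = e by exact: hin.
  have PAe : oproj es' (A e) = \sum_(e' <- es') ((ph (al e'))%:C * inner v e') *: ((al e')%:C *: e').
   have lPA a x y : oproj es' (A (a *: x + y)) = a *: oproj es' (A x) + oproj es' (A y).
    by rewrite linA oproj_lin.
   rewrite {1}/e /h (lin_comb_map _ _ _ lPA); apply: eq_big_seq => e' e'in; by rewrite eig'.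
  rewrite /al -[X in inner _ X]eE -oproj_sym PAe inner_suml raddf_sum /=.
  rewrite (_ : s f = rn (oproj es' v) ^+ 2); last by rewrite Pes' hv.
  rewrite rn_oproj//; apply: eq_ler; apply: eq_big_seq => e' e'in.
  have ie : inner e e' = (ph (al e'))%:C * inner v e'.
   exact: (inner_osum (fun e => (ph (al e))%:C * inner v e) oes' e'in).
  rewrite !innerZl (innerC e e') ie.
  have := ph2 _ e'in; have := al0 _ e'in; move: (al e') (ph (al e')) => b a b0 ab.
  have ab1 : a * a * b = 1 by rewrite -expr2 ab mulVf// gt_eqF.
  rewrite rn_sqr; case: (inner v e') => x y /=.
  by transitivity (a * a * b * (x ^+ 2 + y ^+ 2)); [ring|rewrite ab1 mul1r].
 have s0 : 0 <= s f by exact: sqr_ge0.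
 have M0 : 0 <= (size ks)%:R :> R by [].
 have h1 := le_trans low (ler_wpM2l M0 up).
 have [->|sn] := eqVneq (s f) 0; first by rewrite mulr_ge0.
 have sp : 0 < s f by rewrite lt_def sn.
 by rewrite -(ler_pM2l sp); move: h1; rewrite expr_div_n expr2; lra.
apply: (le_trans tr); apply: (@le_trans _ _ (\sum_(f <- fs) 4 * (size ks)%:R)).
 by apply: ler_sum_seq => f; exact: s4.
rewrite big_const_seq count_predT iter_addr_0 -[leLHS]mulr_natl -[leRHS]mulrA ler_wpM2l//.
rewrite -[leRHS]mulrA ler_wpM2l//; apply: (le_trans szks).
rewrite -[leRHS]mulrA ler_wpM2l// -exprMn lerXn2r ?nnegrE ?mulr_ge0 ?addr_ge0 ?mulr_ge0//.
 by rewrite /r invrK addr_ge0.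
rewrite /r invrK; have := mulr_ge0 C0 L0; lra.
Qed.

End growth.

Lemma near_mulVg (G : topGroupType) (P : G -> Prop) (g : G) :
 (\forall h \near (1%g : G), P h) -> \forall h \near g, P (h * g^-1)%g.
Proof.
move=> hP; have cg : (h * g^-1)%g @[h --> g] --> (1%g : G).
 by have := @continuous_mulgr G g^-1%g g; rewrite /continuous_at mulgV.
exact: cg _ hP.
Qed.

(** * Nuclearity of the space of smooth vectors *)

Section nuclearity.
Variables (R : realType) (G : topGroupType) (V : hilbertType R) (p : unitary_rep G V).
Hypotheses (hG : real_reductive R G) (hp : irreducible_rep p).
Notation sm := (smooth_vector p).

(* B d lists in stages an orthonormal basis of eigenvectors of the Casimir operator of the
  maximal compact subgroup, c e is the eigenvalue of e and W = (1 + Casimir)^N. *)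
Lemma smooth_vectors_nuclear : (exists2 v, sm v & v != 0) ->
 exists (B F : nat -> seq V) (c : V -> R) (N : nat) (Q : R) (W : V -> V),
 [/\ forall d, B d.+1 = F d ++ B d,
   forall d, orthonormal (B d) /\ forall e, e \in B d -> sm e /\ 0 <= c e,
   forall d, \sum_(e <- B d) (1 + c e)^-1 ^+ (2 * N) <= Q &
   forall v (eps : R), 0 < eps -> exists d0, forall d, (d0 <= d)%N -> rn (v - oproj (B d) v) < eps] /\
 [/\ forall a u v, sm u -> sm v -> W (a *: u + v) = a *: W u + W v,
   forall d v e, sm v -> e \in B d -> inner (W v) e = ((1 + c e) ^+ N)%:C * inner v e,
   exists ls : seq (seq (R -> G)), (forall l, l \in ls -> forall gm, List.In gm l -> one_parameter_subgroup gm) /\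
    forall v, sm v -> rn (W v) <= \sum_(l <- ls) rn (foldr (infinitesimal p) v l) &
   forall g v (eps : R), sm v -> 0 < eps -> \forall h \near g, rn (W (p h v - p g v)) < eps].
Proof.
move=> [v1 sv1 v10]; have [haus [n [S [pr [SA prS [pr1 prM] [prC prO] kfin]]]]] := hG.
have GS := algebraic_linear_group SA.
have CP : covering S pr by split.
have [gam hgam] := lifting_exists CP.
have [bsk [ok kin ksp]] := msubspace_basis (lie_k_subspace GS).
have [bsp [op pin psp]] := msubspace_basis (lie_p_subspace GS).
have kp b c : lie_k S b -> lie_p S c -> mdot b c = 0.
 move=> [_ sb] [_ sc]; have : mdot b c = - mdot b c by rewrite -[LHS]mdot_trT sb sc mdotNl.
 lra.
have bs_orth : morthonormal (bsk ++ bsp).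
 by apply: morthonormal_cat => // b c bk cp; apply: kp; [exact: kin|exact: pin].
have bs_span X : lie S X -> X = \sum_(b <- bsk ++ bsp) mdot X b *: b.
 move=> lX; have lXT := lie_tr SA lX.
 (* Skew and symmetric part; both stay in the Lie algebra because S is stable under
    transposition. *)
 pose K := 2^-1 *: (X - X^T); pose P := 2^-1 *: (X + X^T).
 have kK : lie_k S K.
  split; first by apply: lieZ; apply: (lieB GS).
  by rewrite /K linearZ /= linearB /= trmxK -scalerN opprB.
 have pP : lie_p S P.
  split; first by apply: lieZ; apply: (lieD GS).
  by rewrite /P linearZ /= linearD /= trmxK addrC.
 have XE : X = K + P by apply/matrixP => i j; rewrite !mxE; field.
 rewrite big_cat /= {1}XE {1}(ksp _ kK) {1}(psp _ pP); congr (_ + _); apply: eq_big_seq => b bb.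
  by rewrite XE mdotDl (mdotC P) (kp b P (kin b bb) pP) addr0.
 by rewrite XE mdotDl (kp K b kK (pin b bb)) add0r.
have sm_dense : dense_in sm by apply: (smooth_dense hp); exists v1.
have bs_in b : b \in bsk ++ bsp -> lie S b by rewrite mem_cat => /orP[/kin[]|/pin[]].
have [ws [ws_orth ws_ne ws_sm ws_act]] :=
 finite_dim_K_invariant SA CP hgam bs_orth bs_in bs_span sm_dense sv1 v10.
have [fs [_ hcyc]] := K_cyclic SA CP hgam hp bs_orth kin pin bs_span sm_dense ws_orth ws_ne ws_sm ws_act.
have [D D0 hgrowth] := growth SA CP hgam ok kin ksp hcyc.
have [B [F [BF hB]]] := eigenlist_sequence CP hgam bs_orth kin pin bs_span sm_dense ws_orth ws_sm ws_act.
pose c := casimir_value gam p bsk; pose N := (n * n).+1.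
pose Lm := Lam gam p bsk.
have eigB d e : e \in B d -> sm e /\ Om gam p bsk e = (c e)%:C *: e.
 by move=> eB; have [[_ h] _ _] := hB d; exact: h.
have c0 d e : e \in B d -> 0 <= c e by move=> /eigB[se _]; exact: (casimir_value_ge0 hgam kin).
have oB d : orthonormal (B d) by have [[h _] _ _] := hB d.
have iterE d e m : e \in B d -> iter m Lm e = ((1 + c e) ^+ m)%:C *: e.
 move=> eB; have [se ee] := eigB d e eB; elim: m => [|m IH]; first by rewrite expr0 scale1r.
 have l0 a : Lm (a *: e) = a *: Lm e.
  have h := Lam_lin hgam kin a se (smooth0 p); rewrite addr0 in h; rewrite /Lm h.
  have -> : Lam gam p bsk 0 = 0; last by rewrite addr0.
  have := Lam_lin hgam kin (-1) (smooth0 p) (smooth0 p).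
  by rewrite scaler0 addr0 scaleN1r addNr.
 have -> : iter m.+1 Lm e = ((1 + c e) ^+ m)%:C *: (e + (c e)%:C *: e) by rewrite /= IH l0 /Lm /Lam ee.
 have -> : e + (c e)%:C *: e = (1 + c e)%:C *: e by rewrite rmorphD rmorph1 scalerDl scale1r.
 by rewrite scalerA -rmorphM exprSr.
have proj_dense v (eps : R) : 0 < eps -> exists d0, forall d, (d0 <= d)%N -> rn (v - oproj (B d) v) < eps.
 move=> e0; have [z [m hz] vz] := uspan_dense SA CP hgam hp bs_orth kin pin bs_span sm_dense
  ws_orth ws_ne ws_sm ws_act v e0.
 exists m => d md; apply: le_lt_trans vz.
 have Pz : oproj (B d) z = z by have [_ _ h] := hB d; apply: h; exact: usp_leq hz.
 have -> : v - oproj (B d) v = (v - z) - oproj (B d) (v - z).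
  by rewrite oprojB Pz; set y := oproj _ _; lmod R V.
 have := pythagoras (v - z) (oB d); have := sqr_ge0 (rn (oproj (B d) (v - z))) => h1 h2.
 by rewrite -(@ler_pXn2r _ 2) ?nnegrE ?rn_ge0//; lra.
have iter_inner m d v e : sm v -> e \in B d -> inner (iter m Lm v) e = ((1 + c e) ^+ m)%:C * inner v e.
 move=> sv eB; have [se _] := eigB d e eB.
 by rewrite (iter_Lam_sym hgam kin m sv se) -/Lm (iterE d)// innerZr_real.
have iter_lin m a u v : sm u -> sm v -> iter m Lm (a *: u + v) = a *: iter m Lm u + iter m Lm v.
 by move=> su sv; exact: (iter_Lam_lin hgam kin).
have iter_smooth m v : sm v -> sm (iter m Lm v) by exact: (iter_Lam_smooth hgam kin).
have iterB m u v : sm u -> sm v -> iter m Lm (u - v) = iter m Lm u - iter m Lm v.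
 by move=> su sv; have := iter_lin m (-1) v u sv su; rewrite !scaleN1r addrC (addrC (- _)).
(* The constant is the bound of [eigen_sum], independent of d, and N = n^2 + 1 matches its
   exponent. *)
exists B, F, c, N, (D * 2 ^+ (n * n) * 2), (iter N Lm); split; split.
- exact: BF.
- by move=> d; split => // e eB; split; [case: (eigB d e eB)|exact: c0 eB].
- move=> d; have [h1 h2 h3] := hB d.
 exact: (eigen_sum CP hgam bs_orth kin pin bs_span ws_ne ws_sm ws_act D0 hgrowth h1 h2 h3).
- exact: proj_dense.
- exact: iter_lin.
- by move=> d v e; exact: iter_inner.
- have [s [hs he]] := iter_Lam_words CP hgam p bs_orth kin pin bs_span ws_ne N.
 exists [seq [seq gam X | X <- l] | l <- s]; split.
  move=> _ /mapP[l /hs[_ hl] ->] gm /List.in_map_iff[X [<- Xl]].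
  have Xl' : X \in l by elim: l {hl} Xl => //= Y l IH [->|/IH h]; rewrite inE ?eqxx// h orbT.
  by have [] := hgam _ (hl X Xl').
 move=> v sv; rewrite /Lm he// big_map; apply: le_trans (rn_sum _ _ _) _.
 by apply: ler_sum => l _; rewrite foldr_map.
- move=> g v eps sv e0; have sg := smooth_act_vec g sv.
 have /cvg_rnP/(_ _ e0) h1 := iter_Lam_act_cvg CP hgam bs_orth kin pin bs_span ws_ne (N := N) sg.
 have h2 : \forall h \near g, rn (iter N Lm (p g v) - iter N Lm (p (h * g^-1)%g (p g v))) < eps.
  exact: near_mulVg h1.
 apply: filterS h2 => h.
 by rewrite -repM -mulgA mulVg mulg1 rn_distC (iterB _ _ _ (smooth_act_vec h sv) sg).
Qed.

End nuclearity.

Lemma rat_matrix_approx (R : realType) n (A : 'M[R]_n) (e : R) : 0 < e ->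
 exists B : 'M[rat]_n, mnorm (A - map_mx ratr B) < e.
Proof.
move=> e0; have c0 : 0 < e / (n%:R ^+ 2 + 1) by rewrite divr_gt0// ltr_wpDl// sqr_ge0.
have h (ij : 'I_n * 'I_n) : exists q : rat, `|A ij.1 ij.2 - ratr q| < e / (n%:R ^+ 2 + 1).
 have /rat_in_itvoo[q] : A ij.1 ij.2 - e / (n%:R ^+ 2 + 1) < A ij.1 ij.2 + e / (n%:R ^+ 2 + 1).
  by rewrite ltrBlDr -addrA ltrDl addr_gt0.
 by rewrite in_itv /= => /andP[h1 h2]; exists q; rewrite ltr_distlC h1 h2.
have [f hf] := choice h; exists (\matrix_(i, j) f (i, j)).
apply: (@le_lt_trans _ _ (n%:R ^+ 2 * (e / (n%:R ^+ 2 + 1)))).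
 by apply: mnorm_le => i j; rewrite !mxE ltW// (hf (i, j)).
by rewrite mulrC -mulrA gtr_pMr// mulrC ltr_pdivrMr ?mul1r ?ltrDl// ltr_wpDl// sqr_ge0.
Qed.

(* A group element whose image is close to that of h differs from h by a small factor
  and an element of the finite kernel. *)
Lemma reductive_separable (R : realType) (H : topGroupType) : real_reductive R H ->
 exists q : nat -> H, forall (h : H) U, nbhs h U -> exists j, U (q j).
Proof.
move=> [haus [n [S [pr [SA prS [pr1 prM] [prC prO] kfin]]]]].
have CP : covering S pr by split => //; exact: algebraic_linear_group SA.
have /finite_seqP[zs zsE] := kfin.
have hg (x : 'M[rat]_n * nat) : exists g, (exists g', mnorm (pr g' - map_mx ratr x.1) < x.2.+1%:R^-1) ->
  mnorm (pr g - map_mx ratr x.1) < x.2.+1%:R^-1.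
 have [[g h]|nh] := pselect (exists g', mnorm (pr g' - map_mx ratr x.1) < x.2.+1%:R^-1).
  by exists g.
 by exists 1%g.
have [g gP] := choice hg.
exists (fun j => if unpickle j is Some x then (g x.1 * nth 1%g zs x.2)%g else 1%g) => h U hU.
have hU1 : nbhs (1%g : H) [set x | U (h * x)%g].
 by have := @continuous_mulgl H h 1%g; rewrite /continuous_at mulg1; exact.
have [r r0 hr] := cov_lift CP hU1.
have m0 : 0 < mnorm (pr h^-1%g) + 1 by rewrite ltr_wpDl ?mnorm_ge0.
have [k _ hk] : exists2 k : nat, True & 2 * k.+1%:R^-1 < r / (mnorm (pr h^-1%g) + 1).
 have [k hk] := invS_small (divr_gt0 (divr_gt0 r0 m0) (ltr0n R 2)).
 exists k => //; have := hk k (leqnn k); set y := r / _; set w := _^-1; lra.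
have k0 : 0 < k.+1%:R^-1 :> R by rewrite invr_gt0.
have [A hA] := rat_matrix_approx (pr h) k0.
have gA := gP (A, k) (ex_intro _ h hA); rewrite /= in gA.
have [u Uu pu] : exists2 u, U (h * u)%g & pr u = pr (h^-1 * g (A, k))%g.
 apply: hr; first exact: prS.
 have -> : pr (h^-1 * g (A, k))%g - 1%:M = pr h^-1%g *m (pr (g (A, k)) - pr h).
  by rewrite mulmxBr -!prM mulVg pr1.
 apply: le_lt_trans (mnormM _ _) _.
 apply: (@le_lt_trans _ _ ((mnorm (pr h^-1%g) + 1) * (2 * k.+1%:R^-1))); last first.
  by rewrite mulrC -ltr_pdivlMr.
 apply: ler_pM; rewrite ?mnorm_ge0//; first by rewrite lerDl.
 apply: le_trans (mnorm_dist_triangle (map_mx ratr A) _ _) _.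
 by rewrite (mnorm_distC _ (pr h)) mulr_natl mulr2n ltW// ltrD.
pose z := ((g (A, k))^-1 * h * u)%g.
have zz : z \in zs.
 have : [set g | pr g = 1%:M] z.
  by rewrite /= /z prM pu -prM -mulgA mulVKg mulVg pr1.
 by rewrite zsE.
exists (pickle ((A, k), index z zs)); rewrite pickleK /= nth_index//.
by rewrite /z !mulgA mulgV mul1g.
Qed.

(** * Almost everywhere bounds and norms in direct integrals *)

Section measure_bounds.
Context (R : realType) (d : measure_display) (L : measurableType d).
Variable mu : {measure set L -> \bar R}.

(** By monotone convergence the limit has integral at most C, so it is finite almost everywhere. *)
Lemma bounded_integrals_ae (g : nat -> L -> R) (C : R) :
 (forall n, measurable_fun setT (g n)) -> (forall n t, 0 <= g n t) ->
 (forall n t, g n t <= g n.+1 t) -> (forall n, (\int[mu]_t (g n t)%:E <= C%:E)%E) ->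
 \forall t \ae mu, exists b, forall n, g n t <= b.
Proof.
move=> mg g0 gS gC; pose h t := limn (fun n => (g n t)%:E).
have nd t : nondecreasing_seq (fun n => (g n t)%:E).
 by apply/nondecreasing_seqP => n; rewrite lee_fin.
have hc t : (fun n => (g n t)%:E) @ \oo --> h t by exact: ereal_nondecreasing_is_cvgn.
have mE n : measurable_fun setT (fun t => (g n t)%:E) by exact/measurable_EFinP.
have mh : measurable_fun setT h by apply: (emeasurable_fun_cvg (fun n t => (g n t)%:E)).
have gh n t : ((g n t)%:E <= h t)%E.
 by apply: lime_ge => //; exists n => // m /= nm; exact: (nd t).
have h0 t : (0 <= h t)%E by apply: le_trans (gh 0%N t); rewrite lee_fin.
have ih : mu.-integrable setT h.
 apply/integrableP; split => //; under eq_integral => t _ do rewrite gee0_abs//.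
 have -> : (\int[mu]_t h t = limn (fun n => \int[mu]_t (g n t)%:E))%E.
  by apply: monotone_convergence => // n t _; rewrite lee_fin.
 apply: le_lt_trans (ltry C); apply: lime_le; last by exists 0%N.
 apply: ereal_nondecreasing_is_cvgn => m n mn; apply: ge0_le_integral => //.
 - by move=> t _; rewrite lee_fin.
 - by move=> t _; exact: nd.
have := integrable_ae measurableT ih; apply: filterS => t /(_ I) ft.
by exists (fine (h t)) => n; rewrite -lee_fin fineK.
Qed.

End measure_bounds.

Section direct_integral_norm.
Context (R : realType) (d : measure_display) (L : measurableType d).
Context (K : L -> hilbertType R) (F : measurable_family K) (mu : {measure set L -> \bar R}).
Implicit Types x y : direct_integral F mu.

(** Representatives of classes are linear only off a null set that depends on the vectors, so only
    countably many such identities can be combined. *)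
Lemma di_repr_linear (a : R[i]) x y :
 \forall t \ae mu, repr (a *: x + y) t = a *: repr x t + repr y t.
Proof.
apply: filterS2 (di_reprP (l2_linear 1 (repr (a *: x)) (repr y)))
 (di_reprP (l2_linear a (repr x) (l2_0 F mu))) => t /= h1 h2.
by rewrite h1 /= scale1r h2 /= addr0.
Qed.

Lemma di_repr0 : \forall t \ae mu, repr (0 : direct_integral F mu) t = 0.
Proof. exact: di_reprP (l2_0 F mu). Qed.

Lemma measurable_di_norm x : measurable_fun setT (fun t => rn (repr x t) ^+ 2).
Proof.
have [h _] := mf_measurable (l2_measurable (repr x)) (l2_measurable (repr x)).
by under eq_fun do rewrite -Re_inner_rn.
Qed.

Lemma di_norm x : (\int[mu]_t (rn (repr x t) ^+ 2)%:E = (Re (di_inner x x))%:E)%E.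
Proof.
rewrite /di_inner /= /Rintegral fineK; last first.
 rewrite ge0_fin_numE; first exact: (l2_finite (repr x)).
 by apply: integral_ge0 => t _; rewrite lee_fin Re_inner_ge0.
by apply: eq_integral => t _; rewrite Re_inner_rn.
Qed.

End direct_integral_norm.

(** * Convergence of the series that defines a fibre map *)

Section nuclear_sum.
Variables (R : realType) (V X : hilbertType R) (sm : V -> Prop).
Variables (B F : nat -> seq V) (c : V -> R) (N : nat) (W : V -> V).
Hypothesis BF : forall d, B d.+1 = F d ++ B d.
Hypothesis oB : forall d, orthonormal (B d).
Hypothesis c0 : forall d e, e \in B d -> 0 <= c e.
Hypothesis B_dense : forall v (eps : R), 0 < eps ->
 exists d0, forall d, (d0 <= d)%N -> rn (v - oproj (B d) v) < eps.
Hypothesis sm_lin : forall a u v, sm u -> sm v -> sm (a *: u + v).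
Hypothesis W_inner : forall d v e, sm v -> e \in B d -> inner (W v) e = ((1 + c e) ^+ N)%:C * inner v e.

Lemma basis_prefix d k : exists s, B (d + k) = s ++ B d.
Proof.
elim: k => [|k [s IH]]; first by exists [::]; rewrite addn0.
by exists (F (d + k) ++ s); rewrite addnS BF IH catA.
Qed.

Variables (tau : V -> X) (b : R).
Hypothesis hb : forall d, \sum_(e <- B d) (1 + c e)^-1 ^+ (2 * N) * rn (tau e) ^+ 2 <= b.

Definition basis_sum d v : X := \sum_(e <- B d) inner v e *: tau e.

Let b0 : 0 <= b.
Proof.
apply: le_trans (hb 0); apply: sumr_ge0_seq => e eB.
by rewrite mulr_ge0 ?sqr_ge0// exprn_ge0// invr_ge0 addr_ge0// (c0 eB).
Qed.

(** Cauchy-Schwarz with the factors (1 + c e)^N and their inverses: the first sum is a Bessel sum of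
    W v, the second a piece of the weighted sum bounded by b. *)
Let block_bound d v s : sm v -> {subset s <= B d} ->
 rn (\sum_(e <- s) inner v e *: tau e) ^+ 2 <=
 (\sum_(e <- s) rn (inner (W v) e) ^+ 2) * \sum_(e <- s) (1 + c e)^-1 ^+ (2 * N) * rn (tau e) ^+ 2.
Proof.
move=> sv sB.
have hw e : e \in s -> 0 < 1 + c e by move=> /sB/c0 h; lra.
apply: (@le_trans _ _ ((\sum_(e <- s) rn (inner (W v) e) * ((1 + c e)^-1 ^+ N * rn (tau e))) ^+ 2)).
 rewrite ler_pXn2r ?nnegrE ?rn_ge0//; last first.
  apply: sumr_ge0_seq => e /hw h.
  by rewrite !mulr_ge0 ?rn_ge0// exprn_ge0// invr_ge0 ltW.
 apply: le_trans (rn_sum _ _ _) _; apply: ler_sum_seq => e es.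
 have h := hw e es; rewrite rnZ (W_inner sv (sB e es)) rnM rn_real ger0_norm ?exprn_ge0 ?(ltW h)//.
 rewrite [_ * rn (inner v e)]mulrC -mulrA [_ * (_ * rn (tau e))]mulrA -exprMn mulfV ?gt_eqF//.
 by rewrite expr1n mul1r.
apply: le_trans (sum_cauchy_schwarz _ _ _) _; rewrite ler_wpM2l//.
 exact: sum_sqr_ge0.
by apply: ler_sum => e _; rewrite exprMn -exprM mulnC.
Qed.

(** The block between the stages d and d + k sees only the part of W v orthogonal to B d. *)
Lemma basis_sum_diff d k v : sm v ->
 rn (basis_sum (d + k) v - basis_sum d v) ^+ 2 <= b * rn (W v - oproj (B d) (W v)) ^+ 2.
Proof.
move=> sv; have [s hs] := basis_prefix d k.
have sB : {subset s <= B (d + k)} by move=> e es; rewrite hs mem_cat es.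
rewrite /basis_sum hs big_cat /= addrK.
apply: le_trans (block_bound sv sB) _; rewrite mulrC; apply: ler_pM.
- apply: sumr_ge0_seq => e /sB eB.
 by rewrite mulr_ge0 ?sqr_ge0// exprn_ge0// invr_ge0 addr_ge0// (c0 eB).
- exact: sum_sqr_ge0.
- apply: le_trans (hb (d + k)); rewrite hs big_cat /= lerDl big_seq; apply: sumr_ge0 => e eB.
 by rewrite mulr_ge0 ?sqr_ge0// exprn_ge0// invr_ge0 addr_ge0// (c0 eB).
- have := bessel (W v) (oB (d + k)); rewrite hs big_cat /= -(rn_oproj (W v) (oB d)).
 by rewrite (pythagoras (W v) (oB d)); lra.
Qed.

Lemma basis_sum_bound d v : sm v -> rn (basis_sum d v) ^+ 2 <= b * rn (W v) ^+ 2.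
Proof.
move=> sv; apply: le_trans (block_bound sv (fun e => id)) _; rewrite mulrC.
apply: ler_pM (hb d) (bessel (W v) (oB d)); last exact: sum_sqr_ge0.
apply: sumr_ge0_seq => e eB.
by rewrite mulr_ge0 ?sqr_ge0// exprn_ge0// invr_ge0 addr_ge0// (c0 eB).
Qed.

Lemma basis_sum_cvg v : sm v -> exists w, rcvg (fun d => basis_sum d v) w.
Proof.
move=> sv; apply: rcauchy_cvg => e e0.
have b1 : 0 < b + 1 by rewrite ltr_wpDl.
have e2 : 0 < e / (b + 1) by rewrite divr_gt0.
have [d0 hd0] := B_dense (W v) e2; exists d0.
suff key d k : (d0 <= d)%N -> rn (basis_sum (d + k) v - basis_sum d v) < e.
 move=> k l d0k d0l; case: (leqP k l) => kl; first by rewrite rn_distC -(subnKC kl) key.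
 by rewrite -(subnKC (ltnW kl)) key.
move=> dd; have := hd0 d dd; rewrite ltr_pdivlMr//; have := rn_ge0 (W v - oproj (B d) (W v)).
move: (rn (W v - _)) (basis_sum_diff d k sv) => x hx x0 xe.
rewrite -(@ltr_pXn2r _ 2) ?nnegrE ?rn_ge0 ?(ltW e0)//; apply: le_lt_trans hx _.
apply: (@le_lt_trans _ _ ((x * (b + 1)) ^+ 2)); last first.
 by rewrite ltr_pXn2r ?nnegrE ?(ltW e0)//; apply: mulr_ge0 => //; exact: ltW.
by rewrite exprMn mulrC ler_wpM2l ?sqr_ge0// expr2; nra.
Qed.

Lemma rcvg_unique (u : nat -> X) w w' : rcvg u w -> rcvg u w' -> w = w'.
Proof.
move=> h h'; apply: rn_dist_eq => e e0; have e2 : 0 < e / 2 by rewrite divr_gt0.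
have [n1 h1] := h _ e2; have [n2 h2] := h' _ e2.
have {h1} := h1 _ (leq_maxl n1 n2); have {h2} := h2 _ (leq_maxr n1 n2).
move: (maxn _ _) => m h2 h1; have := rn_dist_triangle (u m) w w'; rewrite (rn_distC w (u m)); lra.
Qed.

Lemma basis_sum_limit : exists A : V -> X,
 [/\ forall v, sm v -> rcvg (fun d => basis_sum d v) (A v),
   forall a u v, sm u -> sm v -> A (a *: u + v) = a *: A u + A v &
   forall v, sm v -> rn (A v) ^+ 2 <= b * rn (W v) ^+ 2].
Proof.
have h v : exists w, sm v -> rcvg (fun d => basis_sum d v) w.
 have [sv|nsv] := pselect (sm v); first by have [w hw] := basis_sum_cvg sv; exists w.
 by exists 0.
have [A hA] := choice h; exists A; split => // [a u v su sv|v sv].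
 apply: rcvg_unique (hA _ (sm_lin a su sv)) _ => e e0.
 have a1 : 0 < rn a + 1 by rewrite ltr_wpDl ?rn_ge0.
 have e2 : 0 < e / 2 / (rn a + 1) by rewrite !divr_gt0.
 have e3 : 0 < e / 2 by rewrite divr_gt0.
 have [n1 h1] := hA u su _ e2; have [n2 h2] := hA v sv _ e3.
 exists (maxn n1 n2) => k; rewrite geq_max => /andP[/h1 k1 /h2 k2].
 have -> : basis_sum k (a *: u + v) - (a *: A u + A v) =
   a *: (basis_sum k u - A u) + (basis_sum k v - A v).
  rewrite scalerBr opprD addrACA; congr (_ + _).
  rewrite /basis_sum scaler_sumr -big_split /=; apply: eq_bigr => i _.
  by rewrite innerDl innerZl scalerDl scalerA.
 apply: le_lt_trans (rnD _ _) _; rewrite rnZ [e]splitr; apply: ler_ltD => //.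
 rewrite ltr_pdivlMr// in k1; apply: ltW; apply: le_lt_trans k1.
 by rewrite mulrC ler_wpM2l ?rn_ge0// lerDl.
apply/ler_addgt0Pr => e e0; have sb : 0 <= Num.sqrt (b * rn (W v) ^+ 2) by exact: sqrtr_ge0.
have y0 : 0 <= b * rn (W v) ^+ 2 by rewrite mulr_ge0 ?sqr_ge0.
suff : rn (A v) <= Num.sqrt (b * rn (W v) ^+ 2).
 move=> hs; apply: (@le_trans _ _ (b * rn (W v) ^+ 2)); last by rewrite lerDl ltW.
 by rewrite -[leRHS]sqr_sqrtr// ler_pXn2r ?nnegrE ?rn_ge0.
apply/ler_addgt0Pr => e' e'0; have [n hn] := hA v sv _ e'0.
have := hn n (leqnn n); have : rn (basis_sum n v) <= Num.sqrt (b * rn (W v) ^+ 2).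
 by rewrite -(@ler_pXn2r _ 2) ?nnegrE ?rn_ge0 ?sqr_sqrtr//; exact: basis_sum_bound.
by have := rnB (basis_sum n v) (basis_sum n v - A v); rewrite opprB addrC subrK; lra.
Qed.

End nuclear_sum.

(** * Comparison of the series with the sections T(v) *)

Section pointwise.
Context (R : realType) (d : measure_display) (L : measurableType d).
Context (K : L -> hilbertType R) (F : measurable_family K) (mu : {measure set L -> \bar R}).
Context (V : hilbertType R) (T : {linear V -> direct_integral F mu}).
Hypothesis T_inner : forall v w, di_inner (T v) (T w) = inner v w.
Notation tau v t := (repr (T v) t).

Let tau_lin a u v : \forall t \ae mu, tau (a *: u + v) t = a *: tau u t + tau v t.
Proof. rewrite linearP; exact: di_repr_linear. Qed.

Let tau_measurable v : measurable_fun setT (fun t => rn (tau v t) ^+ 2).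
Proof. exact: measurable_di_norm. Qed.

Let tau_norm v : (\int[mu]_t (rn (tau v t) ^+ 2)%:E = (rn v ^+ 2)%:E)%E.
Proof. by rewrite di_norm T_inner Re_inner_rn. Qed.

Let tau_sum (c : V -> R[i]) (s : seq V) :
 \forall t \ae mu, tau (\sum_(e <- s) c e *: e) t = \sum_(e <- s) c e *: tau e t.
Proof.
elim: s => [|e s IH].
 by rewrite big_nil linear0; apply: filterS (di_repr0 F mu) => t ->; rewrite big_nil.
rewrite big_cons; apply: filterS2 IH (tau_lin (c e) e (\sum_(i <- s) c i *: i)) => t h1 h2.
by rewrite big_cons h2 h1.
Qed.

Let weighted_measurable (I : Type) (s : seq I) (w : I -> R) (x : I -> V) :
 measurable_fun setT (fun t => \sum_(i <- s) w i * rn (tau (x i) t) ^+ 2).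
Proof. by apply: measurable_sum => i; apply: measurable_funM. Qed.

Let weighted_integral (I : Type) (s : seq I) (w : I -> R) (x : I -> V) : (forall i, 0 <= w i) ->
 (\int[mu]_t (\sum_(i <- s) w i * rn (tau (x i) t) ^+ 2)%:E =
  (\sum_(i <- s) w i * rn (x i) ^+ 2)%:E)%E.
Proof.
move=> w0; under eq_integral => t _ do rewrite -sumEFin.
rewrite ge0_integral_sum//.
- rewrite -sumEFin; apply: eq_bigr => i _; under eq_integral => t _ do rewrite EFinM.
 rewrite ge0_integralZl_EFin//.
 + by rewrite tau_norm.
 + by move=> t _; rewrite lee_fin sqr_ge0.
 + exact/measurable_EFinP.
- by move=> i; apply/measurable_EFinP; apply: measurable_funM.
- by move=> i t _; rewrite lee_fin mulr_ge0// sqr_ge0.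
Qed.

Variables (B S : nat -> seq V) (w : V -> R) (Q : R).
Hypothesis BS : forall n, B n.+1 = S n ++ B n.
Hypothesis w0 : forall e, 0 <= w e.
Hypothesis oB : forall n, orthonormal (B n).
Hypothesis wQ : forall n, \sum_(e <- B n) w e <= Q.

(** As T is isometric and the e are unit vectors, each partial sum integrates to a sum of weights,
    at most Q. *)
Lemma weighted_sums_bounded_ae :
 \forall t \ae mu, exists b, forall n, \sum_(e <- B n) w e * rn (tau e t) ^+ 2 <= b.
Proof.
apply: (@bounded_integrals_ae _ _ _ mu _ Q) => [n|n t|n t|n].
- exact: weighted_measurable.
- by apply: sumr_ge0 => e _; rewrite mulr_ge0// sqr_ge0.
- rewrite BS big_cat /= lerDr; apply: sumr_ge0 => e _; rewrite mulr_ge0// sqr_ge0//.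
- rewrite weighted_integral// lee_fin; apply: le_trans (wQ n).
 apply: ler_sum_seq => e eB.
 rewrite -Re_inner_rn; have [_ ->] := oB n; rewrite // eqxx /= mulr1 lexx//.
Qed.

Hypothesis B_dense : forall v (eps : R), 0 < eps ->
 exists n0, forall n, (n0 <= n)%N -> rn (v - oproj (B n) v) < eps.

(* Fast convergence of a subsequence of the projections makes the sections converge a.e. *)
Lemma basis_sum_limit_ae (v : V) : \forall t \ae mu, forall a,
 rcvg (fun n => basis_sum B (fun e => tau e t) n v) a -> tau v t = a.
Proof.
have iS J : iota 0 J.+1 = iota 0 J ++ [:: J] by rewrite -addn1 iotaD.
have aux (m y z : R) : 0 <= y -> y <= 1 -> 0 <= z -> z <= 1 -> m * z = 1 -> m * (y * z) ^+ 2 <= y.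
 move=> y0 y1 z0 z1 mz; have -> : m * (y * z) ^+ 2 = (m * z) * (y * (y * z)) by ring.
 by rewrite mz mul1r -[leRHS]mulr1; apply: ler_wpM2l => //; exact: mulr_ile1.
(* The remainders satisfy |x_j| < r_j with (j+1) r_j^2 <= 2^-j, so the weighted sums have integral
   at most 2. Where they are bounded by some b, the squared norm of the j-th section is at most b /
   (j+1) and tends to 0. *)
pose r (j : nat) : R := 2^-1 ^+ j / j.+1%:R.
have r0 j : 0 < r j by rewrite divr_gt0// exprn_gt0// invr_gt0.
have hn j : exists n, (j <= n)%N /\ rn (v - oproj (B n) v) < r j.
 have [n0 hn0] := B_dense v (r0 j); exists (maxn j n0).
 by rewrite leq_maxl; split => //; apply: hn0; exact: leq_maxr.
have [n hnP] := choice hn; pose x j := v - oproj (B (n j)) v.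
have h1 : \forall t \ae mu, exists b, forall J, \sum_(j <- iota 0 J) j.+1%:R * rn (tau (x j) t) ^+ 2 <= b.
 apply: (@bounded_integrals_ae _ _ _ mu _ 2) => [J|J t|J t|J].
 - exact: weighted_measurable.
 - by apply: sumr_ge0 => e _; rewrite mulr_ge0// sqr_ge0.
 - by rewrite iS big_cat /= lerDl big_seq1 mulr_ge0// sqr_ge0.
 - rewrite weighted_integral// lee_fin.
  apply: (@le_trans _ _ (\sum_(j <- iota 0 J) 2^-1 ^+ j)).
   apply: ler_sum => j _; have [_ xr] := hnP j.
   have xr' : rn (x j) ^+ 2 <= r j ^+ 2.
    by rewrite ler_pXn2r ?nnegrE ?rn_ge0 ?(ltW (r0 j))// ltW.
   apply: (@le_trans _ _ (j.+1%:R * r j ^+ 2)); first by rewrite ler_wpM2l.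
   rewrite /r.
   have y0 : 0 <= 2^-1 ^+ j :> R by rewrite exprn_ge0// invr_ge0.
   have y1 : 2^-1 ^+ j <= 1 :> R by rewrite exprn_ile1// ?invr_ge0// invf_le1// ler1n.
   have z1 : j.+1%:R^-1 <= 1 :> R by rewrite invf_le1// ler1n.
   have z0 : 0 <= j.+1%:R^-1 :> R by rewrite invr_ge0.
   have z2 : j.+1%:R * j.+1%:R^-1 = 1 :> R by rewrite mulfV.
   exact: aux.
  elim: J => [|J IH]; first by rewrite big_nil.
  have -> : \sum_(j <- iota 0 J.+1) 2^-1 ^+ j = 2 - 2^-1 ^+ J :> R.
   elim: J {IH} => [|J IH]; first by rewrite big_seq1 expr0; lra.
   by rewrite iS big_cat /= IH big_seq1 exprS; lra.
  by rewrite lerBlDr lerDl exprn_ge0// invr_ge0.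
have h2 : \forall t \ae mu, forall j, tau (x j) t = tau v t - basis_sum B (fun e => tau e t) (n j) v.
 apply: ae_foralln => j; have := tau_lin (-1) (oproj (B (n j)) v) v.
 have -> : -1 *: oproj (B (n j)) v + v = x j by rewrite scaleN1r addrC.
 apply: filterS2 (tau_sum (inner v) (B (n j))) => t e1 e2.
 by rewrite e2 e1 scaleN1r addrC; congr (_ - _).
apply: filterS2 h1 h2 => t [b hb] ht a ha.
apply: rn_dist_eq => e e0; have e2 : 0 < e / 2 by rewrite divr_gt0.
have [k0 hk0] := ha _ e2.
have b0 : 0 <= b by apply: le_trans (hb 0%N); rewrite big_nil.
have b1 : 0 < b + 1 by rewrite ltr_wpDl.
have [N hN] := invS_small (divr_gt0 (exprn_gt0 2 e2) b1).
pose j := maxn k0 N; have [jn _] := hnP j.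
have hj := hk0 (n j) (leq_trans (leq_maxl _ _) jn).
suff hx : rn (tau (x j) t) < e / 2.
 have -> : tau v t - a = tau (x j) t + (basis_sum B (fun e => tau e t) (n j) v - a).
  by rewrite ht addrA subrK.
 by apply: le_trans (rnD _ _) _; rewrite [leRHS]splitr; apply/ltW/ltrD.
rewrite -(@ltr_pXn2r _ 2) ?nnegrE ?rn_ge0 ?(ltW e2)//.
have := hb j.+1; rewrite iS big_cat /= big_seq1 => hbj.
have hbj' : j.+1%:R * rn (tau (x j) t) ^+ 2 <= b.
 apply: le_trans hbj; rewrite lerDr; apply: sumr_ge0 => i _.
 by rewrite mulr_ge0// sqr_ge0.
have := hN j (leq_maxr _ _); rewrite ltr_pdivlMr// => hjN.
have j0 : 0 < j.+1%:R^-1 :> R by rewrite invr_gt0.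
apply: le_lt_trans hjN; rewrite mulrC ler_pdivlMr// mulrC.
by apply: le_trans hbj' _; rewrite lerDl.
Qed.

End pointwise.

(** * The Frechet topology of the smooth vectors *)

Section smooth_topology.
Variables (R : realType) (G : topGroupType) (V X : hilbertType R) (p : unitary_rep G V).
Implicit Types (v : smooth_vectors p) (l : seq (R -> G)).

Lemma smooth_vector_val v : smooth_vector p (sv_val v).
Proof. exact/asboolP/sv_smooth. Qed.

Lemma nbhs_smooth_vectors l v (e : R) : (forall c, List.In c l -> one_parameter_subgroup c) -> 0 < e ->
 nbhs v [set u : smooth_vectors p |
  rn (foldr (infinitesimal p) (sv_val v) l - foldr (infinitesimal p) (sv_val u) l) < e].
Proof.
move=> hl e0; set x := foldr _ (sv_val v) l; set A := [set u | _].
have [U oU [Ux hU]] : exists2 U : set V, open U & U x /\ forall y, U y -> rn (x - y) < e.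
 have /cvg_rnP/(_ e e0) : id y @[y --> x] --> x by exact: cvg_id.
 by rewrite nbhsE => -[U [oU Ux] UA]; exists U.
pose A' := [set u : smooth_vectors p | U (foldr (infinitesimal p) (sv_val u) l)].
apply: (@filterS _ (nbhs v) _ A') => [u|]; first exact: hU.
exists A'; split => //; exists [set A']; last by rewrite bigcup_set1.
move=> _ ->; exists (finmap.fset1 A'); last by rewrite set_fset1 bigcap_set1.
by move=> ?; rewrite finmap.in_fset1 inE => /eqP ->; exists l, U.
Qed.

Lemma foldr_infinitesimal_smooth l (u : V) : (forall c, List.In c l -> one_parameter_subgroup c) ->
 smooth_vector p u -> smooth_vector p (foldr (infinitesimal p) u l).
Proof.
elim: l => [|c l IH] //= hl su.
by have [] := smooth_ders (hl c (or_introl erefl)) (IH (fun c cl => hl c (or_intror cl)) su).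
Qed.

Lemma foldr_infinitesimalB l (u v : V) : (forall c, List.In c l -> one_parameter_subgroup c) ->
 smooth_vector p u -> smooth_vector p v ->
 foldr (infinitesimal p) (u - v) l = foldr (infinitesimal p) u l - foldr (infinitesimal p) v l.
Proof.
move=> + su sv; elim: l => [|c l IH] //= hl.
have hl' c' : List.In c' l -> one_parameter_subgroup c' by move=> h; apply: hl; right.
have hc := hl c (or_introl erefl); rewrite IH//.
have [d1 _] := smooth_ders hc (foldr_infinitesimal_smooth hl' su).
have [d2 _] := smooth_ders hc (foldr_infinitesimal_smooth hl' sv).
have := infinitesimal_eq hc (ders_lin (-1) d2 d1).
by rewrite !scaleN1r (addrC (- foldr _ v l)) (addrC (- infinitesimal _ _ _)).
Qed.

(** Finitely many seminorm balls meet in a neighbourhood. Their radius is e divided by |C| + 1 and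
    by the number of seminorms plus 1, which keeps both divisors positive and the final inequality
    strict. *)
Lemma continuous_smooth_vectors (A : {linear smooth_vectors p -> X}) (C : R) (ls : seq (seq (R -> G))) :
 (forall l, l \in ls -> forall c, List.In c l -> one_parameter_subgroup c) ->
 (forall v, rn (A v) <= C * \sum_(l <- ls) rn (foldr (infinitesimal p) (sv_val v) l)) ->
 continuous A.
Proof.
move=> hls hA v; have FF : Filter (nbhs v) by exact: nbhs_filter.
apply/cvg_rnP => e e0.
have C1 : 0 < `|C| + 1 by rewrite ltr_wpDl.
have e1 : 0 < e / (`|C| + 1) / ((size ls)%:R + 1) by rewrite !divr_gt0// ltr_wpDl.
have h : \forall u \near v, forall l, l \in ls ->
  rn (foldr (infinitesimal p) (sv_val v) l - foldr (infinitesimal p) (sv_val u) l) <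
  e / (`|C| + 1) / ((size ls)%:R + 1).
 move: (_ / (_ + 1)) e1 => r r0; elim: (ls) hls => [|l s IH] hs; first by apply: filterE.
 have := IH (fun l' hl' => hs l' (mem_behead (s := l :: s) hl')).
 have := nbhs_smooth_vectors v (hs l (mem_head _ _)) r0.
 apply: filterS2 => u h1 h2 l'; rewrite inE => /orP[/eqP->//|]; exact: h2.
apply: filterS h => u hu; rewrite -linearB; apply: le_lt_trans (hA _) _.
have hd l : l \in ls -> rn (foldr (infinitesimal p) (sv_val (v - u)) l) <=
  e / (`|C| + 1) / ((size ls)%:R + 1).
 move=> ll; apply: ltW; have := hu l ll; rewrite -foldr_infinitesimalB//.
 - exact: hls.
 - exact: smooth_vector_val.
 - exact: smooth_vector_val.
have s0 : 0 <= \sum_(l <- ls) rn (foldr (infinitesimal p) (sv_val (v - u)) l).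
 by apply: sumr_ge0 => l _; exact: rn_ge0.
have hs : \sum_(l <- ls) rn (foldr (infinitesimal p) (sv_val (v - u)) l) < e / (`|C| + 1).
 apply: (@le_lt_trans _ _ (\sum_(l <- ls) e / (`|C| + 1) / ((size ls)%:R + 1))).
  by rewrite big_seq [leRHS]big_seq; apply: ler_sum.
 have -> (r : R) : \sum_(l <- ls) r = (size ls)%:R * r.
  by rewrite big_const_seq count_predT iter_addr addr0 mulr_natl.
 by rewrite mulrCA gtr_pMr ?divr_gt0// ltr_pdivrMr ?ltr_wpDl// mul1r ltrDl.
apply: (@le_lt_trans _ _ ((`|C| + 1) * \sum_(l <- ls) rn (foldr (infinitesimal p) (sv_val (v - u)) l))).
 by rewrite ler_wpM2r// (le_trans (ler_norm C))// lerDl.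
by rewrite mulrC -ltr_pdivlMr.
Qed.

End smooth_topology.

Lemma dense_sequence (R : realType) (V : hilbertType R) :
 exists a : nat -> V, forall v (eps : R), 0 < eps -> exists j, rn (v - a j) < eps.
Proof.
have [D /countable_injP[f hf] dD] := hilbert_separable (s := V).
have h j : exists a : V, forall x, D x -> f x = j -> a = x.
 have [[x Dx fx]|nx] := pselect (exists2 x, D x & f x = j); last by exists 0 => x Dx fx; case: nx; exists x.
 by exists x => y Dy fy; apply: hf; rewrite ?inE// fx fy.
have [a ha] := choice h; exists a => v eps e0.
have /cvg_rnP/(_ _ e0) : id y @[y --> v] --> v by exact: cvg_id.
rewrite nbhsE => -[U [oU Uv] hU].
have [x [Ux Dx]] := dD U (ex_intro _ v Uv) oU.
by exists (f x); rewrite (ha _ x Dx erefl); exact: hU.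
Qed.

(* The countable set is chosen in the image of V under v |-> (f 0 v, f j v), a subset of
  a separable space. *)
Lemma countable_dense_seminorms (R : realType) (V : hilbertType R) (P : V -> Prop) (f : nat -> V -> V) :
 P 0 -> exists u : nat -> V, (forall m, P (u m)) /\
 forall v j (eps : R), P v -> 0 < eps ->
  exists m, rn (f 0%N v - f 0%N (u m)) < eps /\ rn (f j v - f j (u m)) < eps.
Proof.
move=> P0; have [a ha] := dense_sequence V.
pose near_ (x : nat * nat * nat * nat) w := [/\ P w, rn (f 0%N w - a x.1.1.1) < x.2.+1%:R^-1 &
 rn (f x.1.2 w - a x.1.1.2) < x.2.+1%:R^-1].
have h x : exists w, P w /\ ((exists w', near_ x w') -> near_ x w).
 have [[w hw]|nw] := pselect (exists w, near_ x w); last by exists 0.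
 by exists w; split => //; have [] := hw.
have [g hg] := choice h.
exists (fun m => if unpickle m is Some x then g x else 0); split.
 by move=> m; case: (unpickle m) => // x; have [] := hg x.
move=> v j eps Pv e0; have [k hk] := invS_small (divr_gt0 e0 (ltr0n R 2)).
have k0 : 0 < k.+1%:R^-1 :> R by rewrite invr_gt0.
have [j0 h0] := ha (f 0%N v) _ k0; have [j1 h1] := ha (f j v) _ k0.
exists (pickle (j0, j1, j, k)); rewrite pickleK.
have [_ [|_ h2 h3]] := hg (j0, j1, j, k); first by exists v.
have {hk} := hk k (leqnn k); rewrite /= in h2 h3; rewrite rn_distC in h2; rewrite rn_distC in h3.
move: h0 h1 h2 h3; move: (_^-1) => r h0 h1 h2 h3 hr; split.
 by apply: le_lt_trans (rn_dist_triangle (a j0) _ _) _; lra.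
by apply: le_lt_trans (rn_dist_triangle (a j1) _ _) _; lra.
Qed.

(** * Equivariance from countably many identities *)

Section equivariance.
Variables (R : realType) (G H : topGroupType) (iota : H -> G).
Variables (V X : hilbertType R) (p : unitary_rep G V) (s : unitary_rep H X).
Notation sm := (smooth_vector p).
Variables (W : V -> V) (q : nat -> H) (u : nat -> V) (A : V -> X) (C : R).
Hypothesis iota_cont : continuous iota.
Hypothesis q_dense : forall (h : H) U, nbhs h U -> exists j, U (q j).
Hypothesis u_sm : forall m, sm (u m).
Hypothesis W_lin : forall a v w, sm v -> sm w -> W (a *: v + w) = a *: W v + W w.
Hypothesis u_dense : forall v j (eps : R), sm v -> 0 < eps ->
 exists m, rn (W v - W (u m)) < eps /\ rn (W (p (iota (q j)) v) - W (p (iota (q j)) (u m))) < eps.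
Hypothesis W_act : forall g v (eps : R), sm v -> 0 < eps -> \forall h \near g, rn (W (p h v - p g v)) < eps.
Hypothesis A_lin : forall a v w, sm v -> sm w -> A (a *: v + w) = a *: A v + A w.
Hypothesis C0 : 0 < C.
Hypothesis A_bound : forall v, sm v -> rn (A v) <= C * rn (W v).
Hypothesis A_equiv : forall j m, A (p (iota (q j)) (u m)) = s (q j) (A (u m)).

Let AB v w : sm v -> sm w -> A (v - w) = A v - A w.
Proof. by move=> sv sw; rewrite addrC -scaleN1r A_lin// scaleN1r addrC. Qed.

Let WB v w : sm v -> sm w -> W (v - w) = W v - W w.
Proof. by move=> sv sw; rewrite addrC -scaleN1r W_lin// scaleN1r addrC. Qed.

Let A_small v w (eps : R) : sm v -> sm w -> rn (W v - W w) < eps / C -> rn (A v - A w) < eps.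
Proof.
move=> sv sw h; rewrite -AB//; apply: le_lt_trans (A_bound (smoothB sv sw)) _.
by rewrite WB// mulrC -ltr_pdivlMr.
Qed.

Let A_equiv_dense j v : sm v -> A (p (iota (q j)) v) = s (q j) (A v).
Proof.
move=> sv; apply: rn_dist_eq => e e0.
have e2 : 0 < e / 2 / C by rewrite !divr_gt0.
have [m [h1 h2]] := u_dense j sv e2.
have := A_small (smooth_act_vec _ sv) (smooth_act_vec _ (u_sm m)) h2.
have := A_small sv (u_sm m) h1; rewrite A_equiv => h3 h4.
apply: le_trans (rn_dist_triangle (s (q j) (A (u m))) _ _) _.
by rewrite -repB rep_rn (rn_distC (A (u m))); lra.
Qed.

(** For q_j both sides extend from the u_m to all v, because W v and W (p (iota q_j) v) are
    approximated together. From the q_j to all h one uses that W (p(g) v) is continuous in g and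
    that the action on X is strongly continuous. *)
Lemma equivariant_closure h v : sm v -> A (p (iota h) v) = s h (A v).
Proof.
move=> sv; apply: rn_dist_eq => e e0; have e3 : 0 < e / 2 by rewrite divr_gt0.
have e2 : 0 < e / 2 / C by rewrite !divr_gt0.
have h1 : \forall k \near h, rn (W (p (iota k) v - p (iota h) v)) < e / 2 / C.
 exact: (@iota_cont h _ (W_act (iota h) sv e2)).
have /cvg_rnP/(_ _ e3) h2 := @rep_continuous _ _ _ s (A v) h.
have [j [k1 k2]] := q_dense (filterI h1 h2).
have [sv1 sv2] := (smooth_act_vec (iota (q j)) sv, smooth_act_vec (iota h) sv).
rewrite /= WB// in k1; have := A_small sv1 sv2 k1; rewrite A_equiv_dense// => k3.
have := rn_dist_triangle (s (q j) (A v)) (A (p (iota h) v)) (s h (A v)).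
rewrite (rn_distC _ (s (q j) (A v))) (rn_distC (s (q j) (A v)) (s h (A v))); lra.
Qed.

End equivariance.

(** * Assembly of the fibre maps *)

Section smooth_pointwise.
Context (R : realType) (d : measure_display) (L : measurableType d).
Context (K : L -> hilbertType R) (F : measurable_family K) (mu : {measure set L -> \bar R}).
Context (V : hilbertType R) (T : {linear V -> direct_integral F mu}).
Context (G H : topGroupType) (iota : H -> G) (p : unitary_rep G V).
Context (sigma : forall t, unitary_rep H (K t)).
Hypotheses (hG : real_reductive R G) (hH : real_reductive R H) (iota_cont : continuous iota).
Hypothesis hp : irreducible_rep p.
Hypothesis T_inner : forall v w, di_inner (T v) (T w) = inner v w.
Hypothesis T_equiv : forall h v, \forall t \ae mu, repr (T (p (iota h) v)) t = sigma t h (repr (T v) t).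
Notation sm := (smooth_vector p).
Notation tau v t := (repr (T v) t).

(** The exceptional points are those where the weighted sums are unbounded or one of countably many
    equivariance identities fails. They form a null set, and A is set to 0 there, which keeps all
    properties valid at every t. *)
Lemma smooth_fibre_maps : (exists2 v, sm v & v != 0) ->
 exists (ls : seq (seq (R -> G))) (A : forall t, V -> K t),
 [/\ forall l, l \in ls -> forall gm, List.In gm l -> one_parameter_subgroup gm,
   forall t, [/\ forall a u v, sm u -> sm v -> A t (a *: u + v) = a *: A t u + A t v,
    exists C, forall v, sm v -> rn (A t v) <= C * \sum_(l <- ls) rn (foldr (infinitesimal p) v l) &
    forall h v, sm v -> A t (p (iota h) v) = sigma t h (A t v)] &
   forall v, sm v -> \forall t \ae mu, tau v t = A t v].
Proof.
move=> hne.
have [B [S [c [N [Q [W [[BS hB wQ Bd] [W_lin W_inner [ls [hls W_ls]] W_act]]]]]]]] :=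
 smooth_vectors_nuclear hG hp hne.
have [q q_dense] := reductive_separable hH.
(* Index 0 is the seminorm of W itself, index k + 1 the same seminorm after the action of q k. *)
have [u [u_sm u_dense]] := countable_dense_seminorms
 (fun j v => if j is k.+1 then W (p (iota (q k)) v) else W v) (smooth0 p).
have oB n : orthonormal (B n) by have [] := hB n.
have Bc n e : e \in B n -> 0 <= c e by have [_ h] := hB n; move=> /h[].
pose w e := (1 + c e)^-1 ^+ (2 * N).
have w0 e : 0 <= w e by rewrite /w mulnC exprM sqr_ge0.
pose bs t := basis_sum B (fun e => tau e t).
pose good t := exists b, forall n, \sum_(e <- B n) w e * rn (tau e t) ^+ 2 <= b.
have good_ae : \forall t \ae mu, good t by exact: (weighted_sums_bounded_ae T_inner BS w0 oB wQ).
have hlim t : exists A : V -> K t, good t ->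
  [/\ forall v, sm v -> rcvg (fun n => bs t n v) (A v),
    forall a u v, sm u -> sm v -> A (a *: u + v) = a *: A u + A v &
    exists2 C, 0 < C & forall v, sm v -> rn (A v) <= C * rn (W v)].
 have [[b hb]|ng] := pselect (good t); last by exists (fun=> 0).
 have [A [h1 h2 h3]] := basis_sum_limit BS oB Bc Bd (fun a u v => @smooth_lin _ _ _ p a u v) W_inner hb.
 exists A => _; split => //; have b0 : 0 <= b.
  by apply: le_trans (hb 0%N); apply: sumr_ge0 => e _; rewrite mulr_ge0// sqr_ge0.
 exists (b + 1) => [|v sv]; first by rewrite ltr_wpDl.
 have bW : 0 <= (b + 1) * rn (W v) by rewrite mulr_ge0 ?rn_ge0// addr_ge0.
 rewrite -(@ler_pXn2r _ 2) ?nnegrE ?rn_ge0//; apply: le_trans (h3 v sv) _.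
 by rewrite exprMn ler_wpM2r ?sqr_ge0//; nra.
(* The target K t varies with t, so the maps are chosen fibre by fibre by dependent choice. *)
pose A0 t := projT1 (cid (hlim t)); have hA0 t := projT2 (cid (hlim t)) : good t -> _.
have A0_ae v : sm v -> \forall t \ae mu, good t -> tau v t = A0 t v.
 move=> sv; apply: filterS (basis_sum_limit_ae T_inner Bd v) => t h gt.
 by apply: h; have [h _ _] := hA0 t gt; exact: h.
pose good2 t := forall j m, A0 t (p (iota (q j)) (u m)) = sigma t (q j) (A0 t (u m)).
have good2_ae : \forall t \ae mu, good t -> good2 t.
 suff : \forall t \ae mu, forall j m, good t ->
   A0 t (p (iota (q j)) (u m)) = sigma t (q j) (A0 t (u m)).
  by apply: filterS => t h gt j m; exact: h.
 apply: ae_foralln => j; apply: ae_foralln => m.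
 apply: filterS3 (A0_ae _ (u_sm m)) (A0_ae _ (smooth_act_vec (iota (q j)) (u_sm m)))
  (T_equiv (q j) (u m)) => t h1 h2 h3 gt.
 by rewrite -h1// -h2.
pose A t v := if `[< good t /\ good2 t >] then A0 t v else 0.
exists ls, A; split => //; last first.
 move=> v sv; apply: filterS3 good_ae good2_ae (A0_ae v sv) => t g1 g2 h.
 by rewrite /A asboolT ?h//; split => //; exact: g2.
move=> t; rewrite /A; case: asboolP => [[gt g2]|_]; last first.
 split => [a x y _ _||h v sv]; first by rewrite scaler0 addr0.
  by exists 0 => v _; rewrite rn0 mul0r.
 by rewrite linear0.
have [_ A_lin [C C0 A_bound]] := hA0 t gt; split => //.
 exists C => v sv; apply: le_trans (A_bound v sv) _.
 by rewrite ler_wpM2l ?(ltW C0)// W_ls.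
move=> h v sv; apply: (equivariant_closure iota_cont q_dense u_sm W_lin _ W_act A_lin C0 A_bound) => //.
by move=> v1 j; exact: (u_dense v1 j.+1).
Qed.

Theorem smooth_pointwise : exists A : forall t, {linear smooth_vectors p -> K t},
 (forall t, continuous (A t) /\
   forall h (v : smooth_vectors p), A t (smooth_act (iota h) v) = sigma t h (A t v)) /\
 (forall v : smooth_vectors p, \forall t \ae mu, tau (sv_val v) t = A t v).
Proof.
have [hne|hne] := pselect (exists2 v, sm v & v != 0); last first.
 have z (v : smooth_vectors p) : sv_val v = 0.
  apply/eqP/negPn/negP => h; apply: hne; exists (sv_val v) => //; exact: smooth_vector_val.
 exists (fun t => \0); split => [t|v]; last first.
  by rewrite z linear0; apply: filterS (di_repr0 F mu) => t ->.
 split => [|h v]; last by rewrite /= linear0.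
 by apply: (continuous_smooth_vectors (C := 0) (ls := [::])) => // v; rewrite /= rn0 mul0r.
have [ls [A [hls hA A_ae]]] := smooth_fibre_maps hne.
have lin t : linear (fun v : smooth_vectors p => A t (sv_val v)).
 by move=> a u v; have [h _ _] := hA t; rewrite /= h//; exact: smooth_vector_val.
pose Al t : {linear smooth_vectors p -> K t} :=
 HB.pack (fun v : smooth_vectors p => A t (sv_val v)) (GRing.isLinear.Build _ _ _ _ _ (lin t)).
exists Al; split => [t|v]; last by apply: A_ae; exact: smooth_vector_val.
have [_ [C hC] hE] := hA t; split => [|h v].
 apply: (continuous_smooth_vectors (C := C) hls) => v; apply: hC; exact: smooth_vector_val.
by apply: hE; exact: smooth_vector_val.
Qed.

End smooth_pointwise.

Unset Implicit Arguments.
Set Strict Implicit.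
Set Printing Implicit Defensive.
Local Close Scope complex_scope.

Theorem theoremA (R : realType) (G H : topGroupType) (iota : H -> G)
    (hG : real_reductive R G) (hH : real_reductive R H)
    (hiota : closed_subgroup iota)
    (V : hilbertType R) (p : unitary_rep G V) (hp : irreducible_rep p)
    (D : unitary_dual R H)
    (M : D -> hilbertType R)
    (E : forall t : D, hilbert_tensor (irrep_space (dual_rep t)) (M t))
    (sigma : forall t : D, unitary_rep H (E t))
    (hsigma : forall t : D,
       acts_on_first_factor (irrep_act (dual_rep t)) (sigma t))
    (mu : {sigma_finite_measure set (borel_dual D) -> \bar R})
    (F : measurable_family (fun t : borel_dual D => tensor_space (E t)))
    (T : {linear V -> direct_integral F mu})
    (hT : unitary_isomorphism T)
    (hTequiv : forall (h : H) (v : V), \forall t \ae mu,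
       repr (T (p (iota h) v)) t = sigma t h (repr (T v) t)) :
  exists A : forall t : D, {linear smooth_vectors p -> E t},
    (forall t : D, continuous (A t) /\
       forall (h : H) (v : smooth_vectors p),
         A t (smooth_act (iota h) v) = sigma t h (A t v)) /\
    (forall v : smooth_vectors p, \forall t \ae mu,
       repr (T (sv_val v)) t = A t v).
Proof.
have [_ _ iota_cont _] := hiota; have [_ T_inner] := hT.
exact: (@smooth_pointwise R _ (borel_dual D) _ F mu V T G H iota p sigma hG hH iota_cont hp T_inner hTequiv).
Qed.
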